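(* Let $a\in\mathbb{R}$ be fixed and let $M$ be a fixed positive integer. For $x>0$ let $$w_1(a,x)=M\left(\tfrac12 a+\tfrac14,\tfrac12,-\tfrac12x^2\right),\qquad w_2(a,x)=x\,M\left(\tfrac12 a+\tfrac34,\tfrac32,-\tfrac12x^2\right),$$ where $M(\cdot,\cdot,\cdot)$ with three arguments is the confluent hypergeometric (Kummer) function of the first kind. Put $\vartheta=\tfrac12 a-\tfrac14$. For each sufficiently large $x$ let $m_o=m_o(x)$ be a positive integer (the optimal truncation index) of the form $$m_o=\tfrac12x^2-a+\alpha,\qquad |\alpha|<1,$$ which defines $\alpha=\alpha(x)$, and let $B_j=B_j(a,\alpha)$ be the coefficients defined in the context. Then, as $x\to+\infty$, $$w_1(a,x)-\frac{2^{\frac14+\frac12a}\sqrt{\pi}}{\Gamma(\frac14-\frac12a)}\,x^{-a-\frac12}\sum_{k=0}^{m_o-1}\frac{(\frac12+a)_{2k}}{k!\,(2x^2)^k}=E_1(a,x),$$ $$w_2(a,x)-\frac{2^{\frac12a-\frac14}\sqrt{\pi}}{\Gamma(\frac34-\frac12a)}\,x^{-a-\frac12}\sum_{k=0}^{m_o-1}\frac{(\frac12+a)_{2k}}{k!\,(2x^2)^k}=E_2(a,x),$$ where $$E_1(a,x)=\frac{2^{\frac14-\frac12a}\sqrt{\pi}}{\Gamma(\frac14+\frac12a)}\,x^{a-\frac12}e^{-x^2/2}\left\{\cos\pi\vartheta\sum_{j=0}^{M-1}\frac{(-1)^j(\frac12-a)_{2j}}{j!\,(2x^2)^j}-\frac{2\sin\pi\vartheta}{\sqrt{\pi}}\sum_{j=0}^{M-1}\frac{(-1)^j2^jB_j}{x^{2j+1}}+O(x^{-2M})\right\},$$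 $$E_2(a,x)=\frac{2^{-\frac12a-\frac14}\sqrt{\pi}}{\Gamma(\frac34+\frac12a)}\,x^{a-\frac12}e^{-x^2/2}\left\{\sin\pi\vartheta\sum_{j=0}^{M-1}\frac{(-1)^j(\frac12-a)_{2j}}{j!\,(2x^2)^j}+\frac{2\cos\pi\vartheta}{\sqrt{\pi}}\sum_{j=0}^{M-1}\frac{(-1)^j2^jB_j}{x^{2j+1}}+O(x^{-2M})\right\}.$$
   Context: Notation. $(c)_k=\Gamma(c+k)/\Gamma(c)=c(c+1)\cdots(c+k-1)$ is the Pochhammer symbol, with $(c)_0=1$. The Kummer function is $M(p,q,z)=\sum_{k\ge0}\frac{(p)_k}{(q)_k}\frac{z^k}{k!}$. The reciprocal $1/\Gamma$ is the entire function, equal to $0$ at the poles of $\Gamma$. The functions $w_1,w_2$ are the even and odd solutions of $w''+xw'+(a+\frac12)w=0$ with $w(0)=1,\ w'(0)=0$ and $w(0)=0,\ w'(0)=1$, respectively. Coefficients $A_j$. For $j\ge0$, $$A_j=\frac{(\frac14-\frac12a)_j(\frac34-\frac12a)_j}{j!}=\frac{(\frac12-a)_{2j}}{2^{2j}\,j!}.$$ Coefficients $G_{k,j}$. For $j\ge0$ put $\gamma_j=\alpha-j$. Let $t=t(w)$ be the function analytic near $w=0$ determined by $\frac12w^2=t-\log t-1$ with the branch $w\sim t-1$ as $t\to1$, so that $t=1+w+\frac13w^2+\frac1{36}w^3-\frac1{270}w^4+\cdots$. The numbers $G_{k,j}$ are defined by the power series expansion near $w=0$ $$\frac{t^{\gamma_j-1}}{1-t}\,\frac{dt}{dw}+\frac1w=\sum_{k=0}^\infty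 G_{k,j}\,w^k .$$ Only the even-order coefficients $G_{2k,j}$ are used. For example, $G_{0,j}=\frac23-\gamma_j$ and $G_{2,j}=\frac{1}{36\cdot15}\left(46-225\gamma_j+270\gamma_j^2-90\gamma_j^3\right)$. Coefficients $B_j$. For $j\ge0$, $$B_j=\sum_{k=0}^{j}(-2)^k\left(\tfrac12\right)_kA_{j-k}\,G_{2k,j-k}.$$ The $B_j$ depend on $a$ and on $\alpha$, and hence on $x$ through $\alpha=\alpha(x)$. *)

(* Defs.v *)
From Stdlib Require Import Reals Factorial ClassicalEpsilon.
From Coquelicot Require Import Coquelicot.
Open Scope R_scope.

Fixpoint poch (c : R) (k : nat) : R :=
  match k with
  | O => 1
  | S k' => poch c k' * (c + INR k')
  end.

(* Only used for z > 0, where the integral converges. *)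
Definition Gamma_int (z : R) : R :=
  RInt_gen (fun t => Rpower t (z - 1) * exp (- t))
    (at_right 0) (Rbar_locally p_infty).

(* 1/Gamma on the whole real line, from Gamma (z + n) = poch z n * Gamma z.
   The shift n satisfies z + n > 0; at z = 0, -1, -2, ... the factor
   poch z n vanishes, which gives the value 0 at the poles of Gamma. *)
Definition rGamma (z : R) : R :=
  let n := Z.to_nat (up (- z)) in
  poch z n / Gamma_int (z + INR n).

Definition kummerM (p q z : R) : R :=
  PSeries (fun k => poch p k / poch q k / INR (fact k)) z.

Definition w1 (a x : R) : R := kummerM (a / 2 + 1 / 4) (1 / 2) (- (x ^ 2 / 2)).
Definition w2 (a x : R) : R :=
  x * kummerM (a / 2 + 3 / 4) (3 / 2) (- (x ^ 2 / 2)).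

Definition theta (a : R) : R := a / 2 - 1 / 4.

Definition A (a : R) (j : nat) : R :=
  poch (1 / 4 - a / 2) j * poch (3 / 4 - a / 2) j / INR (fact j).

(* t is real-analytic at 0, solves w^2/2 = t - ln t - 1 near 0, and lies on
   the branch t - 1 ~ w; these conditions determine t near 0. *)
Definition is_t_branch (t : R -> R) : Prop :=
  (exists c : nat -> R, locally 0 (fun w => is_pseries c w (t w))) /\
  locally 0 (fun w => w ^ 2 / 2 = t w - ln (t w) - 1) /\
  is_lim (fun w => (t w - 1) / w) 0 1.

Definition t_branch : R -> R := epsilon (inhabits (fun _ : R => 1)) is_t_branch.

(* The expanded function has a removable singularity at w = 0, hence the
   punctured neighbourhood. *)
Definition is_G (gamma : R) (g : nat -> R) : Prop :=
  locally' 0 (fun w =>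
    is_pseries g w
      (Rpower (t_branch w) (gamma - 1) / (1 - t_branch w) * Derive t_branch w
       + 1 / w)).

Definition Gcoef (gamma : R) : nat -> R :=
  epsilon (inhabits (fun _ : nat => 0)) (is_G gamma).

(* G_{k,j} is Gcoef (alpha - j) k. *)
Definition B (a alpha : R) (j : nat) : R :=
  sum_f_R0 (fun k =>
    (- 2) ^ k * poch (1 / 2) k * A a (j - k)
    * Gcoef (alpha - INR (j - k)) (2 * k)) j.

Definition is_bigO_infty (f g : R -> R) : Prop :=
  exists C : R, Rbar_locally p_infty (fun x => Rabs (f x) <= C * Rabs (g x)).

(* Main.v *)
(* Let v be the solution of the equation of w_1, w_2 that is recessive at
   infinity, v ~ x^(a-1/2) exp(-x^2/2), and put kappa = a - 1/2 + 2 m and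
     Pi_m(x) = - (1/pi) PV-int exp(kappa y) v(x exp y) / sinh y dy  (y real).
   For every large truncation index m there is an exact formula
     w_1 = H_1 X_m + C_1 (cos(pi theta) v - sin(pi theta) Pi_m),
     w_2 = H_2 X_m + C_2 (sin(pi theta) v + cos(pi theta) Pi_m),
   X_m being the truncated algebraic expansion.  Since Pi_(m+1) - Pi_m is a
   Mellin transform of v, raising m by one adds one term to X_m; for
   |a| < 1/2 and m = 0 both sides solve the same first order system with the
   same values at x = 0 (by the reflection and duplication formulas), and
   three-term recurrences in a reach all other a.
   At m = x^2/2 - a + alpha the expansion of v turns Pi_m into a combination
   of the integrals PV-int exp(g Y - z phi(Y)) / (1 - exp Y) dY, z = x^2/2,
   phi(Y) = exp Y - 1 - Y, g = alpha - j, whose saddle point and pole both lie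
   at Y = 0.  With exp Y = t(w) the phase becomes w^2/2 and the integrand
   -1/w + sum G_(k,j) w^k; the principal value kills -1/w and the odd powers,
   the even ones give Gaussian moments, and collecting powers of 1/x gives
   the B_j. *)

Require Import Defs.
From Stdlib Require Import Reals Factorial Lra Lia Psatz ClassicalEpsilon.
From Coquelicot Require Import Coquelicot.
Open Scope R_scope.

(** * Integrals over the real line *)

(** Half-line integrals are written in the variable y = ln t. The integrands then decay
    exponentially at both ends, multiplicative convolutions become additive ones, and the single
    integral [II] serves Gamma, the recessive solution and the principal value. Everything stays on
    the real line, so the constants rest on three real-variable arguments: duplication by
    log-convexity, the integral of sinh(k y) / sinh y by a functional equation, and reflection by
    differentiation in a parameter. Two obstacles shape the estimates. As alpha varies with x, every
    bound on the G_(k,j) and on the local integrals must be uniform over a bounded range of gamma;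
    hence the explicit geometric constants. And as the principal value is a difference quotient at
    its pole, the remainder of the expansion of v must be controlled together with its derivative.
    This is why v is carried with its partner vb = - v': vb is itself the recessive solution for a +
    1 and has an expansion of its own. The same pair lets the exact formula be propagated by first
    order systems and recurrences. *)

Definition edom (C e : R) (f : R -> R) : Prop :=
  (forall y, continuous f y) /\ 0 < e /\ forall y, Rabs (f y) <= C * exp (- (e * Rabs y)).

(** [edom] keeps the constants because several bounds on [II] must be uniform in a parameter; [dom]
    hides them where only convergence matters. *)
Definition dom (f : R -> R) : Prop := exists C e, edom C e f.

(* Only used on [dom], where the symmetric limit is the absolutely convergent integral. *)
Definition II (f : R -> R) : R := real (Lim_seq (fun n => RInt f (- INR n) (INR n))).

Lemma dom_cont f : dom f -> forall y, continuous f y.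
Proof. intros (C & e & H & _) y; apply H. Qed.

Lemma cont_ex_RInt (f : R -> R) a b : (forall y, continuous f y) -> ex_RInt f a b.
Proof. intros H; apply (ex_RInt_continuous (V := R_CompleteNormedModule)); auto. Qed.

Lemma is_RInt_exp_scal (C e : R) a b : e <> 0 ->
  is_RInt (fun y => C * exp (e * y)) a b (C / e * exp (e * b) - C / e * exp (e * a)).
Proof.
  intros He.
  apply (is_RInt_derive (V := R_CompleteNormedModule) (fun y => C / e * exp (e * y))).
  - intros x _. auto_derive; auto. field; auto.
  - intros x _. apply (ex_derive_continuous (V := R_NormedModule)). auto_derive; auto.
Qed.

Lemma RInt_abs_bound (f : R -> R) C e a b : (forall y, continuous f y) -> 0 < e -> 0 <= C -> a <= b ->
  (forall y, a <= y <= b -> Rabs (f y) <= C * exp (- (e * y))) ->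
  Rabs (RInt f a b) <= C / e * exp (- (e * a)).
Proof.
  intros Hc He HC Hab Hf.
  assert (I : is_RInt (fun y => C * exp (- e * y)) a b (C / (- e) * exp (- e * b) - C / (- e) * exp (- e * a)))
    by (apply is_RInt_exp_scal; lra).
  apply Rle_trans with (RInt (fun y => C * exp (- e * y)) a b).
  - apply (norm_RInt_le (V := R_NormedModule) f (fun y => C * exp (- e * y)) a b); auto.
    + intros y Hy. replace (- e * y) with (- (e * y)) by ring. apply Hf; lra.
    + apply (RInt_correct (V := R_CompleteNormedModule)). now apply cont_ex_RInt.
    + apply (RInt_correct (V := R_CompleteNormedModule)). eexists; apply I.
  - rewrite (is_RInt_unique _ _ _ _ I).
    replace (- e * a) with (- (e * a)) by ring.
    assert (0 <= C / e * exp (- e * b)).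
    { apply Rmult_le_pos; [apply Rdiv_le_0_compat; lra | left; apply exp_pos]. }
    replace (C / - e) with (- (C / e)) by (field; lra). lra.
Qed.

Lemma RInt_abs_bound_neg (f : R -> R) C e a b : (forall y, continuous f y) -> 0 < e -> 0 <= C -> a <= b ->
  (forall y, a <= y <= b -> Rabs (f y) <= C * exp (e * y)) ->
  Rabs (RInt f a b) <= C / e * exp (e * b).
Proof.
  intros Hc He HC Hab Hf.
  assert (I : is_RInt (fun y => C * exp (e * y)) a b (C / e * exp (e * b) - C / e * exp (e * a)))
    by (apply is_RInt_exp_scal; lra).
  apply Rle_trans with (RInt (fun y => C * exp (e * y)) a b).
  - apply (norm_RInt_le (V := R_NormedModule) f (fun y => C * exp (e * y)) a b); auto.
    + apply (RInt_correct (V := R_CompleteNormedModule)). now apply cont_ex_RInt.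
    + apply (RInt_correct (V := R_CompleteNormedModule)). eexists; apply I.
  - rewrite (is_RInt_unique _ _ _ _ I).
    assert (0 <= C / e * exp (e * a)).
    { apply Rmult_le_pos; [apply Rdiv_le_0_compat; lra | left; apply exp_pos]. }
    lra.
Qed.

Lemma exp_le_exp x y : x <= y -> exp x <= exp y.
Proof. intros [H|H]; [left; now apply exp_increasing | right; now f_equal]. Qed.

Lemma exp_INR_mult n x : exp (INR n * x) = exp x ^ n.
Proof.
  induction n as [|n IH]; [now rewrite Rmult_0_l, exp_0|].
  rewrite S_INR. simpl. rewrite <- IH, <- exp_plus. f_equal; ring.
Qed.

Lemma exp_neg_INR_lim e : 0 < e -> is_lim_seq (fun n => exp (- (e * INR n))) 0.
Proof.
  intros He.
  apply (is_lim_seq_ext (fun n => (exp (- e)) ^ n)).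
  - intros n. rewrite <- exp_INR_mult. f_equal. ring.
  - apply is_lim_seq_geom. rewrite Rabs_pos_eq by (left; apply exp_pos).
    rewrite <- exp_0. apply exp_increasing. lra.
Qed.

(** Enlarging a window changes the integral by at most two exponential tails. This estimate yields
    the Cauchy property, the tail bound of [II] and its independence of the chosen windows. *)
Lemma tail_diff f C e A B A' B' : (forall y, continuous f y) -> 0 < e -> 0 <= C ->
  0 <= A <= A' -> 0 <= B <= B' ->
  (forall y, y <= - A \/ B <= y -> Rabs (f y) <= C * exp (- (e * Rabs y))) ->
  Rabs (RInt f (- A') B' - RInt f (- A) B) <= C / e * (exp (- (e * A)) + exp (- (e * B))).
Proof.
  intros Hc He HC HA HB Hf.
  assert (Hex : forall u v, ex_RInt f u v) by (intros; now apply cont_ex_RInt).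
  assert (E : RInt f (- A') B' - RInt f (- A) B = RInt f (- A') (- A) + RInt f B B').
  { rewrite <- (RInt_Chasles f (- A') (- A) B') by apply Hex.
    rewrite <- (RInt_Chasles f (- A) B B') by apply Hex.
    unfold plus; simpl. ring. }
  rewrite E.
  eapply Rle_trans; [apply Rabs_triang|].
  rewrite Rmult_plus_distr_l. apply Rplus_le_compat.
  - replace (- (e * A)) with (e * (- A)) by ring.
    apply RInt_abs_bound_neg; auto; try lra.
    intros y Hy. replace (e * y) with (- (e * Rabs y)) by (rewrite Rabs_left1 by lra; ring).
    apply Hf; lra.
  - apply RInt_abs_bound; auto; try lra.
    intros y Hy. rewrite <- (Rabs_pos_eq y) at 2 by lra. apply Hf; lra.
Qed.

Lemma edom_C f C e : edom C e f -> 0 <= C.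
Proof.
  intros (_ & _ & H). specialize (H 0). rewrite Rabs_R0, Rmult_0_r, Ropp_0, exp_0 in H.
  pose proof (Rabs_pos (f 0)). lra.
Qed.

Lemma II_cvg f : dom f -> is_lim_seq (fun n => RInt f (- INR n) (INR n)) (II f).
Proof.
  intros (C & e & Hd). pose proof (edom_C _ _ _ Hd) as HC. destruct Hd as (Hc & He & Hf).
  unfold II.
  assert (Hex : ex_finite_lim_seq (fun n => RInt f (- INR n) (INR n))).
  { apply ex_lim_seq_cauchy_corr. intros eps.
    assert (L : is_lim_seq (fun n => 2 * (C / e) * exp (- (e * INR n))) (2 * (C / e) * 0)).
    { apply is_lim_seq_mult'. apply is_lim_seq_const. now apply exp_neg_INR_lim. }
    rewrite Rmult_0_r in L.
    apply is_lim_seq_spec in L. destruct (L eps) as [N HN]. exists N.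
    assert (W : forall n m, (N <= n)%nat -> (n <= m)%nat ->
       Rabs (RInt f (- INR m) (INR m) - RInt f (- INR n) (INR n)) < eps).
    { intros n m Hn Hm. eapply Rle_lt_trans.
      - apply (tail_diff f C e (INR n) (INR n) (INR m) (INR m)); auto.
        + split; [apply pos_INR | now apply le_INR].
        + split; [apply pos_INR | now apply le_INR].
      - specialize (HN n Hn). rewrite Rminus_0_r in HN.
        apply Rabs_def2 in HN. lra. }
    intros n m Hn Hm. destruct (Nat.le_ge_cases n m) as [H|H].
    - rewrite Rabs_minus_sym. now apply W.
    - now apply W. }
  now apply Lim_seq_correct'.
Qed.

Lemma II_unique f (l : R) : is_lim_seq (fun n => RInt f (- INR n) (INR n)) l -> II f = l.
Proof. intros H. unfold II. now rewrite (is_lim_seq_unique _ _ H). Qed.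

Lemma II_tail f C e A B : dom f -> 0 < e -> 0 <= C -> 0 <= A -> 0 <= B ->
  (forall y, y <= - A \/ B <= y -> Rabs (f y) <= C * exp (- (e * Rabs y))) ->
  Rabs (II f - RInt f (- A) B) <= C / e * (exp (- (e * A)) + exp (- (e * B))).
Proof.
  intros Hd He HC HA HB Hf.
  pose proof (II_cvg f Hd) as L.
  assert (L2 : is_lim_seq (fun n => Rabs (RInt f (- INR n) (INR n) - RInt f (- A) B))
                 (Rabs (II f - RInt f (- A) B))).
  { apply (is_lim_seq_abs _ (Finite (II f - RInt f (- A) B))).
    apply is_lim_seq_minus'; [exact L | apply is_lim_seq_const]. }
  apply (is_lim_seq_le_loc _ (fun _ => C / e * (exp (- (e * A)) + exp (- (e * B)))) _ _) with (2 := L2)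
    (3 := is_lim_seq_const _).
  destruct (nfloor_ex (A + B)) as [N [HN1 HN2]]; [lra|].
  exists (S N). intros n Hn. apply le_INR in Hn. rewrite S_INR in Hn.
  apply tail_diff; auto; try lra.
  apply dom_cont; auto.
Qed.

Lemma II_abs_le f C e : edom C e f -> Rabs (II f) <= 2 * C / e.
Proof.
  intros Hd. pose proof (edom_C _ _ _ Hd) as HC. destruct Hd as (Hc & He & Hf).
  assert (H : Rabs (II f - RInt f (- 0) 0) <= C / e * (exp (- (e * 0)) + exp (- (e * 0)))).
  { apply II_tail; auto; try lra. exists C, e. repeat split; auto. }
  rewrite Ropp_0, RInt_point in H. rewrite Rmult_0_r, Ropp_0, exp_0 in H.
  unfold zero in H; simpl in H. rewrite Rminus_0_r in H.
  eapply Rle_trans; [apply H|]. right. field. lra.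
Qed.

Lemma edom_weaken C e C' e' f : edom C e f -> C <= C' -> 0 < e' <= e -> edom C' e' f.
Proof.
  intros Hd HC He. pose proof (edom_C _ _ _ Hd) as HC0. destruct Hd as (Hc & He0 & Hf).
  repeat split; auto; try lra. intros y. eapply Rle_trans; [apply Hf|].
  apply Rmult_le_compat; auto; [left; apply exp_pos|].
  assert (e' * Rabs y <= e * Rabs y) by (apply Rmult_le_compat_r; [apply Rabs_pos | lra]).
  apply exp_le_exp. lra.
Qed.

Lemma edom_plus C e C' e' f g : edom C e f -> edom C' e' g -> edom (C + C') (Rmin e e') (fun y => f y + g y).
Proof.
  intros Hf Hg. pose proof (edom_C _ _ _ Hf). pose proof (edom_C _ _ _ Hg).
  assert (Hm : 0 < Rmin e e') by (apply Rmin_pos; [apply Hf | apply Hg]).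
  apply (edom_weaken _ _ C (Rmin e e')) in Hf; [|lra|split; auto; apply Rmin_l].
  apply (edom_weaken _ _ C' (Rmin e e')) in Hg; [|lra|split; auto; apply Rmin_r].
  destruct Hf as (Hc & He & Hf), Hg as (Hc' & He' & Hg). repeat split; auto.
  - intros y. apply (continuous_plus (V := R_NormedModule)); auto.
  - intros y. eapply Rle_trans; [apply Rabs_triang|]. rewrite Rmult_plus_distr_r.
    apply Rplus_le_compat; auto.
Qed.

Lemma dom_plus f g : dom f -> dom g -> dom (fun y => f y + g y).
Proof.
  intros (C & e & Hf) (C' & e' & Hg). eexists; eexists; apply (edom_plus _ _ _ _ _ _ Hf Hg).
Qed.

Lemma dom_scal k f : dom f -> dom (fun y => k * f y).
Proof.
  intros (C & e & Hc & He & Hf). exists (Rabs k * C), e. repeat split; auto.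
  - intros y. apply (continuous_scal_r (V := R_NormedModule) k f); auto.
  - intros y. rewrite Rabs_mult, Rmult_assoc. apply Rmult_le_compat_l; auto. apply Rabs_pos.
Qed.

Lemma dom_ext f g : (forall y, f y = g y) -> dom f -> dom g.
Proof.
  intros E (C & e & Hc & He & Hf). exists C, e. repeat split; auto.
  - intros y. apply (continuous_ext f); auto.
  - intros y. rewrite <- E. auto.
Qed.

Lemma dom_minus f g : dom f -> dom g -> dom (fun y => f y - g y).
Proof.
  intros Hf Hg. apply (dom_ext (fun y => f y + (-1) * g y)). intros; ring.
  apply dom_plus; auto. apply dom_scal; auto.
Qed.

Ltac dom_tac := repeat match goal with
  | |- dom (fun t => @?u t + @?v t) => apply (dom_plus u v)
  | |- dom (fun t => @?u t - @?v t) => apply (dom_minus u v)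
  | |- dom (fun t => ?c * @?v t) => apply (dom_scal c v)
  end.

Lemma II_ext f g : (forall y, f y = g y) -> II f = II g.
Proof.
  intros E. unfold II. f_equal. apply Lim_seq_ext. intros n. apply RInt_ext. auto.
Qed.

Lemma II_plus f g : dom f -> dom g -> II (fun y => f y + g y) = II f + II g.
Proof.
  intros Hf Hg. apply II_unique.
  apply (is_lim_seq_ext (fun n => RInt f (- INR n) (INR n) + RInt g (- INR n) (INR n))).
  - intros n. symmetry. apply (RInt_plus (V := R_CompleteNormedModule)); apply cont_ex_RInt; now apply dom_cont.
  - apply is_lim_seq_plus'; now apply II_cvg.
Qed.

Lemma II_scal k f : dom f -> II (fun y => k * f y) = k * II f.
Proof.
  intros Hf. apply II_unique.
  apply (is_lim_seq_ext (fun n => k * RInt f (- INR n) (INR n))).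
  - intros n. symmetry. apply (RInt_scal (V := R_CompleteNormedModule)); apply cont_ex_RInt; now apply dom_cont.
  - apply is_lim_seq_mult'; [apply is_lim_seq_const | now apply II_cvg].
Qed.

Lemma II_minus f g : dom f -> dom g -> II (fun y => f y - g y) = II f - II g.
Proof.
  intros Hf Hg. rewrite (II_ext _ (fun y => f y + (-1) * g y)) by (intros; ring).
  rewrite II_plus, II_scal; auto. ring. now apply dom_scal.
Qed.

Lemma II_le f g : dom f -> dom g -> (forall y, f y <= g y) -> II f <= II g.
Proof.
  intros Hf Hg H.
  apply (is_lim_seq_le (fun n => RInt f (- INR n) (INR n)) (fun n => RInt g (- INR n) (INR n)) (II f) (II g)).
  - intros n. pose proof (pos_INR n). apply RInt_le; try lra; try (apply cont_ex_RInt; now apply dom_cont).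
    intros; apply H.
  - now apply II_cvg.
  - now apply II_cvg.
Qed.

Lemma II_pos f : dom f -> (forall y, 0 < f y) -> 0 < II f.
Proof.
  intros Hd Hf.
  assert (H1 : 0 < RInt f (- INR 1) (INR 1)).
  { apply RInt_gt_0; simpl; try lra; intros; auto. now apply dom_cont. }
  apply Rlt_le_trans with (1 := H1).
  apply (is_lim_seq_le_loc (fun _ => RInt f (- INR 1) (INR 1)) (fun n => RInt f (- INR n) (INR n))
    (RInt f (- INR 1) (INR 1)) (II f)).
  - exists 1%nat. intros n Hn. apply le_INR in Hn. simpl INR in *.
    assert (Hex : forall u v, ex_RInt f u v) by (intros; apply cont_ex_RInt; now apply dom_cont).
    rewrite <- (RInt_Chasles f (- INR n) (- (1)) (INR n)) by apply Hex.
    rewrite <- (RInt_Chasles f (- (1)) 1 (INR n)) by apply Hex.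
    assert (0 <= RInt f (- INR n) (-(1))) by (apply RInt_ge_0; auto; try lra; intros; left; auto).
    assert (0 <= RInt f 1 (INR n)) by (apply RInt_ge_0; auto; try lra; intros; left; auto).
    unfold plus; simpl. lra.
  - apply is_lim_seq_const.
  - now apply II_cvg.
Qed.

(** Shifts and scalings of the variable turn the symmetric windows of [II] into others; the limit is
    the same for all of them. *)
Lemma II_window f (A B : nat -> R) : dom f -> is_lim_seq A p_infty -> is_lim_seq B p_infty ->
  is_lim_seq (fun n => RInt f (- A n) (B n)) (II f).
Proof.
  intros Hd HA HB. pose proof Hd as (C & e & Hd'). pose proof (edom_C _ _ _ Hd') as HC.
  destruct Hd' as (Hc & He & Hf).
  assert (LE : forall U, is_lim_seq U p_infty -> is_lim_seq (fun n => exp (- (e * U n))) 0).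
  { intros U HU. apply is_lim_seq_spec. intros eps.
    apply is_lim_seq_spec in HU. destruct (HU (- ln eps / e)) as [N HN]. exists N. intros n Hn.
    specialize (HN n Hn). rewrite Rminus_0_r, Rabs_pos_eq by (left; apply exp_pos).
    rewrite <- (exp_ln eps) by apply cond_pos. apply exp_increasing.
    apply Rmult_lt_compat_r with (r := e) in HN; auto.
    replace (- ln eps / e * e) with (- ln eps) in HN by (field; lra). lra. }
  assert (L : is_lim_seq (fun n => C / e * (exp (- (e * A n)) + exp (- (e * B n)))) 0).
  { replace (Finite 0) with (Finite (C / e * (0 + 0))) by (f_equal; ring).
    apply is_lim_seq_mult'; [apply is_lim_seq_const|]. apply is_lim_seq_plus'; now apply LE. }
  apply is_lim_seq_spec. intros eps. apply is_lim_seq_spec in L.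
  apply is_lim_seq_spec in HA. apply is_lim_seq_spec in HB.
  destruct (L eps) as [N1 H1]. destruct (HA 0) as [N2 H2]. destruct (HB 0) as [N3 H3].
  exists (N1 + N2 + N3)%nat. intros n Hn.
  specialize (H1 n ltac:(lia)). specialize (H2 n ltac:(lia)). specialize (H3 n ltac:(lia)).
  rewrite Rabs_minus_sym. eapply Rle_lt_trans.
  - apply (II_tail f C e (A n) (B n)); auto; lra.
  - rewrite Rminus_0_r in H1. apply Rabs_def2 in H1. apply H1.
Qed.

Lemma is_lim_seq_INR_shift c : is_lim_seq (fun n => INR n + c) p_infty.
Proof.
  apply (is_lim_seq_plus _ _ p_infty c). apply is_lim_seq_INR. apply is_lim_seq_const. easy.
Qed.

Lemma RInt_shift (f : R -> R) c a b : (forall y, continuous f y) ->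
  RInt (fun y => f (y + c)) a b = RInt f (a + c) (b + c).
Proof.
  intros Hc. replace (a + c) with (1 * a + c) by ring. replace (b + c) with (1 * b + c) by ring.
  rewrite <- (RInt_comp_lin f 1 c a b).
  - apply RInt_ext. intros. unfold scal; simpl; unfold mult; simpl. rewrite !Rmult_1_l. auto.
  - now apply cont_ex_RInt.
Qed.

Lemma II_shift f c : dom f -> II (fun y => f (y + c)) = II f.
Proof.
  intros Hd. apply II_unique.
  apply (is_lim_seq_ext (fun n => RInt f (- (INR n + - c)) (INR n + c))).
  - intros n. rewrite RInt_shift by now apply dom_cont. f_equal; ring.
  - apply II_window; auto; apply is_lim_seq_INR_shift.
Qed.

Lemma dom_shift f c : dom f -> dom (fun y => f (y + c)).
Proof.
  intros (C & e & Hd). pose proof (edom_C _ _ _ Hd) as HC. destruct Hd as (Hc & He & Hf).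
  exists (C * exp (e * Rabs c)), e. repeat split; auto.
  - intros y. apply (continuous_comp (fun y => y + c) f); auto.
    apply (ex_derive_continuous (V := R_NormedModule)). auto_derive; auto.
  - intros y. eapply Rle_trans; [apply Hf|]. rewrite Rmult_assoc, <- exp_plus.
    apply Rmult_le_compat_l; auto.
    assert (Rabs y <= Rabs (y + c) + Rabs c).
    { replace y with ((y + c) + - c) at 1 by ring. eapply Rle_trans; [apply Rabs_triang|].
      rewrite Rabs_Ropp. lra. }
    assert (e * Rabs y <= e * (Rabs (y + c) + Rabs c)) by (apply Rmult_le_compat_l; lra).
    apply exp_le_exp. lra.
Qed.

Lemma RInt_scale (f : R -> R) k a b : (forall y, continuous f y) ->
  k * RInt (fun y => f (k * y)) a b = RInt f (k * a) (k * b).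
Proof.
  intros Hc.
  assert (Hc' : forall y, continuous (fun y => f (k * y)) y).
  { intros y. apply (continuous_comp (fun y => k * y) f); auto.
    apply (ex_derive_continuous (V := R_NormedModule)). auto_derive; auto. }
  rewrite <- (Rplus_0_r (k * a)), <- (Rplus_0_r (k * b)), <- (RInt_comp_lin f k 0 a b).
  - rewrite <- (RInt_scal (V := R_CompleteNormedModule)) by now apply cont_ex_RInt.
    apply RInt_ext. intros. unfold scal; simpl; unfold mult; simpl. rewrite Rplus_0_r. auto.
  - now apply cont_ex_RInt.
Qed.

Lemma dom_scale f k : 0 < k -> dom f -> dom (fun y => f (k * y)).
Proof.
  intros Hk (C & e & Hc & He & Hf). exists C, (e * k). repeat split.
  - intros y. apply (continuous_comp (fun y => k * y) f); auto.
    apply (ex_derive_continuous (V := R_NormedModule)). auto_derive; auto.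
  - now apply Rmult_lt_0_compat.
  - intros y. eapply Rle_trans; [apply Hf|]. rewrite Rabs_mult, (Rabs_pos_eq k) by lra.
    rewrite Rmult_assoc. lra.
Qed.

Lemma II_scale f k : 0 < k -> dom f -> k * II (fun y => f (k * y)) = II f.
Proof.
  intros Hk Hd. rewrite <- II_scal by now apply dom_scale. apply II_unique.
  apply (is_lim_seq_ext (fun n => RInt f (- (k * INR n)) (k * INR n))).
  - intros n. replace (- (k * INR n)) with (k * - INR n) by ring.
    rewrite <- RInt_scale by now apply dom_cont.
    symmetry. apply (RInt_scal (V := R_CompleteNormedModule)). apply cont_ex_RInt.
    apply dom_cont. now apply dom_scale.
  - assert (L : is_lim_seq (fun n => k * INR n) p_infty).
    { replace p_infty with (Rbar_mult k p_infty).
      - apply (is_lim_seq_scal_l _ k p_infty). apply is_lim_seq_INR.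
      - simpl. destruct (Rle_dec 0 k) as [H|H]; [destruct (Rle_lt_or_eq_dec 0 k H)|]; auto; lra. }
    now apply II_window.
Qed.

Lemma is_lim_INR_comp F (l : Rbar) : is_lim F p_infty l -> is_lim_seq (fun n => F (INR n)) l.
Proof.
  intros H. apply (is_lim_comp_seq F INR p_infty l); auto.
  - exists 0%nat. easy.
  - apply is_lim_seq_INR.
Qed.

Lemma II_FTC f F (l0 l1 : R) : dom f -> (forall y, is_derive F y (f y)) ->
  is_lim F m_infty l0 -> is_lim F p_infty l1 -> II f = l1 - l0.
Proof.
  intros Hd HF H0 H1. apply II_unique.
  apply (is_lim_seq_ext (fun n => F (INR n) - F (- INR n))).
  - intros n. symmetry. apply is_RInt_unique.
    apply (is_RInt_derive (V := R_CompleteNormedModule) F f); intros; auto. now apply dom_cont.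
  - apply is_lim_seq_minus'.
    + now apply is_lim_INR_comp.
    + apply (is_lim_comp_seq F (fun n => - INR n) m_infty l0); auto.
      * exists 0%nat. easy.
      * apply (is_lim_seq_opp INR p_infty). apply is_lim_seq_INR.
Qed.

Lemma edom_lim_p f C e : edom C e f -> is_lim f p_infty 0.
Proof.
  intros Hd. pose proof (edom_C _ _ _ Hd) as HC. destruct Hd as (Hc & He & Hf).
  apply is_lim_spec. intros eps. exists (Rmax 1 (ln ((C + 1) / eps) / e)). intros x Hx.
  rewrite Rminus_0_r. eapply Rle_lt_trans; [apply Hf|].
  assert (1 < x) by (eapply Rle_lt_trans; [apply Rmax_l | apply Hx]).
  assert (H2 : ln ((C + 1) / eps) / e < x) by (eapply Rle_lt_trans; [apply Rmax_r | apply Hx]).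
  rewrite Rabs_pos_eq by lra.
  pose proof (cond_pos eps) as Hp.
  assert (H3 : ln ((C + 1) / eps) < e * x).
  { apply Rmult_lt_compat_r with (r := e) in H2; auto.
    replace (ln ((C + 1) / eps) / e * e) with (ln ((C + 1) / eps)) in H2 by (field; lra). lra. }
  apply exp_increasing in H3. rewrite exp_ln in H3 by (apply Rdiv_lt_0_compat; lra).
  rewrite exp_Ropp. apply Rmult_lt_reg_r with (exp (e * x)); [apply exp_pos|].
  rewrite Rmult_assoc, Rinv_l, Rmult_1_r by (apply Rgt_not_eq; apply exp_pos).
  apply Rlt_trans with (C + 1); [lra|].
  apply Rmult_lt_compat_r with (r := eps) in H3; auto.
  replace ((C + 1) / eps * eps) with (C + 1) in H3 by (field; lra). lra.
Qed.

Lemma dom_lim_p f : dom f -> is_lim f p_infty 0.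
Proof. intros (C & e & H). now apply (edom_lim_p f C e). Qed.

Lemma dom_opp_arg f : dom f -> dom (fun y => f (- y)).
Proof.
  intros (C & e & Hc & He & Hf). exists C, e. repeat split; auto.
  - intros y. apply (continuous_comp Ropp f); auto.
    apply (continuous_opp (V := R_NormedModule)). apply continuous_id.
  - intros y. rewrite <- (Rabs_Ropp y). apply Hf.
Qed.

Lemma dom_lim_m f : dom f -> is_lim f m_infty 0.
Proof.
  intros H. apply (is_lim_ext (fun y => f (- (- y)))). intros; f_equal; ring.
  apply (is_lim_comp (fun y => f (- y)) Ropp m_infty 0 p_infty).
  - apply dom_lim_p. now apply dom_opp_arg.
  - apply (is_lim_opp (fun y => y) m_infty m_infty). apply is_lim_id.
  - exists 0. easy.
Qed.

(** The form in which integration by parts is used throughout: the primitive vanishes at both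
    ends. *)
Lemma II_derive_zero f F : dom f -> dom F -> (forall y, is_derive F y (f y)) -> II f = 0.
Proof.
  intros Hf HF H. rewrite (II_FTC f F 0 0); auto. ring. now apply dom_lim_m. now apply dom_lim_p.
Qed.

(** * Differentiation under the integral sign *)

Lemma is_derive_quad (F : R -> R) x l C r : 0 < r ->
  (forall h, Rabs h < r -> Rabs (F (x + h) - F x - h * l) <= C * h ^ 2) -> is_derive F x l.
Proof.
  intros Hr H. apply is_derive_Reals. intros eps Heps.
  assert (Hd : 0 < Rmin r (eps / (Rabs C + 1))).
  { apply Rmin_pos; auto. apply Rdiv_lt_0_compat; auto. pose proof (Rabs_pos C); lra. }
  exists (mkposreal _ Hd). intros h Hh0 Hh. simpl in Hh.
  assert (Hh1 : Rabs h < r) by (eapply Rlt_le_trans; [apply Hh | apply Rmin_l]).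
  assert (Hh2 : Rabs h < eps / (Rabs C + 1)) by (eapply Rlt_le_trans; [apply Hh | apply Rmin_r]).
  replace ((F (x + h) - F x) / h - l) with ((F (x + h) - F x - h * l) / h) by (field; auto).
  unfold Rdiv at 1. rewrite Rabs_mult, Rabs_inv.
  assert (Ha : 0 < Rabs h) by now apply Rabs_pos_lt.
  apply Rmult_lt_reg_r with (Rabs h); auto. rewrite Rmult_assoc, Rinv_l, Rmult_1_r by lra.
  eapply Rle_lt_trans; [apply H; auto|].
  rewrite <- Rsqr_pow2, Rsqr_abs. unfold Rsqr.
  pose proof (Rabs_pos C). pose proof (Rle_abs C).
  apply Rle_lt_trans with ((Rabs C + 1) * Rabs h * Rabs h); [nra|].
  apply Rmult_lt_compat_r; auto.
  apply Rmult_lt_compat_r with (r := Rabs C + 1) in Hh2; [|lra].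
  replace (eps / (Rabs C + 1) * (Rabs C + 1)) with eps in Hh2 by (field; lra). lra.
Qed.

Lemma mvt_bound (f f' : R -> R) a b M : 
  (forall t, Rmin a b <= t <= Rmax a b -> is_derive f t (f' t)) ->
  (forall t, Rmin a b <= t <= Rmax a b -> Rabs (f' t) <= M) ->
  Rabs (f b - f a) <= M * Rabs (b - a).
Proof.
  intros Hd HM.
  destruct (MVT_gen f a b f') as (c & Hc & E).
  - intros x Hx. apply Hd. lra.
  - intros x Hx. apply continuity_pt_filterlim.
    apply (ex_derive_continuous (V := R_NormedModule)). eexists; apply Hd; lra.
  - rewrite E, Rabs_mult. apply Rmult_le_compat_r; [apply Rabs_pos|]. auto.
Qed.

(** The auxiliary [g] has derivative f1 t - f1 x, to which the mean value theorem applies a second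
    time; this costs the sharp factor 1/2. *)
Lemma taylor2 (f f1 f2 : R -> R) x h M r : Rabs h < r ->
  (forall t, Rabs (t - x) < r -> is_derive f t (f1 t)) ->
  (forall t, Rabs (t - x) < r -> is_derive f1 t (f2 t)) ->
  (forall t, Rabs (t - x) < r -> Rabs (f2 t) <= M) ->
  Rabs (f (x + h) - f x - h * f1 x) <= M * h ^ 2.
Proof.
  intros Hh H1 H2 HM.
  assert (Hin : forall u t, Rabs (u - x) <= Rabs h -> Rmin x u <= t <= Rmax x u -> Rabs (t - x) <= Rabs h).
  { intros u t Hu Ht. eapply Rle_trans; [|apply Hu].
    unfold Rmin, Rmax in Ht. destruct (Rle_dec x u).
    - rewrite !Rabs_pos_eq; lra.
    - rewrite !Rabs_left1; lra. }
  assert (M0 : 0 <= M).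
  { eapply Rle_trans; [apply Rabs_pos|]. apply (HM x). rewrite Rminus_diag, Rabs_R0.
    eapply Rle_lt_trans; [apply Rabs_pos|apply Hh]. }
  set (g := fun t => f t - (t - x) * f1 x).
  assert (G : Rabs (g (x + h) - g x) <= M * Rabs h * Rabs (x + h - x)).
  { apply (mvt_bound g (fun t => f1 t - f1 x)).
    - intros t Ht. assert (Hth : Rabs (t - x) <= Rabs h).
      { apply (Hin (x + h)); auto. replace (x + h - x) with h by ring. lra. }
      unfold g. apply (is_derive_minus (V := R_NormedModule) f (fun t => (t - x) * f1 x)).
      + apply H1. lra.
      + auto_derive; auto; ring.
    - intros t Ht. assert (Hth : Rabs (t - x) <= Rabs h).
      { apply (Hin (x + h)); auto. replace (x + h - x) with h by ring. lra. }
      eapply Rle_trans; [apply (mvt_bound f1 f2 x t M)|].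
      + intros s Hs. apply H2. eapply Rle_lt_trans; [apply (Hin t s Hth Hs)|auto].
      + intros s Hs. apply HM. eapply Rle_lt_trans; [apply (Hin t s Hth Hs)|auto].
      + now apply Rmult_le_compat_l. }
  unfold g in G. replace (x + h - x) with h in G by ring.
  rewrite Rminus_diag in G. 
  replace (f (x + h) - f x - h * f1 x) with (f (x + h) - h * f1 x - (f x - 0 * f1 x)) by ring.
  eapply Rle_trans; [apply G|]. right. rewrite <- Rsqr_pow2, (Rsqr_abs h). unfold Rsqr. ring.
Qed.

(** An integrable bound on the second parameter derivative, uniform near x, survives integration as
    a quadratic remainder, and [is_derive_quad] turns that into a derivative. *)
Lemma II_param (f f1 f2 : R -> R -> R) x r C e : 0 < r -> 
  (forall t, Rabs (t - x) < r -> dom (f t)) -> dom (f1 x) ->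
  (forall t y, Rabs (t - x) < r -> is_derive (fun t => f t y) t (f1 t y)) ->
  (forall t y, Rabs (t - x) < r -> is_derive (fun t => f1 t y) t (f2 t y)) ->
  0 < e -> (forall t y, Rabs (t - x) < r -> Rabs (f2 t y) <= C * exp (- (e * Rabs y))) ->
  is_derive (fun t => II (f t)) x (II (f1 x)).
Proof.
  intros Hr Hd Hd1 D1 D2 He HC.
  assert (Hx : dom (f x)) by (apply Hd; rewrite Rminus_diag, Rabs_R0; auto).
  apply (is_derive_quad _ x _ (2 * C / e) r); auto. intros h Hh.
  assert (Hxh : dom (f (x + h))) by (apply Hd; replace (x + h - x) with h by ring; auto).
  rewrite <- II_scal, <- II_minus, <- II_minus; auto.
  2: now apply dom_minus. 2: now apply dom_scal.
  replace (2 * C / e * h ^ 2) with (2 * (C * h ^ 2) / e) by (field; lra).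
  apply II_abs_le. split; [|split; auto].
  - apply dom_cont. apply dom_minus. now apply dom_minus. now apply dom_scal.
  - intros y. replace (C * h ^ 2 * exp (- (e * Rabs y))) with (C * exp (- (e * Rabs y)) * h ^ 2) by ring.
    apply (taylor2 (fun t => f t y) (fun t => f1 t y) (fun t => f2 t y) x h _ r); auto.
Qed.

(** * The Gamma function *)

Lemma exp_quad_le y : 0 <= y -> 1 + y + y ^ 2 / 2 <= exp y.
Proof.
  intros Hy.
  assert (Hd : forall t, is_derive (fun t => exp t - (1 + t + t ^ 2 / 2)) t (exp t - (1 + t))).
  { intros t. auto_derive; auto. field. }
  destruct (MVT_gen (fun t => exp t - (1 + t + t ^ 2 / 2)) 0 y (fun t => exp t - (1 + t))) as (c & Hc & E).
  - intros; apply Hd.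
  - intros. apply continuity_pt_filterlim. apply (ex_derive_continuous (V := R_NormedModule) (fun t => exp t - (1 + t + t ^ 2 / 2))).
    exists (exp x - (1 + x)). apply Hd.
  - rewrite exp_0 in E. pose proof (exp_ineq1_le c). nra.
Qed.

(** For y >= 0 the double exponential dominates: exp y >= y^2 / 2, and completing the square gives
    the constant. For y < 0 only exp(b y) is left, which decays when b > 0. *)
Lemma exp_decay b c : 0 < c -> exists C, 0 < C /\ forall y, exp (b * y - c * exp y) <= C * exp (- (Rabs b * Rabs y)) \/ y < 0 /\ exp (b * y - c * exp y) <= exp (b * y).
Proof.
  intros Hc. exists (exp ((2 * Rabs b) ^ 2 / (2 * c))). split; [apply exp_pos|]. intros y.
  destruct (Rle_lt_dec 0 y) as [Hy|Hy].
  - left. rewrite <- exp_plus. apply exp_le_exp. rewrite (Rabs_pos_eq y) by lra.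
    pose proof (exp_quad_le y Hy). pose proof (Rle_abs b).
    assert (H1 : c * (y ^ 2 / 2) <= c * exp y) by (apply Rmult_le_compat_l; nra).
    assert (H2 : 2 * Rabs b * y - c * (y ^ 2 / 2) <= (2 * Rabs b) ^ 2 / (2 * c)).
    { apply Rmult_le_reg_r with (2 * c); [lra|].
      replace ((2 * Rabs b) ^ 2 / (2 * c) * (2 * c)) with ((2 * Rabs b) ^ 2) by (field; lra).
      pose proof (pow2_ge_0 (2 * Rabs b - c * y)). nra. }
    assert (b * y <= Rabs b * y) by (apply Rmult_le_compat_r; lra). lra.
  - right. split; auto. apply exp_le_exp. pose proof (exp_pos y). nra.
Qed.

Lemma exp_decay_pos b c : 0 < b -> 0 < c -> exists C, 0 < C /\ forall y, exp (b * y - c * exp y) <= C * exp (- (b * Rabs y)).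
Proof.
  intros Hb Hc. destruct (exp_decay b c Hc) as (C & HC & H). exists (C + 1). split; [lra|].
  intros y. pose proof (exp_pos (- (b * Rabs y))). destruct (H y) as [H1|[Hy H1]].
  - rewrite (Rabs_pos_eq b) in H1 by lra. nra.
  - rewrite (Rabs_left y) in * by lra. replace (- (b * - y)) with (b * y) in * by ring. nra.
Qed.

Lemma continuous_derivable (f : R -> R) y : ex_derive f y -> continuous f y.
Proof. apply (ex_derive_continuous (V := R_NormedModule)). Qed.

Lemma dom_exp b c : 0 < b -> 0 < c -> dom (fun y => exp (b * y - c * exp y)).
Proof.
  intros Hb Hc. destruct (exp_decay_pos b c Hb Hc) as (C & HC & H).
  exists C, b. repeat split; auto.
  - intros y. apply continuous_derivable. auto_derive; auto.
  - intros y. rewrite Rabs_pos_eq by (left; apply exp_pos). auto.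
Qed.

(** Euler's integral for Gamma(s) after t = exp y. *)
Definition G (s : R) : R := II (fun y => exp (s * y - exp y)).

Lemma dom_G s : 0 < s -> dom (fun y => exp (s * y - exp y)).
Proof.
  intros Hs. apply (dom_ext (fun y => exp (s * y - 1 * exp y))). intros; f_equal; ring.
  apply dom_exp; lra.
Qed.

Lemma G_pos s : 0 < s -> 0 < G s.
Proof. intros Hs. apply II_pos. now apply dom_G. intros; apply exp_pos. Qed.

Lemma G_succ s : 0 < s -> G (s + 1) = s * G s.
Proof.
  intros Hs. unfold G.
  assert (E : II (fun y => s * exp (s * y - exp y) - exp ((s + 1) * y - exp y)) = 0).
  { apply (II_derive_zero _ (fun y => exp (s * y - exp y))).
    - apply dom_minus; [apply dom_scal|]; apply dom_G; lra.
    - now apply dom_G.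
    - intros y. auto_derive; auto.
      replace ((s + 1) * y - exp y) with (s * y - exp y + y) by ring.
      rewrite (exp_plus (s * y - exp y) y). unfold Rminus. ring. }
  rewrite II_minus, II_scal in E. lra.
  now apply dom_G. apply dom_scal; now apply dom_G. apply dom_G; lra.
Qed.

Lemma G_scale s c : 0 < s -> 0 < c -> II (fun y => exp (s * y - c * exp y)) = exp (- (s * ln c)) * G s.
Proof.
  intros Hs Hc. unfold G. rewrite <- II_scal by now apply dom_G.
  rewrite <- (II_shift (fun y => exp (- (s * ln c)) * exp (s * y - exp y)) (ln c)).
  - apply II_ext. intros y. rewrite (exp_plus y (ln c)), exp_ln by auto. rewrite <- exp_plus. f_equal. ring.
  - apply dom_scal. now apply dom_G.
Qed.

(** The two ends of the improper integral vary independently. For 0 < a < exp(- N) and b > exp N the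
    substitution t = exp y leaves the window [ln a, ln b], which [II_tail] compares with [G]. *)
Lemma Gamma_int_G z : 0 < z -> Gamma_int z = G z.
Proof.
  intros Hz. unfold Gamma_int. apply is_RInt_gen_unique.
  intros P [eps HP].
  destruct (exp_decay_pos z 1 Hz Rlt_0_1) as (C & HC & H).
  assert (L : is_lim_seq (fun n => 2 * (C / z) * exp (- (z * INR n))) (2 * (C / z) * 0)).
  { apply is_lim_seq_mult'. apply is_lim_seq_const. now apply exp_neg_INR_lim. }
  rewrite Rmult_0_r in L. apply is_lim_seq_spec in L. destruct (L eps) as [N HN].
  specialize (HN N (le_n N)). rewrite Rminus_0_r in HN. apply Rabs_def2 in HN.
  apply (Filter_prod _ _ _ (fun a => 0 < a < exp (- INR N)) (fun b => exp (INR N) < b)).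
  - assert (Hp : 0 < exp (- INR N)) by apply exp_pos. exists (mkposreal _ Hp).
    intros y Hy Hy'. split; auto. change (Rabs (y - 0) < exp (- INR N)) in Hy.
    rewrite Rminus_0_r, Rabs_pos_eq in Hy; lra.
  - exists (exp (INR N)). auto.
  - intros a b [Ha0 Ha] Hb. simpl.
    assert (Hb0 : 0 < b) by (eapply Rlt_trans; [apply exp_pos | apply Hb]).
    exists (RInt (fun y => exp (z * y - exp y)) (ln a) (ln b)). split.
    + assert (I : is_RInt (fun y => scal (exp y) (Rpower (exp y) (z - 1) * exp (- exp y))) (ln a) (ln b)
                    (RInt (fun t => Rpower t (z - 1) * exp (- t)) (exp (ln a)) (exp (ln b)))).
      { apply (is_RInt_comp (V := R_CompleteNormedModule)).
        - intros x _. apply continuous_derivable. pose proof (exp_pos x). unfold Rpower. auto_derive; auto.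
        - intros x _. split. auto_derive; auto; ring. apply continuous_derivable. auto_derive; auto. }
      rewrite !exp_ln in I by auto.
      assert (E : RInt (fun t => Rpower t (z - 1) * exp (- t)) a b = RInt (fun y => exp (z * y - exp y)) (ln a) (ln b)).
      { rewrite <- (is_RInt_unique _ _ _ _ I). apply RInt_ext. intros x _.
        unfold scal; simpl; unfold mult; simpl. unfold Rpower. rewrite ln_exp, <- !exp_plus. f_equal. ring. }
      rewrite <- E. apply (RInt_correct (V := R_CompleteNormedModule)).
      apply (ex_RInt_continuous (V := R_CompleteNormedModule)). intros t Ht.
      apply continuous_derivable. unfold Rpower. auto_derive.
      destruct Ht as [Ht _]. eapply Rlt_le_trans; [|apply Ht]. apply Rmin_pos; auto.
    + apply HP. unfold ball; simpl. unfold AbsRing_ball, abs, minus, plus, opp; simpl.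
      apply ln_increasing in Ha; auto. rewrite ln_exp in Ha.
      apply ln_increasing in Hb; [|apply exp_pos]. rewrite ln_exp in Hb.
      pose proof (pos_INR N).
      assert (T := II_tail (fun y => exp (z * y - exp y)) C z (- ln a) (ln b) (dom_G z Hz) Hz).
      rewrite Ropp_involutive in T.
      change (Rabs (RInt (fun y => exp (z * y - exp y)) (ln a) (ln b) - G z) < eps).
      rewrite Rabs_minus_sym. eapply Rle_lt_trans; [apply T; try lra|].
      * intros y _. rewrite Rabs_pos_eq by (left; apply exp_pos).
        specialize (H y). rewrite Rmult_1_l in H. auto.
      * eapply Rle_lt_trans; [|apply HN].
        replace (2 * (C / z) * exp (- (z * INR N))) with (C / z * (exp (- (z * INR N)) + exp (- (z * INR N)))) by ring.
        apply Rmult_le_compat_l; [apply Rdiv_le_0_compat; lra|].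
        apply Rplus_le_compat; apply exp_le_exp; nra.
Qed.

Lemma up_unique x (k : Z) : x < IZR k <= x + 1 -> up x = k.
Proof. intros H. symmetry. now apply tech_up. Qed.

Lemma rGamma_pos z : 0 < z -> rGamma z = / G z.
Proof.
  intros Hz. unfold rGamma. destruct (archimed (- z)) as [H1 H2].
  assert (Z.to_nat (up (- z)) = 0%nat).
  { assert (up (- z) <= 0)%Z; [|lia]. apply Z.lt_succ_r. apply lt_IZR. simpl. lra. }
  rewrite H. simpl. rewrite Rplus_0_r, Gamma_int_G by auto. unfold Rdiv. ring.
Qed.

Lemma poch_shift z n : poch z (S n) = z * poch (z + 1) n.
Proof.
  induction n as [|n IH]; [simpl; ring|].
  change (poch z (S (S n))) with (poch z (S n) * (z + INR (S n))).
  change (poch (z + 1) (S n)) with (poch (z + 1) n * (z + 1 + INR n)).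
  rewrite IH, S_INR. ring.
Qed.

(** For z <= 0 the shift at z exceeds the shift at z + 1 by one, so both sides use the same value of
    [Gamma_int]; the poles are included. *)
Lemma rGamma_succ z : rGamma z = z * rGamma (z + 1).
Proof.
  destruct (Rlt_le_dec 0 z) as [Hz|Hz].
  - rewrite !rGamma_pos, G_succ by lra. field. split. apply Rgt_not_eq, G_pos; auto. lra.
  - unfold rGamma. destruct (archimed (- z)) as [H1 H2].
    assert (E : up (- (z + 1)) = (up (- z) - 1)%Z).
    { apply up_unique. rewrite minus_IZR. lra. }
    assert (P : (0 < up (- z))%Z) by (apply lt_IZR; simpl; lra).
    rewrite E. replace (Z.to_nat (up (- z))) with (S (Z.to_nat (up (- z) - 1))) by lia.
    rewrite poch_shift, S_INR. replace (z + (INR (Z.to_nat (up (- z) - 1)) + 1)) with (z + 1 + INR (Z.to_nat (up (- z) - 1))) by ring.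
    unfold Rdiv. ring.
Qed.

(** The tangent at d x lies below exp at x and at 0; with the weights d and 1 - d the linear terms
    cancel. *)
Lemma exp_wconvex d x : 0 <= d <= 1 -> exp (d * x) <= 1 - d + d * exp x.
Proof.
  intros Hd. pose proof (exp_ineq1_le (x - d * x)) as H1. pose proof (exp_ineq1_le (- (d * x))) as H2.
  pose proof (exp_pos (d * x)).
  assert (E1 : exp x = exp (d * x) * exp (x - d * x)) by (rewrite <- exp_plus; f_equal; ring).
  assert (E2 : 1 = exp (d * x) * exp (- (d * x))) by (rewrite <- exp_plus, <- exp_0; f_equal; ring).
  rewrite E1. rewrite E2 at 1.
  assert (A1 : exp (d * x) * (1 + (x - d * x)) <= exp (d * x) * exp (x - d * x)) by (apply Rmult_le_compat_l; lra).
  assert (A2 : exp (d * x) * (1 + - (d * x)) <= exp (d * x) * exp (- (d * x))) by (apply Rmult_le_compat_l; lra).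
  assert (B1 : d * (exp (d * x) * (1 + (x - d * x))) <= d * (exp (d * x) * exp (x - d * x))) by (apply Rmult_le_compat_l; lra).
  assert (B2 : (1 - d) * (exp (d * x) * (1 + - (d * x))) <= (1 - d) * (exp (d * x) * exp (- (d * x)))) by (apply Rmult_le_compat_l; lra).
  rewrite <- E2 in B2. nra.
Qed.

(* Convexity of the exponential in the integrand replaces Hoelder's inequality. *)
Lemma G_add_le y d : 0 < y -> 0 <= d <= 1 -> G (y + d) <= exp (d * ln y) * G y.
Proof.
  intros Hy Hd.
  assert (E : exp (d * ln y) * G y = II (fun t => exp (d * ln y) * ((1 - d) * exp (y * t - exp t) + d / y * exp ((y + 1) * t - exp t)))).
  { rewrite II_scal, II_plus, !II_scal.
    fold (G y). fold (G (y + 1)). rewrite G_succ by auto. field. lra.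
    all: dom_tac; apply dom_G; lra. }
  rewrite E. apply II_le.
  - apply dom_G; lra.
  - dom_tac; apply dom_G; lra.
  - intros t. pose proof (exp_wconvex d (t - ln y) Hd) as H.
    replace (d * (t - ln y)) with (d * t + - (d * ln y)) in H by ring.
    rewrite exp_plus in H. unfold Rminus in H at 2. rewrite exp_plus, exp_Ropp, exp_Ropp, exp_ln in H by auto.
    replace ((y + d) * t - exp t) with (d * t + (y * t - exp t)) by ring.
    replace ((y + 1) * t - exp t) with (t + (y * t - exp t)) by ring.
    rewrite !exp_plus.
    pose proof (exp_pos (y * t - exp t)). pose proof (exp_pos (d * ln y)).
    apply Rmult_le_compat_r with (r := exp (d * ln y) * exp (y * t - exp t)) in H; [|nra].
    replace (exp (d * t) * / exp (d * ln y) * (exp (d * ln y) * exp (y * t - exp t))) with (exp (d * t) * exp (y * t - exp t)) in H by (field; lra).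
    eapply Rle_trans; [apply H|]. right. unfold Rdiv. ring.
Qed.

(** The upper bound for the step from y + d to y + 1, read backwards through G(y + 1) = y G(y). *)
Lemma G_add_ge y d : 0 < y -> 0 <= d <= 1 -> y / (y + d) * exp (d * ln y) * G y <= G (y + d).
Proof.
  intros Hy Hd. pose proof (G_add_le (y + d) (1 - d) ltac:(lra) ltac:(lra)) as H.
  replace (y + d + (1 - d)) with (y + 1) in H by ring. rewrite G_succ in H by auto.
  replace ((1 - d) * ln (y + d)) with (ln (y + d) + - (d * ln (y + d))) in H by ring.
  rewrite exp_plus, exp_ln in H by lra.
  pose proof (G_pos y Hy). pose proof (G_pos (y + d) ltac:(lra)).
  assert (L : exp (d * ln y) <= exp (d * ln (y + d))).
  { apply exp_le_exp. apply Rmult_le_compat_l; try lra. apply ln_le; lra. }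
  rewrite exp_Ropp in H. pose proof (exp_pos (d * ln (y + d))). pose proof (exp_pos (d * ln y)).
  apply Rmult_le_reg_r with ((y + d) * / exp (d * ln (y + d))).
  { apply Rmult_lt_0_compat; [lra | now apply Rinv_0_lt_compat]. }
  apply Rle_trans with (y * G y).
  - replace (y / (y + d) * exp (d * ln y) * G y * ((y + d) * / exp (d * ln (y + d)))) with
      (y * G y * (exp (d * ln y) * / exp (d * ln (y + d)))) by (field; lra).
    rewrite <- (Rmult_1_r (y * G y)) at 2. apply Rmult_le_compat_l; [nra|].
    apply Rmult_le_reg_r with (exp (d * ln (y + d))); auto.
    rewrite Rmult_assoc, Rinv_l by lra. lra.
  - lra.
Qed.

(* 1-periodic, and [dupq (N + d) / dupq N] tends to 1 by log-convexity of [G]; hence constant. *)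
Definition dupq (s : R) : R := exp ((s - 1) * ln 2) * G (s / 2) * G ((s + 1) / 2) / G s.

Lemma dupq_succ s : 0 < s -> dupq (s + 1) = dupq s.
Proof.
  intros Hs. unfold dupq. rewrite G_succ by auto.
  replace ((s + 1 + 1) / 2) with (s / 2 + 1) by field. rewrite G_succ by lra.
  replace ((s + 1 - 1) * ln 2) with ((s - 1) * ln 2 + ln 2) by ring.
  rewrite exp_plus, exp_ln by lra. field. split; [apply Rgt_not_eq, G_pos|]; lra.
Qed.

Lemma dupq_add s n : 0 < s -> dupq (s + INR n) = dupq s.
Proof.
  intros Hs. induction n as [|n IH]; [simpl; now rewrite Rplus_0_r|].
  rewrite S_INR, <- Rplus_assoc, dupq_succ; auto. pose proof (pos_INR n). lra.
Qed.

(** Each of the three Gamma ratios is a power of its argument up to a factor 1 + O(1/N), and the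
    factor exp(d ln 2) makes these powers cancel up to ((N + 1) / N)^(d/2), see [Eq]. Both bounds
    tend to 1. *)
Lemma dupq_bounds N d : 0 < N -> 0 <= d <= 1 ->
  N / (N + 2) * ((N + 1) / (N + 3)) <= dupq (N + d) / dupq N <= (N + 1) / N * ((N + 1) / N).
Proof.
  intros HN Hd. unfold dupq.
  set (x1 := N / 2). set (x2 := (N + 1) / 2).
  assert (Hx1 : 0 < x1) by (unfold x1; lra). assert (Hx2 : 0 < x2) by (unfold x2; lra).
  replace ((N + d) / 2) with (x1 + d / 2) by (unfold x1; field).
  replace ((N + d + 1) / 2) with (x2 + d / 2) by (unfold x2; field).
  pose proof (G_add_le x1 (d / 2) Hx1 ltac:(lra)) as U1. pose proof (G_add_ge x1 (d / 2) Hx1 ltac:(lra)) as L1.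
  pose proof (G_add_le x2 (d / 2) Hx2 ltac:(lra)) as U2. pose proof (G_add_ge x2 (d / 2) Hx2 ltac:(lra)) as L2.
  pose proof (G_add_le N d HN Hd) as U3. pose proof (G_add_ge N d HN Hd) as L3.
  pose proof (G_pos _ Hx1) as P1. pose proof (G_pos _ Hx2) as P2. pose proof (G_pos _ HN) as P3.
  pose proof (G_pos (x1 + d / 2) ltac:(lra)) as P4. pose proof (G_pos (x2 + d / 2) ltac:(lra)) as P5.
  pose proof (G_pos (N + d) ltac:(lra)) as P6.
  assert (E2 : exp ((N + d - 1) * ln 2) = exp ((N - 1) * ln 2) * exp (d * ln 2)).
  { rewrite <- exp_plus. f_equal. ring. }
  rewrite E2. pose proof (exp_pos ((N - 1) * ln 2)) as P7.
  set (r1 := G (x1 + d / 2) / G x1) in *. set (r2 := G (x2 + d / 2) / G x2). set (r3 := G (N + d) / G N).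
  assert (Q3 : 0 < r3) by (unfold r3; apply Rdiv_lt_0_compat; auto).
  replace (exp ((N - 1) * ln 2) * exp (d * ln 2) * G (x1 + d / 2) * G (x2 + d / 2) / G (N + d) / (exp ((N - 1) * ln 2) * G x1 * G x2 / G N)) with
   (exp (d * ln 2) * r1 * r2 / r3) by (unfold r1, r2, r3; field; repeat split; lra).
  set (e1 := exp (d / 2 * ln x1)) in *. set (e2 := exp (d / 2 * ln x2)) in *. set (e3 := exp (d * ln N)) in *.
  set (e := exp (d * ln 2)).
  assert (V1 : r1 <= e1) by (unfold r1; apply Rmult_le_reg_r with (G x1); auto; unfold Rdiv; rewrite Rmult_assoc, Rinv_l by lra; lra).
  assert (V2 : r2 <= e2) by (unfold r2; apply Rmult_le_reg_r with (G x2); auto; unfold Rdiv; rewrite Rmult_assoc, Rinv_l by lra; lra).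
  assert (V3 : r3 <= e3) by (unfold r3; apply Rmult_le_reg_r with (G N); auto; unfold Rdiv; rewrite Rmult_assoc, Rinv_l by lra; lra).
  assert (W1 : x1 / (x1 + d / 2) * e1 <= r1) by (unfold r1; apply Rmult_le_reg_r with (G x1); auto; unfold Rdiv at 3; rewrite (Rmult_assoc (G (x1 + d / 2))), Rinv_l by lra; lra).
  assert (W2 : x2 / (x2 + d / 2) * e2 <= r2) by (unfold r2; apply Rmult_le_reg_r with (G x2); auto; unfold Rdiv at 3; rewrite (Rmult_assoc (G (x2 + d / 2))), Rinv_l by lra; lra).
  assert (W3 : N / (N + d) * e3 <= r3) by (unfold r3; apply Rmult_le_reg_r with (G N); auto; unfold Rdiv at 2; rewrite (Rmult_assoc (G (N + d))), Rinv_l by lra; lra).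
  assert (p : 0 < e) by apply exp_pos. assert (p1 : 0 < e1) by apply exp_pos.
  assert (p2 : 0 < e2) by apply exp_pos. assert (p3 : 0 < e3) by apply exp_pos.
  assert (LN : ln x1 = ln N - ln 2) by (unfold x1; apply ln_div; lra).
  assert (LN2 : ln x2 = ln (N + 1) - ln 2) by (unfold x2; apply ln_div; lra).
  assert (Eq : e * e1 * e2 = e3 * exp (d / 2 * (ln (N + 1) - ln N))).
  { unfold e, e1, e2, e3. rewrite <- !exp_plus. f_equal. rewrite LN, LN2. field. }
  assert (B0 : 0 <= ln (N + 1) - ln N) by (assert (ln N <= ln (N + 1)) by (apply ln_le; lra); lra).
  assert (B1 : 1 <= exp (d / 2 * (ln (N + 1) - ln N))) by (apply Rle_trans with (exp 0); [rewrite exp_0; lra | apply exp_le_exp; nra]).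
  assert (B2 : exp (d / 2 * (ln (N + 1) - ln N)) <= (N + 1) / N).
  { rewrite <- (exp_ln ((N + 1) / N)) by (apply Rdiv_lt_0_compat; lra).
    apply exp_le_exp. rewrite ln_div by lra. nra. }
  set (B := exp (d / 2 * (ln (N + 1) - ln N))) in *.
  assert (F1 : N / (N + 1) <= N / (N + d)) by (apply Rmult_le_compat_l; [lra|]; apply Rinv_le_contravar; lra).
  assert (F2 : N / (N + 2) <= x1 / (x1 + d / 2)).
  { replace (x1 / (x1 + d / 2)) with (N / (N + d)) by (unfold x1; field; lra).
    apply Rmult_le_compat_l; [lra|]; apply Rinv_le_contravar; lra. }
  assert (F3 : (N + 1) / (N + 3) <= x2 / (x2 + d / 2)).
  { replace (x2 / (x2 + d / 2)) with ((N + 1) / (N + 1 + d)) by (unfold x2; field; lra).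
    apply Rmult_le_compat_l; [lra|]; apply Rinv_le_contravar; lra. }
  assert (p4 : 0 < N / (N + 2)) by (apply Rdiv_lt_0_compat; lra).
  assert (p5 : 0 < (N + 1) / (N + 3)) by (apply Rdiv_lt_0_compat; lra).
  assert (p6 : 0 < N / (N + 1)) by (apply Rdiv_lt_0_compat; lra).
  assert (q1 : N / (N + 2) * e1 <= r1) by (eapply Rle_trans; [|apply W1]; apply Rmult_le_compat_r; lra).
  assert (q2 : (N + 1) / (N + 3) * e2 <= r2) by (eapply Rle_trans; [|apply W2]; apply Rmult_le_compat_r; lra).
  assert (q3 : N / (N + 1) * e3 <= r3) by (eapply Rle_trans; [|apply W3]; apply Rmult_le_compat_r; lra).
  assert (s1 : 0 < N / (N + 2) * e1) by (apply Rmult_lt_0_compat; auto).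
  assert (s2 : 0 < (N + 1) / (N + 3) * e2) by (apply Rmult_lt_0_compat; auto).
  assert (s3 : 0 < N / (N + 1) * e3) by (apply Rmult_lt_0_compat; auto).
  assert (M1 : N / (N + 2) * e1 * ((N + 1) / (N + 3) * e2) <= r1 * r2) by (apply Rmult_le_compat; lra).
  assert (M2 : r1 * r2 <= e1 * e2) by (apply Rmult_le_compat; lra).
  split.
  - apply Rmult_le_reg_r with r3; auto.
    replace (e * r1 * r2 / r3 * r3) with (e * (r1 * r2)) by (field; lra).
    apply Rle_trans with (e * (N / (N + 2) * e1 * ((N + 1) / (N + 3) * e2))).
    + replace (e * (N / (N + 2) * e1 * ((N + 1) / (N + 3) * e2))) with (N / (N + 2) * ((N + 1) / (N + 3)) * (e * e1 * e2)) by (field; lra).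
      rewrite Eq. apply Rmult_le_compat_l; [apply Rlt_le, Rmult_lt_0_compat; auto|]. nra.
    + apply Rmult_le_compat_l; lra.
  - apply Rmult_le_reg_r with r3; auto.
    replace (e * r1 * r2 / r3 * r3) with (e * (r1 * r2)) by (field; lra).
    apply Rle_trans with (e * (e1 * e2)); [apply Rmult_le_compat_l; lra|].
    replace (e * (e1 * e2)) with (e3 * B) by lra.
    apply Rle_trans with ((N + 1) / N * ((N + 1) / N) * (N / (N + 1) * e3)).
    + replace ((N + 1) / N * ((N + 1) / N) * (N / (N + 1) * e3)) with (e3 * ((N + 1) / N)) by (field; lra).
      apply Rmult_le_compat_l; lra.
    + apply Rmult_le_compat_l; auto. assert (0 < (N + 1) / N) by (apply Rdiv_lt_0_compat; lra). nra.
Qed.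

Lemma inv_INR_lim : is_lim_seq (fun n => / (INR n + 1)) 0.
Proof.
  apply (is_lim_seq_inv (fun n => INR n + 1) p_infty); [apply is_lim_seq_INR_shift | easy].
Qed.

Lemma dupq_const s : 0 < s <= 1 -> dupq s = dupq 1.
Proof.
  intros Hs. rewrite <- (dupq_succ s) by lra.
  assert (P : forall u, 0 < u -> 0 < dupq u).
  { intros u Hu. unfold dupq. apply Rdiv_lt_0_compat; [|now apply G_pos].
    repeat apply Rmult_lt_0_compat; try apply exp_pos; apply G_pos; lra. }
  enough (E : dupq (s + 1) / dupq 1 = 1).
  { apply Rmult_eq_reg_r with (/ dupq 1). unfold Rdiv in E. rewrite E.
    symmetry; apply Rinv_r. apply Rgt_not_eq, P; lra. apply Rinv_neq_0_compat, Rgt_not_eq, P; lra. }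
  assert (B : forall n, (INR n + 1) / (INR n + 1 + 2) * ((INR n + 1 + 1) / (INR n + 1 + 3)) <= dupq (s + 1) / dupq 1
     <= (INR n + 1 + 1) / (INR n + 1) * ((INR n + 1 + 1) / (INR n + 1))).
  { intros n. pose proof (pos_INR n). rewrite <- (dupq_add (s + 1) n), <- (dupq_add 1 n) by lra.
    replace (s + 1 + INR n) with (INR n + 1 + s) by ring. rewrite (Rplus_comm 1).
    apply dupq_bounds; lra. }
  pose proof inv_INR_lim as I.
  assert (HI : forall n, 0 < / (INR n + 1)) by (intros n; apply Rinv_0_lt_compat; pose proof (pos_INR n); lra).
  apply Rle_antisym.
  - apply (is_lim_seq_le (fun _ => dupq (s + 1) / dupq 1) (fun n => (1 + / (INR n + 1)) * (1 + / (INR n + 1))) (dupq (s + 1) / dupq 1) 1).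
    + intros n. eapply Rle_trans; [apply (proj2 (B n))|]. right. field. pose proof (pos_INR n); lra.
    + apply is_lim_seq_const.
    + replace (Finite 1) with (Finite ((1 + 0) * (1 + 0))) by (f_equal; ring).
      apply is_lim_seq_mult'; (apply is_lim_seq_plus'; [apply is_lim_seq_const | apply I]).
  - apply (is_lim_seq_le (fun n => 1 - 5 * / (INR n + 1)) (fun _ => dupq (s + 1) / dupq 1) 1 (dupq (s + 1) / dupq 1)).
    + intros n. eapply Rle_trans; [|apply (proj1 (B n))]. pose proof (pos_INR n). specialize (HI n).
      set (m := INR n + 1) in *. assert (1 <= m) by (unfold m; lra).
      apply Rmult_le_reg_r with (m * (m + 2) * (m + 3)); [apply Rmult_lt_0_compat; nra|].
      replace (m / (m + 2) * ((m + 1) / (m + 3)) * (m * (m + 2) * (m + 3))) with (m * m * (m + 1)) by (field; lra).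
      replace ((1 - 5 * / m) * (m * (m + 2) * (m + 3))) with ((m - 5) * ((m + 2) * (m + 3))) by (field; lra). nra.
    + replace (Finite 1) with (Finite (1 - 5 * 0)) by (f_equal; ring).
      apply is_lim_seq_minus'; [apply is_lim_seq_const|]. apply is_lim_seq_mult'; [apply is_lim_seq_const | apply I].
    + apply is_lim_seq_const.
Qed.

(** Legendre's formula with G(1/2) left unevaluated; its value sqrt PI comes later from the
    reflection formula. *)
Lemma G_duplication s : 0 < s <= 1 -> exp ((s - 1) * ln 2) * G (s / 2) * G ((s + 1) / 2) = G (1 / 2) * G s.
Proof.
  intros Hs. pose proof (dupq_const s Hs) as E. unfold dupq in E.
  replace ((1 + 1) / 2) with 1 in E by field. replace ((1 - 1) * ln 2) with 0 in E by ring.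
  rewrite exp_0 in E. pose proof (G_pos 1 Rlt_0_1). pose proof (G_pos s ltac:(lra)).
  apply Rmult_eq_reg_r with (/ G s); [|apply Rinv_neq_0_compat; lra].
  unfold Rdiv in E at 1. rewrite E. field. lra.
Qed.

(** * Integrals against [1 / sinh] and the reflection formula *)

(* [N y / sinh y] with the removable singularity filled in by [n1 = N'(0)]. *)
Definition sq (N : R -> R) (n1 y : R) : R := if Req_EM_T y 0 then n1 else N y / sinh y.

Lemma sinh_pos y : 0 < y -> 0 < sinh y.
Proof. intros Hy. unfold sinh. assert (exp (- y) < exp y) by (apply exp_increasing; lra). lra. Qed.

Lemma sinh_opp y : sinh (- y) = - sinh y.
Proof. unfold sinh. rewrite Ropp_involutive. field. Qed.

Lemma sinh_neq y : y <> 0 -> sinh y <> 0.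
Proof.
  intros Hy. destruct (Rdichotomy _ _ Hy) as [H|H].
  - assert (0 < sinh (- y)) by (apply sinh_pos; lra). rewrite sinh_opp in H0. lra.
  - apply Rgt_not_eq. now apply sinh_pos.
Qed.

Lemma is_derive_sinh y : is_derive sinh y (cosh y).
Proof. unfold sinh, cosh. auto_derive; auto. field. Qed.

Lemma locally_neq (y z : R) : y <> z -> locally y (fun t => t <> z).
Proof.
  intros H. assert (Hp : 0 < Rabs (y - z)) by (apply Rabs_pos_lt; lra).
  exists (mkposreal _ Hp). intros t Ht E. subst t.
  change (Rabs (z - y) < Rabs (y - z)) in Ht. rewrite Rabs_minus_sym in Ht. lra.
Qed.

Lemma is_lim_quot0 (N : R -> R) (n1 : R) : is_derive N 0 n1 -> N 0 = 0 -> is_lim (fun h => N h / h) 0 n1.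
Proof.
  intros Hd H0. apply is_derive_Reals in Hd. apply is_lim_spec. intros eps.
  destruct (Hd eps (cond_pos eps)) as [d Hdel]. exists d. intros h Hh Hh0.
  change (Rabs (h - 0) < d) in Hh. rewrite Rminus_0_r in Hh.
  specialize (Hdel h Hh0 Hh). rewrite Rplus_0_l, H0, Rminus_0_r in Hdel. auto.
Qed.

Lemma sq_cont (N : R -> R) (n1 : R) : is_derive N 0 n1 -> N 0 = 0 -> (forall y, continuous N y) -> forall y, continuous (sq N n1) y.
Proof.
  intros Hd H0 Hc y. destruct (Req_dec y 0) as [->|Hy].
  - apply continuity_pt_filterlim. apply continuity_pt_filterlim'.
    assert (L : is_lim (fun h => (N h / h) / (sinh h / h)) 0 (n1 / 1)).
    { apply (is_lim_div _ _ 0 n1 1).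
      - now apply is_lim_quot0.
      - apply is_lim_quot0. replace 1 with (cosh 0). apply is_derive_sinh. apply cosh_0. apply sinh_0.
      - intros E. injection E. lra.
      - easy. }
    replace (sq N n1 0) with (n1 / 1) by (unfold sq; destruct (Req_EM_T 0 0); [field|easy]).
    change (is_lim (sq N n1) 0 (n1 / 1)).
    apply (is_lim_ext_loc (fun h => (N h / h) / (sinh h / h))); [|exact L].
    exists (mkposreal 1 Rlt_0_1). intros h _ Hh. unfold sq. destruct (Req_EM_T h 0); [easy|].
    field. split; auto. now apply sinh_neq.
  - apply (continuous_ext_loc _ (fun t => N t * / sinh t)).
    + apply (filter_imp (fun t => t <> 0)). 2: now apply locally_neq.
      intros t Ht. unfold sq. destruct (Req_EM_T t 0); easy.
    + apply (continuous_mult (K := R_AbsRing)); auto.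
      apply continuous_derivable. exists (- cosh y / sinh y ^ 2).
      apply is_derive_inv. apply is_derive_sinh. now apply sinh_neq.
Qed.

(** From 1 + 2 y <= exp(2 y). It bounds y / sinh y by (1 + 2 y) exp(- y), uniformly down to 0. *)
Lemma sinh_lower y : 0 <= y -> y * exp y <= (1 + 2 * y) * sinh y.
Proof.
  intros Hy. unfold sinh.
  assert (H : (1 + 2 * y) * exp (- y) <= exp y).
  { replace (exp y) with (exp (2 * y) * exp (- y)) by (rewrite <- exp_plus; f_equal; ring).
    apply Rmult_le_compat_r; [left; apply exp_pos|]. apply exp_ineq1_le. }
  lra.
Qed.

Lemma sq_bound0 N n1 y M : Rabs n1 <= M -> Rabs (N y) <= M * Rabs y ->
  Rabs (sq N n1 y) <= M * (1 + 2 * Rabs y) * exp (- Rabs y).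
Proof.
  intros H1 HN. unfold sq. destruct (Req_EM_T y 0) as [->|Hy].
  - rewrite Rabs_R0, Ropp_0, exp_0. lra.
  - assert (Ha : 0 < Rabs y) by now apply Rabs_pos_lt.
    assert (Hs : Rabs (sinh y) = sinh (Rabs y)).
    { unfold Rabs at 2. destruct (Rcase_abs y).
      - rewrite sinh_opp. apply Rabs_left. assert (0 < sinh (- y)) by (apply sinh_pos; lra). rewrite sinh_opp in H. lra.
      - apply Rabs_pos_eq. left. apply sinh_pos. lra. }
    pose proof (sinh_lower (Rabs y) ltac:(lra)) as HL. pose proof (sinh_pos _ Ha) as HP.
    unfold Rdiv. rewrite Rabs_mult, Rabs_inv, Hs.
    assert (HM : 0 <= M) by (pose proof (Rabs_pos n1); lra).
    apply Rmult_le_reg_r with (sinh (Rabs y)); auto.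
    rewrite Rmult_assoc, Rinv_l, Rmult_1_r by lra.
    eapply Rle_trans; [apply HN|]. rewrite !Rmult_assoc. apply Rmult_le_compat_l; auto.
    pose proof (exp_pos (Rabs y)). rewrite exp_Ropp.
    apply Rmult_le_reg_r with (exp (Rabs y)); auto.
    replace ((1 + 2 * Rabs y) * (/ exp (Rabs y) * sinh (Rabs y)) * exp (Rabs y)) with ((1 + 2 * Rabs y) * sinh (Rabs y)) by (field; lra).
    lra.
Qed.

Lemma lin_exp_bound b y : 0 < b -> 0 <= y -> 1 + 2 * y <= (1 + 2 / b) * exp (b * y).
Proof.
  intros Hb Hy. apply Rle_trans with ((1 + 2 / b) * (1 + b * y)).
  - replace ((1 + 2 / b) * (1 + b * y)) with (1 + 2 * y + 2 / b + b * y) by (field; lra).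
    assert (0 < 2 / b) by (apply Rdiv_lt_0_compat; lra). nra.
  - assert (0 < 2 / b) by (apply Rdiv_lt_0_compat; lra).
    apply Rmult_le_compat_l; [lra|]. apply exp_ineq1_le.
Qed.

(** A numerator vanishing linearly at 0 may grow almost like exp |y|. Of the margin e one half pays
    for the linear factor of [sinh_lower], which gives the rate e / 2 and the constant 1 + 4 / e. *)
Lemma sq_edom (N : R -> R) (n1 M e : R) : 0 < e -> is_derive N 0 n1 -> N 0 = 0 -> (forall y, continuous N y) ->
  Rabs n1 <= M -> (forall y, Rabs (N y) <= M * Rabs y * exp ((1 - e) * Rabs y)) ->
  edom (M * (1 + 4 / e)) (e / 2) (sq N n1).
Proof.
  intros He Hd H0 Hc H1 HN. split; [now apply sq_cont|]. split; [lra|].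
  assert (HM : 0 <= M) by (pose proof (Rabs_pos n1); lra).
  intros y. 
  set (E := exp ((1 - e) * Rabs y)) in *.
  assert (E1 : exp ((1 - e) * Rabs y) = E) by reflexivity.
  assert (HE : 0 < E) by apply exp_pos.
  pose proof (Rabs_pos y) as Hy.
  assert (B : Rabs (sq N n1 y) <= M * (1 + 2 * Rabs y) * exp (- (e * Rabs y))).
  { destruct (Req_dec y 0) as [->|Hy0].
    - unfold sq. destruct (Req_EM_T 0 0); [|easy]. rewrite Rabs_R0, !Rmult_0_r, Ropp_0, exp_0. lra.
    (* [sq_bound0] is a statement about one point, so it is applied to a numerator that is constant
       in t; the growth E is put back afterwards. *)
    - assert (Hz : Rabs (sq (fun t => N y / E) 0 y) <= M * (1 + 2 * Rabs y) * exp (- Rabs y)).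
      { apply sq_bound0. rewrite Rabs_R0; auto. unfold Rdiv. rewrite Rabs_mult, Rabs_inv, (Rabs_pos_eq E) by lra.
        apply Rmult_le_reg_r with E; auto. rewrite Rmult_assoc, Rinv_l, Rmult_1_r by lra. apply HN. }
      unfold sq in *. destruct (Req_EM_T y 0); [easy|].
      replace (N y / sinh y) with (N y / E / sinh y * E) by (field; split; [now apply sinh_neq|lra]).
      rewrite Rabs_mult, (Rabs_pos_eq E) by lra.
      replace (exp (- (e * Rabs y))) with (exp (- Rabs y) * E).
      + rewrite <- Rmult_assoc. apply Rmult_le_compat_r; lra.
      + unfold E. rewrite <- exp_plus. f_equal. ring. }
  eapply Rle_trans; [apply B|].
  pose proof (lin_exp_bound (e / 2) (Rabs y) ltac:(lra) Hy) as HL.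
  replace (2 / (e / 2)) with (4 / e) in HL by (field; lra).
  replace (exp (- (e / 2 * Rabs y))) with (exp (e / 2 * Rabs y) * exp (- (e * Rabs y))).
  2: { rewrite <- exp_plus. f_equal. field. }
  rewrite !Rmult_assoc. apply Rmult_le_compat_l; auto. rewrite <- Rmult_assoc.
  apply Rmult_le_compat_r; auto. left; apply exp_pos.
Qed.

Lemma sinh_abs_le k y : Rabs (sinh (k * y)) <= Rabs k * Rabs y * exp (Rabs k * Rabs y).
Proof.
  assert (P : forall t, 0 <= t -> 0 <= sinh t <= t * exp t).
  { intros t Ht. split.
    - destruct Ht as [Ht|<-]; [left; now apply sinh_pos | rewrite sinh_0; lra].
    - unfold sinh. pose proof (exp_ineq1_le (- (2 * t))) as H1.
      replace (exp (- t)) with (exp t * exp (- (2 * t))) by (rewrite <- exp_plus; f_equal; ring).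
      pose proof (exp_pos t). nra. }
  rewrite <- Rabs_mult. destruct (Rle_lt_dec 0 (k * y)) as [H|H].
  - rewrite (Rabs_pos_eq (k * y)) by auto. destruct (P _ H). rewrite Rabs_pos_eq; auto.
  - rewrite (Rabs_left (k * y)) by auto. destruct (P (- (k * y))) as [P1 P2]; [lra|].
    rewrite sinh_opp in *. rewrite Rabs_left1; lra.
Qed.

Definition shq (k : R) : R -> R := sq (fun y => sinh (k * y)) k.
Definition cint (k : R) : R := II (shq k).

Lemma is_derive_sinh_scal k y : is_derive (fun y => sinh (k * y)) y (k * cosh (k * y)).
Proof. unfold sinh, cosh. auto_derive; auto. field. Qed.

Lemma shq_dom k : Rabs k < 1 -> dom (shq k).
Proof.
  intros Hk. pose proof (Rabs_pos k). exists (1 * (1 + 4 / (1 - Rabs k))), ((1 - Rabs k) / 2).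
  apply sq_edom; try lra.
  - pose proof (is_derive_sinh_scal k 0) as D. rewrite Rmult_0_r, cosh_0, Rmult_1_r in D. exact D.
  - rewrite Rmult_0_r. apply sinh_0.
  - intros y. apply continuous_derivable. eexists; apply is_derive_sinh_scal.
  - intros y. eapply Rle_trans; [apply sinh_abs_le|]. pose proof (Rabs_pos y).
    replace (1 - (1 - Rabs k)) with (Rabs k) by ring. pose proof (exp_pos (Rabs k * Rabs y)).
    apply Rmult_le_compat_r; [lra|]. nra.
Qed.

Lemma shq_opp k y : shq (- k) y = - shq k y.
Proof.
  unfold shq, sq. destruct (Req_EM_T y 0); auto.
  replace (- k * y) with (- (k * y)) by ring. rewrite sinh_opp. unfold Rdiv; ring.
Qed.

Lemma cint_opp k : Rabs k < 1 -> cint (- k) = - cint k.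
Proof.
  intros Hk. unfold cint. rewrite (II_ext _ (fun y => (-1) * shq k y)).
  - rewrite II_scal by now apply shq_dom. ring.
  - intros y. rewrite shq_opp. ring.
Qed.

Lemma sinh_add x y : sinh (x + y) = sinh x * cosh y + cosh x * sinh y.
Proof. unfold sinh, cosh. rewrite Ropp_plus_distr, !exp_plus. field. Qed.

Lemma cosh_opp y : cosh (- y) = cosh y.
Proof. unfold cosh. rewrite Ropp_involutive. field. Qed.

Lemma cosh_pos y : 0 < cosh y.
Proof. unfold cosh. pose proof (exp_pos y). pose proof (exp_pos (- y)). lra. Qed.

Lemma sinh_2 y : sinh (2 * y) = 2 * sinh y * cosh y.
Proof. replace (2 * y) with (y + y) by ring. rewrite sinh_add. ring. Qed.

(** In the variable 2 y the kernel is 1 / (2 sinh y cosh y), and sinh(k y + y) + sinh(k y - y) = 2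
    sinh(k y) cosh y cancels the cosh. The tangent obeys the same relation ([tan_half_sum]). *)
Lemma cint_double k : Rabs k < 1 -> 2 * cint k = cint ((k + 1) / 2) + cint ((k - 1) / 2).
Proof.
  intros Hk. apply Rabs_def2 in Hk.
  assert (D1 : dom (shq ((k + 1) / 2))) by (apply shq_dom, Rabs_def1; lra).
  assert (D2 : dom (shq ((k - 1) / 2))) by (apply shq_dom, Rabs_def1; lra).
  unfold cint. rewrite <- II_plus by auto.
  rewrite <- (II_scale (fun y => shq ((k + 1) / 2) y + shq ((k - 1) / 2) y) 2) by (try lra; now apply dom_plus).
  f_equal. apply II_ext. intros y.
  unfold shq, sq. destruct (Req_EM_T y 0) as [->|Hy]; destruct (Req_EM_T (2 * _) 0); try lra.
  replace ((k + 1) / 2 * (2 * y)) with (k * y + y) by field.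
  replace ((k - 1) / 2 * (2 * y)) with (k * y + - y) by field.
  pose proof (sinh_neq y Hy). pose proof (cosh_pos y).
  rewrite !sinh_add, sinh_opp, cosh_opp, sinh_2. field. lra.
Qed.

Lemma II_exp_abs b : 0 < b -> dom (fun y => exp (- (b * Rabs y))) /\ II (fun y => exp (- (b * Rabs y))) = 2 / b.
Proof.
  intros Hb.
  assert (Hc : forall y, continuous (fun y => exp (- (b * Rabs y))) y).
  { intros y. apply (continuous_comp (fun y => - (b * Rabs y)) exp).
    - apply (continuous_opp (V := R_NormedModule)). apply (continuous_scal_r (V := R_NormedModule) b Rabs).
      apply continuity_pt_filterlim. apply Rcontinuity_abs.
    - apply continuous_derivable. auto_derive; auto. }
  assert (D : dom (fun y => exp (- (b * Rabs y)))).
  { exists 1, b. repeat split; auto. intros y. rewrite Rabs_pos_eq by (left; apply exp_pos). lra. }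
  split; auto. apply II_unique.
  apply (is_lim_seq_ext (fun n => 2 / b - 2 / b * exp (- (b * INR n)))).
  - intros n. pose proof (pos_INR n).
    rewrite <- (RInt_Chasles _ _ 0) by (now apply cont_ex_RInt).
    rewrite (RInt_ext _ (fun y => 1 * exp (b * y)) (- INR n) 0).
    rewrite (RInt_ext _ (fun y => 1 * exp (- b * y)) 0 (INR n)).
    rewrite (is_RInt_unique _ _ _ _ (is_RInt_exp_scal 1 b _ _ ltac:(lra))).
    rewrite (is_RInt_unique _ _ _ _ (is_RInt_exp_scal 1 (- b) _ _ ltac:(lra))).
    rewrite !Rmult_0_r, exp_0. unfold plus; simpl.
    replace (b * - INR n) with (- (b * INR n)) by ring. replace (- b * INR n) with (- (b * INR n)) by ring.
    field. lra.
    + intros y. rewrite Rmin_left, Rmax_right by lra. intros Hy. rewrite Rabs_pos_eq by lra. rewrite Rmult_1_l. f_equal. ring.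
    + intros y. rewrite Rmin_left, Rmax_right by lra. intros Hy. rewrite Rabs_left by lra. rewrite Rmult_1_l. f_equal. ring.
  - replace (Finite (2 / b)) with (Finite (2 / b - 2 / b * 0)) by (f_equal; ring).
    apply is_lim_seq_minus'; [apply is_lim_seq_const|].
    apply is_lim_seq_mult'; [apply is_lim_seq_const|]. now apply exp_neg_INR_lim.
Qed.

Lemma exp_lip x y : x <= 0 -> y <= 0 -> Rabs (exp x - exp y) <= Rabs (x - y).
Proof.
  intros Hx Hy. rewrite <- (Rmult_1_l (Rabs (x - y))). apply (mvt_bound exp exp).
  - intros t _. auto_derive; auto; ring.
  - intros t [_ Ht]. rewrite Rabs_pos_eq by (left; apply exp_pos). rewrite <- exp_0. apply exp_le_exp.
    eapply Rle_trans; [apply Ht|]. now apply Rmax_lub.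
Qed.

(* Near [k = 1] the function [cint k] is [2 / (1 - k)] plus a Lipschitz function. *)
Lemma cint_lip k k' : 0 <= k < 1 -> 0 <= k' < 1 ->
  Rabs ((cint k - 2 / (1 - k)) - (cint k' - 2 / (1 - k'))) <= 20 * Rabs (k - k').
Proof.
  assert (W : forall k, 0 <= k < 1 -> dom (fun y => shq k y - exp (- ((1 - k) * Rabs y))) /\
             II (fun y => shq k y - exp (- ((1 - k) * Rabs y))) = cint k - 2 / (1 - k)).
  { clear. intros k Hk. destruct (II_exp_abs (1 - k)) as [E1 E2]; [lra|].
    assert (Hs : dom (shq k)) by (apply shq_dom; rewrite Rabs_pos_eq; lra).
    split. now apply dom_minus. rewrite II_minus by auto. now rewrite E2. }
  intros Hk Hk'. destruct (W k Hk) as [D1 <-]. destruct (W k' Hk') as [D2 <-].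
  rewrite <- II_minus by auto.
  eapply Rle_trans. apply (II_abs_le _ (Rabs (k - k') * (1 + 2 / (1 / 2))) (1 / 2)).
  2: right; field.
  split; [apply dom_cont; now apply dom_minus|]. split; [lra|]. intros y.
  pose proof (Rabs_pos (k - k')) as Hkk. pose proof (Rabs_pos y) as Hy0.
  assert (B : Rabs (shq k y - exp (- ((1 - k) * Rabs y)) - (shq k' y - exp (- ((1 - k') * Rabs y))))
     <= Rabs (k - k') * (1 + 2 * Rabs y) * exp (- Rabs y)).
  (* For t > 0, sinh(k t) / sinh t - exp(- (1 - k) t) equals (exp(- (2 - k) t) - exp(- k t)) / (2
     sinh t). The numerator is Lipschitz in k with constant of order t, and t / sinh t is
     integrable. *)
  { assert (S0 : forall t, 0 < t ->
      sinh (k * t) / sinh t - exp (- ((1 - k) * t)) - (sinh (k' * t) / sinh t - exp (- ((1 - k') * t))) =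
      ((exp (- ((2 - k) * t)) - exp (- ((2 - k') * t))) - (exp (- (k * t)) - exp (- (k' * t)))) / 2 / sinh t).
    { intros t Ht. pose proof (sinh_pos t Ht) as Hs.
      assert (Ek : forall l, exp (l * t) = exp (- ((1 - l) * t)) * exp t) by (intros; rewrite <- exp_plus; f_equal; ring).
      assert (Ek2 : forall l, exp (- ((2 - l) * t)) = exp (- ((1 - l) * t)) * exp (- t)) by (intros; rewrite <- exp_plus; f_equal; ring).
      assert (Q : forall l, sinh (l * t) / sinh t - exp (- ((1 - l) * t)) = (exp (- ((2 - l) * t)) - exp (- (l * t))) / 2 / sinh t).
      { intros l. apply Rmult_eq_reg_r with (sinh t); [|lra].
        transitivity (sinh (l * t) - exp (- ((1 - l) * t)) * sinh t); [field; lra|].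
        transitivity ((exp (- ((2 - l) * t)) - exp (- (l * t))) / 2); [|field; lra].
        unfold sinh. rewrite Ek, Ek2. field. }
      rewrite !Q. field. lra. }
    assert (S1 : forall t, 0 < t ->
      Rabs (sinh (k * t) / sinh t - exp (- ((1 - k) * t)) - (sinh (k' * t) / sinh t - exp (- ((1 - k') * t))))
       <= Rabs (k - k') * (1 + 2 * t) * exp (- t)).
    { intros t Ht. rewrite S0 by auto.
      pose proof (sq_bound0 (fun _ => (exp (- ((2 - k) * t)) - exp (- ((2 - k') * t)) - (exp (- (k * t)) - exp (- (k' * t)))) / 2) 0 t (Rabs (k - k'))) as Q.
      unfold sq in Q. destruct (Req_EM_T t 0); [lra|]. rewrite (Rabs_pos_eq t) in Q by lra. apply Q.
      - rewrite Rabs_R0. auto.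
      - assert (T1 := exp_lip (- ((2 - k) * t)) (- ((2 - k') * t)) ltac:(nra) ltac:(nra)).
        assert (T2 := exp_lip (- (k * t)) (- (k' * t)) ltac:(nra) ltac:(nra)).
        replace (- ((2 - k) * t) - - ((2 - k') * t)) with ((k - k') * t) in T1 by ring.
        replace (- (k * t) - - (k' * t)) with (- ((k - k') * t)) in T2 by ring.
        rewrite Rabs_Ropp in T2. rewrite Rabs_mult, (Rabs_pos_eq t) in T1, T2 by lra.
        unfold Rdiv. rewrite Rabs_mult, (Rabs_pos_eq (/ 2)) by lra.
        eapply Rle_trans. apply Rmult_le_compat_r; [lra|]. eapply Rle_trans; [apply Rabs_triang|].
        rewrite Rabs_Ropp. apply Rplus_le_compat; [apply T1 | apply T2]. lra. }
    unfold shq, sq. destruct (Req_EM_T y 0) as [->|Hy].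
    - rewrite Rabs_R0, !Rmult_0_r, Ropp_0, exp_0. right. rewrite Rplus_0_r, !Rmult_1_r. f_equal. ring.
    - destruct (Rdichotomy _ _ Hy) as [Hn|Hp].
      + rewrite (Rabs_left y) by auto.
        replace (sinh (k * y) / sinh y) with (sinh (k * - y) / sinh (- y)).
        replace (sinh (k' * y) / sinh y) with (sinh (k' * - y) / sinh (- y)).
        apply S1; lra.
        1,2: rewrite Ropp_mult_distr_r_reverse, !sinh_opp; field; now apply sinh_neq.
      + rewrite (Rabs_pos_eq y) by lra. apply S1; lra. }
  eapply Rle_trans; [apply B|]. rewrite !Rmult_assoc. apply Rmult_le_compat_l; auto.
  pose proof (lin_exp_bound (1 / 2) (Rabs y) ltac:(lra) Hy0) as HL.
  replace (exp (- (1 / 2 * Rabs y))) with (exp (1 / 2 * Rabs y) * exp (- Rabs y)).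
  2: { rewrite <- exp_plus. f_equal. field. }
  rewrite <- Rmult_assoc. apply Rmult_le_compat_r; auto. left; apply exp_pos.
Qed.

Lemma sin_cubic u : 0 <= u <= 4 -> u - u ^ 3 / 6 <= sin u.
Proof.
  intros [H0 H4]. destruct (pre_sin_bound u 0 H0 H4) as [H _].
  unfold sin_approx, sin_term in H. simpl in H. field_simplify in H. lra.
Qed.

(** cot u - 1 / u is regular at 0: its derivative 1 / u^2 - 1 / sin^2 u stays bounded by the cubic
    lower bound of the sine. *)
Lemma cot_lip u v : 0 < u <= PI / 2 -> 0 < v <= PI / 2 ->
  Rabs ((cos u / sin u - 1 / u) - (cos v / sin v - 1 / v)) <= 4 * Rabs (u - v).
Proof.
  intros Hu Hv. pose proof PI_4 as P4. pose proof PI_RGT_0 as P0.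
  assert (HS : forall t, 0 < t <= PI / 2 -> 0 < sin t) by (intros t Ht; apply sin_gt_0; lra).
  assert (Hin : forall t, Rmin v u <= t <= Rmax v u -> 0 < t <= PI / 2).
  { intros t [H1 H2]. split.
    - eapply Rlt_le_trans; [|apply H1]. apply Rmin_pos; lra.
    - eapply Rle_trans; [apply H2|]. apply Rmax_lub; lra. }
  apply (mvt_bound (fun t => cos t / sin t - 1 / t) (fun t => - 1 / (sin t) ^ 2 + 1 / t ^ 2)).
  - intros t Ht. apply Hin in Ht. specialize (HS t Ht).
    auto_derive. split; lra.
    pose proof (sin2_cos2 t) as SC. unfold Rsqr in SC.
    field_simplify; try lra. f_equal. nra.
  - intros t Ht. apply Hin in Ht. specialize (HS t Ht).
    pose proof (sin_cubic t ltac:(lra)) as L. 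
    assert (U : sin t < t) by (apply sin_lt_x; lra).
    assert (t <= 2) by lra.
    assert (Q : 0 <= 1 / sin t ^ 2 - 1 / t ^ 2 <= 4).
    { assert (t / 3 <= sin t) by nra.
      assert (0 < sin t ^ 2) by nra. assert (0 < t ^ 2) by nra.
      assert (E : 1 / sin t ^ 2 - 1 / t ^ 2 = (t ^ 2 - sin t ^ 2) / (sin t ^ 2 * t ^ 2)) by (field; lra).
      rewrite E. split.
      - apply Rdiv_le_0_compat; [nra|]. nra.
      - apply Rmult_le_reg_r with (sin t ^ 2 * t ^ 2); [nra|].
        unfold Rdiv. rewrite Rmult_assoc, Rinv_l, Rmult_1_r by nra.
        assert (B1 : t ^ 2 - sin t ^ 2 <= t ^ 4 / 3).
        { assert (t - sin t <= t ^ 3 / 6) by lra. assert (t + sin t <= 2 * t) by lra.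
          replace (t ^ 2 - sin t ^ 2) with ((t - sin t) * (t + sin t)) by ring.
          replace (t ^ 4 / 3) with (t ^ 3 / 6 * (2 * t)) by field.
          apply Rmult_le_compat; lra. }
        assert (B2 : t / 3 <= sin t) by auto.
        assert (B3 : t ^ 2 / 12 <= sin t ^ 2).
        { assert (t - t ^ 3 / 6 >= t / 3) by nra. nra. }
        nra. }
    replace (- 1 / sin t ^ 2 + 1 / t ^ 2) with (- (1 / sin t ^ 2 - 1 / t ^ 2)) by (field; lra).
    rewrite Rabs_Ropp, Rabs_pos_eq; lra.
Qed.

(** Reflection at PI / 2 turns the tangent into a cotangent at PI (1 - k) / 2, whose pole is the
    same 2 / (1 - k) as the pole of [cint]. *)
Lemma tan_lip k k' : 0 <= k < 1 -> 0 <= k' < 1 ->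
  Rabs ((PI * tan (PI * k / 2) - 2 / (1 - k)) - (PI * tan (PI * k' / 2) - 2 / (1 - k'))) <= 32 * Rabs (k - k').
Proof.
  assert (W : forall k, 0 <= k < 1 -> PI * tan (PI * k / 2) - 2 / (1 - k) =
      PI * (cos (PI * (1 - k) / 2) / sin (PI * (1 - k) / 2) - 1 / (PI * (1 - k) / 2))).
  { clear. intros k Hk. pose proof PI_RGT_0. replace (PI * (1 - k) / 2) with (PI / 2 - PI * k / 2) by field.
    rewrite cos_shift, sin_shift. fold (tan (PI * k / 2)). field. nra. }
  intros Hk Hk'. rewrite !W by auto. pose proof PI_RGT_0 as P0. pose proof PI_4 as P4.
  rewrite <- Rmult_minus_distr_l, Rabs_mult, (Rabs_pos_eq PI) by lra.
  eapply Rle_trans. apply Rmult_le_compat_l; [lra|]. apply cot_lip; nra.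
  replace (PI * (1 - k) / 2 - PI * (1 - k') / 2) with (- (PI / 2 * (k - k'))) by field.
  rewrite Rabs_Ropp, Rabs_mult, (Rabs_pos_eq (PI / 2)) by lra.
  pose proof (Rabs_pos (k - k')). rewrite <- !Rmult_assoc. apply Rmult_le_compat_r; auto. nra.
Qed.

(** The aim is [cdiff] = 0 by Herglotz's argument: the two terms have the same pole at k = 1 and
    obey the same duplication relation. *)
Definition cdiff k := cint k - PI * tan (PI * k / 2).

Lemma tan_half_sum u : cos u <> 0 -> cos (u / 2 + PI / 4) <> 0 -> cos (u / 2 - PI / 4) <> 0 ->
  2 * tan u = tan (u / 2 + PI / 4) + tan (u / 2 - PI / 4).
Proof.
  intros H0 H1 H2. unfold tan.
  set (p := u / 2 + PI / 4) in *. set (q := u / 2 - PI / 4) in *.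
  assert (E1 : u = p + q) by (unfold p, q; field).
  assert (E2 : cos (p - q) = 0) by (replace (p - q) with (PI / 2) by (unfold p, q; field); apply cos_PI2).
  rewrite cos_minus in E2. rewrite E1 in *. rewrite cos_plus in H0. rewrite sin_plus, cos_plus.
  assert (E3 : cos p * cos q - sin p * sin q = 2 * (cos p * cos q)) by lra.
  rewrite E3. field. auto.
Qed.

Lemma cos_neq_small u : - (PI / 2) < u < PI / 2 -> cos u <> 0.
Proof. intros H. apply Rgt_not_eq, cos_gt_0; lra. Qed.

Lemma cdiff_double k : Rabs k < 1 -> 2 * cdiff k = cdiff ((k + 1) / 2) + cdiff ((k - 1) / 2).
Proof.
  intros Hk. pose proof (cint_double k Hk) as C. apply Rabs_def2 in Hk. pose proof PI_RGT_0.
  unfold cdiff.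
  replace (PI * ((k + 1) / 2) / 2) with (PI * k / 2 / 2 + PI / 4) by field.
  replace (PI * ((k - 1) / 2) / 2) with (PI * k / 2 / 2 - PI / 4) by field.
  assert (T := tan_half_sum (PI * k / 2)).
  rewrite Rmult_minus_distr_l, C. rewrite <- Rmult_assoc, (Rmult_comm 2 PI), Rmult_assoc, T; [ring|..];
  apply cos_neq_small; nra.
Qed.

Lemma cdiff_opp k : Rabs k < 1 -> cdiff (- k) = - cdiff k.
Proof.
  intros Hk. unfold cdiff. rewrite cint_opp by auto.
  replace (PI * - k / 2) with (- (PI * k / 2)) by field. rewrite tan_neg. ring.
Qed.

(** On [0, 1) the constant is 20 + 32 from [cint_lip] and [tan_lip]; oddness and the zero at 0 carry
    it over to both signs. *)
Lemma cdiff_lip k k' : Rabs k < 1 -> Rabs k' < 1 -> Rabs (cdiff k - cdiff k') <= 52 * Rabs (k - k').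
Proof.
  assert (P : forall k k', 0 <= k < 1 -> 0 <= k' < 1 -> Rabs (cdiff k - cdiff k') <= 52 * Rabs (k - k')).
  { clear. intros k k' Hk Hk'. pose proof (cint_lip k k' Hk Hk') as A1. pose proof (tan_lip k k' Hk Hk') as A2.
    unfold cdiff.
    replace (cint k - PI * tan (PI * k / 2) - (cint k' - PI * tan (PI * k' / 2))) with
     ((cint k - 2 / (1 - k) - (cint k' - 2 / (1 - k'))) + - (PI * tan (PI * k / 2) - 2 / (1 - k) - (PI * tan (PI * k' / 2) - 2 / (1 - k')))) by ring.
    eapply Rle_trans; [apply Rabs_triang|]. rewrite Rabs_Ropp. lra. }
  assert (Z : cdiff 0 = 0).
  { pose proof (cdiff_opp 0) as H. rewrite Ropp_0, Rabs_R0 in H. specialize (H Rlt_0_1). lra. }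
  assert (M : forall k k', 0 <= k < 1 -> -1 < k' <= 0 -> Rabs (cdiff k - cdiff k') <= 52 * Rabs (k - k')).
  { intros l l' Hl Hl'. pose proof (P l 0 Hl ltac:(lra)) as A1. pose proof (P (- l') 0 ltac:(lra) ltac:(lra)) as A2.
    rewrite cdiff_opp in A2 by (apply Rabs_def1; lra). rewrite Z in *. rewrite !Rminus_0_r in *.
    rewrite !Rabs_Ropp in A2. rewrite (Rabs_pos_eq (l - l')) by lra. rewrite (Rabs_pos_eq l) in A1 by lra.
    rewrite (Rabs_left1 l') in A2 by lra.
    eapply Rle_trans; [apply Rabs_triang|]. rewrite Rabs_Ropp. lra. }
  intros Hk Hk'. apply Rabs_def2 in Hk. apply Rabs_def2 in Hk'.
  destruct (Rle_lt_dec 0 k) as [H|H]; destruct (Rle_lt_dec 0 k') as [H'|H'].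
  - apply P; lra.
  - apply M; lra.
  - rewrite Rabs_minus_sym, (Rabs_minus_sym k). apply M; lra.
  - pose proof (P (- k) (- k') ltac:(lra) ltac:(lra)) as A1.
    rewrite !cdiff_opp in A1 by (apply Rabs_def1; lra).
    replace (- cdiff k - - cdiff k') with (- (cdiff k - cdiff k')) in A1 by ring.
    replace (- k - - k') with (- (k - k')) in A1 by ring. now rewrite !Rabs_Ropp in A1.
Qed.

(* Each use of the duplication relation halves the Lipschitz constant. *)
Lemma cdiff_lip_pow n k k' : Rabs k < 1 -> Rabs k' < 1 -> Rabs (cdiff k - cdiff k') <= 52 * (/ 2) ^ n * Rabs (k - k').
Proof.
  revert k k'. induction n as [|n IH]; intros k k' Hk Hk'.
  - simpl. rewrite Rmult_1_r. now apply cdiff_lip.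
  - pose proof (cdiff_double k Hk) as E. pose proof (cdiff_double k' Hk') as E'.
    apply Rabs_def2 in Hk. apply Rabs_def2 in Hk'.
    pose proof (IH ((k + 1) / 2) ((k' + 1) / 2) ltac:(apply Rabs_def1; lra) ltac:(apply Rabs_def1; lra)) as A1.
    pose proof (IH ((k - 1) / 2) ((k' - 1) / 2) ltac:(apply Rabs_def1; lra) ltac:(apply Rabs_def1; lra)) as A2.
    replace ((k + 1) / 2 - (k' + 1) / 2) with ((k - k') * / 2) in A1 by field.
    replace ((k - 1) / 2 - (k' - 1) / 2) with ((k - k') * / 2) in A2 by field.
    rewrite Rabs_mult, (Rabs_pos_eq (/ 2)) in A1, A2 by lra.
    replace (cdiff k - cdiff k') with (/ 2 * ((cdiff ((k + 1) / 2) - cdiff ((k' + 1) / 2)) + (cdiff ((k - 1) / 2) - cdiff ((k' - 1) / 2)))) by lra.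
    rewrite Rabs_mult, (Rabs_pos_eq (/ 2)) by lra.
    eapply Rle_trans. apply Rmult_le_compat_l; [lra|]. apply Rabs_triang.
    eapply Rle_trans. apply Rmult_le_compat_l; [lra|]. apply Rplus_le_compat; [apply A1|apply A2].
    right. simpl. field.
Qed.

Lemma cint_tan k : Rabs k < 1 -> cint k = PI * tan (PI * k / 2).
Proof.
  intros Hk. enough (E : cdiff k = 0) by (unfold cdiff in E; lra).
  assert (Z : cdiff 0 = 0).
  { pose proof (cdiff_opp 0) as H. rewrite Ropp_0, Rabs_R0 in H. specialize (H Rlt_0_1). lra. }
  enough (H : Rabs (cdiff k) <= 0).
  { destruct (Req_dec (cdiff k) 0); auto. apply Rabs_pos_lt in H0. lra. }
  apply (is_lim_seq_le (fun _ => Rabs (cdiff k)) (fun n => 52 * (/ 2) ^ n * Rabs (k - 0)) (Rabs (cdiff k)) 0).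
  - intros n. pose proof (cdiff_lip_pow n k 0 Hk) as H. rewrite Z, (Rminus_0_r (cdiff k)) in H.
    apply H. rewrite Rabs_R0; lra.
  - apply is_lim_seq_const.
  - replace (Finite 0) with (Finite (52 * 0 * Rabs (k - 0))) by (f_equal; ring).
    apply is_lim_seq_mult'; [|apply is_lim_seq_const]. apply is_lim_seq_mult'; [apply is_lim_seq_const|].
    apply is_lim_seq_geom. rewrite Rabs_pos_eq; lra.
Qed.

(** * The Beta integral and Euler's reflection formula *)

Lemma dom_cosh_quot k : Rabs k < 1 -> dom (fun u => exp (k * u) / cosh u).
Proof.
  intros Hk. exists 2, (1 - Rabs k). split; [|split; [lra|]].
  - intros u. apply (continuous_mult (K := R_AbsRing) (fun u => exp (k * u)) (fun u => / cosh u)).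
    + apply continuous_derivable. auto_derive; auto.
    + apply continuous_derivable. pose proof (cosh_pos u). unfold cosh in *. auto_derive. lra.
  - intros u. pose proof (cosh_pos u) as Hc. unfold Rdiv. rewrite Rabs_mult, Rabs_inv.
    rewrite (Rabs_pos_eq (exp _)) by (left; apply exp_pos). rewrite (Rabs_pos_eq (cosh u)) by lra.
    apply Rmult_le_reg_r with (cosh u); auto. rewrite Rmult_assoc, Rinv_l, Rmult_1_r by lra.
    assert (H1 : exp (k * u) <= exp (Rabs k * Rabs u)) by (apply exp_le_exp; rewrite <- Rabs_mult; apply Rle_abs).
    assert (H2 : exp (Rabs u) <= 2 * cosh u).
    { unfold cosh. pose proof (exp_pos u). pose proof (exp_pos (- u)). unfold Rabs. destruct (Rcase_abs u); lra. }
    eapply Rle_trans; [apply H1|].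
    replace (exp (Rabs k * Rabs u)) with (exp (- ((1 - Rabs k) * Rabs u)) * exp (Rabs u)) by (rewrite <- exp_plus; f_equal; ring).
    replace (2 * exp (- ((1 - Rabs k) * Rabs u)) * cosh u) with (exp (- ((1 - Rabs k) * Rabs u)) * (2 * cosh u)) by ring.
    apply Rmult_le_compat_l; auto. left; apply exp_pos.
Qed.

Lemma II_opp_arg f : dom f -> II (fun y => f (- y)) = II f.
Proof.
  intros Hd. apply II_unique. apply (is_lim_seq_ext (fun n => RInt f (- INR n) (INR n))); [|now apply II_cvg].
  intros n. assert (Hex : forall u v, ex_RInt f u v) by (intros; apply cont_ex_RInt; now apply dom_cont).
  pose proof (RInt_scale f (-1) (- INR n) (INR n) (dom_cont f Hd)) as E.
  replace (-1 * - INR n) with (INR n) in E by ring. replace (-1 * INR n) with (- INR n) in E by ring.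
  rewrite <- (opp_RInt_swap f) in E by apply Hex. unfold opp in E; simpl in E.
  rewrite (RInt_ext (fun y => f (- y)) (fun y => f (-1 * y))) by (intros; f_equal; ring). lra.
Qed.

(** Only the even part cosh(k u) / cosh u contributes. It is the difference of the quotients of
    sinh((k + 1) u) and sinh((k - 1) u) by sinh(2 u), that is, of two instances of [cint]. *)
Lemma II_cosh_quot k : Rabs k < 1 -> II (fun u => exp (k * u) / cosh u) = PI / cos (PI * k / 2).
Proof.
  intros Hk. pose proof (dom_cosh_quot k Hk) as D.
  assert (D' : dom (fun u => exp (k * - u) / cosh (- u))) by (apply (dom_opp_arg (fun u => exp (k * u) / cosh u) D)).
  assert (Hk' := Rabs_def2 _ _ Hk).
  assert (D1 : dom (shq ((k + 1) / 2))) by (apply shq_dom, Rabs_def1; lra).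
  assert (D2 : dom (shq ((k - 1) / 2))) by (apply shq_dom, Rabs_def1; lra).
  assert (E : 2 * II (fun u => exp (k * u) / cosh u) = cint ((k + 1) / 2) - cint ((k - 1) / 2)).
  { replace (2 * II (fun u => exp (k * u) / cosh u)) with (II (fun u => exp (k * u) / cosh u) + II (fun u => exp (k * - u) / cosh (- u))).
    2: { rewrite (II_opp_arg (fun u => exp (k * u) / cosh u) D). ring. }
    rewrite <- II_plus by auto. unfold cint. rewrite <- II_minus by auto.
    rewrite <- (II_scale (fun y => shq ((k + 1) / 2) y - shq ((k - 1) / 2) y) 2) by (try lra; now apply dom_minus).
    rewrite <- II_scal by (apply (dom_scale (fun y => shq ((k + 1) / 2) y - shq ((k - 1) / 2) y) 2); [lra | now apply dom_minus]).
    apply II_ext. intros y.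
    unfold shq, sq. destruct (Req_EM_T (2 * y) 0) as [H|H].
    - assert (y = 0) by lra. subst y. rewrite Ropp_0, Rmult_0_r, exp_0, cosh_0. field.
    - assert (Hy : y <> 0) by lra.
      replace ((k + 1) / 2 * (2 * y)) with (k * y + y) by field.
      replace ((k - 1) / 2 * (2 * y)) with (k * y + - y) by field.
      pose proof (sinh_neq y Hy). pose proof (cosh_pos y).
      rewrite !sinh_add, sinh_opp, !cosh_opp, sinh_2.
      replace (k * - y) with (- (k * y)) by ring.
      replace (exp (k * y)) with (cosh (k * y) + sinh (k * y)) by (unfold cosh, sinh; field).
      replace (exp (- (k * y))) with (cosh (k * y) - sinh (k * y)) by (unfold cosh, sinh; field).
      field. lra. }
  rewrite !cint_tan in E by (apply Rabs_def1; lra).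
  replace (PI * ((k + 1) / 2) / 2) with (PI * k / 4 + PI / 4) in E by field.
  replace (PI * ((k - 1) / 2) / 2) with (- (PI / 2 - (PI * k / 4 + PI / 4))) in E by field.
  rewrite tan_neg in E. unfold tan in E. rewrite sin_shift, cos_shift in E.
  set (A := PI * k / 4 + PI / 4) in *. pose proof PI_RGT_0.
  assert (HA : 0 < A < PI / 2) by (unfold A; split; nra).
  assert (Hs : 0 < sin A) by (apply sin_gt_0; lra).
  assert (Hc : 0 < cos A) by (apply cos_gt_0; lra).
  replace (cos (PI * k / 2)) with (2 * sin A * cos A).
  - pose proof (sin2_cos2 A) as SC. unfold Rsqr in SC.
    apply Rmult_eq_reg_l with 2; [|lra]. rewrite E.
    transitivity (PI * (sin A * sin A + cos A * cos A) / (sin A * cos A)); [field; lra|]. rewrite SC. field. lra.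
  - rewrite <- sin_2a. rewrite <- sin_shift. replace (2 * A) with (PI - (PI / 2 - PI * k / 2)) by (unfold A; field).
    apply sin_PI_x.
Qed.

(** The Beta integral B(s, 1 - s); with y = 2 u it becomes [II_cosh_quot] at k = 2 s - 1. *)
Lemma K0_val s : 0 < s < 1 -> dom (fun y => exp (s * y) / (1 + exp y)) /\
  II (fun y => exp (s * y) / (1 + exp y)) = PI / sin (PI * s).
Proof.
  intros Hs. assert (Hk : Rabs (2 * s - 1) < 1) by (apply Rabs_def1; lra).
  pose proof (dom_cosh_quot _ Hk) as D.
  assert (E : forall y, / 2 * (exp ((2 * s - 1) * (/ 2 * y)) / cosh (/ 2 * y)) = exp (s * y) / (1 + exp y)).
  { intros y. unfold cosh. pose proof (exp_pos y). pose proof (exp_pos (/ 2 * y)). pose proof (exp_pos (- (/ 2 * y))).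
    replace ((2 * s - 1) * (/ 2 * y)) with (s * y + - (/ 2 * y)) by field. rewrite exp_plus.
    replace (exp y) with (exp (/ 2 * y) * exp (/ 2 * y)) by (rewrite <- exp_plus; f_equal; field).
    rewrite exp_Ropp. field. split; nra. }
  assert (D' : dom (fun y => exp (s * y) / (1 + exp y))).
  { apply (dom_ext _ _ E). apply dom_scal. apply (dom_scale (fun u => exp ((2 * s - 1) * u) / cosh u)); auto. lra. }
  split; auto. rewrite <- (II_ext _ _ E).
  assert (D'' : dom (fun y => exp ((2 * s - 1) * (/ 2 * y)) / cosh (/ 2 * y))) by (apply (dom_scale (fun u => exp ((2 * s - 1) * u) / cosh u)); auto; lra).
  rewrite II_scal by auto. rewrite (II_scale (fun u => exp ((2 * s - 1) * u) / cosh u)) by (auto; lra).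
  rewrite II_cosh_quot by auto. f_equal. rewrite <- sin_shift.
  rewrite <- (sin_PI_x (PI * s)). f_equal. field.
Qed.

(** The power u^d interpolates between the bounds u and 1: a small d keeps majorants integrable and
    still gives convergence as u tends to 0. *)
Lemma one_minus_exp_le d u : 0 < d <= 1 -> 0 < u -> 0 <= 1 - exp (- u) <= exp (d * ln u).
Proof.
  intros Hd Hu. split.
  - assert (exp (- u) <= exp 0) by (apply exp_le_exp; lra). rewrite exp_0 in H. lra.
  - destruct (Rle_lt_dec u 1) as [H|H].
    + pose proof (exp_ineq1_le (- u)).
      assert (u <= exp (d * ln u)).
      { rewrite <- (exp_ln u) at 1 by auto. apply exp_le_exp.
        assert (ln u <= 0) by (rewrite <- ln_1; apply ln_le; lra). nra. }
      lra.
    + assert (1 <= exp (d * ln u)).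
      { rewrite <- exp_0 at 1. apply exp_le_exp.
        assert (0 <= ln u) by (rewrite <- ln_1; apply ln_le; lra). nra. }
      pose proof (exp_pos (- u)). lra.
Qed.

Lemma is_lim_exp_scal_m d C : 0 < d -> is_lim (fun x => C * exp (d * x)) m_infty 0.
Proof.
  intros Hd. apply is_lim_spec. intros eps.
  pose proof (Rabs_pos C) as HC. pose proof (cond_pos eps) as He.
  exists (ln (eps / (Rabs C + 1)) / d). intros x Hx. rewrite Rminus_0_r, Rabs_mult, (Rabs_pos_eq (exp _)) by (left; apply exp_pos).
  assert (H : d * x < ln (eps / (Rabs C + 1))).
  { apply Rmult_lt_compat_l with (r := d) in Hx; auto.
    replace (d * (ln (eps / (Rabs C + 1)) / d)) with (ln (eps / (Rabs C + 1))) in Hx by (field; lra). auto. }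
  apply exp_increasing in H. rewrite exp_ln in H by (apply Rdiv_lt_0_compat; lra).
  apply Rle_lt_trans with ((Rabs C + 1) * exp (d * x)).
  - apply Rmult_le_compat_r; [left; apply exp_pos | lra].
  - apply Rmult_lt_compat_l with (r := Rabs C + 1) in H; [|lra].
    replace ((Rabs C + 1) * (eps / (Rabs C + 1))) with (pos eps) in H by (field; lra). auto.
Qed.

Lemma is_lim_squeeze0 (f g : R -> R) x (l : R) : (forall t, Rabs (f t - l) <= g t) -> is_lim g x 0 -> is_lim f x l.
Proof.
  intros H Hg. apply is_lim_spec. intros eps. apply is_lim_spec in Hg. specialize (Hg eps).
  assert (W : forall t, Rabs (g t - 0) < eps -> Rabs (f t - l) < eps).
  { intros t Ht. rewrite Rminus_0_r in Ht. eapply Rle_lt_trans; [apply H|]. eapply Rle_lt_trans; [apply Rle_abs|auto]. }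
  now apply (filter_imp (F := Rbar_locally' x) _ _ W).
Qed.

(** Differentiation in a scale takes the place of Fubini's theorem. The derivative of F(t), the
    integral of exp(s y - exp t (1 + exp y)) / (1 + exp y), is - G(s) times the integrand of G(1 -
    s); F falls from the Beta integral at - oo to 0 at + oo. *)
Lemma G_reflection s : 0 < s < 1 -> G s * G (1 - s) = PI / sin (PI * s).
Proof.
  intros Hs. destruct (K0_val s Hs) as [DK EK]. rewrite <- EK. clear EK.
  set (K0 := II (fun y => exp (s * y) / (1 + exp y))).
  set (f := fun t y => exp (s * y - exp t * (1 + exp y)) / (1 + exp y)).
  set (F := fun t => II (f t)).
  assert (Hp : forall y, 0 < 1 + exp y) by (intros y; pose proof (exp_pos y); lra).
  assert (Fc : forall t y, continuous (f t) y).
  { intros t y. unfold f. apply continuous_derivable. specialize (Hp y). auto_derive. lra. }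
  assert (Fle : forall t y, 0 <= f t y <= exp (- exp t) * (exp (s * y) / (1 + exp y))).
  { intros t y. unfold f. specialize (Hp y). split.
    - apply Rdiv_le_0_compat; auto. left; apply exp_pos.
    - unfold Rdiv. rewrite <- Rmult_assoc. apply Rmult_le_compat_r; [left; now apply Rinv_0_lt_compat|].
      rewrite <- exp_plus. apply exp_le_exp. pose proof (exp_pos y). pose proof (exp_pos t). nra. }
  assert (Fd : forall t, dom (f t)).
  { intros t. destruct DK as (C & e & Hd). pose proof (edom_C _ _ _ Hd). destruct Hd as (Kc & He & HC).
    exists C, e. split; [|split]; auto. intros y.
    specialize (HC y). destruct (Fle t y) as [L1 L2]. rewrite Rabs_pos_eq by auto. eapply Rle_trans; [|apply HC].
    eapply Rle_trans; [apply L2|]. rewrite Rabs_pos_eq by (apply Rdiv_le_0_compat; auto; left; apply exp_pos).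
    rewrite <- (Rmult_1_l (exp (s * y) / (1 + exp y))) at 2. apply Rmult_le_compat_r.
    apply Rdiv_le_0_compat; auto; left; apply exp_pos.
    rewrite <- exp_0. apply exp_le_exp. pose proof (exp_pos t). lra. }
  assert (DF : forall t, is_derive F t (- G s * exp ((1 - s) * t - exp t))).
  { intros x.
    set (f1 := fun t y => - exp t * exp (s * y - exp t * (1 + exp y))).
    set (f2 := fun t y => (- exp t + exp t * exp t * (1 + exp y)) * exp (s * y - exp t * (1 + exp y))).
    assert (E1 : II (f1 x) = - G s * exp ((1 - s) * x - exp x)).
    { transitivity (II (fun y => - exp (x - exp x) * exp (s * y - exp x * exp y))).
      - apply II_ext. intros y. unfold f1.
        replace (s * y - exp x * (1 + exp y)) with (s * y - exp x * exp y + - exp x) by ring.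
        unfold Rminus at 2. rewrite !exp_plus. ring.
      - rewrite II_scal, G_scale by (try apply dom_exp; try apply exp_pos; lra).
        rewrite ln_exp. replace ((1 - s) * x - exp x) with (x - exp x + - (s * x)) by ring. rewrite (exp_plus (x - exp x)). ring. }
    assert (D1 : dom (f1 x)).
    { apply (dom_ext (fun y => - exp (x - exp x) * exp (s * y - exp x * exp y))).
      - intros y. unfold f1.
        replace (s * y - exp x * (1 + exp y)) with (s * y - exp x * exp y + - exp x) by ring.
        unfold Rminus at 1. rewrite !exp_plus. ring.
      - apply dom_scal, dom_exp; try apply exp_pos; lra. }
    rewrite <- E1.
    destruct (exp_decay_pos s (exp (x - 1) / 2) ltac:(lra)) as (C & HC & B).
    { pose proof (exp_pos (x - 1)). lra. }
    (* [1 + exp y <= K * exp (exp (x-1) * exp y / 2)] absorbs the polynomial factor of [f2]. *)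
    set (c := exp (x - 1)) in *. assert (Hc : 0 < c) by apply exp_pos.
    set (X := exp (x + 1)). assert (HX : 0 < X) by apply exp_pos.
    apply (II_param f f1 f2 x 1 ((X + X * X * (1 + 2 / c)) * C) s); auto; try lra.
    - intros t y _. unfold f, f1. specialize (Hp y). auto_derive; [lra|]. unfold Rminus. field. lra.
    - intros t y _. unfold f1, f2. specialize (Hp y). auto_derive; auto. unfold Rminus. ring.
    - intros t y Ht. apply Rabs_def2 in Ht. unfold f2.
      assert (T1 : exp t <= X) by (apply exp_le_exp; lra).
      assert (T2 : c <= exp t) by (apply exp_le_exp; lra).
      pose proof (exp_pos t) as T0. pose proof (exp_pos y) as Y0.
      rewrite Rabs_mult, (Rabs_pos_eq (exp (s * y - _))) by (left; apply exp_pos).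
      assert (A1 : exp (s * y - exp t * (1 + exp y)) <= exp (s * y - c / 2 * exp y) * exp (- (c / 2 * exp y))).
      { rewrite <- exp_plus. apply exp_le_exp. nra. }
      assert (A2 : Rabs (- exp t + exp t * exp t * (1 + exp y)) <= X + X * X * (1 + exp y)).
      { eapply Rle_trans; [apply Rabs_triang|]. rewrite Rabs_Ropp, !Rabs_pos_eq; try nra.
        apply Rplus_le_compat; auto. apply Rmult_le_compat_r; nra. }
      set (u := c / 2 * exp y). assert (Hu : 0 < u) by (unfold u; nra).
      assert (A3 : (X + X * X * (1 + exp y)) * exp (- u) <= X + X * X * (1 + 2 / c)).
      { assert (M1 : exp (- u) <= 1) by (rewrite <- exp_0; apply exp_le_exp; lra).
        assert (M2 : exp y * exp (- u) <= 2 / c).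
        { replace (exp y) with (2 / c * u) by (unfold u; field; lra). rewrite Rmult_assoc.
          rewrite <- (Rmult_1_r (2 / c)) at 2. apply Rmult_le_compat_l; [apply Rlt_le, Rdiv_lt_0_compat; lra|].
          rewrite exp_Ropp. pose proof (exp_ineq1_le u). apply Rmult_le_reg_r with (exp u); [apply exp_pos|].
          rewrite Rmult_assoc, Rinv_l by (apply Rgt_not_eq, exp_pos). lra. }
        pose proof (exp_pos (- u)). nra. }
      specialize (B y). fold u in A1.
      apply Rle_trans with ((X + X * X * (1 + exp y)) * (exp (s * y - u) * exp (- u))).
      + apply Rmult_le_compat; auto. apply Rabs_pos. left; apply exp_pos.
      + replace ((X + X * X * (1 + exp y)) * (exp (s * y - u) * exp (- u))) with (((X + X * X * (1 + exp y)) * exp (- u)) * exp (s * y - u)) by ring.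
        apply Rle_trans with ((X + X * X * (1 + 2 / c)) * (C * exp (- (s * Rabs y)))); [|right; ring].
        apply Rmult_le_compat; auto; try (left; apply exp_pos).
        apply Rmult_le_pos; [|left; apply exp_pos].
        assert (0 < X * X) by (apply Rmult_lt_0_compat; auto).
        assert (0 < X * X * (1 + exp y)) by (apply Rmult_lt_0_compat; lra). lra. }
  assert (L1 : is_lim F p_infty 0).
  { apply (is_lim_squeeze0 F (fun t => K0 * exp (- t))).
    - intros t. rewrite Rminus_0_r. unfold F.
      assert (0 <= II (f t)).
      { replace 0 with (II (fun y => 0 * f t y)) by (rewrite II_scal by auto; ring).
        apply II_le; auto. now apply dom_scal. intros y. destruct (Fle t y). lra. }
      rewrite Rabs_pos_eq by auto. unfold K0. rewrite Rmult_comm, <- II_scal by auto.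
      apply II_le; auto. now apply dom_scal. intros y. eapply Rle_trans; [apply Fle|].
      apply Rmult_le_compat_r. apply Rdiv_le_0_compat; auto; left; apply exp_pos.
      apply exp_le_exp. pose proof (exp_ineq1_le t). lra.
    - apply (is_lim_ext (fun t => K0 * exp (1 * - t))). intros; do 2 f_equal; ring.
      apply (is_lim_comp (fun u => K0 * exp (1 * u)) Ropp p_infty 0 m_infty).
      + apply is_lim_exp_scal_m. lra.
      + apply (is_lim_opp (fun y => y) p_infty p_infty). apply is_lim_id.
      + exists 0. easy. }
  assert (L0 : is_lim F m_infty K0).
  (* The majorant [g] carries the extra growth (1 + exp y)^d and stays integrable as long as s + d <
     1. *)
  { set (d := (1 - s) / 2).
    destruct (K0_val (s + d) ltac:(unfold d; lra)) as [DK' _].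
    set (g := fun y => exp (s * y) / (1 + exp y) * exp (d * ln (1 + exp y))).
    assert (Dg : dom g).
    { destruct DK as (C1 & e1 & H1). destruct DK' as (C2 & e2 & H2).
      pose proof (edom_plus _ _ _ _ _ _ H1 H2) as H3. pose proof (edom_C _ _ _ H3). destruct H3 as (_ & He & H3).
      exists (2 * (C1 + C2)), (Rmin e1 e2). split; [|split]; auto.
      - intros y. unfold g. apply continuous_derivable. specialize (Hp y). auto_derive. split; lra.
      - intros y. specialize (H3 y). specialize (Hp y). pose proof (exp_pos y) as Y.
        assert (Q : exp (d * ln (1 + exp y)) <= 2 * (1 + exp (d * y))).
        { destruct (Rle_lt_dec (exp y) 1) as [Hy|Hy].
          - apply Rle_trans with (exp (ln 2)).
            + apply exp_le_exp. assert (ln (1 + exp y) <= ln 2) by (apply ln_le; lra).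
              assert (0 <= ln (1 + exp y)) by (rewrite <- ln_1; apply ln_le; lra).
              unfold d. nra.
            + rewrite exp_ln by lra. pose proof (exp_pos (d * y)). lra.
          - apply Rle_trans with (exp (ln 2 + d * y)).
            + apply exp_le_exp. assert (E : ln (1 + exp y) <= ln (2 * exp y)) by (apply ln_le; lra).
              rewrite ln_mult, ln_exp in E by lra.
              assert (0 < ln 2) by (rewrite <- ln_1; apply ln_increasing; lra). unfold d in *. nra.
            + rewrite exp_plus, exp_ln by lra. pose proof (exp_pos (d * y)). lra. }
        assert (P1 : 0 < exp (s * y) / (1 + exp y)) by (apply Rdiv_lt_0_compat; auto; apply exp_pos).
        assert (P2 : 0 < exp ((s + d) * y) / (1 + exp y)) by (apply Rdiv_lt_0_compat; auto; apply exp_pos).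
        rewrite Rabs_pos_eq in H3 by lra. unfold g.
        rewrite Rabs_pos_eq by (apply Rmult_le_pos; [lra | left; apply exp_pos]).
        rewrite Rmult_assoc. eapply Rle_trans; [|apply Rmult_le_compat_l; [|apply H3]; lra].
        eapply Rle_trans; [apply Rmult_le_compat_l; [lra | apply Q]|]. right.
        replace ((s + d) * y) with (s * y + d * y) by ring. rewrite exp_plus. field. lra. }
    apply (is_lim_squeeze0 F (fun t => II g * exp (d * t))).
    - intros t. unfold F, K0. rewrite <- II_minus by auto.
      assert (P : forall y, 0 <= exp (s * y) / (1 + exp y) - f t y <= exp (d * t) * g y).
      { intros y. specialize (Hp y).
        replace (exp (s * y) / (1 + exp y) - f t y) with (exp (s * y) / (1 + exp y) * (1 - exp (- (exp t * (1 + exp y))))).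
        2: { unfold f. replace (s * y - exp t * (1 + exp y)) with (s * y + - (exp t * (1 + exp y))) by ring. rewrite exp_plus. field. lra. }
        destruct (one_minus_exp_le d (exp t * (1 + exp y))) as [O1 O2]; [unfold d; lra | apply Rmult_lt_0_compat; auto; apply exp_pos|].
        rewrite ln_mult, ln_exp in O2 by (auto; apply exp_pos).
        rewrite (Rmult_plus_distr_l d), (exp_plus (d * t)) in O2.
        assert (P1 : 0 < exp (s * y) / (1 + exp y)) by (apply Rdiv_lt_0_compat; auto; apply exp_pos).
        split; [nra|]. unfold g.
        eapply Rle_trans; [apply Rmult_le_compat_l; [lra | apply O2]|]. right; ring. }
      rewrite <- Rabs_Ropp. replace (- II (fun y => f t y - exp (s * y) / (1 + exp y))) with (II (fun y => exp (s * y) / (1 + exp y) - f t y)).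
      2: { rewrite !II_minus by auto. ring. }
      rewrite Rabs_pos_eq.
      + rewrite Rmult_comm, <- II_scal by auto. apply II_le. now apply dom_minus. now apply dom_scal. apply P.
      + replace 0 with (II (fun y => 0 * f t y)) by (rewrite II_scal by auto; ring).
        apply II_le. now apply dom_scal. now apply dom_minus. intros y. destruct (P y). lra.
    - apply is_lim_exp_scal_m. unfold d; lra. }
  assert (DG : dom (fun t => exp ((1 - s) * t - exp t))) by (apply dom_G; lra).
  pose proof (II_FTC (fun t => - G s * exp ((1 - s) * t - exp t)) F K0 0 (dom_scal _ _ DG) DF L0 L1) as E.
  rewrite II_scal in E by auto. fold (G (1 - s)) in E. lra.
Qed.

Lemma G_half : G (1 / 2) = sqrt PI.
Proof.
  pose proof (G_reflection (1 / 2) ltac:(lra)) as E. pose proof PI_RGT_0.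
  replace (1 - 1 / 2) with (1 / 2) in E by field.
  replace (PI * (1 / 2)) with (PI / 2) in E by field. rewrite sin_PI2 in E.
  symmetry. replace PI with (G (1 / 2) * G (1 / 2)) by lra. apply sqrt_square. left. apply G_pos. lra.
Qed.

(** * The recessive solution *)

(** Sums indexed by the number of terms, so that the empty sum exists; [sum_f_R0] always has a first
    term. *)
Fixpoint sumn (f : nat -> R) (n : nat) : R :=
  match n with O => 0 | S k => sumn f k + f k end.

Lemma sumn_ext f g n : (forall k, (k < n)%nat -> f k = g k) -> sumn f n = sumn g n.
Proof. induction n as [|n IH]; simpl; intros H; [auto|]. rewrite IH, H; auto. Qed.

Lemma sumn_plus f g n : sumn (fun k => f k + g k) n = sumn f n + sumn g n.
Proof. induction n as [|n IH]; simpl; [ring|]. rewrite IH; ring. Qed.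

Lemma sumn_scal c f n : sumn (fun k => c * f k) n = c * sumn f n.
Proof. induction n as [|n IH]; simpl; [ring|]. rewrite IH; ring. Qed.

Lemma sumn_Sl f n : sumn f (S n) = f O + sumn (fun k => f (S k)) n.
Proof. induction n as [|n IH]; [simpl; ring|]. change (sumn f (S (S n))) with (sumn f (S n) + f (S n)). rewrite IH. simpl. ring. Qed.

Lemma sumn_sum_f_R0 f n : (0 < n)%nat -> sum_f_R0 f (n - 1) = sumn f n.
Proof.
  intros H. destruct n as [|n]; [lia|]. replace (S n - 1)%nat with n by lia. clear H.
  induction n as [|n IH]; simpl in *; [ring|]. now rewrite IH.
Qed.

(* Satisfied by the recessive solutions [va], [vb] for the parameters [a] and [a + 1]. *)
Definition sys (a : R) (va vb : R -> R) : Prop :=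
  forall x, 0 < x -> is_derive va x (- vb x) /\ is_derive vb x (- x * vb x + (a + 1 / 2) * va x).

Definition dcoef (a : R) (j : nat) : R := (-1) ^ j * poch (1 / 2 - a) (2 * j) / (INR (fact j) * 2 ^ j).

Definition scaled (a : R) (v : R -> R) (x : R) : R := v x * exp ((1 / 2 - a) * ln x + x ^ 2 / 2).

(** The complete expansion, with errors uniform on [1, oo): later v is evaluated at x exp y for y in
    a whole interval. [bdd] covers the remaining range (0, 1]. *)
Definition asy (a : R) (v : R -> R) : Prop :=
  forall J, exists C, forall x, 1 <= x ->
    Rabs (scaled a v x - sumn (fun j => dcoef a j / x ^ (2 * j)) J) <= C / x ^ (2 * J).

Definition bdd (v : R -> R) : Prop := exists C, forall x, 0 < x <= 1 -> Rabs (v x) <= C.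

(* For [b > 0], [vh b x = int_0^oo u^(b-1) exp (-(x+u)^2/2) du]; the recessive solution is [vh (1/2 - a) / G (1/2 - a)]. *)
Definition vh (b x : R) : R := II (fun y => exp (b * y - (x + exp y) ^ 2 / 2)).

(** Half of the Gaussian absorbs the polynomial and the other half gives exp(1 - u), by (u - 2)^2 >=
    0. With u = x + exp y the result is a double exponential, to which [exp_decay_pos] applies. *)
Lemma gauss_poly_le u : (1 + u ^ 2) * exp (- (u ^ 2 / 2)) <= 5 * exp (1 - u).
Proof.
  pose proof (exp_ineq1_le (u ^ 2 / 4)) as H. pose proof (pow2_ge_0 u) as H2.
  replace (- (u ^ 2 / 2)) with (- (u ^ 2 / 4) + - (u ^ 2 / 4)) by field. rewrite exp_plus.
  assert (H3 : exp (- (u ^ 2 / 4)) <= exp (1 - u)) by (apply exp_le_exp; pose proof (pow2_ge_0 (u - 2)); nra).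
  assert (H4 : (1 + u ^ 2) * exp (- (u ^ 2 / 4)) <= 5).
  { apply Rle_trans with (5 * exp (u ^ 2 / 4) * exp (- (u ^ 2 / 4))).
    - apply Rmult_le_compat_r; [left; apply exp_pos|]. lra.
    - rewrite Rmult_assoc, <- exp_plus, Rplus_opp_r, exp_0. lra. }
  rewrite <- Rmult_assoc. apply Rmult_le_compat; auto; try (left; apply exp_pos).
  apply Rmult_le_pos; [lra | left; apply exp_pos].
Qed.

Lemma vh_dom_poly b x (p : R -> R) : 0 < b -> (forall y, continuous p y) ->
  (forall y, Rabs (p y) <= 1 + (x + exp y) ^ 2) -> dom (fun y => p y * exp (b * y - (x + exp y) ^ 2 / 2)).
Proof.
  intros Hb Hc Hp. destruct (exp_decay_pos b 1 Hb Rlt_0_1) as (C & HC & B).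
  exists (5 * exp (1 - x) * C), b. split; [|split; auto].
  - intros y. apply (continuous_mult (K := R_AbsRing)); auto. apply continuous_derivable. auto_derive; auto.
  - intros y. rewrite Rabs_mult, (Rabs_pos_eq (exp _)) by (left; apply exp_pos).
    specialize (B y). rewrite Rmult_1_l in B. pose proof (gauss_poly_le (x + exp y)) as Q.
    unfold Rminus at 1. rewrite exp_plus.
    apply Rle_trans with (exp (b * y) * ((1 + (x + exp y) ^ 2) * exp (- ((x + exp y) ^ 2 / 2)))).
    + rewrite (Rmult_comm (exp (b * y))), <- Rmult_assoc, (Rmult_comm (exp (b * y))).
      apply Rmult_le_compat_r; [left; apply exp_pos|]. apply Rmult_le_compat_r; [left; apply exp_pos|]. apply Hp.
    + apply Rle_trans with (exp (b * y) * (5 * exp (1 - (x + exp y)))).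
      apply Rmult_le_compat_l; [left; apply exp_pos|]. auto.
      replace (1 - (x + exp y)) with (1 - x + - exp y) by ring. rewrite exp_plus.
      unfold Rminus in B. rewrite exp_plus in B. pose proof (exp_pos (1 - x)). 
      replace (exp (b * y) * (5 * (exp (1 - x) * exp (- exp y)))) with (5 * exp (1 - x) * (exp (b * y) * exp (- exp y))) by ring.
      rewrite (Rmult_assoc (5 * exp (1 - x))). apply Rmult_le_compat_l; lra.
Qed.

Lemma vh_dom b x : 0 < b -> dom (fun y => exp (b * y - (x + exp y) ^ 2 / 2)).
Proof.
  intros Hb. apply (dom_ext (fun y => 1 * exp (b * y - (x + exp y) ^ 2 / 2))). intros; ring.
  apply (vh_dom_poly b x (fun _ => 1)); auto. intros; apply continuous_const.
  intros. rewrite Rabs_R1. pose proof (pow2_ge_0 (x + exp y)). lra.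
Qed.

Lemma vh_parts b x : 0 < b -> vh (b + 2) x = b * vh b x - x * vh (b + 1) x.
Proof.
  intros Hb. unfold vh.
  assert (E : II (fun y => b * exp (b * y - (x + exp y) ^ 2 / 2) - x * exp ((b + 1) * y - (x + exp y) ^ 2 / 2)
     - exp ((b + 2) * y - (x + exp y) ^ 2 / 2)) = 0).
  { apply (II_derive_zero _ (fun y => exp (b * y - (x + exp y) ^ 2 / 2))).
    - apply dom_minus; [apply dom_minus; apply dom_scal|]; apply vh_dom; lra.
    - now apply vh_dom.
    - intros y. auto_derive; auto.
      replace ((b + 1) * y - (x + exp y) ^ 2 / 2) with ((b * y - (x + exp y) ^ 2 / 2) + y) by ring.
      replace ((b + 2) * y - (x + exp y) ^ 2 / 2) with ((b * y - (x + exp y) ^ 2 / 2) + y + y) by ring.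
      rewrite !(exp_plus _ y).
      replace (b * y + - ((x + exp y) * ((x + exp y) * 1) * / 2)) with (b * y - (x + exp y) ^ 2 / 2) by (simpl; field).
      field. }
  rewrite II_minus, II_minus, !II_scal in E. lra.
  all: dom_tac; apply vh_dom; lra.
Qed.

Lemma vh_derive0 b x : 0 < b -> is_derive (vh b) x (- (x * vh b x + vh (b + 1) x)).
Proof.
  intros Hb.
  set (f := fun x y => exp (b * y - (x + exp y) ^ 2 / 2)).
  set (f1 := fun x y => - (x + exp y) * exp (b * y - (x + exp y) ^ 2 / 2)).
  set (f2 := fun x y => ((x + exp y) ^ 2 - 1) * exp (b * y - (x + exp y) ^ 2 / 2)).
  assert (D1 : dom (f1 x)).
  { apply (vh_dom_poly b x (fun y => - (x + exp y))); auto.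
    - intros y. apply continuous_derivable. auto_derive; auto.
    - intros y. rewrite Rabs_Ropp. unfold Rabs. destruct (Rcase_abs _).
      pose proof (pow2_ge_0 (x + exp y + 1)). nra. pose proof (pow2_ge_0 (x + exp y - 1)). nra. }
  replace (- (x * vh b x + vh (b + 1) x)) with (II (f1 x)).
  2: { unfold vh. rewrite <- II_scal, <- II_plus by (dom_tac; apply vh_dom; lra).
    replace (- II (fun y => x * exp (b * y - (x + exp y) ^ 2 / 2) + exp ((b + 1) * y - (x + exp y) ^ 2 / 2)))
      with ((-1) * II (fun y => x * exp (b * y - (x + exp y) ^ 2 / 2) + exp ((b + 1) * y - (x + exp y) ^ 2 / 2))) by ring.
    rewrite <- II_scal by (apply dom_plus; [apply dom_scal|]; apply vh_dom; lra).
    apply II_ext. intros y. unfold f1.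
    replace ((b + 1) * y - (x + exp y) ^ 2 / 2) with ((b * y - (x + exp y) ^ 2 / 2) + y) by ring.
    rewrite (exp_plus _ y). ring. }
  destruct (exp_decay_pos b 1 Hb Rlt_0_1) as (C & HC & B).
  apply (II_param f f1 f2 x 1 (5 * exp (2 - x) * C) b); auto; try lra.
  - intros t _. now apply vh_dom.
  - intros t y _. unfold f, f1. auto_derive; auto.
    replace (b * y + - ((t + exp y) * ((t + exp y) * 1) * / 2)) with (b * y - (t + exp y) ^ 2 / 2) by (simpl; field). field.
  - intros t y _. unfold f1, f2. auto_derive; auto.
    replace (b * y + - ((t + exp y) * ((t + exp y) * 1) * / 2)) with (b * y - (t + exp y) ^ 2 / 2) by (simpl; field). field.
  - intros t y Ht. unfold f2. apply Rabs_def2 in Ht. specialize (B y). rewrite Rmult_1_l in B.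
    rewrite Rabs_mult, (Rabs_pos_eq (exp _)) by (left; apply exp_pos).
    pose proof (gauss_poly_le (t + exp y)) as Q. pose proof (pow2_ge_0 (t + exp y)) as Q2.
    unfold Rminus at 2. rewrite exp_plus.
    apply Rle_trans with (exp (b * y) * ((1 + (t + exp y) ^ 2) * exp (- ((t + exp y) ^ 2 / 2)))).
    + rewrite (Rmult_comm (exp (b * y))), <- Rmult_assoc, (Rmult_comm (exp (b * y))).
      apply Rmult_le_compat_r; [left; apply exp_pos|]. apply Rmult_le_compat_r; [left; apply exp_pos|].
      unfold Rabs. destruct (Rcase_abs _); lra.
    + apply Rle_trans with (exp (b * y) * (5 * (exp (2 - x) * exp (- exp y)))).
      * apply Rmult_le_compat_l; [left; apply exp_pos|]. eapply Rle_trans; [apply Q|].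
        apply Rmult_le_compat_l; [lra|]. rewrite <- exp_plus. apply exp_le_exp. lra.
      * unfold Rminus in B. rewrite exp_plus in B. pose proof (exp_pos (2 - x)). 
        replace (exp (b * y) * (5 * (exp (2 - x) * exp (- exp y)))) with (5 * exp (2 - x) * (exp (b * y) * exp (- exp y))) by ring.
        rewrite (Rmult_assoc (5 * exp (2 - x))). apply Rmult_le_compat_l; lra.
Qed.

(** [vh_parts] trades [vh] (b + 2) for [vh] b, and so [vh] b and [vh] (b + 1) close up into a first
    order system. *)
Lemma vh_derive1 b x : 0 < b -> is_derive (vh (b + 1)) x (- b * vh b x).
Proof.
  intros Hb. replace (- b * vh b x) with (- (x * vh (b + 1) x + vh (b + 1 + 1) x)).
  - apply vh_derive0. lra.
  - replace (b + 1 + 1) with (b + 2) by ring. rewrite vh_parts by auto. ring.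
Qed.

Lemma vh_pos_le b x : 0 < b -> 0 <= x -> 0 <= vh b x <= vh b 0.
Proof.
  intros Hb Hx. split.
  - left. apply II_pos. now apply vh_dom. intros; apply exp_pos.
  - apply II_le; try now apply vh_dom. intros y. apply exp_le_exp. pose proof (exp_pos y). nra.
Qed.

Lemma vh_0 b : 0 < b -> vh b 0 = exp ((b / 2 - 1) * ln 2) * G (b / 2).
Proof.
  intros Hb. unfold vh.
  assert (D : dom (fun s => exp (b / 2 * s - / 2 * exp s))) by (apply dom_exp; lra).
  rewrite (II_ext _ (fun y => exp (b / 2 * (2 * y) - / 2 * exp (2 * y)))).
  - pose proof (II_scale (fun s => exp (b / 2 * s - / 2 * exp s)) 2 ltac:(lra) D) as E.
    rewrite G_scale in E by lra. rewrite ln_Rinv in E by lra.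
    replace ((b / 2 - 1) * ln 2) with (- (b / 2 * - ln 2) + - ln 2) by ring.
    rewrite exp_plus, exp_Ropp, exp_Ropp, exp_ln in * by lra. lra.
  - intros y. f_equal. replace (2 * y) with (y + y) by ring. rewrite exp_plus. field.
Qed.

(** Induction on J: the remainder for S J vanishes at 0 and has minus the remainder for J as
    derivative, so the bound integrates for either sign. Bounding by the first omitted term is what
    can be integrated termwise in [asy_vh]. *)
Lemma exp_taylor_bound J u : 0 <= u ->
  Rabs (exp (- u) - sumn (fun j => (-1) ^ j * u ^ j / INR (fact j)) J) <= u ^ J / INR (fact J).
Proof.
  revert u. induction J as [|J IH]; intros u Hu.
  - simpl. rewrite Rminus_0_r, Rabs_pos_eq by (left; apply exp_pos).
    apply Rle_trans with (exp 0); [apply exp_le_exp; lra | rewrite exp_0; lra].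
  - set (F := fun J u => exp (- u) - sumn (fun j => (-1) ^ j * u ^ j / INR (fact j)) J).
    assert (DS : forall n t, is_derive (fun u => sumn (fun j => (-1) ^ j * u ^ j / INR (fact j)) (S n)) t
                 (- sumn (fun j => (-1) ^ j * t ^ j / INR (fact j)) n)).
    { clear. induction n as [|n IH]; intros t.
      - simpl. rewrite Ropp_0. auto_derive; auto.
      - change (fun u => sumn (fun j => (-1) ^ j * u ^ j / INR (fact j)) (S (S n))) with
          (fun u => sumn (fun j => (-1) ^ j * u ^ j / INR (fact j)) (S n) + (-1) ^ (S n) * u ^ (S n) / INR (fact (S n))).
        replace (- sumn (fun j => (-1) ^ j * t ^ j / INR (fact j)) (S n)) with
          (plus (- sumn (fun j => (-1) ^ j * t ^ j / INR (fact j)) n) (- ((-1) ^ n * t ^ n / INR (fact n)))).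
        2: { unfold plus; simpl. ring. }
        apply (is_derive_plus (V := R_NormedModule)); [apply IH|].
        auto_derive; auto. change (fact n + n * fact n)%nat with (fact (S n)). rewrite fact_simpl, mult_INR.
        pose proof (INR_fact_neq_0 n). assert (INR (S n) <> 0) by (apply not_0_INR; lia).
        replace (match n with 0%nat => 1 | S _ => INR n + 1 end) with (INR (S n)) by reflexivity.
        simpl pow. field. auto. }
    assert (DF : forall t, is_derive (F (S J)) t (- F J t)).
    { intros t. unfold F. replace (- (exp (- t) - sumn (fun j => (-1) ^ j * t ^ j / INR (fact j)) J)) with
        (minus (- exp (- t)) (- sumn (fun j => (-1) ^ j * t ^ j / INR (fact j)) J)) by (unfold minus, plus, opp; simpl; ring).
      apply (is_derive_minus (V := R_NormedModule) (fun u => exp (- u))).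
      - auto_derive; auto. ring.
      - apply DS. }
    assert (DP : forall t, is_derive (fun u => u ^ S J / INR (fact (S J))) t (t ^ J / INR (fact J))).
    { intros t. auto_derive; auto. change (fact J + J * fact J)%nat with (fact (S J)). rewrite fact_simpl, mult_INR.
      pose proof (INR_fact_neq_0 J). assert (INR (S J) <> 0) by (apply not_0_INR; lia).
      replace (match J with 0%nat => 1 | S _ => INR J + 1 end) with (INR (S J)) by reflexivity.
      field. auto. }
    assert (F0 : F (S J) 0 = 0).
    { assert (Z : forall n, sumn (fun k => (-1) ^ S k * 0 ^ S k / INR (fact (S k))) n = 0).
      { induction n as [|n IHn]; [reflexivity|]. cbn [sumn]. rewrite IHn. cbn [pow]. unfold Rdiv. ring. }
      unfold F. rewrite sumn_Sl, Ropp_0, exp_0, Z. simpl. field. }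
    assert (P0 : 0 ^ S J / INR (fact (S J)) = 0) by (simpl; unfold Rdiv; ring).
    assert (W : forall sg, sg = 1 \/ sg = -1 -> 0 <= u ^ S J / INR (fact (S J)) + sg * F (S J) u).
    { intros sg Hsg.
      set (g := fun t => t ^ S J / INR (fact (S J)) + sg * F (S J) t).
      assert (Dg : forall t, is_derive g t (t ^ J / INR (fact J) + sg * - F J t)).
      { intros t. apply (is_derive_plus (V := R_NormedModule)); [apply DP|].
        apply (is_derive_scal (F (S J))). apply DF. }
      destruct (MVT_gen g 0 u (fun t => t ^ J / INR (fact J) + sg * - F J t)) as (c & Hc & E).
      - intros; apply Dg.
      - intros t _. apply continuity_pt_filterlim. apply (continuous_derivable g). eexists; apply Dg.
      - unfold g in E at 2. rewrite P0, F0 in E. fold (g u). 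
        rewrite Rmin_left, Rmax_right in Hc by lra.
        specialize (IH c ltac:(lra)). fold (F J c) in IH.
        assert (0 <= c ^ J / INR (fact J) + sg * - F J c).
        { pose proof (Rle_abs (F J c)). pose proof (Rle_abs (- F J c)). rewrite Rabs_Ropp in *.
          destruct Hsg as [-> | ->]; lra. }
        nra. }
    fold (F (S J) u). apply Rabs_le.
    pose proof (W 1 ltac:(auto)). pose proof (W (-1) ltac:(auto)). lra.
Qed.

Lemma G_poch b n : 0 < b -> G (b + INR n) = poch b n * G b.
Proof.
  intros Hb. induction n as [|n IH]; [simpl; rewrite Rplus_0_r; ring|].
  rewrite S_INR, <- Rplus_assoc, G_succ, IH by (pose proof (pos_INR n); lra). simpl. ring.
Qed.

Lemma pow_exp_ln x n : 0 < x -> x ^ n = exp (INR n * ln x).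
Proof. intros Hx. rewrite exp_INR_mult, exp_ln; auto. Qed.

(** Watson's lemma: exp(- (x + u)^2 / 2) is exp(- x^2 / 2) exp(- x u) exp(- u^2 / 2). The last
    factor is expanded over the whole range, and every term, as well as the error, is a Gamma
    integral. *)
Lemma asy_vh b : 0 < b -> asy (1 / 2 - b) (fun x => vh b x / G b).
Proof.
  intros Hb J. pose proof (G_pos b Hb) as HG.
  set (cj := fun j => (-1) ^ j / (INR (fact j) * 2 ^ j)).
  exists (G (b + INR (2 * J)) / (G b * INR (fact J) * 2 ^ J)). intros x Hx.
  unfold scaled. replace (1 / 2 - (1 / 2 - b)) with b by ring.
  assert (Dj : forall j, dom (fun y => exp ((b + INR (2 * j)) * y - x * exp y))).
  { intros j. pose proof (pos_INR (2 * j)). apply dom_exp; lra. }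
  assert (DS : forall n, dom (fun y => sumn (fun j => cj j * exp ((b + INR (2 * j)) * y - x * exp y)) n) /\
     II (fun y => sumn (fun j => cj j * exp ((b + INR (2 * j)) * y - x * exp y)) n)
       = sumn (fun j => cj j * (exp (- ((b + INR (2 * j)) * ln x)) * G (b + INR (2 * j)))) n).
  { induction n as [|n [IH1 IH2]].
    - simpl. assert (D0 : dom (fun _ : R => 0)).
      { apply (dom_ext (fun y => 0 * exp (b * y - x * exp y))). intros; ring. apply dom_scal, dom_exp; lra. }
      split; auto. rewrite (II_ext _ (fun y => 0 * (fun _ => 0) y)) by (intros; ring). rewrite II_scal by auto. ring.
    - cbn [sumn]. split. apply dom_plus; auto. apply dom_scal. apply Dj.
      rewrite II_plus, II_scal, IH2; auto. rewrite G_scale; auto; try lra. pose proof (pos_INR (2 * n)). lra.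
      apply dom_scal, Dj. }
  destruct (DS J) as [DS1 DS2].
  assert (D0 : dom (fun y => exp (x ^ 2 / 2) * exp (b * y - (x + exp y) ^ 2 / 2))) by (apply dom_scal; now apply vh_dom).
  assert (M : Rabs (exp (x ^ 2 / 2) * vh b x - II (fun y => sumn (fun j => cj j * exp ((b + INR (2 * j)) * y - x * exp y)) J))
    <= / (INR (fact J) * 2 ^ J) * (exp (- ((b + INR (2 * J)) * ln x)) * G (b + INR (2 * J)))).
  { unfold vh. rewrite <- II_scal, <- II_minus by (auto; now apply vh_dom).
    rewrite <- G_scale by (pose proof (pos_INR (2 * J)); lra). rewrite <- II_scal by apply Dj.
    assert (P : forall y, Rabs (exp (x ^ 2 / 2) * exp (b * y - (x + exp y) ^ 2 / 2) -
       sumn (fun j => cj j * exp ((b + INR (2 * j)) * y - x * exp y)) J) <=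
       / (INR (fact J) * 2 ^ J) * exp ((b + INR (2 * J)) * y - x * exp y)).
    { intros y. set (E := exp (b * y - x * exp y)). set (u := exp y * exp y / 2).
      assert (Hu : 0 <= u) by (unfold u; pose proof (exp_pos y); nra).
      assert (EE : forall j, exp ((b + INR (2 * j)) * y - x * exp y) = E * (u ^ j * 2 ^ j)).
      { intros j. rewrite <- Rpow_mult_distr. replace (u * 2) with (exp y * exp y) by (unfold u; field).
        rewrite <- exp_plus, <- exp_INR_mult. unfold E. rewrite <- exp_plus. f_equal. rewrite mult_INR. simpl. ring. }
      assert (E1 : exp (x ^ 2 / 2) * exp (b * y - (x + exp y) ^ 2 / 2) = E * exp (- u)).
      { unfold E, u. rewrite <- 2 exp_plus. f_equal. field. }
      rewrite E1, EE. rewrite (sumn_ext _ (fun j => E * ((-1) ^ j * u ^ j / INR (fact j)))).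
      2: { intros j _. rewrite EE. unfold cj. pose proof (INR_fact_neq_0 j). pose proof (pow_nonzero 2 j ltac:(lra)). field. auto. }
      rewrite sumn_scal, <- Rmult_minus_distr_l, Rabs_mult, (Rabs_pos_eq E) by (left; apply exp_pos).
      replace (/ (INR (fact J) * 2 ^ J) * (E * (u ^ J * 2 ^ J))) with (E * (u ^ J / INR (fact J))).
      2: { pose proof (INR_fact_neq_0 J). pose proof (pow_nonzero 2 J ltac:(lra)). field. auto. }
      apply Rmult_le_compat_l; [left; apply exp_pos|]. now apply exp_taylor_bound. }
    apply Rabs_le. split.
    - apply Rle_trans with (II (fun y => (-1) * (/ (INR (fact J) * 2 ^ J) * exp ((b + INR (2 * J)) * y - x * exp y)))).
      + rewrite (II_scal (-1)) by (apply dom_scal, Dj). lra.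
      + apply II_le; [apply dom_scal, dom_scal, Dj | now apply dom_minus|].
        intros y. specialize (P y). apply Rabs_le_between in P. lra.
    - apply II_le; [now apply dom_minus | apply dom_scal, Dj|].
      intros y. specialize (P y). apply Rabs_le_between in P. lra. }
  rewrite DS2 in M.
  assert (Lx : 0 < x) by lra.
  assert (E2 : forall j, exp (- ((b + INR (2 * j)) * ln x)) = exp (- (b * ln x)) * / x ^ (2 * j)).
  { intros j. rewrite pow_exp_ln by auto. rewrite <- exp_Ropp, <- exp_plus. f_equal. ring. }
  set (e := exp (b * ln x)). assert (He : 0 < e) by apply exp_pos.
  assert (Ee : exp (- (b * ln x)) = / e) by (apply exp_Ropp).
  assert (S1 : sumn (fun j => dcoef (1 / 2 - b) j / x ^ (2 * j)) J =
     e / G b * sumn (fun j => cj j * (exp (- ((b + INR (2 * j)) * ln x)) * G (b + INR (2 * j)))) J).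
  { rewrite <- sumn_scal. apply sumn_ext. intros j _. rewrite E2, Ee, G_poch by auto. unfold dcoef, cj.
    replace (1 / 2 - (1 / 2 - b)) with b by ring.
    pose proof (INR_fact_neq_0 j). pose proof (pow_nonzero 2 j ltac:(lra)). pose proof (pow_nonzero x (2 * j) ltac:(lra)). field. repeat split; auto; lra. }
  rewrite S1, exp_plus. fold e.
  replace (vh b x / G b * (e * exp (x ^ 2 / 2))) with (e / G b * (exp (x ^ 2 / 2) * vh b x)) by (field; lra).
  rewrite <- Rmult_minus_distr_l, Rabs_mult, (Rabs_pos_eq (e / G b)) by (left; now apply Rdiv_lt_0_compat).
  eapply Rle_trans; [apply Rmult_le_compat_l; [left; now apply Rdiv_lt_0_compat | apply M]|].
  right. rewrite E2, Ee.
  pose proof (INR_fact_neq_0 J). pose proof (pow_nonzero 2 J ltac:(lra)). pose proof (pow_nonzero x (2 * J) ltac:(lra)).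
  field. repeat split; auto; lra.
Qed.

Lemma dcoef_0 a : dcoef a 0 = 1.
Proof. unfold dcoef. simpl. field. Qed.

(** The recurrence v_(a+1) = x v_a - (a - 1/2) v_(a-1) on the level of the coefficients. *)
Lemma dcoef_succ a j : dcoef (a + 1) (S j) = dcoef a (S j) - (a - 1 / 2) * dcoef (a - 1) j.
Proof.
  unfold dcoef. set (c := 1 / 2 - a). replace (1 / 2 - (a + 1)) with (c - 1) by (unfold c; field).
  replace (1 / 2 - (a - 1)) with (c + 1) by (unfold c; field). replace (a - 1 / 2) with (- c) by (unfold c; field).
  replace (2 * S j)%nat with (S (S (2 * j))) by lia.
  rewrite (poch_shift (c - 1)). replace (c - 1 + 1) with c by ring. 
  change (poch c (S (S (2 * j)))) with (poch c (S (2 * j)) * (c + INR (S (2 * j)))).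
  rewrite (poch_shift c). rewrite fact_simpl, mult_INR, !S_INR, mult_INR. simpl (INR 2). simpl pow.
  pose proof (INR_fact_neq_0 j). pose proof (pow_nonzero 2 j ltac:(lra)). pose proof (pos_INR j). field. repeat split; auto; lra.
Qed.

Lemma scaled_up a u v x : 0 < x ->
  scaled (a + 1) (fun x => x * v x - (a - 1 / 2) * u x) x = scaled a v x - (a - 1 / 2) / x ^ 2 * scaled (a - 1) u x.
Proof.
  intros Hx. unfold scaled.
  replace ((1 / 2 - a) * ln x + x ^ 2 / 2) with ((1 / 2 - (a + 1)) * ln x + x ^ 2 / 2 + ln x) by ring.
  replace ((1 / 2 - (a - 1)) * ln x + x ^ 2 / 2) with ((1 / 2 - (a + 1)) * ln x + x ^ 2 / 2 + ln x + ln x) by ring.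
  rewrite !(exp_plus _ (ln x)), exp_ln by auto. field. lra.
Qed.

Lemma pow_inv_le x n : 1 <= x -> 0 < / x ^ n <= 1.
Proof.
  intros Hx. pose proof (pow_R1_Rle x n Hx). split; [apply Rinv_0_lt_compat; lra|].
  rewrite <- Rinv_1. apply Rinv_le_contravar; lra.
Qed.

(** After scaling, u enters with a factor 1 / x^2, so its expansion is used with one term less than
    that of v. *)
Lemma asy_up a u v : asy (a - 1) u -> asy a v -> asy (a + 1) (fun x => x * v x - (a - 1 / 2) * u x).
Proof.
  intros Hu Hv J. destruct J as [|J].
  - destruct (Hu O) as [C1 H1]. destruct (Hv O) as [C2 H2]. exists (C2 + Rabs (a - 1 / 2) * C1). intros x Hx.
    specialize (H1 x Hx). specialize (H2 x Hx). simpl in *. rewrite Rminus_0_r in *.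
    rewrite scaled_up by lra. eapply Rle_trans; [apply Rabs_triang|]. rewrite Rabs_Ropp, Rabs_mult.
    replace (Rabs ((a - 1 / 2) / x ^ 2)) with (Rabs (a - 1 / 2) * / x ^ 2).
    2: { unfold Rdiv at 2. rewrite Rabs_mult, (Rabs_pos_eq (/ x ^ 2)). reflexivity.
         left. apply (pow_inv_le x 2 Hx). }
    pose proof (pow_inv_le x 2 Hx). pose proof (Rabs_pos (a - 1 / 2)). pose proof (Rabs_pos (scaled (a - 1) u x)).
    assert (Rabs (a - 1 / 2) * / x ^ 2 * Rabs (scaled (a - 1) u x) <= Rabs (a - 1 / 2) * C1).
    { rewrite Rmult_assoc. apply Rmult_le_compat_l; auto. nra. }
    lra.
  - destruct (Hu J) as [C1 H1]. destruct (Hv (S J)) as [C2 H2]. exists (C2 + Rabs (a - 1 / 2) * C1). intros x Hx.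
    specialize (H1 x Hx). specialize (H2 x Hx). rewrite scaled_up by lra.
    assert (E : sumn (fun j => dcoef (a + 1) j / x ^ (2 * j)) (S J) =
       sumn (fun j => dcoef a j / x ^ (2 * j)) (S J) - (a - 1 / 2) / x ^ 2 * sumn (fun j => dcoef (a - 1) j / x ^ (2 * j)) J).
    { rewrite !sumn_Sl, <- sumn_scal, !dcoef_0.
      replace (sumn (fun k => dcoef (a + 1) (S k) / x ^ (2 * S k)) J) with
       (sumn (fun k => dcoef a (S k) / x ^ (2 * S k) + (-1) * ((a - 1 / 2) / x ^ 2 * (dcoef (a - 1) k / x ^ (2 * k)))) J).
      - rewrite sumn_plus, sumn_scal. ring.
      - apply sumn_ext. intros k _. rewrite dcoef_succ. replace (2 * S k)%nat with (2 + 2 * k)%nat by lia.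
        rewrite pow_add. pose proof (pow_nonzero x (2 * k) ltac:(lra)). field. split; auto; lra. }
    rewrite E.
    match goal with |- Rabs ?t <= _ => replace t with
      ((scaled a v x - sumn (fun j => dcoef a j / x ^ (2 * j)) (S J)) +
       - ((a - 1 / 2) * (/ x ^ 2 * (scaled (a - 1) u x - sumn (fun j => dcoef (a - 1) j / x ^ (2 * j)) J)))) by (field; lra) end.
    eapply Rle_trans; [apply Rabs_triang|]. rewrite Rabs_Ropp, !Rabs_mult.
    pose proof (pow_inv_le x 2 Hx) as P2. rewrite (Rabs_pos_eq (/ x ^ 2)) by lra.
    replace ((C2 + Rabs (a - 1 / 2) * C1) / x ^ (2 * S J)) with (C2 / x ^ (2 * S J) + Rabs (a - 1 / 2) * (/ x ^ 2 * (C1 / x ^ (2 * J)))).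
    + apply Rplus_le_compat; auto. apply Rmult_le_compat_l; [apply Rabs_pos|]. apply Rmult_le_compat_l; lra.
    + replace (2 * S J)%nat with (2 + 2 * J)%nat by lia. rewrite pow_add.
      pose proof (pow_nonzero x (2 * J) ltac:(lra)). field. split; auto; lra.
Qed.

(** The recurrence solved for the lowest parameter: the leading terms cancel and a factor x^2
    appears, so both expansions are used with one term more. *)
Lemma asy_down a v w : a <> 1 / 2 -> asy a v -> asy (a + 1) w -> asy (a - 1) (fun x => (x * v x - w x) / (a - 1 / 2)).
Proof.
  intros Ha Hv Hw J. destruct (Hv (S J)) as [C1 H1]. destruct (Hw (S J)) as [C2 H2].
  exists ((C1 + C2) * / Rabs (a - 1 / 2)). intros x Hx. specialize (H1 x Hx). specialize (H2 x Hx).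
  set (u := fun x => (x * v x - w x) / (a - 1 / 2)).
  assert (Hd : a - 1 / 2 <> 0) by lra.
  assert (E : scaled (a - 1) u x = x ^ 2 * / (a - 1 / 2) * (scaled a v x - scaled (a + 1) w x)).
  { pose proof (scaled_up a u v x ltac:(lra)) as E.
    replace (scaled (a + 1) (fun x => x * v x - (a - 1 / 2) * u x) x) with (scaled (a + 1) w x) in E.
    - rewrite E. field. lra.
    - unfold scaled, u. f_equal. field. lra. }
  rewrite E.
  assert (ES : sumn (fun j => dcoef (a - 1) j / x ^ (2 * j)) J = x ^ 2 * / (a - 1 / 2) *
    (sumn (fun j => dcoef a j / x ^ (2 * j)) (S J) - sumn (fun j => dcoef (a + 1) j / x ^ (2 * j)) (S J))).
  { rewrite !sumn_Sl, !dcoef_0.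
    replace (sumn (fun k => dcoef a (S k) / x ^ (2 * S k)) J) with
      (sumn (fun k => dcoef (a + 1) (S k) / x ^ (2 * S k) + (a - 1 / 2) / x ^ 2 * (dcoef (a - 1) k / x ^ (2 * k))) J).
    - rewrite sumn_plus, sumn_scal. field. repeat split; try lra. simpl. lra.
    - apply sumn_ext. intros k _. rewrite dcoef_succ. replace (2 * S k)%nat with (2 + 2 * k)%nat by lia.
        rewrite pow_add. pose proof (pow_nonzero x (2 * k) ltac:(lra)). field. split; auto; lra. }
  rewrite ES, <- Rmult_minus_distr_l, !Rabs_mult, Rabs_inv, (Rabs_pos_eq (x ^ 2)) by (apply pow2_ge_0).
  pose proof (Rabs_pos_lt _ Hd) as Hp.
  replace ((C1 + C2) * / Rabs (a - 1 / 2) / x ^ (2 * J)) with (x ^ 2 * / Rabs (a - 1 / 2) * (C1 / x ^ (2 * S J) + C2 / x ^ (2 * S J))).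
  2: { replace (2 * S J)%nat with (2 + 2 * J)%nat by lia. rewrite pow_add.
      pose proof (pow_nonzero x (2 * J) ltac:(lra)). field. repeat split; auto; lra. }
  apply Rmult_le_compat_l.
  - apply Rmult_le_pos; [apply pow2_ge_0 | left; now apply Rinv_0_lt_compat].
  - match goal with |- Rabs (?s1 - ?s2 - (?t1 - ?t2)) <= _ => replace (s1 - s2 - (t1 - t2)) with ((s1 - t1) + - (s2 - t2)) by ring end.
    eapply Rle_trans; [apply Rabs_triang|]. rewrite Rabs_Ropp. lra.
Qed.

(** Gaussian decay up to a polynomial factor, on all of (0, oo). [Kf_tail] uses the true Gaussian;
    the transforms use only the weaker [rap]. *)
Definition gb (v : R -> R) : Prop :=
  exists C N, 0 <= C /\ forall x, 0 < x -> Rabs (v x) <= C * (1 + x) ^ N * exp (- (x ^ 2 / 2)).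

Lemma asy_gb a v : asy a v -> bdd v -> gb v.
Proof.
  intros Ha [C1 H1]. destruct (Ha O) as [C2 H2].
  destruct (nfloor_ex (Rabs (a - 1 / 2)) (Rabs_pos _)) as [N [_ HN]].
  set (C := Rabs C1 * exp 1 + Rabs C2).
  assert (HC1 := Rabs_pos C1). assert (HC2 := Rabs_pos C2). pose proof (exp_pos 1) as He.
  exists C, (S N). split; [unfold C; nra|]. intros x Hx.
  assert (P : 1 <= (1 + x) ^ S N) by (apply pow_R1_Rle; lra).
  destruct (Rle_lt_dec x 1) as [Hx1|Hx1].
  - assert (Q : 1 <= exp 1 * exp (- (x ^ 2 / 2))).
    { rewrite <- exp_plus. apply Rle_trans with (exp 0); [rewrite exp_0; lra|]. apply exp_le_exp. nra. }
    apply Rle_trans with (Rabs C1); [apply Rle_trans with C1; [apply H1; lra | apply Rle_abs]|].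
    pose proof (exp_pos (- (x ^ 2 / 2))).
    apply Rle_trans with (Rabs C1 * (exp 1 * exp (- (x ^ 2 / 2)))); [nra|].
    replace (C * (1 + x) ^ S N * exp (- (x ^ 2 / 2))) with (C * exp (- (x ^ 2 / 2)) * (1 + x) ^ S N) by ring.
    apply Rle_trans with (C * exp (- (x ^ 2 / 2)) * 1).
    + unfold C. nra.
    + apply Rmult_le_compat_l; auto. apply Rmult_le_pos; [unfold C; nra | lra].
  - specialize (H2 x ltac:(lra)). simpl in H2. rewrite Rminus_0_r in H2. unfold scaled in H2.
    rewrite Rabs_mult, (Rabs_pos_eq (exp _)) in H2 by (left; apply exp_pos).
    assert (Hl : 0 < ln x) by (rewrite <- ln_1; apply ln_increasing; lra).
    assert (Q : exp ((a - 1 / 2) * ln x) <= (1 + x) ^ S N).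
    { rewrite pow_exp_ln by lra. apply exp_le_exp. rewrite S_INR.
      assert (ln x <= ln (1 + x)) by (apply ln_le; lra).
      pose proof (Rle_abs (a - 1 / 2)). pose proof (pos_INR N).
      apply Rle_trans with ((INR N + 1) * ln x); [apply Rmult_le_compat_r; lra | apply Rmult_le_compat_l; lra]. }
    replace (Rabs (v x)) with (Rabs (v x) * exp ((1 / 2 - a) * ln x + x ^ 2 / 2) * (exp ((a - 1 / 2) * ln x) * exp (- (x ^ 2 / 2)))).
    2: { rewrite <- exp_plus, Rmult_assoc, <- exp_plus.
         replace ((1 / 2 - a) * ln x + x ^ 2 / 2 + ((a - 1 / 2) * ln x + - (x ^ 2 / 2))) with 0 by ring. rewrite exp_0. ring. }
    rewrite (Rmult_assoc C). pose proof (exp_pos (- (x ^ 2 / 2))). pose proof (exp_pos ((a - 1 / 2) * ln x)).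
    apply Rmult_le_compat.
    + apply Rmult_le_pos; [apply Rabs_pos | left; apply exp_pos].
    + nra.
    + eapply Rle_trans; [apply H2|]. unfold C. pose proof (Rle_abs C2). unfold Rdiv. rewrite Rinv_1. nra.
    + apply Rmult_le_compat_r; lra.
Qed.

Definition rap (v : R -> R) : Prop := forall n : nat, exists C, 0 <= C /\ forall x, 0 < x -> (1 + x) ^ n * Rabs (v x) <= C.

Lemma gb_rap v : gb v -> rap v.
Proof.
  intros (C & N & HC & H) n. set (k := INR (n + N)). exists (C * exp (k ^ 2 / 2)). split.
  - apply Rmult_le_pos; [auto | left; apply exp_pos].
  - intros x Hx. apply Rle_trans with ((1 + x) ^ n * (C * (1 + x) ^ N * exp (- (x ^ 2 / 2)))).
    + apply Rmult_le_compat_l; auto. apply pow_le; lra.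
    + replace ((1 + x) ^ n * (C * (1 + x) ^ N * exp (- (x ^ 2 / 2)))) with (C * ((1 + x) ^ (n + N) * exp (- (x ^ 2 / 2)))) by (rewrite pow_add; ring).
      apply Rmult_le_compat_l; auto. rewrite pow_exp_ln, <- exp_plus by lra. apply exp_le_exp. fold k.
      assert (ln (1 + x) <= x).
      { rewrite <- (ln_exp x) at 2. apply ln_le; [lra|]. apply exp_ineq1_le. }
      assert (k * ln (1 + x) <= k * x) by (apply Rmult_le_compat_l; auto; apply pos_INR).
      pose proof (pow2_ge_0 (k - x)). nra.
Qed.

Definition near0 (f : R -> R) (f0 : R) : Prop := exists C, 0 <= C /\ forall x, 0 < x -> Rabs (f x - f0) <= C * x.

Lemma near0_derive (f f' : R -> R) C C' : 0 <= C' -> (forall x, is_derive f x (f' x)) ->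
  (forall x, 0 <= x <= 1 -> Rabs (f' x) <= C') -> (forall x, 0 < x -> Rabs (f x) <= C) -> near0 f (f 0).
Proof.
  intros HC' D H' H. exists (C' + (Rabs C + Rabs (f 0))). pose proof (Rabs_pos C). pose proof (Rabs_pos (f 0)).
  split; [lra|]. intros x Hx. destruct (Rle_lt_dec x 1) as [Hx1|Hx1].
  - apply Rle_trans with (C' * Rabs (x - 0)).
    + apply (mvt_bound f f'); intros; auto. apply H'. rewrite Rmin_left, Rmax_right in H2; lra.
    + rewrite Rminus_0_r, Rabs_pos_eq by lra. nra.
  - eapply Rle_trans; [apply Rabs_triang|]. rewrite Rabs_Ropp. specialize (H x Hx). pose proof (Rle_abs C). nra.
Qed.

Definition vA (a x : R) : R := vh (1 / 2 - a) x / G (1 / 2 - a).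
(** Minus the derivative of [vA] a, and at the same time the recessive solution for a + 1, see
    [vB_asy]. *)
Definition vB (a x : R) : R := (x * vh (1 / 2 - a) x + vh (1 / 2 - a + 1) x) / G (1 / 2 - a).

Lemma v_derive a x : a < 1 / 2 -> is_derive (vA a) x (- vB a x) /\ is_derive (vB a) x (- x * vB a x + (a + 1 / 2) * vA a x).
Proof.
  intros Ha. unfold vA, vB. set (b := 1 / 2 - a). assert (Hb : 0 < b) by (unfold b; lra).
  pose proof (G_pos b Hb). split.
  - replace (- ((x * vh b x + vh (b + 1) x) / G b)) with (/ G b * - (x * vh b x + vh (b + 1) x)) by (field; lra).
    apply (is_derive_ext (fun x => / G b * vh b x)). intros t; apply Rmult_comm.
    apply (is_derive_scal (vh b)). now apply vh_derive0.
  - replace (a + 1 / 2) with (1 - b) by (unfold b; field).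
    replace (- x * ((x * vh b x + vh (b + 1) x) / G b) + (1 - b) * (vh b x / G b)) with
      (/ G b * plus (1 * vh b x + x * - (x * vh b x + vh (b + 1) x)) (- b * vh b x)) by (unfold plus; simpl; field; lra).
    apply (is_derive_ext (fun x => / G b * (plus (x * vh b x) (vh (b + 1) x)))). intros t; apply Rmult_comm.
    apply (is_derive_scal (fun x => plus (x * vh b x) (vh (b + 1) x))).
    apply (is_derive_plus (V := R_NormedModule)).
    + apply (is_derive_mult (K := R_AbsRing) (fun x => x) (vh b)); [apply (is_derive_id (K := R_AbsRing) x) | now apply vh_derive0 | apply Rmult_comm].
    + now apply vh_derive1.
Qed.

Lemma v_sys a : a < 1 / 2 -> sys a (vA a) (vB a).
Proof. intros Ha x _. now apply v_derive. Qed.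

Lemma asy_ext a u v : (forall x, 1 <= x -> u x = v x) -> asy a u -> asy a v.
Proof.
  intros E H J. destruct (H J) as [C HC]. exists C. intros x Hx. unfold scaled. rewrite <- E by auto. now apply HC.
Qed.

Lemma vA_asy a : a < 1 / 2 -> asy a (vA a).
Proof.
  intros Ha. pose proof (asy_vh (1 / 2 - a) ltac:(lra)) as H. replace (1 / 2 - (1 / 2 - a)) with a in H by ring. exact H.
Qed.

(** By G(b + 1) = b G(b) the function [vB] a is x [vA] a - (a - 1/2) [vA] (a - 1). *)
Lemma vB_asy a : a < 1 / 2 -> asy (a + 1) (vB a).
Proof.
  intros Ha. apply (asy_ext _ (fun x => x * vA a x - (a - 1 / 2) * vA (a - 1) x)).
  - intros x _. unfold vA, vB. replace (1 / 2 - (a - 1)) with (1 / 2 - a + 1) by ring. rewrite G_succ by lra.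
    pose proof (G_pos (1 / 2 - a) ltac:(lra)). field. lra.
  - apply asy_up; apply vA_asy; lra.
Qed.

Lemma v_bounds a : a < 1 / 2 -> exists C, 0 <= C /\ forall x, 0 <= x <= 1 -> Rabs (vA a x) <= C /\ Rabs (vB a x) <= C.
Proof.
  intros Ha. pose proof (G_pos (1 / 2 - a) ltac:(lra)) as HG.
  exists ((vh (1 / 2 - a) 0 + vh (1 / 2 - a + 1) 0) / G (1 / 2 - a)).
  pose proof (vh_pos_le (1 / 2 - a) 0 ltac:(lra) ltac:(lra)). pose proof (vh_pos_le (1 / 2 - a + 1) 0 ltac:(lra) ltac:(lra)).
  split; [apply Rdiv_le_0_compat; lra|]. intros x Hx.
  pose proof (vh_pos_le (1 / 2 - a) x ltac:(lra) ltac:(lra)). pose proof (vh_pos_le (1 / 2 - a + 1) x ltac:(lra) ltac:(lra)).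
  unfold vA, vB, Rdiv. rewrite !Rabs_mult, !(Rabs_pos_eq (/ _)) by (left; now apply Rinv_0_lt_compat).
  rewrite !Rabs_pos_eq by nra.
  split; apply Rmult_le_compat_r; try (left; now apply Rinv_0_lt_compat); nra.
Qed.

Lemma v_bdd a : a < 1 / 2 -> bdd (vA a) /\ bdd (vB a).
Proof.
  intros Ha. destruct (v_bounds a Ha) as (C & _ & H). split; exists C; intros x Hx; apply H; lra.
Qed.

Lemma rap_bounded v : rap v -> exists C, 0 <= C /\ forall x, 0 < x -> Rabs (v x) <= C.
Proof.
  intros H. destruct (H O) as (C & HC & B). exists C. split; auto. intros x Hx. specialize (B x Hx). simpl in B. lra.
Qed.

Lemma v_near0 a : a < 1 / 2 -> near0 (vA a) (vA a 0) /\ near0 (vB a) (vB a 0).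
Proof.
  intros Ha. destruct (v_bounds a Ha) as (C & HC & H). destruct (v_bdd a Ha) as [B1 B2].
  destruct (rap_bounded _ (gb_rap _ (asy_gb _ _ (vA_asy a Ha) B1))) as (C1 & _ & H1).
  destruct (rap_bounded _ (gb_rap _ (asy_gb _ _ (vB_asy a Ha) B2))) as (C2 & _ & H2).
  split.
  - apply (near0_derive _ (fun x => - vB a x) C1 C); auto. intros x; apply (v_derive a x Ha).
    intros x Hx. rewrite Rabs_Ropp. now apply H.
  - apply (near0_derive _ (fun x => - x * vB a x + (a + 1 / 2) * vA a x) C2 (C + Rabs (a + 1 / 2) * C)); auto.
    + pose proof (Rabs_pos (a + 1 / 2)). nra.
    + intros x; apply (v_derive a x Ha).
    + intros x Hx. destruct (H x Hx) as [E1 E2]. eapply Rle_trans; [apply Rabs_triang|].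
      rewrite !Rabs_mult, Rabs_Ropp, (Rabs_pos_eq x) by lra. pose proof (Rabs_pos (a + 1 / 2)). pose proof (Rabs_pos (vB a x)).
      apply Rplus_le_compat; [nra|]. apply Rmult_le_compat_l; auto.
Qed.

(** * Kummer functions *)

Definition kc (p q : R) (k : nat) : R := poch p k / poch q k / INR (fact k).

Lemma poch_pos q k : 0 < q -> 0 < poch q k.
Proof.
  intros Hq. induction k as [|k IH]; simpl; [lra|]. apply Rmult_lt_0_compat; auto. pose proof (pos_INR k). lra.
Qed.

(** Factor by factor |p + k| <= (1 + |p| / q) (q + k). The Kummer coefficients are then at most L^k
    / k!, so the series is entire. *)
Lemma poch_ratio_le p q k : 0 < q -> Rabs (poch p k) <= (1 + Rabs p / q) ^ k * poch q k.
Proof.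
  intros Hq. induction k as [|k IH]; [simpl; rewrite Rabs_R1; lra|].
  cbn [poch pow]. rewrite Rabs_mult.
  replace ((1 + Rabs p / q) * (1 + Rabs p / q) ^ k * (poch q k * (q + INR k))) with
    ((1 + Rabs p / q) ^ k * poch q k * ((1 + Rabs p / q) * (q + INR k))) by ring.
  apply Rmult_le_compat; auto; try apply Rabs_pos.
  eapply Rle_trans; [apply Rabs_triang|]. pose proof (pos_INR k). rewrite (Rabs_pos_eq (INR k)) by auto.
  replace ((1 + Rabs p / q) * (q + INR k)) with (q + INR k + Rabs p + Rabs p / q * INR k) by (field; lra).
  assert (0 <= Rabs p / q) by (apply Rdiv_le_0_compat; auto; apply Rabs_pos). nra.
Qed.

Lemma CV_radius_ge (c : nat -> R) r : CV_disk c r -> Rbar_le r (CV_radius c).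
Proof. intros H. apply (Lub_Rbar_correct (CV_disk c)). exact H. Qed.

Lemma CV_radius_exp_bound (c : nat -> R) L : 0 < L -> (forall k, Rabs (c k) <= L ^ k / INR (fact k)) -> CV_radius c = p_infty.
Proof.
  intros HL H.
  assert (D : forall r, CV_disk c r).
  { intros r. apply (ex_series_le (K := R_AbsRing) (V := R_CompleteNormedModule)) with (b := fun n => Rabs (L ^ n / INR (fact n) * r ^ n)).
    - intros n. unfold norm; simpl; unfold abs; simpl. rewrite Rabs_Rabsolu, !Rabs_mult.
      apply Rmult_le_compat_r; [apply Rabs_pos|]. eapply Rle_trans; [apply H | apply Rle_abs].
    - apply (CV_disk_DAlembert (fun n => L ^ n / INR (fact n)) r 0); auto.
      + intros n. apply Rgt_not_eq. apply Rdiv_lt_0_compat; [now apply pow_lt | apply INR_fact_lt_0].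
      + apply (is_lim_seq_ext (fun n => L * / (INR n + 1))).
        * intros n. rewrite fact_simpl, mult_INR, S_INR. pose proof (pos_INR n). pose proof (INR_fact_lt_0 n).
          pose proof (pow_lt L n HL).
          replace (L ^ S n / ((INR n + 1) * INR (fact n)) / (L ^ n / INR (fact n))) with (L * / (INR n + 1)).
          rewrite Rabs_pos_eq; auto. apply Rmult_le_pos; [lra | left; apply Rinv_0_lt_compat; lra].
          simpl. field. repeat split; lra.
        * replace (Finite 0) with (Finite (L * 0)) by (f_equal; ring).
          apply is_lim_seq_mult'; [apply is_lim_seq_const | apply inv_INR_lim]. }
  destruct (CV_radius c) as [r| |] eqn:E; auto.
  - pose proof (CV_radius_ge c (r + 1) (D _)) as W. rewrite E in W. simpl in W. lra.
  - pose proof (CV_radius_ge c 0 (D _)) as W. rewrite E in W. simpl in W. easy.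
Qed.

Lemma kc_radius p q : 0 < q -> CV_radius (kc p q) = p_infty.
Proof.
  intros Hq. assert (0 <= Rabs p / q) by (apply Rdiv_le_0_compat; auto; apply Rabs_pos).
  apply (CV_radius_exp_bound _ (1 + Rabs p / q)); [lra|]. intros k. unfold kc.
  pose proof (poch_pos q k Hq) as P. pose proof (INR_fact_lt_0 k) as F. unfold Rdiv at 1 2.
  rewrite !Rabs_mult, !Rabs_inv, (Rabs_pos_eq (poch q k)), (Rabs_pos_eq (INR _)) by lra.
  unfold Rdiv at 2. apply Rmult_le_compat_r; [left; now apply Rinv_0_lt_compat|].
  apply Rmult_le_reg_r with (poch q k); auto. rewrite Rmult_assoc, Rinv_l, Rmult_1_r by lra. now apply poch_ratio_le.
Qed.

Lemma entire_ex c y : CV_radius c = p_infty -> ex_pseries c y.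
Proof. intros H. apply CV_radius_inside. now rewrite H. Qed.

Lemma kummer_derive p q y : 0 < q -> is_derive (kummerM p q) y (PSeries (PS_derive (kc p q)) y).
Proof. intros Hq. apply (is_derive_PSeries (kc p q)). now rewrite kc_radius. Qed.

Lemma kummer_derive_half p y : is_derive (kummerM p (1 / 2)) y (2 * p * kummerM (p + 1) (3 / 2) y).
Proof.
  replace (2 * p * kummerM (p + 1) (3 / 2) y) with (PSeries (PS_derive (kc p (1 / 2))) y).
  - apply kummer_derive. lra.
  - unfold kummerM. rewrite <- (PSeries_scal (2 * p)). apply PSeries_ext. intros k. unfold PS_derive, kc, PS_scal, scal; simpl; unfold mult; simpl.
    change (poch p k * (p + INR k)) with (poch p (S k)). change (poch (1 / 2) k * (1 / 2 + INR k)) with (poch (1 / 2) (S k)).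
    change (match k with 0%nat => 1 | S _ => INR k + 1 end) with (INR (S k)). change (fact k + k * fact k)%nat with (fact (S k)).
    rewrite !poch_shift, fact_simpl, mult_INR. replace (1 / 2 + 1) with (3 / 2) by field.
    pose proof (poch_pos (3 / 2) k ltac:(lra)). pose proof (INR_fact_lt_0 k). assert (INR (S k) <> 0) by (apply not_0_INR; lia).
    field. repeat split; auto; lra.
Qed.

Lemma poch_half k : poch (1 / 2) k * (1 + 2 * INR k) = poch (3 / 2) k.
Proof.
  pose proof (poch_shift (1 / 2) k) as E. simpl in E. replace (1 / 2 + 1) with (3 / 2) in E by field. lra.
Qed.

(** The operator 1 + 2 y d/dy multiplies the k-th coefficient by 1 + 2 k, which turns (3/2)_k in the
    denominator into (1/2)_k. *)
Lemma kummer_euler p y : kummerM p (3 / 2) y + 2 * y * PSeries (PS_derive (kc p (3 / 2))) y = kummerM p (1 / 2) y.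
Proof.
  rewrite Rmult_assoc, <- (PSeries_incr_1 (PS_derive (kc p (3 / 2)))).
  unfold kummerM. rewrite <- (PSeries_scal 2).
  assert (EX : CV_radius (kc p (3 / 2)) = p_infty) by (apply kc_radius; lra).
  rewrite <- (PSeries_plus (kc p (3 / 2))).
  - apply PSeries_ext. intros k.
    change (kc p (3 / 2) k + 2 * PS_incr_1 (PS_derive (kc p (3 / 2))) k = kc p (1 / 2) k).
    assert (E : PS_incr_1 (PS_derive (kc p (3 / 2))) k = INR k * kc p (3 / 2) k).
    { destruct k as [|k]; [unfold PS_incr_1, zero; simpl; ring | reflexivity]. }
    rewrite E. unfold kc. rewrite <- poch_half.
    pose proof (poch_pos (1 / 2) k ltac:(lra)). pose proof (INR_fact_lt_0 k). pose proof (pos_INR k).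
    field. repeat split; lra.
  - now apply entire_ex.
  - apply ex_pseries_scal. apply Rmult_comm. apply ex_pseries_incr_1. apply CV_radius_inside. rewrite CV_radius_derive, EX. easy.
Qed.

Lemma kummer_shift p y : kummerM (p + 1) (1 / 2) y = kummerM p (1 / 2) y + 2 * y * kummerM (p + 1) (3 / 2) y.
Proof.
  unfold kummerM. rewrite Rmult_assoc. rewrite <- (PSeries_incr_1 (kc (p + 1) (3 / 2))), <- (PSeries_scal 2).
  rewrite <- (PSeries_plus (kc p (1 / 2))).
  - apply PSeries_ext. intros k. unfold PS_plus, PS_scal, plus, scal, kc; simpl; unfold mult; simpl.
    destruct k as [|k].
    + simpl. unfold zero; simpl. field.
    + unfold PS_incr_1. rewrite (poch_shift p). change (poch (p + 1) (S k)) with (poch (p + 1) k * (p + 1 + INR k)).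
      rewrite (poch_shift (1 / 2)), fact_simpl, mult_INR, S_INR. replace (1 / 2 + 1) with (3 / 2) by field.
      pose proof (poch_pos (3 / 2) k ltac:(lra)). pose proof (INR_fact_lt_0 k). pose proof (pos_INR k). field. repeat split; lra.
  - apply entire_ex, kc_radius. lra.
  - apply ex_pseries_scal. apply Rmult_comm. apply ex_pseries_incr_1. apply entire_ex, kc_radius. lra.
Qed.

(** The contiguous relation behind [w_rec2]; coefficientwise it is p (p + 1)_k = (p)_k (p + k). *)
Lemma kummer_cross p y : kummerM p (1 / 2) y = 2 * p * kummerM (p + 1) (3 / 2) y - (2 * p - 1) * kummerM p (3 / 2) y.
Proof.
  unfold kummerM, Rminus at 1. rewrite <- Ropp_mult_distr_l_reverse.
  rewrite <- (PSeries_scal (2 * p)), <- (PSeries_scal (- (2 * p - 1))), <- (PSeries_plus (PS_scal (2 * p) (kc (p + 1) (3 / 2)))).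
  - apply PSeries_ext. intros k. unfold PS_plus, PS_scal, plus, scal, kc; simpl; unfold mult; simpl.
    pose proof (poch_shift p k) as E. simpl in E. pose proof (poch_half k) as PH. rewrite <- PH.
    pose proof (poch_pos (1 / 2) k ltac:(lra)) as P1. pose proof (INR_fact_lt_0 k).
    pose proof (pos_INR k).
    transitivity ((2 * (p * poch (p + 1) k) - (2 * p - 1) * poch p k) / (poch (1 / 2) k * (1 + 2 * INR k)) / INR (fact k)).
    + rewrite <- E. field. repeat split; lra.
    + field. repeat split; lra.
  - apply ex_pseries_scal. apply Rmult_comm. apply entire_ex, kc_radius. lra.
  - apply ex_pseries_scal. apply Rmult_comm. apply entire_ex, kc_radius. lra.
Qed.

Lemma w1_derive a x : is_derive (w1 a) x (- (a + 1 / 2) * w2 (a + 1) x).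
Proof.
  unfold w1, w2. replace (- (a + 1 / 2) * (x * kummerM ((a + 1) / 2 + 3 / 4) (3 / 2) (- (x ^ 2 / 2)))) with
    (scal (- x) (2 * (a / 2 + 1 / 4) * kummerM (a / 2 + 1 / 4 + 1) (3 / 2) (- (x ^ 2 / 2)))).
  - apply (is_derive_comp (kummerM (a / 2 + 1 / 4) (1 / 2)) (fun x => - (x ^ 2 / 2))).
    + apply kummer_derive_half.
    + auto_derive; auto. field.
  - unfold scal; simpl; unfold mult; simpl. replace ((a + 1) / 2 + 3 / 4) with (a / 2 + 1 / 4 + 1) by field. field.
Qed.

Lemma w2_derive a x : is_derive (w2 a) x (w1 (a + 1) x).
Proof.
  unfold w1, w2. set (y := - (x ^ 2 / 2)). replace ((a + 1) / 2 + 1 / 4) with (a / 2 + 3 / 4) by field.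
  rewrite <- kummer_euler.
  replace (kummerM (a / 2 + 3 / 4) (3 / 2) y + 2 * y * PSeries (PS_derive (kc (a / 2 + 3 / 4) (3 / 2))) y) with
    (1 * kummerM (a / 2 + 3 / 4) (3 / 2) y + x * scal (- x) (PSeries (PS_derive (kc (a / 2 + 3 / 4) (3 / 2))) y)).
  - apply (is_derive_mult (K := R_AbsRing) (fun x => x) (fun x => kummerM (a / 2 + 3 / 4) (3 / 2) (- (x ^ 2 / 2)))).
    + apply (is_derive_id (K := R_AbsRing) x).
    + apply (is_derive_comp (kummerM (a / 2 + 3 / 4) (3 / 2)) (fun x => - (x ^ 2 / 2))).
      * apply kummer_derive. lra.
      * auto_derive; auto. field.
    + apply Rmult_comm.
  - unfold scal; simpl; unfold mult; simpl. unfold y. field.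
Qed.

Lemma w_rec1 a x : x * w2 a x = w1 (a - 1) x - w1 (a + 1) x.
Proof.
  unfold w1, w2. replace ((a + 1) / 2 + 1 / 4) with ((a - 1) / 2 + 1 / 4 + 1) by field.
  rewrite kummer_shift. replace ((a - 1) / 2 + 1 / 4 + 1) with (a / 2 + 3 / 4) by field. field.
Qed.

Lemma w_rec2 a x : x * w1 a x = (1 / 2 - a) * w2 (a - 1) x + (a + 1 / 2) * w2 (a + 1) x.
Proof.
  unfold w1, w2. rewrite kummer_cross.
  replace ((a - 1) / 2 + 3 / 4) with (a / 2 + 1 / 4) by field.
  replace ((a + 1) / 2 + 3 / 4) with (a / 2 + 1 / 4 + 1) by field. field.
Qed.

Lemma kummer_0 p q : kummerM p q 0 = 1.
Proof. unfold kummerM. rewrite PSeries_0. simpl. field. Qed.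

Lemma w1_0 a : w1 a 0 = 1.
Proof. unfold w1. replace (- (0 ^ 2 / 2)) with 0 by field. apply kummer_0. Qed.

Lemma w2_0 a : w2 a 0 = 0.
Proof. unfold w2. ring. Qed.

(** With minus its derivative as partner, [w1] solves the same system as the recessive solution;
    this makes the two comparable through their values at 0. *)
Lemma w_sys1 a : sys a (w1 a) (fun x => (a + 1 / 2) * w2 (a + 1) x).
Proof.
  intros x _. split.
  - replace (- ((a + 1 / 2) * w2 (a + 1) x)) with (- (a + 1 / 2) * w2 (a + 1) x) by ring. apply w1_derive.
  - replace (- x * ((a + 1 / 2) * w2 (a + 1) x) + (a + 1 / 2) * w1 a x) with ((a + 1 / 2) * w1 (a + 1 + 1) x).
    + apply (is_derive_scal (w2 (a + 1))). apply w2_derive.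
    + pose proof (w_rec1 (a + 1) x) as E. replace (a + 1 - 1) with a in E by ring.
      replace (w1 (a + 1 + 1) x) with (w1 a x - x * w2 (a + 1) x) by lra. ring.
Qed.

Lemma w_sys2 a : sys a (w2 a) (fun x => - w1 (a + 1) x).
Proof.
  intros x _. split.
  - rewrite Ropp_involutive. apply w2_derive.
  - replace (- x * - w1 (a + 1) x + (a + 1 / 2) * w2 a x) with (- (- (a + 1 + 1 / 2) * w2 (a + 1 + 1) x)).
    + apply (is_derive_opp (w1 (a + 1))). apply w1_derive.
    + pose proof (w_rec2 (a + 1) x) as E. replace (a + 1 - 1) with a in E by ring. lra.
Qed.

Lemma sys_lin a va vb ua ub c d : sys a va vb -> sys a ua ub ->
  sys a (fun x => c * va x + d * ua x) (fun x => c * vb x + d * ub x).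
Proof.
  intros H1 H2 x Hx. destruct (H1 x Hx) as [A1 B1]. destruct (H2 x Hx) as [A2 B2]. split.
  - replace (- (c * vb x + d * ub x)) with (plus (c * - vb x) (d * - ub x)) by (unfold plus; simpl; ring).
    apply (is_derive_plus (V := R_NormedModule)); [apply (is_derive_scal va) | apply (is_derive_scal ua)]; auto.
  - replace (- x * (c * vb x + d * ub x) + (a + 1 / 2) * (c * va x + d * ua x)) with
      (plus (c * (- x * vb x + (a + 1 / 2) * va x)) (d * (- x * ub x + (a + 1 / 2) * ua x))) by (unfold plus; simpl; ring).
    apply (is_derive_plus (V := R_NormedModule)); [apply (is_derive_scal vb) | apply (is_derive_scal ub)]; auto.
Qed.

(** * Uniqueness for the first order system with values prescribed at 0 *)

Definition tends0 (f : R -> R) (l : R) : Prop :=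
  forall eps, 0 < eps -> exists d, 0 < d /\ forall x, 0 < x < d -> Rabs (f x - l) < eps.

Lemma tends0_cont f : continuous f 0 -> tends0 f (f 0).
Proof.
  intros H eps Heps. assert (H' : is_lim f 0 (f 0)).
  { apply is_lim_continuity. now apply continuity_pt_filterlim. }
  apply is_lim_spec in H'. destruct (H' (mkposreal eps Heps)) as [d Hd]. exists d. split; [apply cond_pos|].
  intros x Hx. apply Hd; [|lra]. change (Rabs (x - 0) < d). rewrite Rminus_0_r, Rabs_pos_eq; lra.
Qed.

Lemma tends0_lin f g lf lg c d : tends0 f lf -> tends0 g lg -> tends0 (fun x => c * f x + d * g x) (c * lf + d * lg).
Proof.
  intros Hf Hg eps Heps. pose proof (Rabs_pos c). pose proof (Rabs_pos d).
  set (e := eps / (Rabs c + Rabs d + 1)). assert (He : 0 < e) by (apply Rdiv_lt_0_compat; lra).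
  destruct (Hf e He) as (d1 & P1 & H1). destruct (Hg e He) as (d2 & P2 & H2).
  exists (Rmin d1 d2). split; [now apply Rmin_pos|]. intros x Hx.
  specialize (H1 x ltac:(pose proof (Rmin_l d1 d2); lra)). specialize (H2 x ltac:(pose proof (Rmin_r d1 d2); lra)).
  replace (c * f x + d * g x - (c * lf + d * lg)) with (c * (f x - lf) + d * (g x - lg)) by ring.
  eapply Rle_lt_trans; [apply Rabs_triang|]. rewrite !Rabs_mult.
  assert (E : e * (Rabs c + Rabs d + 1) = eps) by (unfold e; field; lra). nra.
Qed.

(* Gronwall's inequality for [va^2 + vb^2]. *)
Lemma sys_unique0 a va vb : sys a va vb -> tends0 va 0 -> tends0 vb 0 -> forall x, 0 < x -> va x = 0 /\ vb x = 0.
Proof.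
  intros S H1 H2 x Hx.
  set (E := fun t => (va t ^ 2 + vb t ^ 2)). set (K := Rabs (2 * a - 1)).
  set (F := fun t => E t * exp (- (K * t))).
  set (F' := fun t => ((2 * a - 1) * (va t * vb t) - 2 * t * vb t ^ 2 - K * E t) * exp (- (K * t))).
  assert (DF : forall t, 0 < t -> is_derive F t (F' t)).
  { intros t Ht. destruct (S t Ht) as [A1 A2]. unfold F, F', E.
    auto_derive. repeat split; eexists; eauto.
    replace (Derive (fun x => va x) t) with (- vb t) by (symmetry; apply is_derive_unique; exact A1).
    replace (Derive (fun x => vb x) t) with (- t * vb t + (a + 1 / 2) * va t) by (symmetry; apply is_derive_unique; exact A2). field. }
  assert (NF : forall t, 0 < t -> F' t <= 0).
  { intros t Ht. unfold F'. pose proof (exp_pos (- (K * t))).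
    assert (Q : (2 * a - 1) * (va t * vb t) - 2 * t * vb t ^ 2 - K * E t <= 0).
    { unfold E. assert ((2 * a - 1) * (va t * vb t) <= K * (va t ^ 2 + vb t ^ 2)).
      { unfold K. pose proof (Rle_abs (2 * a - 1)). pose proof (Rle_abs (- (2 * a - 1))). rewrite Rabs_Ropp in *.
        pose proof (Rabs_pos (2 * a - 1)).
        pose proof (pow2_ge_0 (va t + vb t)). pose proof (pow2_ge_0 (va t - vb t)).
        pose proof (pow2_ge_0 (va t)). pose proof (pow2_ge_0 (vb t)).
        destruct (Rle_lt_dec 0 (va t * vb t)); nra. }
      pose proof (pow2_ge_0 (vb t)). nra. }
    nra. }
  assert (Mon : forall y, 0 < y < x -> F x <= F y).
  { intros y Hy. destruct (MVT_gen F y x F') as (c & Hc & Ec).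
    - intros t Ht. rewrite Rmin_left, Rmax_right in Ht by lra. apply DF. lra.
    - intros t Ht. rewrite Rmin_left, Rmax_right in Ht by lra. apply continuity_pt_filterlim. apply (continuous_derivable F).
      eexists; apply DF; lra.
    - rewrite Rmin_left, Rmax_right in Hc by lra. pose proof (NF c ltac:(lra)). nra. }
  assert (Ex : E x <= 0).
  { destruct (Rle_lt_dec (E x) 0) as [|Hp]; auto. exfalso.
    assert (HF : 0 < F x) by (unfold F; apply Rmult_lt_0_compat; auto; apply exp_pos).
    (* Near 0 both squares are at most F x / 4, so E y <= F x / 2, against the monotonicity F x <= F
       y <= E y. *)
    set (e := Rmin 1 (F x / 4)). assert (He : 0 < e) by (apply Rmin_pos; lra).
    destruct (H1 e He) as (d1 & P1 & Q1). destruct (H2 e He) as (d2 & P2 & Q2).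
    set (y := Rmin x (Rmin d1 d2) / 2).
    assert (Hm : 0 < Rmin x (Rmin d1 d2)) by (repeat apply Rmin_pos; auto).
    pose proof (Rmin_l x (Rmin d1 d2)). pose proof (Rmin_r x (Rmin d1 d2)). pose proof (Rmin_l d1 d2). pose proof (Rmin_r d1 d2).
    assert (Hy : 0 < y < x) by (unfold y; lra).
    specialize (Q1 y ltac:(unfold y in *; lra)). specialize (Q2 y ltac:(unfold y in *; lra)). rewrite Rminus_0_r in *.
    specialize (Mon y Hy).
    assert (e <= 1) by apply Rmin_l. assert (e <= F x / 4) by apply Rmin_r.
    assert (va y ^ 2 <= e) by (rewrite <- Rsqr_pow2, Rsqr_abs; unfold Rsqr; pose proof (Rabs_pos (va y)); nra).
    assert (vb y ^ 2 <= e) by (rewrite <- Rsqr_pow2, Rsqr_abs; unfold Rsqr; pose proof (Rabs_pos (vb y)); nra).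
    assert (F y <= E y).
    { unfold F. assert (exp (- (K * y)) <= 1).
      { apply Rle_trans with (exp 0); [apply exp_le_exp | rewrite exp_0; lra]. pose proof (Rabs_pos (2 * a - 1)). unfold K. nra. }
      assert (0 <= E y) by (unfold E; pose proof (pow2_ge_0 (va y)); pose proof (pow2_ge_0 (vb y)); lra). nra. }
    unfold E in *. lra. }
  unfold E in Ex. pose proof (pow2_ge_0 (va x)). pose proof (pow2_ge_0 (vb x)).
  split; apply Rsqr_0_uniq; rewrite Rsqr_pow2; lra.
Qed.

Lemma sys_unique a va vb ua ub : sys a va vb -> sys a ua ub ->
  forall la lb, tends0 va la -> tends0 ua la -> tends0 vb lb -> tends0 ub lb ->
  forall x, 0 < x -> va x = ua x /\ vb x = ub x.
Proof.
  intros S1 S2 la lb A1 A2 B1 B2 x Hx.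
  pose proof (tends0_lin _ _ _ _ 1 (-1) A1 A2) as T1. pose proof (tends0_lin _ _ _ _ 1 (-1) B1 B2) as T2.
  replace (1 * la + -1 * la) with 0 in T1 by ring. replace (1 * lb + -1 * lb) with 0 in T2 by ring.
  destruct (sys_unique0 a _ _ (sys_lin a va vb ua ub 1 (-1) S1 S2) T1 T2 x Hx). lra.
Qed.

(** * The principal value transform *)

(* [T K xi] is the principal value of the integral of [- K (xi + y) / sinh y] over the line. *)
Definition Tint (K : R -> R) (xi : R) : R -> R := sq (fun y => K (xi - y) - K (xi + y)) (- 2 * Derive K xi).
Definition T (K : R -> R) (xi : R) : R := / 2 * II (Tint K xi).

(** The growth that the kernel 1 / sinh still integrates, with margin e. *)
Definition expo (e C : R) (K : R -> R) : Prop := forall t, Rabs (K t) <= C * exp ((1 - e) * Rabs t).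

Lemma exp_abs_add e x y : 0 < e < 1 -> exp ((1 - e) * Rabs (x + y)) <= exp ((1 - e) * Rabs x) * exp ((1 - e) * Rabs y).
Proof.
  intros He. rewrite <- exp_plus. apply exp_le_exp. rewrite <- Rmult_plus_distr_l.
  apply Rmult_le_compat_l; [lra|]. apply Rabs_triang.
Qed.

Lemma expo_C e C K : expo e C K -> 0 <= C.
Proof.
  intros H. specialize (H 0). rewrite Rabs_R0, Rmult_0_r, exp_0 in H. pose proof (Rabs_pos (K 0)). lra.
Qed.

(** A bound on the derivative alone suffices: by the mean value theorem it gives the linear
    vanishing of the numerator at y = 0 together with its growth. *)
Lemma Tint_edom (K K1 : R -> R) e C xi : 0 < e < 1 -> (forall t, is_derive K t (K1 t)) -> expo e C K1 ->
  edom (2 * C * exp ((1 - e) * Rabs xi) * (1 + 4 / e)) (e / 2) (Tint K xi).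
Proof.
  intros He D B. pose proof (expo_C _ _ _ B) as HC.
  set (M := 2 * C * exp ((1 - e) * Rabs xi)).
  assert (Ex : 0 < exp ((1 - e) * Rabs xi)) by apply exp_pos.
  assert (DN : forall y, is_derive (fun y => K (xi - y) - K (xi + y)) y (- K1 (xi - y) - K1 (xi + y))).
  { intros y. auto_derive. repeat split; eexists; apply D.
    replace (Derive (fun x => K x) (xi + - y)) with (K1 (xi - y)) by (symmetry; apply is_derive_unique; apply D).
    replace (Derive (fun x => K x) (xi + y)) with (K1 (xi + y)) by (symmetry; apply is_derive_unique; apply D). ring. }
  apply sq_edom; try lra.
  - rewrite (is_derive_unique _ _ _ (D xi)). pose proof (DN 0) as D0. rewrite Rminus_0_r, Rplus_0_r in D0.
    replace (-2 * K1 xi) with (- K1 xi - K1 xi) by ring. exact D0.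
  - rewrite Rminus_0_r, Rplus_0_r. ring.
  - intros y. apply (continuous_derivable (fun y => K (xi - y) - K (xi + y))). eexists; apply DN.
  - rewrite (is_derive_unique _ _ _ (D xi)), Rabs_mult. replace (Rabs (-2)) with 2 by (rewrite Rabs_left; lra).
    unfold M. specialize (B xi). nra.
  - intros y.
    eapply Rle_trans. apply (mvt_bound K K1 (xi + y) (xi - y) (C * (exp ((1 - e) * Rabs xi) * exp ((1 - e) * Rabs y)))).
    + intros; apply D.
    + intros t Ht. eapply Rle_trans; [apply B|]. apply Rmult_le_compat_l; auto. rewrite <- exp_plus. apply exp_le_exp.
      rewrite <- Rmult_plus_distr_l. apply Rmult_le_compat_l; [lra|].
      assert (Hty : Rabs (t - xi) <= Rabs y).
      { unfold Rmin, Rmax in Ht. destruct (Rle_dec (xi + y) (xi - y)).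
        - rewrite (Rabs_left1 y) by lra. apply Rabs_le. lra.
        - rewrite (Rabs_pos_eq y) by lra. apply Rabs_le. lra. }
      replace t with (xi + (t - xi)) by ring. eapply Rle_trans; [apply Rabs_triang|]. lra.
    + replace (xi - y - (xi + y)) with (- (2 * y)) by ring. rewrite Rabs_Ropp, Rabs_mult, (Rabs_pos_eq 2) by lra.
      unfold M. right. ring.
Qed.

Lemma T_bound (K K1 : R -> R) e C xi : 0 < e < 1 -> (forall t, is_derive K t (K1 t)) -> expo e C K1 ->
  Rabs (T K xi) <= 4 * (1 + 4 / e) / e * C * exp ((1 - e) * Rabs xi).
Proof.
  intros He D B. unfold T. rewrite Rabs_mult, (Rabs_pos_eq (/ 2)) by lra.
  eapply Rle_trans. apply Rmult_le_compat_l; [lra|]. apply II_abs_le. now apply (Tint_edom K K1 e C).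
  right. field. lra.
Qed.

Lemma T_lin (K K1 L L1 : R -> R) e C e' C' c d xi : 0 < e < 1 -> 0 < e' < 1 ->
  (forall t, is_derive K t (K1 t)) -> expo e C K1 -> (forall t, is_derive L t (L1 t)) -> expo e' C' L1 ->
  T (fun t => c * K t + d * L t) xi = c * T K xi + d * T L xi.
Proof.
  intros He He' DK BK DL BL. unfold T.
  assert (D1 : dom (Tint K xi)) by (eexists; eexists; now apply (Tint_edom K K1 e C)).
  assert (D2 : dom (Tint L xi)) by (eexists; eexists; now apply (Tint_edom L L1 e' C')).
  rewrite (II_ext _ (fun y => c * Tint K xi y + d * Tint L xi y)).
  - rewrite II_plus, !II_scal by (auto; now apply dom_scal). ring.
  - intros y. unfold Tint, sq. destruct (Req_EM_T y 0) as [Hy|Hy].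
    + rewrite (is_derive_unique _ _ _ (DK xi)), (is_derive_unique _ _ _ (DL xi)).
      replace (Derive (fun t => c * K t + d * L t) xi) with (c * K1 xi + d * L1 xi); [ring|].
      symmetry. apply is_derive_unique. apply (is_derive_plus (V := R_NormedModule)); [apply (is_derive_scal K) | apply (is_derive_scal L)]; auto.
    + field. now apply sinh_neq.
Qed.

Lemma T_ext K L xi : (forall t, K t = L t) -> T K xi = T L xi.
Proof.
  intros E. unfold T. f_equal. apply II_ext. intros y. unfold Tint, sq. rewrite (Derive_ext K L) by auto.
  destruct (Req_EM_T y 0); auto. now rewrite !E.
Qed.

Lemma is_derive_shift (K : R -> R) h t l : is_derive K (t + h) l -> is_derive (fun t => K (t + h)) t l.
Proof.
  intros H. replace l with (scal 1 l) by (unfold scal; simpl; unfold mult; simpl; ring).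
  apply (is_derive_comp K (fun t => t + h)); auto. auto_derive; auto.
Qed.

Lemma T_shift (K K1 : R -> R) h xi : (forall t, is_derive K t (K1 t)) -> T K (xi + h) = T (fun t => K (t + h)) xi.
Proof.
  intros D. unfold T. f_equal. apply II_ext. intros y. unfold Tint, sq.
  destruct (Req_EM_T y 0).
  - rewrite (is_derive_unique _ _ _ (D (xi + h))).
    replace (Derive (fun t => K (t + h)) xi) with (K1 (xi + h)); auto.
    symmetry. apply is_derive_unique. apply is_derive_shift, D.
  - do 2 f_equal; f_equal; ring.
Qed.

Lemma expo_shift e C K h : 0 < e < 1 -> expo e C K -> expo e (C * exp ((1 - e) * Rabs h)) (fun t => K (t + h)).
Proof.
  intros He B t. pose proof (expo_C _ _ _ B). eapply Rle_trans; [apply B|]. rewrite Rmult_assoc. apply Rmult_le_compat_l; auto.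
  rewrite (Rmult_comm (exp _)). now apply exp_abs_add.
Qed.

(** [T] commutes with differentiation because the remainder L = K(. + h) - K - h K1 can itself be
    fed to [T_bound]. That bound looks at L' = K1(. + h) - K1 - h K2, of order h^2 by [taylor2];
    hence three derivatives of K. *)
Lemma T_derive (K K1 K2 K3 : R -> R) e C xi : 0 < e < 1 -> (forall t, is_derive K t (K1 t)) -> (forall t, is_derive K1 t (K2 t)) ->
  (forall t, is_derive K2 t (K3 t)) -> expo e C K1 -> expo e C K2 -> expo e C K3 ->
  is_derive (T K) xi (T K1 xi).
Proof.
  intros He D1 D2 D3 B1 B2 B3.
  pose proof (expo_C _ _ _ B3) as HC.
  apply (is_derive_quad _ xi _ (4 * (1 + 4 / e) / e * (C * exp (1 - e)) * exp ((1 - e) * Rabs xi)) 1); [lra|].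
  intros h Hh.
  set (L := fun t => 1 * (1 * K (t + h) + (-1) * K t) + (- h) * K1 t).
  assert (DL : forall t, is_derive L t (K1 (t + h) - K1 t - h * K2 t)).
  { intros t. replace (K1 (t + h) - K1 t - h * K2 t) with (plus (1 * plus (1 * K1 (t + h)) ((-1) * K1 t)) ((- h) * K2 t)) by (unfold plus; simpl; ring).
    apply (is_derive_plus (V := R_NormedModule)).
    - apply (is_derive_scal (fun t => 1 * K (t + h) + -1 * K t)). apply (is_derive_plus (V := R_NormedModule)).
      + apply (is_derive_scal (fun t => K (t + h))). apply is_derive_shift, D1.
      + apply (is_derive_scal K). apply D1.
    - apply (is_derive_scal K1). apply D2. }
  assert (BL : expo e (C * exp (1 - e) * h ^ 2) (fun t => K1 (t + h) - K1 t - h * K2 t)).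
  { intros t. replace (C * exp (1 - e) * h ^ 2 * exp ((1 - e) * Rabs t)) with (C * (exp (1 - e) * exp ((1 - e) * Rabs t)) * h ^ 2) by ring.
    apply (taylor2 K1 K2 K3 t h _ 1); auto. intros s Hs. eapply Rle_trans; [apply B3|].
    apply Rmult_le_compat_l; auto. rewrite <- exp_plus. apply exp_le_exp.
    assert (Rabs s <= Rabs t + 1). { replace s with (t + (s - t)) by ring. eapply Rle_trans; [apply Rabs_triang|]. lra. }
    nra. }
  assert (E : T K (xi + h) - T K xi - h * T K1 xi = T L xi).
  { unfold L. 
    assert (BL1 : expo e (C * exp ((1 - e) * Rabs h) + C) (fun t => 1 * K1 (t + h) + -1 * K1 t)).
    { intros t. eapply Rle_trans; [apply Rabs_triang|]. rewrite Rmult_plus_distr_r, !Rabs_mult, Rabs_R1, Rmult_1_l.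
      replace (Rabs (-1)) with 1 by (rewrite Rabs_left; lra). rewrite Rmult_1_l.
      apply Rplus_le_compat; [apply (expo_shift e C K1 h He B1) | apply B1]. }
    rewrite (T_lin (fun t => 1 * K (t + h) + -1 * K t) (fun t => 1 * K1 (t + h) + -1 * K1 t) K1 K2 e (C * exp ((1 - e) * Rabs h) + C) e C 1 (- h) xi); auto.
    rewrite (T_lin (fun t => K (t + h)) (fun t => K1 (t + h)) K K1 e (C * exp ((1 - e) * Rabs h)) e C 1 (-1) xi); auto.
    - rewrite <- (T_shift K K1) by auto. ring.
    - intros t; apply is_derive_shift, D1.
    - now apply expo_shift.
    - intros t. apply (is_derive_plus (V := R_NormedModule)).
      + apply (is_derive_scal (fun t => K (t + h))). apply is_derive_shift, D1.
      + apply (is_derive_scal K). apply D1. }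
  rewrite E. eapply Rle_trans; [apply (T_bound L _ e _ xi He DL BL)|]. right. ring.
Qed.

(** The successive derivatives are existential, since those produced by the system are ever longer
    linear combinations. *)
Fixpoint smooth (e : R) (n : nat) (K : R -> R) : Prop :=
  (exists C, expo e C K) /\
  match n with O => True | S m => exists K', (forall t, is_derive K t (K' t)) /\ smooth e m K' end.

Lemma smooth_lin e n : forall K L c d, smooth e n K -> smooth e n L -> smooth e n (fun t => c * K t + d * L t).
Proof.
  assert (W : forall K L c d, (exists C, expo e C K) -> (exists C, expo e C L) -> exists C, expo e C (fun t => c * K t + d * L t)).
  { intros K L c d [C1 H1] [C2 H2]. exists (Rabs c * C1 + Rabs d * C2). intros t.
    eapply Rle_trans; [apply Rabs_triang|]. rewrite !Rabs_mult, Rmult_plus_distr_r, !Rmult_assoc.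
    apply Rplus_le_compat; (apply Rmult_le_compat_l; [apply Rabs_pos|auto]). }
  induction n as [|n IH]; intros K L c d [H1 H2] [H3 H4].
  - split; auto.
  - split; auto. destruct H2 as (K' & D1 & S1). destruct H4 as (L' & D2 & S2).
    exists (fun t => c * K' t + d * L' t). split; [|now apply IH].
    intros t. apply (is_derive_plus (V := R_NormedModule)); [apply (is_derive_scal K) | apply (is_derive_scal L)]; auto.
Qed.

(** x^k f(x) at x = exp t: translation in t is dilation in x, which lets [T] act as a multiplicative
    transform. *)
Definition Kf (k : R) (f : R -> R) (t : R) : R := exp (k * t) * f (exp t).

Lemma rap_lin f g c d : rap f -> rap g -> rap (fun x => c * f x + d * g x).
Proof.
  intros Hf Hg n. destruct (Hf n) as (C1 & P1 & H1). destruct (Hg n) as (C2 & P2 & H2).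
  exists (Rabs c * C1 + Rabs d * C2). pose proof (Rabs_pos c). pose proof (Rabs_pos d). split; [nra|].
  intros x Hx. specialize (H1 x Hx). specialize (H2 x Hx).
  assert (0 < (1 + x) ^ n) by (apply pow_lt; lra).
  apply Rle_trans with ((1 + x) ^ n * (Rabs c * Rabs (f x) + Rabs d * Rabs (g x))).
  - apply Rmult_le_compat_l; [lra|]. rewrite <- !Rabs_mult. apply Rabs_triang.
  - nra.
Qed.

Lemma rap_x f : rap f -> rap (fun x => x * f x).
Proof.
  intros Hf n. destruct (Hf (S n)) as (C & P & H). exists C. split; auto. intros x Hx. specialize (H x Hx).
  rewrite Rabs_mult, (Rabs_pos_eq x) by lra. simpl in H. assert (0 < (1 + x) ^ n) by (apply pow_lt; lra).
  pose proof (Rabs_pos (f x)).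
  apply Rle_trans with ((1 + x) * (1 + x) ^ n * Rabs (f x)); auto.
  replace ((1 + x) ^ n * (x * Rabs (f x))) with (x * ((1 + x) ^ n * Rabs (f x))) by ring.
  rewrite Rmult_assoc. apply Rmult_le_compat_r; [apply Rmult_le_pos; lra | lra].
Qed.

Lemma Kf_growth k f : rap f -> exists C, 0 <= C /\ forall t,
  (t <= 0 -> Rabs (Kf k f t) <= C * exp (k * t)) /\ (0 <= t -> Rabs (Kf k f t) <= C * exp (- t)).
Proof.
  (* S N exceeds |k + 1|, so (1 + exp t)^(S N) dominates exp((k + 1) t) for t >= 0, leaving a factor
     exp(- t). *)
  intros Hf. destruct (nfloor_ex (Rabs (k + 1)) (Rabs_pos _)) as [N [_ HN]].
  destruct (Hf (S N)) as (C & HC & H). exists C. split; auto. intros t. unfold Kf. specialize (H (exp t) (exp_pos t)).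
  rewrite Rabs_mult, (Rabs_pos_eq (exp _)) by (left; apply exp_pos). pose proof (exp_pos t) as Et. pose proof (exp_pos (k * t)).
  assert (P1 : 1 <= (1 + exp t) ^ S N) by (apply pow_R1_Rle; lra).
  pose proof (Rabs_pos (f (exp t))). assert (B : Rabs (f (exp t)) <= C) by nra.
  split; intros Ht; [nra|].
  assert (P2 : exp ((k + 1) * t) <= (1 + exp t) ^ S N).
  { rewrite pow_exp_ln by lra. apply exp_le_exp. rewrite S_INR.
    assert (t <= ln (1 + exp t)) by (rewrite <- (ln_exp t) at 1; apply ln_le; lra).
    pose proof (Rle_abs (k + 1)). pose proof (Rabs_pos (k + 1)).
    apply Rle_trans with ((INR N + 1) * t); [apply Rmult_le_compat_r; lra | apply Rmult_le_compat_l; lra]. }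
  replace (k * t) with ((k + 1) * t + - t) by ring. rewrite exp_plus. pose proof (exp_pos (- t)).
  apply Rle_trans with ((1 + exp t) ^ S N * exp (- t) * Rabs (f (exp t))).
  - apply Rmult_le_compat_r; auto. apply Rmult_le_compat_r; lra.
  - replace ((1 + exp t) ^ S N * exp (- t) * Rabs (f (exp t))) with ((1 + exp t) ^ S N * Rabs (f (exp t)) * exp (- t)) by ring.
    apply Rmult_le_compat_r; lra.
Qed.

Lemma Kf_expo k f e : 0 < e < 1 -> - (1 - e) <= k -> rap f -> exists C, expo e C (Kf k f).
Proof.
  intros He Hk Hf. destruct (Kf_growth k f Hf) as (C & HC & H). exists C. intros t. destruct (H t) as [H1 H2].
  destruct (Rle_lt_dec t 0) as [Ht|Ht].
  - eapply Rle_trans; [now apply H1|]. apply Rmult_le_compat_l; auto. apply exp_le_exp. rewrite Rabs_left1 by auto. nra.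
  - eapply Rle_trans; [apply H2; lra|]. apply Rmult_le_compat_l; auto. apply exp_le_exp. rewrite Rabs_pos_eq by lra. nra.
Qed.

Lemma Kf_derive k (f f' : R -> R) t : is_derive f (exp t) (f' (exp t)) -> is_derive (Kf k f) t (k * Kf k f t + Kf (k + 1) f' t).
Proof.
  intros D. unfold Kf. replace ((k + 1) * t) with (k * t + t) by ring. rewrite exp_plus.
  auto_derive. repeat split. eexists; apply D.
  replace (Derive (fun x => f x) (exp t)) with (f' (exp t)) by (symmetry; apply is_derive_unique, D). ring.
Qed.

Lemma Kf_lin k f g c d t : Kf k (fun x => c * f x + d * g x) t = c * Kf k f t + d * Kf k g t.
Proof. unfold Kf. ring. Qed.

Lemma Kf_x k f t : Kf k (fun x => x * f x) t = Kf (k + 1) f t.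
Proof. unfold Kf. replace ((k + 1) * t) with (k * t + t) by ring. rewrite exp_plus. ring. Qed.

Lemma Kfa_derive a va vb k t : sys a va vb -> is_derive (Kf k va) t (k * Kf k va t + -1 * Kf (k + 1) vb t).
Proof.
  intros S. replace (-1 * Kf (k + 1) vb t) with (Kf (k + 1) (fun x => - vb x) t) by (unfold Kf; ring).
  apply (Kf_derive k va (fun x => - vb x)). apply S, exp_pos.
Qed.

Lemma Kfb_derive a va vb k t : sys a va vb -> is_derive (Kf k vb) t (k * Kf k vb t + 1 * (-1 * Kf (k + 2) vb t + (a + 1 / 2) * Kf (k + 1) va t)).
Proof.
  intros S. replace (1 * (-1 * Kf (k + 2) vb t + (a + 1 / 2) * Kf (k + 1) va t)) with (Kf (k + 1) (fun x => - x * vb x + (a + 1 / 2) * va x) t).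
  - apply (Kf_derive k vb (fun x => - x * vb x + (a + 1 / 2) * va x)). apply S, exp_pos.
  - unfold Kf. replace ((k + 2) * t) with ((k + 1) * t + t) by ring. rewrite exp_plus. ring.
Qed.

(** The system expresses a derivative of [Kf] k through [Kf] at k, k + 1 and k + 2, so the induction
    on n runs over all admissible k with a fixed margin e. *)
Lemma Kf_smooth a va vb e n : sys a va vb -> rap va -> rap vb -> 0 < e < 1 -> forall k, - (1 - e) <= k -> smooth e n (Kf k va) /\ smooth e n (Kf k vb).
Proof.
  intros HS Ra Rb He. induction n as [|n IH]; intros k Hk.
  - split; split; auto; apply Kf_expo; auto.
  - destruct (IH k Hk) as [I1 I2]. destruct (IH (k + 1) ltac:(lra)) as [I3 I4]. destruct (IH (k + 2) ltac:(lra)) as [_ I6].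
    split.
    + split; [apply Kf_expo; auto|]. exists (fun t => k * Kf k va t + -1 * Kf (k + 1) vb t).
      split; [intros t; apply (Kfa_derive a va vb k t HS) | now apply smooth_lin].
    + split; [apply Kf_expo; auto|].
      exists (fun t => k * Kf k vb t + 1 * (-1 * Kf (k + 2) vb t + (a + 1 / 2) * Kf (k + 1) va t)).
      split; [intros t; apply (Kfb_derive a va vb k t HS) | apply smooth_lin; auto; apply smooth_lin; auto].
Qed.

Lemma T_derive_smooth (K K1 : R -> R) e xi : 0 < e < 1 -> (forall t, is_derive K t (K1 t)) -> smooth e 2 K1 ->
  is_derive (T K) xi (T K1 xi).
Proof.
  intros He D ((C1 & B1) & K2 & D2 & (C2 & B2) & K3 & D3 & (C3 & B3) & _).
  pose proof (expo_C _ _ _ B1). pose proof (expo_C _ _ _ B2). pose proof (expo_C _ _ _ B3).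
  assert (W : forall C' K, expo e C' K -> C' <= C1 + C2 + C3 -> expo e (C1 + C2 + C3) K).
  { intros C' L B HC t. eapply Rle_trans; [apply B|]. apply Rmult_le_compat_r; auto. left; apply exp_pos. }
  apply (T_derive K K1 K2 K3 e (C1 + C2 + C3)); auto.
  apply (W C1); auto; lra. apply (W C2); auto; lra. apply (W C3); auto; lra.
Qed.

Lemma T_lin_smooth K L c d e xi : 0 < e < 1 -> smooth e 1 K -> smooth e 1 L ->
  T (fun t => c * K t + d * L t) xi = c * T K xi + d * T L xi.
Proof.
  intros He (_ & K1 & D1 & (C1 & B1) & _) (_ & L1 & D2 & (C2 & B2) & _).
  now apply (T_lin K K1 L L1 e C1 e C2).
Qed.

(** Pi_m of the overview for f = v and k = kappa; the prefactor removes the power x^k contributed by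
    [Kf] at ln x. *)
Definition Pv (k : R) (f : R -> R) (x : R) : R := exp (- (k * ln x)) / PI * T (Kf k f) (ln x).

(** The derivative of the prefactor x^(- k) cancels the term k T that comes from differentiating
    exp(k t). *)
Lemma Pv_derive_aux k K1 (x : R) f : 0 < x -> is_derive (T (Kf k f)) (ln x) (k * T (Kf k f) (ln x) + K1) ->
  is_derive (Pv k f) x (exp (- ((k + 1) * ln x)) / PI * K1).
Proof.
  intros Hx D. unfold Pv. pose proof PI_RGT_0.
  assert (E : exp (- ((k + 1) * ln x)) = exp (- (k * ln x)) / x).
  { replace (- ((k + 1) * ln x)) with (- (k * ln x) + - ln x) by ring. rewrite exp_plus, (exp_Ropp (ln x)), exp_ln by auto. reflexivity. }
  rewrite E. auto_derive.
  - repeat split; auto. eexists; apply D.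
  - replace (Derive (fun x0 => T (Kf k f) x0) (ln x)) with (k * T (Kf k f) (ln x) + K1) by (symmetry; apply is_derive_unique, D).
    field. lra.
Qed.

Lemma PvA_derive a va vb k x : sys a va vb -> rap va -> rap vb -> -1 < k -> 0 < x ->
  is_derive (Pv k va) x (- Pv (k + 1) vb x).
Proof.
  intros S Ra Rb Hk Hx. set (e := Rmin (1 / 2) (1 + k)).
  assert (He : 0 < e < 1). { unfold e. split; [apply Rmin_pos; lra | pose proof (Rmin_l (1 / 2) (1 + k)); lra]. }
  assert (Hke : - (1 - e) <= k) by (unfold e; pose proof (Rmin_r (1 / 2) (1 + k)); lra).
  assert (SM : forall n k', k <= k' -> smooth e n (Kf k' va) /\ smooth e n (Kf k' vb)) by (intros; apply (Kf_smooth a); auto; lra).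
  replace (- Pv (k + 1) vb x) with (exp (- ((k + 1) * ln x)) / PI * (-1 * T (Kf (k + 1) vb) (ln x))) by (unfold Pv; field; apply PI_neq0).
  apply Pv_derive_aux; auto.
  rewrite <- (T_lin_smooth _ _ _ _ e) by (auto; apply SM; lra).
  apply (T_derive_smooth _ _ e); auto.
  - intros t. now apply (Kfa_derive a).
  - apply smooth_lin; apply SM; lra.
Qed.

Lemma PvB_derive a va vb k x : sys a va vb -> rap va -> rap vb -> -1 < k -> 0 < x ->
  is_derive (Pv k vb) x (- x * Pv (k + 2) vb x + (a + 1 / 2) * Pv (k + 1) va x).
Proof.
  intros S Ra Rb Hk Hx. set (e := Rmin (1 / 2) (1 + k)).
  assert (He : 0 < e < 1). { unfold e. split; [apply Rmin_pos; lra | pose proof (Rmin_l (1 / 2) (1 + k)); lra]. }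
  assert (Hke : - (1 - e) <= k) by (unfold e; pose proof (Rmin_r (1 / 2) (1 + k)); lra).
  assert (SM : forall n k', k <= k' -> smooth e n (Kf k' va) /\ smooth e n (Kf k' vb)) by (intros; apply (Kf_smooth a); auto; lra).
  replace (- x * Pv (k + 2) vb x + (a + 1 / 2) * Pv (k + 1) va x) with
    (exp (- ((k + 1) * ln x)) / PI * (1 * (-1 * T (Kf (k + 2) vb) (ln x) + (a + 1 / 2) * T (Kf (k + 1) va) (ln x)))).
  2: { unfold Pv. replace (- ((k + 1) * ln x)) with (- ((k + 2) * ln x) + ln x) at 1 by ring.
       replace (- ((k + 1) * ln x)) with (- ((k + 2) * ln x) + ln x) by ring.
       rewrite exp_plus, exp_ln by auto. field. apply PI_neq0. }
  apply Pv_derive_aux; auto.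
  rewrite <- (T_lin_smooth (Kf (k + 2) vb) _ _ _ e) by (auto; apply SM; lra).
  rewrite <- (T_lin_smooth _ _ _ _ e).
  - apply (T_derive_smooth _ _ e); auto.
    + intros t. now apply Kfb_derive.
    + apply smooth_lin. apply SM; lra. apply smooth_lin; apply SM; lra.
  - auto.
  - apply SM; lra.
  - apply smooth_lin; apply SM; lra.
Qed.

(** * Raising the exponent of the transform by two *)

Definition Mel (s : R) (f : R -> R) : R := II (Kf s f).

Lemma Kf_dom s f : 0 < s -> rap f -> (forall x, 0 < x -> continuous f x) -> dom (Kf s f).
Proof.
  intros Hs Hf Hc. destruct (Kf_growth s f Hf) as (C & HC & H). 
  exists C, (Rmin s 1). assert (Hm : 0 < Rmin s 1) by (apply Rmin_pos; lra).
  split; [|split; auto].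
  - intros y. unfold Kf. apply (continuous_mult (K := R_AbsRing)).
    + apply continuous_derivable. auto_derive; auto.
    + apply (continuous_comp exp f). apply continuous_derivable. auto_derive; auto. apply Hc, exp_pos.
  - intros t. destruct (H t) as [H1 H2]. pose proof (Rmin_l s 1). pose proof (Rmin_r s 1).
    destruct (Rle_lt_dec t 0) as [Ht|Ht].
    + eapply Rle_trans; [now apply H1|]. apply Rmult_le_compat_l; auto. apply exp_le_exp. rewrite Rabs_left1 by auto. nra.
    + eapply Rle_trans; [apply H2; lra|]. apply Rmult_le_compat_l; auto. apply exp_le_exp. rewrite Rabs_pos_eq by lra. nra.
Qed.

(** exp((k + 2) y) - exp(k y) = 2 exp((k + 1) y) sinh y cancels the kernel, so two neighbouring
    principal values differ by an ordinary integral, a Mellin transform. *)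
Lemma Pv_step k (f f' : R -> R) x : -1 < k -> 0 < x -> rap f -> rap f' -> (forall x, 0 < x -> is_derive f x (f' x)) ->
  Pv (k + 2) f x = Pv k f x - 2 / PI * exp (- ((k + 1) * ln x)) * Mel (k + 1) f.
Proof.
  intros Hk Hx Hf Hf' D. set (e := Rmin (1 / 2) (1 + k)).
  assert (He : 0 < e < 1). { unfold e. split; [apply Rmin_pos; lra | pose proof (Rmin_l (1 / 2) (1 + k)); lra]. }
  assert (Hke : - (1 - e) <= k) by (unfold e; pose proof (Rmin_r (1 / 2) (1 + k)); lra).
  set (xi := ln x).
  assert (DK : forall k' t, is_derive (Kf k' f) t (k' * Kf k' f t + Kf (k' + 1) f' t)) by (intros k' t; apply Kf_derive, D, exp_pos).
  assert (ED : forall k', k <= k' -> dom (Tint (Kf k' f) xi)).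
  { intros k' Hk'. destruct (Kf_expo k' f e He ltac:(lra) Hf) as [C1 B1]. destruct (Kf_expo (k' + 1) f' e He ltac:(lra) Hf') as [C2 B2].
    eexists; eexists. apply (Tint_edom _ _ e (Rabs k' * C1 + C2) xi He (DK k')).
    intros t. eapply Rle_trans; [apply Rabs_triang|]. rewrite Rabs_mult, Rmult_plus_distr_r, Rmult_assoc.
    apply Rplus_le_compat; [apply Rmult_le_compat_l; [apply Rabs_pos|apply B1] | apply B2]. }
  assert (DM : dom (Kf (k + 1) f)).
  { apply Kf_dom; auto; try lra. intros y Hy. apply continuous_derivable. eexists; apply D; auto. }
  assert (DM1 : dom (fun y => Kf (k + 1) f (y + xi))) by now apply dom_shift.
  assert (DM2 : dom (fun y => Kf (k + 1) f (- y + xi))) by apply (dom_opp_arg (fun y => Kf (k + 1) f (y + xi)) DM1).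
  assert (E : exp (- (2 * xi)) * T (Kf (k + 2) f) xi = T (Kf k f) xi - 2 * exp (- xi) * Mel (k + 1) f).
  { unfold T, Mel.
    assert (E1 : II (Kf (k + 1) f) = II (fun y => Kf (k + 1) f (y + xi))) by (symmetry; now apply II_shift).
    assert (E2 : II (Kf (k + 1) f) = II (fun y => Kf (k + 1) f (- y + xi))).
    { rewrite (II_opp_arg (fun y => Kf (k + 1) f (y + xi))); auto. }
    replace (2 * exp (- xi) * II (Kf (k + 1) f)) with (exp (- xi) * (II (fun y => Kf (k + 1) f (y + xi)) + II (fun y => Kf (k + 1) f (- y + xi)))) by (rewrite <- E1, <- E2; ring).
    replace (exp (- (2 * xi)) * (/ 2 * II (Tint (Kf (k + 2) f) xi))) with (/ 2 * (exp (- (2 * xi)) * II (Tint (Kf (k + 2) f) xi))) by ring.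
    rewrite <- (II_scal (exp (- (2 * xi)))) by (apply ED; lra).
    rewrite <- II_plus by auto. 
    replace (II (fun y => exp (- (2 * xi)) * Tint (Kf (k + 2) f) xi y)) with
      (II (fun y => Tint (Kf k f) xi y - 2 * exp (- xi) * (Kf (k + 1) f (y + xi) + Kf (k + 1) f (- y + xi)))).
    - rewrite II_minus, II_scal by (dom_tac; auto; apply ED; lra). field.
    (* At y = 0 the filled-in values are derivatives of [Kf], and they satisfy the same relation. *)
    - apply II_ext. intros y. unfold Tint, sq. destruct (Req_EM_T y 0) as [->|Hy].
      + rewrite !(is_derive_unique _ _ _ (DK _ xi)). rewrite Ropp_0, Rplus_0_l. unfold Kf.
        replace (k + 2 + 1) with (k + 1 + 2) by ring. rewrite !Rmult_plus_distr_r, !exp_plus, !Rmult_1_l.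
        replace (2 * xi) with (xi + xi) by ring. rewrite Ropp_plus_distr, !exp_plus, exp_Ropp.
        field. apply Rgt_not_eq, exp_pos.
      + unfold Kf. replace (- y + xi) with (xi - y) by ring. rewrite (Rplus_comm y xi).
        pose proof (sinh_neq y Hy) as Hs.
        assert (X1 : exp (- (2 * xi)) * exp ((k + 2) * (xi - y)) = exp (k * (xi - y)) * exp (- (2 * y))) by (rewrite <- !exp_plus; f_equal; ring).
        assert (X2 : exp (- (2 * xi)) * exp ((k + 2) * (xi + y)) = exp (k * (xi + y)) * exp (2 * y)) by (rewrite <- !exp_plus; f_equal; ring).
        assert (X3 : exp (- xi) * exp ((k + 1) * (xi - y)) = exp (k * (xi - y)) * exp (- y)) by (rewrite <- !exp_plus; f_equal; ring).
        assert (X4 : exp (- xi) * exp ((k + 1) * (xi + y)) = exp (k * (xi + y)) * exp y) by (rewrite <- !exp_plus; f_equal; ring).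
        assert (Y1 : 1 - exp (- (2 * y)) = 2 * exp (- y) * sinh y).
        { unfold sinh. replace (- (2 * y)) with (- y + - y) by ring. rewrite exp_plus, exp_Ropp. field. apply Rgt_not_eq, exp_pos. }
        assert (Y2 : exp (2 * y) - 1 = 2 * exp y * sinh y).
        { unfold sinh. replace (2 * y) with (y + y) by ring. rewrite exp_plus, exp_Ropp. field. apply Rgt_not_eq, exp_pos. }
        apply Rmult_eq_reg_r with (sinh y); auto.
        set (F1 := f (exp (xi - y))). set (F2 := f (exp (xi + y))).
        transitivity (exp (k * (xi - y)) * F1 - exp (k * (xi + y)) * F2 -
          ((exp (- xi) * exp ((k + 1) * (xi + y))) * F2 * (2 * sinh y) + (exp (- xi) * exp ((k + 1) * (xi - y))) * F1 * (2 * sinh y))); [field; auto|].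
        transitivity ((exp (- (2 * xi)) * exp ((k + 2) * (xi - y))) * F1 - (exp (- (2 * xi)) * exp ((k + 2) * (xi + y))) * F2); [|field; auto].
        rewrite X1, X2, X3, X4. 
        replace (exp (k * (xi - y)) * exp (- (2 * y)) * F1) with (exp (k * (xi - y)) * F1 * (1 - (1 - exp (- (2 * y))))) by ring.
        replace (exp (k * (xi + y)) * exp (2 * y) * F2) with (exp (k * (xi + y)) * F2 * (1 + (exp (2 * y) - 1))) by ring.
        rewrite Y1, Y2. ring. }
  unfold Pv. fold xi. pose proof PI_RGT_0.
  replace (- ((k + 2) * xi)) with (- (k * xi) + - (2 * xi)) by ring. rewrite (exp_plus (- (k * xi))).
  replace (exp (- (k * xi)) * exp (- (2 * xi)) / PI * T (Kf (k + 2) f) xi) with (exp (- (k * xi)) / PI * (exp (- (2 * xi)) * T (Kf (k + 2) f) xi)) by (field; lra).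
  rewrite E. replace (- ((k + 1) * xi)) with (- (k * xi) + - xi) by ring. rewrite (exp_plus (- (k * xi)) (- xi)). field. lra.
Qed.

Lemma exp_pow_le d s : 0 < d <= 1 -> 0 < s -> Rmin 1 s <= exp (d * ln s).
Proof.
  intros Hd Hs. destruct (Rle_lt_dec s 1) as [H|H].
  - rewrite Rmin_right by auto. rewrite <- (exp_ln s) at 1 by auto. apply exp_le_exp.
    assert (ln s <= 0) by (rewrite <- ln_1; apply ln_le; lra). nra.
  - rewrite Rmin_left by lra. apply Rle_trans with (exp 0); [rewrite exp_0; lra|]. apply exp_le_exp.
    assert (0 <= ln s) by (rewrite <- ln_1; apply ln_le; lra). nra.
Qed.

Lemma T_exp k : Rabs k < 1 -> T (fun t => exp (k * t)) 0 = - (PI * tan (PI * k / 2)).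
Proof.
  intros Hk. rewrite <- cint_tan by auto. unfold T, cint.
  replace (- II (shq k)) with (/ 2 * ((-2) * II (shq k))) by field. f_equal.
  rewrite <- II_scal by now apply shq_dom. apply II_ext. intros y. unfold Tint, shq, sq.
  destruct (Req_EM_T y 0).
  - f_equal. apply is_derive_unique. auto_derive; auto. rewrite Rmult_0_r, exp_0. ring.
  - unfold sinh at 2. rewrite Rplus_0_l, Rminus_0_l. replace (k * - y) with (- (k * y)) by ring. field. now apply sinh_neq.
Qed.

(** As x tends to 0, f(x exp y) tends to f0, which leaves the transform of exp(k y) known from
    [T_exp]. The difference f(s) - f0 is O(s^d) with |k| + d < 1, so [T_bound] still applies and
    gives an error O(x^d). *)
Lemma Pv_lim0 k (f f' : R -> R) f0 : Rabs k < 1 -> (forall x, 0 < x -> is_derive f x (f' x)) -> rap f -> rap f' -> near0 f f0 ->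
  tends0 (Pv k f) (- f0 * tan (PI * k / 2)).
Proof.
  intros Hk D Hf Hf' (C0 & HC0 & N0).
  set (d := (1 - Rabs k) / 2). pose proof (Rabs_pos k) as Hk0.
  assert (Hd : 0 < d <= 1) by (unfold d; lra).
  destruct (rap_bounded f Hf) as (C1 & HC1 & B1). destruct (rap_bounded f' Hf') as (C2 & HC2 & B2).
  destruct (rap_bounded _ (rap_x _ Hf')) as (C3 & HC3 & B3).
  set (C := (C0 + C1 + Rabs f0) + (C2 + C3)). pose proof (Rabs_pos f0).
  assert (Bf : forall s, 0 < s -> Rabs (f s - f0) <= (C0 + C1 + Rabs f0) * exp (d * ln s)).
  { intros s Hs. apply Rle_trans with ((C0 + C1 + Rabs f0) * Rmin 1 s); [|apply Rmult_le_compat_l; [lra | now apply exp_pow_le]].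
    destruct (Rle_lt_dec s 1) as [H1|H1].
    - rewrite Rmin_right by auto. eapply Rle_trans; [now apply N0|]. nra.
    - rewrite Rmin_left by lra. eapply Rle_trans; [apply Rabs_triang|]. rewrite Rabs_Ropp. specialize (B1 s Hs). lra. }
  assert (Bf' : forall s, 0 < s -> Rabs (s * f' s) <= (C2 + C3) * exp (d * ln s)).
  { intros s Hs. apply Rle_trans with ((C2 + C3) * Rmin 1 s); [|apply Rmult_le_compat_l; [lra | now apply exp_pow_le]].
    destruct (Rle_lt_dec s 1) as [H1|H1].
    - rewrite Rmin_right by auto. rewrite Rabs_mult, (Rabs_pos_eq s) by lra. specialize (B2 s Hs). nra.
    - rewrite Rmin_left by lra. specialize (B3 s Hs). lra. }
  assert (He : 0 < 1 - (Rabs k + d) < 1) by (unfold d; lra). set (e := 1 - (Rabs k + d)) in *.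
  pose proof PI_RGT_0 as HPI.
  set (CC := 4 * (1 + 4 / e) / e * ((Rabs k + 1) * C) / PI).
  assert (HCC : 0 <= CC).
  { unfold CC. assert (0 < 4 / e) by (apply Rdiv_lt_0_compat; lra). assert (0 < / e) by (apply Rinv_0_lt_compat; lra).
    apply Rdiv_le_0_compat; auto. apply Rmult_le_pos; [|unfold C; nra]. apply Rmult_le_pos; lra. }
  assert (Main : forall x, 0 < x -> Rabs (Pv k f x - - f0 * tan (PI * k / 2)) <= CC * exp (d * ln x)).
  { intros x Hx. set (xi := ln x).
    set (H0 := fun t => exp (k * t) * (f (exp (t + xi)) - f0)).
    set (H1 := fun t => k * H0 t + exp (k * t) * (exp (t + xi) * f' (exp (t + xi)))).
    assert (DH : forall t, is_derive H0 t (H1 t)).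
    { intros t. unfold H1, H0. auto_derive. repeat split. eexists; apply D, exp_pos.
      replace (Derive (fun x => f x) (exp (t + xi))) with (f' (exp (t + xi))) by (symmetry; apply is_derive_unique, D, exp_pos). ring. }
    assert (BH : expo e ((Rabs k + 1) * C * exp (d * xi)) H1).
    { intros t. unfold H1, H0. replace (1 - e) with (Rabs k + d) by (unfold e; ring).
      pose proof (Bf _ (exp_pos (t + xi))) as X1. pose proof (Bf' _ (exp_pos (t + xi))) as X2. rewrite ln_exp in X1, X2.
      assert (Q1 : exp (k * t) <= exp (Rabs k * Rabs t)) by (apply exp_le_exp; rewrite <- Rabs_mult; apply Rle_abs).
      assert (Q2 : exp (d * (t + xi)) <= exp (d * Rabs t) * exp (d * xi)).
      { rewrite <- exp_plus. apply exp_le_exp. pose proof (Rle_abs t). nra. }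
      rewrite (Rmult_plus_distr_r (Rabs k) d), (exp_plus (Rabs k * Rabs t)).
      set (E1 := exp (Rabs k * Rabs t)) in *. set (E2 := exp (d * Rabs t)) in *. set (E3 := exp (d * xi)) in *.
      pose proof (exp_pos (k * t)). assert (0 < E2) by apply exp_pos. assert (0 < E3) by apply exp_pos. assert (0 < E1) by apply exp_pos.
      assert (Y1 : Rabs (f (exp (t + xi)) - f0) <= C * (E2 * E3)).
      { eapply Rle_trans; [apply X1|]. apply Rle_trans with (C * exp (d * (t + xi))).
        apply Rmult_le_compat_r; [left; apply exp_pos | unfold C; lra]. apply Rmult_le_compat_l; [unfold C; lra | auto]. }
      assert (Y2 : Rabs (exp (t + xi) * f' (exp (t + xi))) <= C * (E2 * E3)).
      { eapply Rle_trans; [apply X2|]. apply Rle_trans with (C * exp (d * (t + xi))).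
        apply Rmult_le_compat_r; [left; apply exp_pos | unfold C; lra]. apply Rmult_le_compat_l; [unfold C; lra | auto]. }
      eapply Rle_trans; [apply Rabs_triang|]. rewrite !Rabs_mult, (Rabs_pos_eq (exp (k * t))) by lra.
      rewrite <- (Rabs_mult (exp (t + xi))).
      assert (Z1 : exp (k * t) * Rabs (f (exp (t + xi)) - f0) <= E1 * (C * (E2 * E3))) by (apply Rmult_le_compat; auto; try lra; apply Rabs_pos).
      assert (Z2 : exp (k * t) * Rabs (exp (t + xi) * f' (exp (t + xi))) <= E1 * (C * (E2 * E3))) by (apply Rmult_le_compat; auto; try lra; apply Rabs_pos).
      replace ((Rabs k + 1) * C * E3 * (E1 * E2)) with (Rabs k * (E1 * (C * (E2 * E3))) + E1 * (C * (E2 * E3))) by ring.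
      apply Rplus_le_compat; auto. apply Rmult_le_compat_l; auto. }
    assert (EX : expo e (Rabs k) (fun t => k * exp (k * t))).
    { intros t. rewrite Rabs_mult, (Rabs_pos_eq (exp _)) by (left; apply exp_pos). apply Rmult_le_compat_l; auto.
      apply exp_le_exp. apply Rle_trans with (Rabs k * Rabs t); [rewrite <- Rabs_mult; apply Rle_abs|].
      apply Rmult_le_compat_r; [apply Rabs_pos | unfold e; lra]. }
    assert (DX : forall t, is_derive (fun t => exp (k * t)) t (k * exp (k * t))) by (intros t; auto_derive; auto; ring).
    assert (E : Pv k f x - - f0 * tan (PI * k / 2) = T H0 0 / PI).
    { replace (- f0 * tan (PI * k / 2)) with (f0 * T (fun t => exp (k * t)) 0 / PI) by (rewrite T_exp by auto; field; lra).
      assert (DKf : forall t, is_derive (Kf k f) t (k * Kf k f t + Kf (k + 1) f' t)) by (intros t; apply Kf_derive, D, exp_pos).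
      assert (E1 : T (Kf k f) xi = T (fun t => exp (k * xi) * (fun t => 1 * H0 t + f0 * exp (k * t)) t + 0 * H0 t) 0).
      { replace xi with (0 + xi) at 1 by ring. rewrite (T_shift _ _ xi 0 DKf). apply T_ext. intros t. unfold Kf, H0.
        replace (k * (t + xi)) with (k * xi + k * t) by ring. rewrite exp_plus. ring. }
      unfold Pv. fold xi.
      assert (BS : expo e ((Rabs k + 1) * C * exp (d * xi) + Rabs f0 * Rabs k) (fun t => 1 * H1 t + f0 * (k * exp (k * t)))).
      { intros t. eapply Rle_trans; [apply Rabs_triang|]. rewrite Rabs_mult, Rabs_R1, Rmult_1_l, (Rabs_mult f0), Rmult_plus_distr_r.
        apply Rplus_le_compat; [apply BH|]. rewrite Rmult_assoc. apply Rmult_le_compat_l; [lra|]. apply EX. }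
      set (X := fun t : R => exp (k * t)) in *. set (A1 := fun t : R => 1 * H0 t + f0 * X t).
      assert (DS : forall t, is_derive A1 t (1 * H1 t + f0 * (k * exp (k * t)))).
      { intros t. apply (is_derive_plus (V := R_NormedModule)); [apply (is_derive_scal H0) | apply (is_derive_scal X)]; auto. }
      pose proof (T_lin A1 _ H0 H1 e _ e _ (exp (k * xi)) 0 0 He He DS BS DH BH) as L1.
      pose proof (T_lin H0 H1 X _ e _ e _ 1 f0 0 He He DH BH DX EX) as L2.
      pose proof (eq_trans E1 L1) as E2. pose proof (eq_refl : T A1 0 = T (fun t => 1 * H0 t + f0 * X t) 0) as E3.
      rewrite E2, E3, L2, exp_Ropp. field. split; [lra | apply Rgt_not_eq, exp_pos]. }
    rewrite E. unfold Rdiv. rewrite Rabs_mult, (Rabs_pos_eq (/ PI)) by (left; now apply Rinv_0_lt_compat).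
    apply Rle_trans with (4 * (1 + 4 / e) / e * ((Rabs k + 1) * C * exp (d * xi)) * exp ((1 - e) * Rabs 0) * / PI).
    - apply Rmult_le_compat_r; [left; now apply Rinv_0_lt_compat|]. now apply (T_bound H0 H1).
    - rewrite Rabs_R0, Rmult_0_r, exp_0. unfold CC. right. fold xi. field. lra. }
  intros eps Heps. exists (exp (ln (eps / (CC + 1)) / d)). split; [apply exp_pos|]. intros x [Hx1 Hx2].
  eapply Rle_lt_trans; [now apply Main|].
  apply ln_increasing in Hx2; auto. rewrite ln_exp in Hx2.
  apply Rmult_lt_compat_l with (r := d) in Hx2; [|lra].
  replace (d * (ln (eps / (CC + 1)) / d)) with (ln (eps / (CC + 1))) in Hx2 by (field; lra).
  apply exp_increasing in Hx2. rewrite exp_ln in Hx2 by (apply Rdiv_lt_0_compat; lra).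
  apply Rle_lt_trans with ((CC + 1) * exp (d * ln x)); [apply Rmult_le_compat_r; [left; apply exp_pos | lra]|].
  apply Rmult_lt_compat_l with (r := CC + 1) in Hx2; [|lra].
  replace ((CC + 1) * (eps / (CC + 1))) with eps in Hx2 by (field; lra). auto.
Qed.

Lemma Pv_lin k (f f' g g' : R -> R) c d x : -1 < k -> 
  (forall x, 0 < x -> is_derive f x (f' x)) -> rap f -> rap f' ->
  (forall x, 0 < x -> is_derive g x (g' x)) -> rap g -> rap g' ->
  Pv k (fun x => c * f x + d * g x) x = c * Pv k f x + d * Pv k g x.
Proof.
  intros Hk Df Rf Rf' Dg Rg Rg'. set (e := Rmin (1 / 2) (1 + k)).
  assert (He : 0 < e < 1). { unfold e. split; [apply Rmin_pos; lra | pose proof (Rmin_l (1 / 2) (1 + k)); lra]. }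
  assert (Hke : - (1 - e) <= k) by (unfold e; pose proof (Rmin_r (1 / 2) (1 + k)); lra).
  assert (SM : forall h h', (forall x, 0 < x -> is_derive h x (h' x)) -> rap h -> rap h' -> smooth e 1 (Kf k h)).
  { intros h h' Dh Rh Rh'. split; [now apply Kf_expo|]. exists (fun t => k * Kf k h t + 1 * Kf (k + 1) h' t). split.
    - intros t. rewrite Rmult_1_l. apply Kf_derive, Dh, exp_pos.
    - apply smooth_lin; (split; [apply Kf_expo; auto; lra | auto]). }
  unfold Pv. rewrite (T_ext _ (fun t => c * Kf k f t + d * Kf k g t)) by (intros; apply Kf_lin).
  rewrite (T_lin_smooth _ _ _ _ e); eauto. field. apply PI_neq0.
Qed.

Lemma Pv_x k f x : 0 < x -> Pv k (fun x => x * f x) x = x * Pv (k + 1) f x.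
Proof.
  intros Hx. unfold Pv. rewrite (T_ext _ (Kf (k + 1) f)) by (intros; apply Kf_x).
  replace (- (k * ln x)) with (- ((k + 1) * ln x) + ln x) by ring. rewrite exp_plus, exp_ln by auto. field. apply PI_neq0.
Qed.

(** * The exact remainder formula *)

(** [cH1], [cH2] are the H_i and [cG1], [cG2] the C_i of the overview. Written with 1/Gamma, their
    recurrences hold at the poles too. *)
Definition cH1 a := Rpower 2 (1 / 4 + a / 2) * sqrt PI * rGamma (1 / 4 - a / 2).
Definition cG1 a := Rpower 2 (1 / 4 - a / 2) * sqrt PI * rGamma (1 / 4 + a / 2).
Definition cH2 a := Rpower 2 (a / 2 - 1 / 4) * sqrt PI * rGamma (3 / 4 - a / 2).
Definition cG2 a := Rpower 2 (- (a / 2) - 1 / 4) * sqrt PI * rGamma (3 / 4 + a / 2).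

Lemma Rpower_2_succ y : Rpower 2 (y + 1) = 2 * Rpower 2 y.
Proof. rewrite Rpower_plus, Rpower_1 by lra. ring. Qed.

Lemma cH1_pred a : cH1 (a - 1) = cH2 a.
Proof. unfold cH1, cH2. f_equal; [f_equal|]; f_equal; field. Qed.

Lemma cH1_cH2 a : cH1 a = (1 / 2 - a) * cH2 (a - 1).
Proof.
  unfold cH1, cH2. rewrite (rGamma_succ (1 / 4 - a / 2)).
  replace (3 / 4 - (a - 1) / 2) with (1 / 4 - a / 2 + 1) by field.
  replace (1 / 4 + a / 2) with ((a - 1) / 2 - 1 / 4 + 1) by field. rewrite Rpower_2_succ. field.
Qed.

Lemma cG1_cG2 a : cG1 a = cG2 (a - 1).
Proof. unfold cG1, cG2. f_equal; [f_equal|]; f_equal; field. Qed.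

Lemma cG1_pred a : cG1 (a - 1) = (a - 1 / 2) * cG2 a.
Proof.
  unfold cG1, cG2. rewrite (rGamma_succ (1 / 4 + (a - 1) / 2)).
  replace (3 / 4 + a / 2) with (1 / 4 + (a - 1) / 2 + 1) by field.
  replace (1 / 4 - (a - 1) / 2) with (- (a / 2) - 1 / 4 + 1) by field. rewrite Rpower_2_succ. field.
Qed.

Lemma theta_succ a : PI * theta (a + 1) = PI * theta a + PI / 2.
Proof. unfold theta. field. Qed.
Lemma cos_succ a : cos (PI * theta (a + 1)) = - sin (PI * theta a).
Proof. rewrite theta_succ, Rplus_comm. rewrite <- sin_shift, <- sin_neg. f_equal. field. Qed.
Lemma sin_succ a : sin (PI * theta (a + 1)) = cos (PI * theta a).
Proof. rewrite theta_succ, Rplus_comm. symmetry. apply cos_sin. Qed.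
Lemma cos_pred a : cos (PI * theta (a - 1)) = sin (PI * theta a).
Proof. pose proof (sin_succ (a - 1)) as E. replace (a - 1 + 1) with a in E by ring. auto. Qed.
Lemma sin_pred a : sin (PI * theta (a - 1)) = - cos (PI * theta a).
Proof. pose proof (cos_succ (a - 1)) as E. replace (a - 1 + 1) with a in E by ring. lra. Qed.

Definition ec (a : R) (k : nat) : R := poch (1 / 2 + a) (2 * k) / (INR (fact k) * 2 ^ k).
Definition Xs (a : R) (m : nat) (x : R) : R := Rpower x (- a - 1 / 2) * sumn (fun k => ec a k / x ^ (2 * k)) m.

(** The algebraic series is the recessive one for - a with alternating signs, so its recurrence is
    inherited from [dcoef_succ]. *)
Lemma ec_dcoef a k : ec a k = (-1) ^ k * dcoef (- a) k.
Proof.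
  unfold ec, dcoef. replace (1 / 2 - - a) with (1 / 2 + a) by ring.
  assert (E : (-1) ^ k * (-1) ^ k = 1) by (rewrite <- Rpow_mult_distr; replace (-1 * -1) with 1 by ring; apply pow1).
  pose proof (INR_fact_neq_0 k). pose proof (pow_nonzero 2 k ltac:(lra)).
  transitivity (((-1) ^ k * (-1) ^ k) * poch (1 / 2 + a) (2 * k) / (INR (fact k) * 2 ^ k)).
  rewrite E. field; auto. field; auto.
Qed.

Lemma ec_pred a k : ec (a - 1) (S k) = ec a (S k) - (a + 1 / 2) * ec (a + 1) k.
Proof.
  rewrite !ec_dcoef. pose proof (dcoef_succ (- a) k) as E.
  replace (- (a - 1)) with (- a + 1) by ring. replace (- (a + 1)) with (- a - 1) by ring. rewrite E. simpl. ring.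
Qed.

Lemma ec_0 a : ec a 0 = 1.
Proof. unfold ec. simpl. field. Qed.

(** S m terms for a - 1 and a go with m terms for a + 1. This shift is why neighbouring parameters
    are used with different truncation indices in [good_up] and [good_down]. *)
Lemma Xs_rec a m x : 0 < x -> Xs (a - 1) (S m) x = x * Xs a (S m) x - (a + 1 / 2) * Xs (a + 1) m x.
Proof.
  intros Hx. unfold Xs.
  replace (- (a - 1) - 1 / 2) with (- (a + 1) - 1 / 2 + 1 + 1) by ring.
  replace (- a - 1 / 2) with (- (a + 1) - 1 / 2 + 1) by ring.
  rewrite !(Rpower_plus _ 1), Rpower_1 by auto.
  rewrite !sumn_Sl, !ec_0.
  assert (E : sumn (fun k => ec (a - 1) (S k) / x ^ (2 * S k)) m =
    sumn (fun k => ec a (S k) / x ^ (2 * S k) + - ((a + 1 / 2) / x ^ 2) * (ec (a + 1) k / x ^ (2 * k))) m).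
  { apply sumn_ext. intros k _. rewrite ec_pred. replace (2 * S k)%nat with (2 + 2 * k)%nat by lia. rewrite pow_add.
    pose proof (pow_nonzero x (2 * k) ltac:(lra)). field. split; auto; lra. }
  rewrite E, sumn_plus, sumn_scal. field. repeat split; try lra. simpl. lra.
Qed.

Definition w1_formula (a : R) (v : R -> R) (m : nat) : Prop := forall x, 0 < x ->
  w1 a x = cH1 a * Xs a m x + cG1 a * (cos (PI * theta a) * v x - sin (PI * theta a) * Pv (a - 1 / 2 + 2 * INR m) v x).
Definition w2_formula (a : R) (v : R -> R) (m : nat) : Prop := forall x, 0 < x ->
  w2 a x = cH2 a * Xs a m x + cG2 a * (sin (PI * theta a) * v x + cos (PI * theta a) * Pv (a - 1 / 2 + 2 * INR m) v x).

(** The formulas for a and a + 1 travel together because three-term recurrences take two neighbours.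
    From m0 on the exponents of [Pv] exceed -1, so that the principal value converges at y = -
    oo. *)
Definition good (a : R) : Prop := exists va vb, sys a va vb /\ bdd va /\ bdd vb /\ asy a va /\ asy (a + 1) vb /\
  exists m0, forall m, (m0 <= m)%nat -> w1_formula a va m /\ w2_formula a va m /\ w1_formula (a + 1) vb m /\ w2_formula (a + 1) vb m.

Lemma bdd_rap a v : asy a v -> bdd v -> rap v.
Proof. intros H1 H2. apply gb_rap. now apply (asy_gb a). Qed.

Lemma bdd_x v : bdd v -> bdd (fun x => x * v x).
Proof.
  intros [C H]. exists C. intros x Hx. specialize (H x Hx). rewrite Rabs_mult, (Rabs_pos_eq x) by lra.
  pose proof (Rabs_pos (v x)). nra.
Qed.

Lemma bdd_lin u v c d : bdd u -> bdd v -> bdd (fun x => c * u x + d * v x).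
Proof.
  intros [C H] [C' H']. exists (Rabs c * C + Rabs d * C'). intros x Hx. specialize (H x Hx). specialize (H' x Hx).
  eapply Rle_trans; [apply Rabs_triang|]. rewrite !Rabs_mult.
  apply Rplus_le_compat; (apply Rmult_le_compat_l; [apply Rabs_pos | auto]).
Qed.

Lemma bdd_ext u v : (forall x, 0 < x -> u x = v x) -> bdd u -> bdd v.
Proof. intros E [C H]. exists C. intros x Hx. rewrite <- E by lra. auto. Qed.


Lemma sys_dA a va vb : sys a va vb -> forall x, 0 < x -> is_derive va x ((fun x => - vb x) x).
Proof. intros H x Hx. apply H; auto. Qed.
Lemma sys_dB a va vb : sys a va vb -> forall x, 0 < x -> is_derive vb x ((fun x => - (x * vb x) + (a + 1 / 2) * va x) x).
Proof. intros H x Hx. destruct (H x Hx) as [_ D]. replace (- (x * vb x)) with (- x * vb x) by ring. exact D. Qed.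
Lemma rap_opp f : rap f -> rap (fun x => - f x).
Proof. intros H n. destruct (H n) as (C & P & B). exists C. split; auto. intros x Hx. rewrite Rabs_Ropp. auto. Qed.
Lemma rap_dB a va vb : rap va -> rap vb -> rap (fun x => - (x * vb x) + (a + 1 / 2) * va x).
Proof.
  intros Ha Hb. pose proof (rap_lin _ _ (-1) (a + 1 / 2) (rap_x _ Hb) Ha) as H.
  intros n. destruct (H n) as (C & P & B). exists C. split; auto. intros x Hx.
  replace (- (x * vb x)) with (-1 * (x * vb x)) by ring. auto.
Qed.

Lemma is_derive_xf (f : R -> R) x l : is_derive f x l -> is_derive (fun x => x * f x) x (f x + x * l).
Proof.
  intros D. auto_derive. eexists; apply D.
  replace (Derive (fun x => f x) x) with l by (symmetry; apply is_derive_unique, D). ring.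
Qed.

Lemma Pv_ext k f g x : (forall x, 0 < x -> f x = g x) -> Pv k f x = Pv k g x.
Proof. intros E. unfold Pv. f_equal. apply T_ext. intros t. unfold Kf. rewrite E; auto. apply exp_pos. Qed.

Lemma Pv_rec k (c : R) u u' v v' x : -1 < k -> 0 < x ->
  (forall x, 0 < x -> is_derive v x (v' x)) -> rap v -> rap v' ->
  (forall x, 0 < x -> is_derive u x (u' x)) -> rap u -> rap u' ->
  Pv k (fun x => x * v x - c * u x) x = x * Pv (k + 1) v x - c * Pv k u x.
Proof.
  intros Hk Hx Dv Rv Rv' Du Ru Ru'.
  rewrite (Pv_ext _ _ (fun x => 1 * (x * v x) + (- c) * u x)) by (intros; ring).
  rewrite (Pv_lin k (fun x => x * v x) (fun x => 1 * v x + 1 * (x * v' x)) u u'); auto.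
  - rewrite Pv_x by auto. ring.
  - intros y Hy. rewrite !Rmult_1_l. now apply is_derive_xf, Dv.
  - now apply rap_x.
  - apply rap_lin; auto. now apply rap_x.
Qed.

(** The pair (va, vb) moves on to (vb, vc) with vc given by the three-term recurrence, and the
    formulas for a + 2 combine those for a and a + 1 at index S m. The excluded value is where the
    recurrence for [w2] has the factor a + 3/2 = 0. *)
Lemma good_up a : a <> - (3 / 2) -> good a -> good (a + 1).
Proof.
  intros Ha (va & vb & HS & Ba & Bb & Aa & Ab & m0 & HE).
  assert (Ra : rap va) by now apply (bdd_rap a). assert (Rb : rap vb) by now apply (bdd_rap (a + 1)).
  set (vc := fun x => x * vb x - (a + 1 - 1 / 2) * va x).
  assert (Ea1 : a + 1 - 1 = a) by ring.
  exists vb, vc. split; [|split; [|split; [|split; [|split]]]]; auto.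
  - intros x Hx. destruct (HS x Hx) as [D1 D2]. split.
    + replace (- vc x) with (- x * vb x + (a + 1 / 2) * va x) by (unfold vc; field). exact D2.
    + unfold vc. replace (- x * (x * vb x - (a + 1 - 1 / 2) * va x) + (a + 1 + 1 / 2) * vb x) with
        (minus (vb x + x * (- x * vb x + (a + 1 / 2) * va x)) ((a + 1 - 1 / 2) * (- vb x))) by (unfold minus, plus, opp; simpl; field).
      apply (is_derive_minus (V := R_NormedModule)). now apply is_derive_xf. now apply (is_derive_scal va).
  - apply (bdd_ext (fun x => 1 * (x * vb x) + (- (a + 1 - 1 / 2)) * va x)). intros; unfold vc; ring.
    apply bdd_lin; auto. now apply bdd_x.
  - apply asy_up; auto. now rewrite Ea1.
  - destruct (nfloor_ex (Rabs a) (Rabs_pos _)) as [N [_ HN]].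
    (* N + 1 exceeds |a|, so every exponent of [Pv] occurring below is larger than -1. *)
    exists (m0 + N + 2)%nat. intros m Hm.
    assert (Hm' : INR (N + 2) <= INR m) by (apply le_INR; lia). rewrite plus_INR in Hm'. simpl in Hm'.
    pose proof (Rle_abs (- a)) as HA. rewrite Rabs_Ropp in HA. pose proof (pos_INR m).
    destruct (HE m ltac:(lia)) as (_ & _ & F1 & F2). destruct (HE (S m) ltac:(lia)) as (G1 & G2 & G3 & G4).
    split; [auto|]. split; [auto|].
    assert (HP : forall x, 0 < x -> Pv (a + 1 + 1 - 1 / 2 + 2 * INR m) vc x =
       x * Pv (a + 1 - 1 / 2 + 2 * INR (S m)) vb x - (a + 1 / 2) * Pv (a - 1 / 2 + 2 * INR (S m)) va x).
    { intros x Hx. unfold vc. rewrite S_INR.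
      rewrite (Pv_rec _ _ va (fun x => - vb x) vb (fun x => - (x * vb x) + (a + 1 / 2) * va x)); auto; try lra.
      - f_equal; [f_equal; f_equal; ring | f_equal; [field | f_equal; ring]].
      - apply (sys_dB a va vb HS).
      - now apply (rap_dB a va vb).
      - apply (sys_dA a va vb HS).
      - now apply rap_opp. }
    pose proof (cos_succ a) as T1. pose proof (sin_succ a) as T2. pose proof (cos_succ (a + 1)) as T3. pose proof (sin_succ (a + 1)) as T4.
    pose proof (cH1_cH2 (a + 1)) as C1. pose proof (cH1_cH2 (a + 1 + 1)) as C2. pose proof (cH1_pred (a + 1)) as C3. pose proof (cH1_pred (a + 1 + 1)) as C4.
    pose proof (cG1_cG2 (a + 1)) as C5. pose proof (cG1_cG2 (a + 1 + 1)) as C6. pose proof (cG1_pred (a + 1)) as C7. pose proof (cG1_pred (a + 1 + 1)) as C8.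
    replace (a + 1 + 1 - 1) with (a + 1) in * by ring. rewrite Ea1 in *.
    split; intros x Hx; specialize (HP x Hx).
    + pose proof (w_rec1 (a + 1) x) as W. rewrite Ea1 in W. specialize (G1 x Hx). specialize (G4 x Hx).
      pose proof (Xs_rec (a + 1) m x Hx) as X. rewrite Ea1 in X.
      rewrite HP. rewrite T3, T4, T1, T2 in *. unfold vc.
      replace (w1 (a + 1 + 1) x) with (w1 a x - x * w2 (a + 1) x) by lra. rewrite G1, G4, C2, C6, C3, C7, X. field.
    + pose proof (w_rec2 (a + 1) x) as W. rewrite Ea1 in W. specialize (G2 x Hx). specialize (G3 x Hx).
      pose proof (Xs_rec (a + 1) m x Hx) as X. rewrite Ea1 in X.
      rewrite HP. rewrite T3, T4, T1, T2 in *. unfold vc.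
      apply Rmult_eq_reg_l with (a + 1 + 1 / 2); [|lra].
      replace ((a + 1 + 1 / 2) * w2 (a + 1 + 1) x) with (x * w1 (a + 1) x - (1 / 2 - (a + 1)) * w2 a x) by lra.
      rewrite G2, G3, <- C4. 
      transitivity ((a + 1 + 1 / 2) * (cH1 (a + 1) * Xs (a + 1 + 1) m x) + ((a + 1 + 1 - 1 / 2) * cG2 (a + 1 + 1)) *
        (- sin (PI * theta a) * (x * vb x - (a + 1 - 1 / 2) * va x) + - cos (PI * theta a) * (x * Pv (a + 1 - 1 / 2 + 2 * INR (S m)) vb x - (a + 1 / 2) * Pv (a - 1 / 2 + 2 * INR (S m)) va x))).
      * rewrite <- C8, C5, C1, X. field.
      * field.
Qed.

(** The recurrences solved for the lower neighbour, from a at index S m and a + 1 at index m. The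
    factor a - 1/2 is divided out both in [vz] and in the relation for [w2]. *)
Lemma good_down a : a <> 1 / 2 -> good a -> good (a - 1).
Proof.
  intros Ha (va & vb & HS & Ba & Bb & Aa & Ab & m0 & HE).
  assert (Ra : rap va) by now apply (bdd_rap a). assert (Rb : rap vb) by now apply (bdd_rap (a + 1)).
  set (vz := fun x => (x * va x - vb x) / (a - 1 / 2)).
  assert (Hd : a - 1 / 2 <> 0) by lra. assert (Ea1 : a - 1 + 1 = a) by ring.
  assert (DZ : forall x, 0 < x -> is_derive vz x (- va x)).
  { intros x Hx. destruct (HS x Hx) as [D1 D2].
    replace (- va x) with (/ (a - 1 / 2) * minus (va x + x * - vb x) (- x * vb x + (a + 1 / 2) * va x)) by (unfold minus, plus, opp; simpl; field; lra).
    apply (is_derive_ext (fun x => / (a - 1 / 2) * (minus (x * va x) (vb x)))).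
    { intros t. unfold vz. apply Rmult_comm. }
    apply (is_derive_scal (fun x => minus (x * va x) (vb x))). apply (is_derive_minus (V := R_NormedModule)); auto. now apply is_derive_xf. }
  exists vz, va. rewrite Ea1. split; [|split; [|split; [|split; [|split]]]]; auto.
  - intros x Hx. split; auto. destruct (HS x Hx) as [D1 D2].
    replace (- x * va x + (a - 1 + 1 / 2) * vz x) with (- vb x) by (unfold vz; field; lra). auto.
  - apply (bdd_ext (fun x => / (a - 1 / 2) * (x * va x) + (- / (a - 1 / 2)) * vb x)). intros; unfold vz; field; lra.
    apply bdd_lin; auto. now apply bdd_x.
  - now apply asy_down.
  - destruct (nfloor_ex (Rabs a) (Rabs_pos _)) as [N [_ HN]].
    exists (m0 + N + 2)%nat. intros m Hm. destruct m as [|m]; [lia|].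
    assert (Hm' : INR (N + 1) <= INR m) by (apply le_INR; lia). rewrite plus_INR in Hm'. simpl in Hm'.
    pose proof (Rle_abs (- a)) as HA. rewrite Rabs_Ropp in HA. pose proof (pos_INR m).
    destruct (HE (S m) ltac:(lia)) as (G1 & G2 & _ & _). destruct (HE m ltac:(lia)) as (_ & _ & G3 & G4).
    assert (HP : forall x, 0 < x -> (a - 1 / 2) * Pv (a - 1 - 1 / 2 + 2 * INR (S m)) vz x =
       x * Pv (a - 1 / 2 + 2 * INR (S m)) va x - Pv (a + 1 - 1 / 2 + 2 * INR m) vb x).
    { intros x Hx. rewrite S_INR.
      pose proof (Pv_rec (a - 1 - 1 / 2 + 2 * (INR m + 1)) (a - 1 / 2) vz (fun x => - va x) va (fun x => - vb x) x) as P.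
      replace (a - 1 - 1 / 2 + 2 * (INR m + 1) + 1) with (a - 1 / 2 + 2 * (INR m + 1)) in P by ring.
      rewrite (Pv_ext _ (fun x => x * va x - (a - 1 / 2) * vz x) vb) in P by (intros; unfold vz; field; lra).
      replace (a + 1 - 1 / 2 + 2 * INR m) with (a - 1 - 1 / 2 + 2 * (INR m + 1)) by ring.
      rewrite P; auto; try lra.
      - apply (sys_dA a va vb HS).
      - now apply rap_opp.
      - intros n. destruct (rap_lin _ _ (/ (a - 1 / 2)) (- / (a - 1 / 2)) (rap_x _ Ra) Rb n) as (C & PC & B).
        exists C. split; auto. intros y Hy. specialize (B y Hy). unfold vz.
        replace ((y * va y - vb y) / (a - 1 / 2)) with (/ (a - 1 / 2) * (y * va y) + - / (a - 1 / 2) * vb y) by (field; lra). auto.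
      - now apply rap_opp. }
    pose proof (cos_succ a) as T1. pose proof (sin_succ a) as T2. pose proof (cos_pred a) as T3. pose proof (sin_pred a) as T4.
    pose proof (cH1_cH2 a) as C1. pose proof (cH1_cH2 (a + 1)) as C2. pose proof (cH1_pred a) as C3. pose proof (cH1_pred (a + 1)) as C4.
    pose proof (cG1_cG2 a) as C5. pose proof (cG1_cG2 (a + 1)) as C6. pose proof (cG1_pred a) as C7. pose proof (cG1_pred (a + 1)) as C8.
    replace (a + 1 - 1) with a in * by ring.
    split; [|split; [|split; [exact G1 | exact G2]]]; intros x Hx; specialize (HP x Hx).
    + pose proof (w_rec1 a x) as W. specialize (G2 x Hx). specialize (G3 x Hx).
      pose proof (Xs_rec a m x Hx) as X.
      rewrite T3, T4, T1, T2 in *.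
      replace (w1 (a - 1) x) with (x * w2 a x + w1 (a + 1) x) by lra. rewrite G2, G3, C3, C7, X, C2, C6.
      transitivity (cH2 a * (x * Xs a (S m) x - (a + 1 / 2) * Xs (a + 1) m x) + cG2 a * (sin (PI * theta a) * ((a - 1 / 2) * vz x) + cos (PI * theta a) * ((a - 1 / 2) * Pv (a - 1 - 1 / 2 + 2 * INR (S m)) vz x))).
      * rewrite HP. unfold vz. field. lra.
      * ring.
    + pose proof (w_rec2 a x) as W. specialize (G1 x Hx). specialize (G4 x Hx).
      pose proof (Xs_rec a m x Hx) as X.
      rewrite T3, T4, T1, T2 in *.
      apply Rmult_eq_reg_l with (1 / 2 - a); [|lra].
      replace ((1 / 2 - a) * w2 (a - 1) x) with (x * w1 a x - (a + 1 / 2) * w2 (a + 1) x) by lra.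
      rewrite G1, G4, <- C4, X, <- C5.
      transitivity (((1 / 2 - a) * cH2 (a - 1)) * (x * Xs a (S m) x - (a + 1 / 2) * Xs (a + 1) m x) + cG1 a * (cos (PI * theta a) * ((a - 1 / 2) * vz x) - sin (PI * theta a) * ((a - 1 / 2) * Pv (a - 1 - 1 / 2 + 2 * INR (S m)) vz x))).
      * rewrite HP, <- C1. unfold vz.
        transitivity (x * cH1 a * Xs a (S m) x + x * cG1 a * (cos (PI * theta a) * va x - sin (PI * theta a) * Pv (a - 1 / 2 + 2 * INR (S m)) va x) -
          ((a + 1 / 2) * (cH1 a * Xs (a + 1) m x) + ((a + 1 - 1 / 2) * cG2 (a + 1)) * (cos (PI * theta a) * vb x + - sin (PI * theta a) * Pv (a + 1 - 1 / 2 + 2 * INR m) vb x))).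
        field. rewrite <- C8. field. lra.
      * ring.
Qed.

(** * Mellin transforms *)

Lemma Mel_A a va vb s : sys a va vb -> rap va -> rap vb -> 0 < s -> Mel (s + 1) vb = s * Mel s va.
Proof.
  intros HS Ra Rb Hs. unfold Mel.
  assert (Ca : forall x, 0 < x -> continuous va x) by (intros x Hx; apply continuous_derivable; eexists; exact (proj1 (HS x Hx))).
  assert (Cb : forall x, 0 < x -> continuous vb x) by (intros x Hx; apply continuous_derivable; eexists; exact (proj2 (HS x Hx))).
  assert (Da : dom (Kf s va)) by now apply Kf_dom. assert (Db : dom (Kf (s + 1) vb)) by (apply Kf_dom; auto; lra).
  assert (E : II (fun t => s * Kf s va t + -1 * Kf (s + 1) vb t) = 0).
  { apply (II_derive_zero _ (Kf s va)); auto. apply dom_plus; now apply dom_scal. intros y. now apply (Kfa_derive a). }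
  rewrite II_plus, !II_scal in E by (auto; now apply dom_scal). lra.
Qed.

Lemma Mel_B a va vb s : sys a va vb -> rap va -> rap vb -> 0 < s ->
  Mel (s + 2) vb = s * Mel s vb + (a + 1 / 2) * Mel (s + 1) va.
Proof.
  intros HS Ra Rb Hs. unfold Mel.
  assert (Ca : forall x, 0 < x -> continuous va x) by (intros x Hx; apply continuous_derivable; eexists; exact (proj1 (HS x Hx))).
  assert (Cb : forall x, 0 < x -> continuous vb x) by (intros x Hx; apply continuous_derivable; eexists; exact (proj2 (HS x Hx))).
  assert (Da : dom (Kf (s + 1) va)) by (apply Kf_dom; auto; lra). assert (Db : dom (Kf s vb)) by (apply Kf_dom; auto; lra).
  assert (Dc : dom (Kf (s + 2) vb)) by (apply Kf_dom; auto; lra).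
  assert (E : II (fun t => s * Kf s vb t + 1 * (-1 * Kf (s + 2) vb t + (a + 1 / 2) * Kf (s + 1) va t)) = 0).
  { apply (II_derive_zero _ (Kf s vb)); auto. apply dom_plus; [|apply dom_scal, dom_plus]; now apply dom_scal. intros y. now apply Kfb_derive. }
  rewrite II_plus, (II_scal 1), II_plus, !II_scal in E; auto; try (now apply dom_scal); try (apply dom_plus; now apply dom_scal).
  lra. apply dom_scal, dom_plus; now apply dom_scal.
Qed.

Lemma Mel_step a va vb s : sys a va vb -> rap va -> rap vb -> 0 < s ->
  (s + 3 / 2 - a) * Mel (s + 2) va = s * (s + 1) * Mel s va.
Proof.
  intros HS Ra Rb Hs.
  pose proof (Mel_A a va vb s HS Ra Rb Hs) as M1. pose proof (Mel_A a va vb (s + 2) HS Ra Rb ltac:(lra)) as M2.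
  pose proof (Mel_B a va vb (s + 1) HS Ra Rb ltac:(lra)) as M3.
  replace (s + 1 + 2) with (s + 2 + 1) in M3 by ring. replace (s + 1 + 1) with (s + 2) in M3 by ring.
  rewrite M2, M1 in M3. lra.
Qed.

Lemma ec_succ a m : ec a (S m) * (2 * (INR m + 1)) = ec a m * ((a + 1 / 2 + 2 * INR m) * (a + 3 / 2 + 2 * INR m)).
Proof.
  unfold ec. replace (2 * S m)%nat with (S (S (2 * m))) by lia. cbn [poch].
  rewrite fact_simpl, (mult_INR (S m)), !S_INR, mult_INR. change (INR 2) with 2. cbn [pow].
  pose proof (INR_fact_neq_0 m). pose proof (pow_nonzero 2 m ltac:(lra)). pose proof (pos_INR m). field. repeat split; auto; lra.
Qed.

(** [Mel_step] and [ec_succ] are the same recurrence in m. Hence the jump of [Pv] from m to m + 1 is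
    a fixed multiple of the next term of the algebraic series. *)
Lemma Mel_ec a va vb m : sys a va vb -> rap va -> rap vb -> - (1 / 2) < a ->
  Mel (a + 1 / 2 + 2 * INR m) va = ec a m * Mel (a + 1 / 2) va.
Proof.
  intros HS Ra Rb Ha. induction m as [|m IH].
  - rewrite ec_0. simpl. rewrite Rmult_0_r, Rplus_0_r. ring.
  - pose proof (pos_INR m).
    pose proof (Mel_step a va vb (a + 1 / 2 + 2 * INR m) HS Ra Rb ltac:(lra)) as M. rewrite IH in M.
    pose proof (ec_succ a m) as EC. rewrite S_INR.
    replace (a + 1 / 2 + 2 * (INR m + 1)) with (a + 1 / 2 + 2 * INR m + 2) by ring.
    apply Rmult_eq_reg_l with (2 * (INR m + 1)); [|lra].
    transitivity ((a + 1 / 2 + 2 * INR m + 3 / 2 - a) * Mel (a + 1 / 2 + 2 * INR m + 2) va); [f_equal; field|].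
    rewrite M. transitivity (ec a (S m) * (2 * (INR m + 1)) * Mel (a + 1 / 2) va); [rewrite EC; field | ring].
Qed.

Lemma Xs_S a m x : Xs a (S m) x = Xs a m x + Rpower x (- a - 1 / 2) * (ec a m / x ^ (2 * m)).
Proof. unfold Xs. cbn [sumn]. ring. Qed.

Lemma Pv_succ a m v v' x : -1 < a - 1 / 2 + 2 * INR m -> 0 < x -> rap v -> rap v' ->
  (forall x, 0 < x -> is_derive v x (v' x)) ->
  Pv (a - 1 / 2 + 2 * INR (S m)) v x = Pv (a - 1 / 2 + 2 * INR m) v x -
     2 / PI * (Rpower x (- a - 1 / 2) * / x ^ (2 * m)) * Mel (a + 1 / 2 + 2 * INR m) v.
Proof.
  intros Hk Hx Rv Rv' D. rewrite S_INR. replace (a - 1 / 2 + 2 * (INR m + 1)) with (a - 1 / 2 + 2 * INR m + 2) by ring.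
  rewrite (Pv_step _ v v') by auto. replace (a - 1 / 2 + 2 * INR m + 1) with (a + 1 / 2 + 2 * INR m) by field.
  do 3 f_equal. unfold Rpower. rewrite pow_exp_ln, <- exp_Ropp, <- exp_plus, mult_INR by auto. simpl (INR 2). f_equal. field.
Qed.

(** The equation between constants says that the jump of [Pv] compensates the term added to [Xs]. *)
Lemma E_step a v v' m : -1 < a - 1 / 2 + 2 * INR m -> rap v -> rap v' -> (forall x, 0 < x -> is_derive v x (v' x)) ->
  (cH1 a * ec a m = - cG1 a * sin (PI * theta a) * (2 / PI) * Mel (a + 1 / 2 + 2 * INR m) v -> w1_formula a v m -> w1_formula a v (S m)) /\
  (cH2 a * ec a m = cG2 a * cos (PI * theta a) * (2 / PI) * Mel (a + 1 / 2 + 2 * INR m) v -> w2_formula a v m -> w2_formula a v (S m)).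
Proof.
  intros Hk Rv Rv' D. split; intros HM HE x Hx; rewrite (HE x Hx), (Pv_succ a m v v') by auto; rewrite Xs_S.
  - set (P := Rpower x (- a - 1 / 2)). set (M := Mel _ v) in *.
    replace (cH1 a * (Xs a m x + P * (ec a m / x ^ (2 * m)))) with (cH1 a * Xs a m x + (cH1 a * ec a m) * (P * / x ^ (2 * m))) by (unfold Rdiv; ring).
    rewrite HM. ring.
  - set (P := Rpower x (- a - 1 / 2)). set (M := Mel _ v) in *.
    replace (cH2 a * (Xs a m x + P * (ec a m / x ^ (2 * m)))) with (cH2 a * Xs a m x + (cH2 a * ec a m) * (P * / x ^ (2 * m))) by (unfold Rdiv; ring).
    rewrite HM. ring.
Qed.

Lemma G_1 : G 1 = 1.
Proof.
  unfold G. rewrite (II_FTC _ (fun y => - exp (- exp y)) (-1) 0); [ring| | | |].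
  - apply dom_G. lra.
  - intros y. auto_derive; auto. replace (1 * y - exp y) with (y + - exp y) by ring. rewrite exp_plus. ring.
  - apply (is_lim_squeeze0 _ (fun t => 1 * exp (1 * t))).
    + intros t. replace (- exp (- exp t) - -1) with (1 - exp (- exp t)) by ring.
      destruct (one_minus_exp_le 1 (exp t) ltac:(lra) (exp_pos t)) as [H1 H2].
      rewrite Rabs_pos_eq by auto. rewrite !Rmult_1_l in *. rewrite ln_exp in H2. auto.
    + apply is_lim_exp_scal_m. lra.
  - apply (is_lim_squeeze0 _ (fun t => 1 * exp (1 * - t))).
    + intros t. rewrite Rminus_0_r, Rabs_Ropp, Rabs_pos_eq by (left; apply exp_pos). rewrite !Rmult_1_l. apply exp_le_exp.
      pose proof (exp_ineq1_le t). lra.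
    + apply (is_lim_comp (fun u => 1 * exp (1 * u)) Ropp p_infty 0 m_infty).
      * apply is_lim_exp_scal_m. lra.
      * apply (is_lim_opp (fun y => y) p_infty p_infty). apply is_lim_id.
      * exists 0. easy.
Qed.

(* [vB (-1/2) x = exp (- x^2/2)], that is [- vh 1' x]. *)
Lemma vh_gauss x : x * vh 1 x + vh 2 x = exp (- (x ^ 2 / 2)).
Proof.
  assert (D : forall y, is_derive (fun y => x * vh 1 y) y (x * - (y * vh 1 y + vh (1 + 1) y))).
  { intros y. apply (is_derive_scal (vh 1)). apply vh_derive0. lra. }
  clear D. unfold vh. 
  assert (D1 : dom (fun y => exp (1 * y - (x + exp y) ^ 2 / 2))) by (apply vh_dom; lra).
  assert (D2 : dom (fun y => exp (2 * y - (x + exp y) ^ 2 / 2))) by (apply vh_dom; lra).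
  rewrite <- II_scal, <- II_plus by (auto; now apply dom_scal).
  rewrite (II_FTC _ (fun y => - exp (- ((x + exp y) ^ 2 / 2))) (- exp (- (x ^ 2 / 2))) 0); [ring| | | |].
  - apply dom_plus; auto. now apply dom_scal.
  - intros y. auto_derive; auto.
    replace (1 * y - (x + exp y) ^ 2 / 2) with (y + - ((x + exp y) ^ 2 / 2)) by ring.
    replace (2 * y - (x + exp y) ^ 2 / 2) with (y + (y + - ((x + exp y) ^ 2 / 2))) by ring.
    rewrite !(exp_plus y).
    replace (- ((x + exp y) * ((x + exp y) * 1) * / 2)) with (- ((x + exp y) ^ 2 / 2)) by (simpl; field). field.
  - assert (C : continuity_pt (fun u => - exp (- ((x + u) ^ 2 / 2))) 0).
    { apply continuity_pt_filterlim. apply (continuous_derivable (fun u => - exp (- ((x + u) ^ 2 / 2)))). auto_derive; auto. }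
    apply is_lim_continuity in C. rewrite Rplus_0_r in C.
    apply (is_lim_comp (fun u => - exp (- ((x + u) ^ 2 / 2))) exp m_infty (- exp (- (x ^ 2 / 2))) 0); auto.
    + apply is_lim_exp_m.
    + exists 0. intros y _ E. injection E. intros E'. pose proof (exp_pos y). lra.
  - apply (is_lim_squeeze0 _ (fun t => exp (1 / 2 - x) * exp (1 * - t))).
    + intros t. rewrite Rminus_0_r, Rabs_Ropp, Rabs_pos_eq by (left; apply exp_pos). rewrite <- exp_plus. apply exp_le_exp.
      pose proof (exp_ineq1_le t). pose proof (pow2_ge_0 (x + exp t - 1)). nra.
    + apply (is_lim_comp (fun u => exp (1 / 2 - x) * exp (1 * u)) Ropp p_infty 0 m_infty).
      * apply is_lim_exp_scal_m. lra.
      * apply (is_lim_opp (fun y => y) p_infty p_infty). apply is_lim_id.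
      * exists 0. easy.
Qed.

Lemma vh1_derive x : is_derive (vh 1) x (- exp (- (x ^ 2 / 2))).
Proof.
  rewrite <- vh_gauss. replace (vh 2 x) with (vh (1 + 1) x) by (f_equal; ring). apply vh_derive0. lra.
Qed.

Lemma vh1_decay : exists C, 0 <= C /\ forall x, 0 <= x -> 0 <= vh 1 x <= C * exp (- x).
Proof.
  assert (D : dom (fun y => exp (1 / 2) * exp (1 * y - exp y))) by (apply dom_scal, dom_G; lra).
  exists (exp (1 / 2)). split; [left; apply exp_pos|]. intros x Hx.
  split; [apply (vh_pos_le 1 x); lra|].
  assert (E : exp (1 / 2) * exp (- x) = II (fun y => exp (1 / 2 - x) * exp (1 * y - exp y))).
  { rewrite II_scal by (apply dom_G; lra). fold (G 1). rewrite G_1. unfold Rminus. rewrite exp_plus. ring. }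
  rewrite E. apply II_le.
  - apply vh_dom; lra.
  - apply dom_scal, dom_G; lra.
  - intros y. rewrite <- exp_plus. apply exp_le_exp. pose proof (pow2_ge_0 (x + exp y - 1)). nra.
Qed.

(* The double integral of [s^(b-1) u^(-b) exp (-(s+u)^2/2)], evaluated by differentiating in a scale parameter. *)
Lemma Mel_vh b : 0 < b < 1 -> II (fun t => exp ((1 - b) * t) * vh b (exp t)) = vh 1 0 * (PI / sin (PI * b)).
Proof.
  intros Hb. destruct (K0_val b Hb) as [DK EK]. rewrite <- EK. clear EK.
  destruct vh1_decay as (C1 & HC1 & B1).
  assert (Hp : forall y, 0 < 1 + exp y) by (intros y; pose proof (exp_pos y); lra).
  (* F integrates the Gaussian tail [vh] 1 against the Beta kernel. Its derivative in the scale t is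
     minus the integrand of the claim, and its limits are [vh] 1 0 times the Beta integral at - oo
     and 0 at + oo. *)
  set (f := fun t y => exp (b * y) / (1 + exp y) * vh 1 (exp t * (1 + exp y))).
  set (f1 := fun t y => - exp (b * y) * exp t * exp (- ((exp t * (1 + exp y)) ^ 2 / 2))).
  set (f2 := fun t y => - exp (b * y) * exp t * exp (- ((exp t * (1 + exp y)) ^ 2 / 2)) * (1 - (exp t * (1 + exp y)) ^ 2)).
  set (F := fun t => II (f t)).
  assert (Hr : forall t y, 0 < exp t * (1 + exp y)) by (intros; apply Rmult_lt_0_compat; auto; apply exp_pos).
  assert (Kp : forall y, 0 < exp (b * y) / (1 + exp y)) by (intros; apply Rdiv_lt_0_compat; auto; apply exp_pos).
  assert (Fle : forall t y, 0 <= f t y <= C1 * exp (- exp t) * (exp (b * y) / (1 + exp y))).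
  { intros t y. unfold f. destruct (B1 (exp t * (1 + exp y)) (Rlt_le _ _ (Hr t y))) as [P1 P2]. specialize (Kp y). split; [nra|].
    rewrite Rmult_comm. apply Rmult_le_compat_r; [lra|]. eapply Rle_trans; [apply P2|]. apply Rmult_le_compat_l; auto. apply exp_le_exp.
    pose proof (exp_pos t). pose proof (exp_pos y). nra. }
  assert (Cont : forall t y, continuous (f t) y).
  { intros t y. unfold f. apply (continuous_mult (K := R_AbsRing) (fun y => exp (b * y) / (1 + exp y)) (fun y => vh 1 (exp t * (1 + exp y)))).
    - apply dom_cont; auto.
    - apply (continuous_comp (fun y => exp t * (1 + exp y)) (vh 1)); apply continuous_derivable.
      auto_derive; auto. eexists; apply vh1_derive. }
  assert (Fd : forall t, dom (f t)).
  { intros t. pose proof (dom_scal (C1 * exp (- exp t)) _ DK) as (C & e & Hd). pose proof (edom_C _ _ _ Hd). destruct Hd as (_ & He & HC).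
    exists C, e. split; [|split]; auto. intros y. eapply Rle_trans; [|apply HC].
    destruct (Fle t y). rewrite !Rabs_pos_eq; auto. eapply Rle_trans; [apply H0|auto]. }
  assert (D1 : forall t, dom (f1 t)).
  { intros t. apply (dom_ext (fun y => - exp t * exp (b * y - (0 + exp t * (1 + exp y)) ^ 2 / 2))).
    { intros y. unfold f1, Rminus. rewrite exp_plus, Rplus_0_l. ring. }
    apply dom_scal. destruct (exp_decay_pos b (exp t) ltac:(lra) (exp_pos t)) as (C & HC & B).
    exists (exp (1 / 2) * C), b. split; [|split; [lra|]].
    - intros y. apply continuous_derivable. auto_derive; auto.
    - intros y. rewrite Rabs_pos_eq by (left; apply exp_pos). rewrite Rmult_assoc.
      eapply Rle_trans; [|apply Rmult_le_compat_l; [left; apply exp_pos | apply B]]. rewrite <- exp_plus. apply exp_le_exp.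
      rewrite Rplus_0_l. pose proof (pow2_ge_0 (exp t * (1 + exp y) - 1)). pose proof (exp_pos t). nra. }
  assert (E1 : forall t, II (f1 t) = - (exp ((1 - b) * t) * vh b (exp t))).
  { intros t. unfold vh.
    assert (Dv : dom (fun y => exp (b * y - (exp t + exp y) ^ 2 / 2))) by (apply vh_dom; lra).
    rewrite <- (II_shift (fun y => exp (b * y - (exp t + exp y) ^ 2 / 2)) t Dv).
    replace (- (exp ((1 - b) * t) * II (fun y => exp (b * (y + t) - (exp t + exp (y + t)) ^ 2 / 2)))) with
      (- exp ((1 - b) * t) * II (fun y => exp (b * (y + t) - (exp t + exp (y + t)) ^ 2 / 2))) by ring.
    rewrite <- II_scal by apply (dom_shift (fun y => exp (b * y - (exp t + exp y) ^ 2 / 2)) t Dv).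
    apply II_ext. intros y. unfold f1. rewrite !Ropp_mult_distr_l_reverse. f_equal.
    rewrite <- !exp_plus. f_equal. rewrite (exp_plus y t). field. }
  assert (DF : forall t, is_derive F t (- (exp ((1 - b) * t) * vh b (exp t)))).
  { intros x. rewrite <- E1. set (c := exp (x - 1)). assert (Hc : 0 < c) by apply exp_pos.
    destruct (exp_decay_pos b c ltac:(lra) Hc) as (C & HC & B).
    set (X := exp (x + 1)). assert (HX : 0 < X) by apply exp_pos.
    apply (II_param f f1 f2 x 1 (X * (5 * exp 1) * C) b); auto; try lra.
    - intros t y _. unfold f, f1. specialize (Hp y).
      assert (DV := vh1_derive (exp t * (1 + exp y))).
      auto_derive. eexists; apply DV.
      replace (Derive (fun x0 => vh 1 x0) (exp t * (1 + exp y))) with (- exp (- ((exp t * (1 + exp y)) ^ 2 / 2))) by (symmetry; apply is_derive_unique, DV).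
      field. lra.
    - intros t y _. unfold f1, f2. auto_derive; auto.
      replace (- (exp t * (1 + exp y) * (exp t * (1 + exp y) * 1) * / 2)) with (- ((exp t * (1 + exp y)) ^ 2 / 2)) by (simpl; field). field.
    - intros t y Ht. apply Rabs_def2 in Ht. unfold f2.
      assert (T1 : exp t <= X) by (apply exp_le_exp; lra).
      assert (T2 : c <= exp t) by (apply exp_le_exp; lra).
      set (u := exp t * (1 + exp y)). pose proof (gauss_poly_le u) as Q. specialize (B y).
      rewrite !Rabs_mult, Rabs_Ropp, !(Rabs_pos_eq (exp _)) by (left; apply exp_pos).
      assert (A1 : exp (- (u ^ 2 / 2)) * Rabs (1 - u ^ 2) <= 5 * exp (1 - u)).
      { eapply Rle_trans; [|apply Q]. rewrite Rmult_comm. apply Rmult_le_compat_r; [left; apply exp_pos|].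
        pose proof (pow2_ge_0 u). unfold Rabs. destruct (Rcase_abs _); lra. }
      assert (A2 : exp (1 - u) <= exp 1 * exp (- (c * exp y))).
      { rewrite <- exp_plus. apply exp_le_exp. unfold u. pose proof (exp_pos y). pose proof (exp_pos t). nra. }
      unfold Rminus in B. rewrite exp_plus in B. pose proof (exp_pos t). pose proof (exp_pos (b * y)). pose proof (exp_pos 1). pose proof (exp_pos (- (c * exp y))).
      replace (exp (b * y) * exp t * exp (- (u ^ 2 / 2)) * Rabs (1 - u ^ 2)) with (exp t * (exp (b * y) * (exp (- (u ^ 2 / 2)) * Rabs (1 - u ^ 2)))) by ring.
      replace (X * (5 * exp 1) * C * exp (- (b * Rabs y))) with (X * (5 * exp 1 * (C * exp (- (b * Rabs y))))) by ring.
      apply Rmult_le_compat; try lra.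
      + apply Rmult_le_pos; [lra|]. apply Rmult_le_pos; [left; apply exp_pos | apply Rabs_pos].
      + apply Rle_trans with (exp (b * y) * (5 * (exp 1 * exp (- (c * exp y))))).
        * apply Rmult_le_compat_l; lra.
        * replace (exp (b * y) * (5 * (exp 1 * exp (- (c * exp y))))) with (5 * exp 1 * (exp (b * y) * exp (- (c * exp y)))) by ring.
          apply Rmult_le_compat_l; lra. }
  set (K0 := II (fun y => exp (b * y) / (1 + exp y))).
  assert (Fpos : forall t, 0 <= II (f t)).
  { intros t. replace 0 with (II (fun y => 0 * f t y)) by (rewrite II_scal by auto; ring).
    apply II_le; auto. now apply dom_scal. intros y. destruct (Fle t y). lra. }
  assert (L1 : is_lim F p_infty 0).
  { apply (is_lim_squeeze0 F (fun t => C1 * K0 * exp (1 * - t))).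
    - intros t. rewrite Rminus_0_r. unfold F. rewrite Rabs_pos_eq by auto.
      apply Rle_trans with (C1 * exp (- exp t) * K0).
      + unfold K0. rewrite <- II_scal by auto. apply II_le; auto. now apply dom_scal. intros y. apply Fle.
      + assert (0 < K0) by (apply II_pos; auto). rewrite Rmult_assoc, (Rmult_comm _ K0), <- Rmult_assoc.
        apply Rmult_le_compat_l; [apply Rmult_le_pos; lra|]. apply exp_le_exp. pose proof (exp_ineq1_le t). lra.
    - apply (is_lim_comp (fun u => C1 * K0 * exp (1 * u)) Ropp p_infty 0 m_infty).
      + apply is_lim_exp_scal_m. lra.
      + apply (is_lim_opp (fun y => y) p_infty p_infty). apply is_lim_id.
      + exists 0. easy. }
  assert (L0 : is_lim F m_infty (vh 1 0 * K0)).
  { set (d := (1 - b) / 2). assert (Hd : 0 < d <= 1) by (unfold d; lra).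
    destruct (K0_val (b + d) ltac:(unfold d; lra)) as [DK' _].
    set (V := 1 + vh 1 0). assert (HV : 0 <= vh 1 0) by (apply (vh_pos_le 1 0); lra).
    assert (Lip : forall r, 0 < r -> 0 <= vh 1 0 - vh 1 r <= V * exp (d * ln r)).
    { intros r Hr'. pose proof (vh_pos_le 1 r ltac:(lra) ltac:(lra)) as P. split; [lra|].
      apply Rle_trans with (V * Rmin 1 r); [|apply Rmult_le_compat_l; [unfold V; lra | now apply exp_pow_le]].
      destruct (Rle_lt_dec r 1) as [H|H].
      - rewrite Rmin_right by auto.
        assert (Q : Rabs (vh 1 r - vh 1 0) <= 1 * Rabs (r - 0)).
        { apply (mvt_bound (vh 1) (fun x => - exp (- (x ^ 2 / 2)))). intros; apply vh1_derive.
          intros t _. rewrite Rabs_Ropp, Rabs_pos_eq by (left; apply exp_pos). apply Rle_trans with (exp 0); [apply exp_le_exp | rewrite exp_0; lra].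
          pose proof (pow2_ge_0 t). lra. }
        rewrite Rminus_0_r, (Rabs_pos_eq r) in Q by lra. apply Rabs_le_between in Q. unfold V. nra.
      - rewrite Rmin_left by lra. unfold V. lra. }
    set (g := fun y => exp (b * y) / (1 + exp y) * exp (d * ln (1 + exp y))).
    assert (Dg : dom g).
    { destruct DK as (A1 & e1 & H1). destruct DK' as (A2 & e2 & H2).
      pose proof (edom_plus _ _ _ _ _ _ H1 H2) as H3. pose proof (edom_C _ _ _ H3). destruct H3 as (_ & He & H3).
      exists (2 * (A1 + A2)), (Rmin e1 e2). split; [|split]; auto.
      - intros y. unfold g. apply continuous_derivable. specialize (Hp y). auto_derive. split; lra.
      - intros y. specialize (H3 y). specialize (Hp y). pose proof (exp_pos y) as Y.
        assert (Q : exp (d * ln (1 + exp y)) <= 2 * (1 + exp (d * y))).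
        { destruct (Rle_lt_dec (exp y) 1) as [Hy|Hy].
          - apply Rle_trans with (exp (ln 2)).
            + apply exp_le_exp. assert (ln (1 + exp y) <= ln 2) by (apply ln_le; lra).
              assert (0 <= ln (1 + exp y)) by (rewrite <- ln_1; apply ln_le; lra). nra.
            + rewrite exp_ln by lra. pose proof (exp_pos (d * y)). lra.
          - apply Rle_trans with (exp (ln 2 + d * y)).
            + apply exp_le_exp. assert (E : ln (1 + exp y) <= ln (2 * exp y)) by (apply ln_le; lra).
              rewrite ln_mult, ln_exp in E by lra.
              assert (0 < ln 2) by (rewrite <- ln_1; apply ln_increasing; lra). nra.
            + rewrite exp_plus, exp_ln by lra. pose proof (exp_pos (d * y)). lra. }
        pose proof (Kp y) as P1.
        assert (P2 : 0 < exp ((b + d) * y) / (1 + exp y)) by (apply Rdiv_lt_0_compat; auto; apply exp_pos).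
        rewrite Rabs_pos_eq in H3 by lra. unfold g.
        rewrite Rabs_pos_eq by (apply Rmult_le_pos; [lra | left; apply exp_pos]).
        rewrite Rmult_assoc. eapply Rle_trans; [|apply Rmult_le_compat_l; [|apply H3]; lra].
        eapply Rle_trans; [apply Rmult_le_compat_l; [lra | apply Q]|]. right.
        replace ((b + d) * y) with (b * y + d * y) by ring. rewrite exp_plus. field. lra. }
    assert (DKs : dom (fun y => vh 1 0 * (exp (b * y) / (1 + exp y)))) by now apply dom_scal.
    apply (is_lim_squeeze0 F (fun t => V * II g * exp (d * t))).
    - intros t. unfold F, K0. rewrite <- II_scal by auto.
      assert (P : forall y, 0 <= vh 1 0 * (exp (b * y) / (1 + exp y)) - f t y <= V * exp (d * t) * g y).
      { intros y. unfold f, g. pose proof (Kp y). destruct (Lip _ (Hr t y)) as [P1 P2].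
        rewrite ln_mult, ln_exp in P2 by (auto; apply exp_pos).
        rewrite (Rmult_plus_distr_l d), (exp_plus (d * t)) in P2.
        replace (vh 1 0 * (exp (b * y) / (1 + exp y)) - exp (b * y) / (1 + exp y) * vh 1 (exp t * (1 + exp y))) with
          (exp (b * y) / (1 + exp y) * (vh 1 0 - vh 1 (exp t * (1 + exp y)))) by ring.
        split; [nra|]. eapply Rle_trans; [apply Rmult_le_compat_l; [lra | apply P2]|]. right; ring. }
      rewrite <- Rabs_Ropp. replace (- (II (f t) - II (fun y => vh 1 0 * (exp (b * y) / (1 + exp y))))) with (II (fun y => vh 1 0 * (exp (b * y) / (1 + exp y)) - f t y)).
      2: { rewrite II_minus by auto. ring. }
      assert (DD : dom (fun y => vh 1 0 * (exp (b * y) / (1 + exp y)) - f t y)) by now apply dom_minus.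
      rewrite Rabs_pos_eq.
      + replace (V * II g * exp (d * t)) with (V * exp (d * t) * II g) by ring. rewrite <- II_scal by auto.
        apply II_le; auto. now apply dom_scal. apply P.
      + apply Rle_trans with (II (fun y => 0 * f t y)); [rewrite II_scal by auto; lra|].
        apply II_le; auto. now apply dom_scal. intros y. destruct (P y). lra.
    - apply is_lim_exp_scal_m. lra. }
  assert (DG : dom (fun t => - (exp ((1 - b) * t) * vh b (exp t)))).
  { apply (dom_ext (fun t => - G b * Kf (1 - b) (vA (1 / 2 - b)) t)).
    - intros t. unfold Kf, vA. replace (1 / 2 - (1 / 2 - b)) with b by ring. pose proof (G_pos b ltac:(lra)). field. lra.
    - apply dom_scal. apply Kf_dom; [lra| |].
      + apply (bdd_rap (1 / 2 - b)). apply vA_asy; lra. apply v_bdd; lra.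
      + intros x Hx. apply continuous_derivable. eexists. exact (proj1 (v_derive (1 / 2 - b) x ltac:(lra))). }
  pose proof (II_FTC _ F _ _ DG DF L0 L1) as E.
  rewrite (II_ext _ (fun t => (-1) * (exp ((1 - b) * t) * vh b (exp t)))) in E by (intros; ring).
  rewrite II_scal in E. lra.
  apply (dom_ext (fun t => -1 * (- (exp ((1 - b) * t) * vh b (exp t))))). intros; ring. now apply dom_scal.
Qed.

(** * Base cases of the exact remainder formula *)

Lemma G_half_pos : 0 < sqrt PI.
Proof. apply sqrt_lt_R0, PI_RGT_0. Qed.

Lemma exp_half_ln2 : exp (1 / 2 * ln 2) * exp (1 / 2 * ln 2) = 2.
Proof. rewrite <- exp_plus. replace (1 / 2 * ln 2 + 1 / 2 * ln 2) with (ln 2) by field. apply exp_ln. lra. Qed.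

Lemma vh_1_0 : vh 1 0 = sqrt PI * exp (1 / 2 * ln 2) / 2.
Proof.
  rewrite vh_0, G_half by lra. replace ((1 / 2 - 1) * ln 2) with (1 / 2 * ln 2 + - ln 2) by field.
  rewrite exp_plus, exp_Ropp, exp_ln by lra. field.
Qed.

(** With b = 1/2 - a every Gamma value is expressed through G(b/2) and G((b+1)/2): duplication
    eliminates G(b), reflection the two values in the C_i. The first two identities match initial
    values at x = 0, the next two match the Mellin jump. *)
Lemma base_constants a : - (1 / 2) < a < 1 / 2 ->
  cG1 a * vA a 0 = cos (PI * theta a) /\ cG2 a * vB a 0 = - sin (PI * theta a) /\
  cH1 a = - cG1 a * sin (PI * theta a) * (2 / PI) * Mel (a + 1 / 2) (vA a) /\
  cH2 a = cG2 a * cos (PI * theta a) * (2 / PI) * Mel (a + 1 / 2) (vA a) /\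
  0 < cos (PI * theta a) /\ sin (PI * theta a) < 0.
Proof.
  intros Ha. set (b := 1 / 2 - a). assert (Hb : 0 < b < 1) by (unfold b; lra).
  pose proof PI_RGT_0 as HPI.
  set (E := exp (b / 2 * ln 2)). assert (HE : 0 < E) by apply exp_pos.
  set (S2 := exp (1 / 2 * ln 2)). assert (HS2 : 0 < S2) by apply exp_pos. pose proof exp_half_ln2 as SS. fold S2 in SS.
  set (sp := sqrt PI). assert (Hsp : 0 < sp) by apply G_half_pos.
  assert (Epi : PI = sp * sp) by (symmetry; apply sqrt_sqrt; lra).
  set (g1 := G (b / 2)). set (g2 := G ((b + 1) / 2)). set (h1 := G ((1 - b) / 2)). set (h2 := G (1 - b / 2)).
  assert (Hg1 : 0 < g1) by (apply G_pos; lra). assert (Hg2 : 0 < g2) by (apply G_pos; lra).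
  assert (Hh1 : 0 < h1) by (apply G_pos; lra). assert (Hh2 : 0 < h2) by (apply G_pos; lra).
  assert (Hgb : 0 < G b) by (apply G_pos; lra).
  set (cb := cos (PI * b / 2)). set (sb := sin (PI * b / 2)).
  assert (Hcb : 0 < cb) by (apply cos_gt_0; nra). assert (Hsb : 0 < sb) by (apply sin_gt_0; nra).
  assert (Th : PI * theta a = - (PI * b / 2)) by (unfold theta, b; field).
  assert (Cth : cos (PI * theta a) = cb) by (rewrite Th; apply cos_neg).
  assert (Sth : sin (PI * theta a) = - sb) by (rewrite Th; apply sin_neg).
  assert (Du : G b = E * E * g1 * g2 / (2 * sp)).
  { pose proof (G_duplication b ltac:(lra)) as D. rewrite G_half in D. fold g1 g2 sp in D.
    replace ((b - 1) * ln 2) with (b / 2 * ln 2 + b / 2 * ln 2 + - ln 2) in D by field.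
    rewrite !exp_plus, exp_Ropp, exp_ln in D by lra. fold E in D.
    apply Rmult_eq_reg_l with sp; [|lra]. rewrite <- D. field. lra. }
  assert (R1 : h2 = sp * sp / (sb * g1)).
  { pose proof (G_reflection (b / 2) ltac:(lra)) as D. fold g1 h2 in D. replace (PI * (b / 2)) with (PI * b / 2) in D by field. fold sb in D.
    apply Rmult_eq_reg_l with g1; [|lra]. rewrite D, <- Epi. field. lra. }
  assert (R2 : h1 = sp * sp / (cb * g2)).
  { pose proof (G_reflection ((1 - b) / 2) ltac:(lra)) as D. replace (1 - (1 - b) / 2) with ((b + 1) / 2) in D by field. fold h1 g2 in D.
    replace (PI * ((1 - b) / 2)) with (PI / 2 - PI * b / 2) in D by field. rewrite sin_shift in D. fold cb in D.
    apply Rmult_eq_reg_r with g2; [|lra]. rewrite D, <- Epi. field. lra. }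
  assert (V0 : vA a 0 = E / 2 * g1 / G b).
  { unfold vA. fold b. rewrite vh_0 by lra. replace ((b / 2 - 1) * ln 2) with (b / 2 * ln 2 + - ln 2) by ring.
    rewrite exp_plus, exp_Ropp, exp_ln by lra. fold E g1. field. lra. }
  assert (V1 : vB a 0 = E * S2 / 2 * g2 / G b).
  { unfold vB. fold b. rewrite (vh_0 (b + 1)) by lra. replace (((b + 1) / 2 - 1) * ln 2) with (b / 2 * ln 2 + 1 / 2 * ln 2 + - ln 2) by field.
    rewrite !exp_plus, exp_Ropp, exp_ln by lra. fold E g2 S2. field. lra. }
  assert (C1 : cG1 a = E * sp / h1).
  { unfold cG1. rewrite rGamma_pos by lra. replace (1 / 4 + a / 2) with ((1 - b) / 2) by (unfold b; field).
    replace (1 / 4 - a / 2) with (b / 2) by (unfold b; field). reflexivity. }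
  assert (C2 : cG2 a = E / S2 * sp / h2).
  { unfold cG2. rewrite rGamma_pos by lra. replace (3 / 4 + a / 2) with (1 - b / 2) by (unfold b; field).
    replace (- (a / 2) - 1 / 4) with (b / 2 + - (1 / 2)) by (unfold b; field). unfold Rpower. rewrite Rmult_plus_distr_r, exp_plus.
    replace (- (1 / 2) * ln 2) with (- (1 / 2 * ln 2)) by field. rewrite exp_Ropp. reflexivity. }
  assert (C3 : cH1 a = S2 / E * sp / g1).
  { unfold cH1. rewrite rGamma_pos by lra. replace (1 / 4 - a / 2) with (b / 2) by (unfold b; field).
    replace (1 / 4 + a / 2) with (1 / 2 + - (b / 2)) by (unfold b; field). unfold Rpower. rewrite Rmult_plus_distr_r, exp_plus.
    replace (- (b / 2) * ln 2) with (- (b / 2 * ln 2)) by field. rewrite exp_Ropp. reflexivity. }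
  assert (C4 : cH2 a = / E * sp / g2).
  { unfold cH2. rewrite rGamma_pos by lra. replace (3 / 4 - a / 2) with ((b + 1) / 2) by (unfold b; field).
    replace (a / 2 - 1 / 4) with (- (b / 2)) by (unfold b; field). unfold Rpower.
    replace (- (b / 2) * ln 2) with (- (b / 2 * ln 2)) by field. rewrite exp_Ropp. reflexivity. }
  assert (MM : Mel (a + 1 / 2) (vA a) = sp * S2 / 2 * (sp * sp / (2 * sb * cb)) / G b).
  { assert (Dm : dom (fun t => exp ((1 - b) * t) * vh b (exp t))).
    { apply (dom_ext (fun t => G b * Kf (1 - b) (vA a) t)).
      - intros t. unfold Kf, vA. fold b. field. lra.
      - apply dom_scal. apply Kf_dom; [lra| |].
        + apply (bdd_rap a). apply vA_asy; lra. apply v_bdd; lra.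
        + intros x Hx. apply continuous_derivable. eexists. exact (proj1 (v_derive a x ltac:(lra))). }
    unfold Mel. rewrite (II_ext _ (fun t => / G b * (exp ((1 - b) * t) * vh b (exp t)))).
    - rewrite II_scal, Mel_vh, vh_1_0 by (auto; lra). fold sp S2.
      replace (sin (PI * b)) with (2 * sb * cb) by (unfold sb, cb; rewrite <- sin_2a; f_equal; field).
      rewrite <- Epi. field. lra.
    - intros t. unfold Kf, vA. fold b. replace (1 - b) with (a + 1 / 2) by (unfold b; field). field. lra. }
  rewrite Cth, Sth, C1, C2, C3, C4, V0, V1, MM, Du, R1, R2, Epi.
  repeat split; try lra; field; lra.
Qed.

Lemma tends0_near0 f f0 : near0 f f0 -> tends0 f f0.
Proof.
  intros (C & HC & H) eps Heps. exists (eps / (C + 1)). split; [apply Rdiv_lt_0_compat; lra|]. intros x [H0 H1].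
  eapply Rle_lt_trans; [now apply H|]. apply Rmult_lt_compat_l with (r := C + 1) in H1; [|lra].
  replace ((C + 1) * (eps / (C + 1))) with eps in H1 by (field; lra). nra.
Qed.

(** Coming back from the exponents raised in [PvB_derive] produces two Mellin terms, and [Mel_A]
    makes them cancel; the transformed pair therefore solves the original system. *)
Lemma Pv_sys a va vb : sys a va vb -> rap va -> rap vb -> - (1 / 2) < a ->
  sys a (Pv (a - 1 / 2) va) (Pv (a + 1 / 2) vb).
Proof.
  intros HS Ra Rb Ha x Hx. split.
  - replace (a + 1 / 2) with (a - 1 / 2 + 1) by field. apply (PvA_derive a va vb); auto. lra.
  - replace (- x * Pv (a + 1 / 2) vb x + (a + 1 / 2) * Pv (a - 1 / 2) va x) with
      (- x * Pv (a + 1 / 2 + 2) vb x + (a + 1 / 2) * Pv (a + 1 / 2 + 1) va x).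
    + apply (PvB_derive a va vb); auto. lra.
    + rewrite (Pv_step (a + 1 / 2) vb (fun x => - (x * vb x) + (a + 1 / 2) * va x)); auto; try lra.
      replace (Pv (a + 1 / 2 + 1) va x) with (Pv (a - 1 / 2 + 2) va x) by (f_equal; field).
      rewrite (Pv_step (a - 1 / 2) va (fun x => - vb x)); auto; try lra.
      * rewrite (Mel_A a va vb (a + 1 / 2)) by (auto; lra). replace (a - 1 / 2 + 1) with (a + 1 / 2) by field.
        replace (- ((a + 1 / 2 + 1) * ln x)) with (- ((a + 1 / 2) * ln x) + - ln x) by ring.
        rewrite exp_plus, (exp_Ropp (ln x)), exp_ln by auto. pose proof PI_RGT_0. field. lra.
      * now apply rap_opp.
      * apply (sys_dA a va vb HS).
      * now apply (rap_dB a).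
      * apply (sys_dB a va vb HS).
Qed.

(** In this strip the exponents a - 1/2 and a + 1/2 lie in (-1, 1), so already for m = 0 both sides
    have limits at 0 and [sys_unique] applies. [E_step] then raises m. *)
Lemma good_strip a : - (1 / 2) < a < 1 / 2 -> good a.
Proof.
  intros Ha. destruct (base_constants a Ha) as (K1 & K2 & K3 & K4 & Hc & Hs).
  pose proof (v_sys a ltac:(lra)) as HS. pose proof (vA_asy a ltac:(lra)) as Aa. pose proof (vB_asy a ltac:(lra)) as Ab.
  destruct (v_bdd a ltac:(lra)) as [Ba Bb]. destruct (v_near0 a ltac:(lra)) as [Na Nb].
  set (va := vA a) in *. set (vb := vB a) in *. set (va0 := va 0) in *. set (vb0 := vb 0) in *.
  assert (Ra : rap va) by now apply (bdd_rap a). assert (Rb : rap vb) by now apply (bdd_rap (a + 1)).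
  pose proof (Pv_sys a va vb HS Ra Rb ltac:(lra)) as PS.
  pose proof (tends0_near0 _ _ Na) as Ta. pose proof (tends0_near0 _ _ Nb) as Tb.
  assert (Pa : tends0 (Pv (a - 1 / 2) va) (- va0 * (sin (PI * theta a) / cos (PI * theta a)))).
  { pose proof (Pv_lim0 (a - 1 / 2) va (fun x => - vb x) va0 ltac:(apply Rabs_def1; lra) (sys_dA a va vb HS) Ra (rap_opp _ Rb) Na) as L.
    replace (PI * (a - 1 / 2) / 2) with (PI * theta a) in L by (unfold theta; field). exact L. }
  assert (Pb : tends0 (Pv (a + 1 / 2) vb) (vb0 * (cos (PI * theta a) / sin (PI * theta a)))).
  { pose proof (Pv_lim0 (a + 1 / 2) vb _ vb0 ltac:(apply Rabs_def1; lra) (sys_dB a va vb HS) Rb (rap_dB a va vb Ra Rb) Nb) as L.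
    replace (PI * (a + 1 / 2) / 2) with (PI * theta (a + 1)) in L by (unfold theta; field). unfold tan in L. rewrite cos_succ, sin_succ in L.
    replace (vb0 * (cos (PI * theta a) / sin (PI * theta a))) with (- vb0 * (cos (PI * theta a) / - sin (PI * theta a))) by (field; lra). exact L. }
  pose proof (cos_succ a) as T1. pose proof (sin_succ a) as T2.
  set (c := cos (PI * theta a)) in *. set (s := sin (PI * theta a)) in *.
  assert (SC : s * s + c * c = 1) by (pose proof (sin2_cos2 (PI * theta a)) as Q; exact Q).
  (* At x = 0 the tangent from [Pv_lim0] combines with the trigonometric weights into sin^2 + cos^2
     in one component, and cancels in the other. *)
  assert (U1 : forall x, 0 < x -> w1 a x = cG1 a * c * va x + (- cG1 a * s) * Pv (a - 1 / 2) va x /\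
     (a + 1 / 2) * w2 (a + 1) x = cG1 a * c * vb x + (- cG1 a * s) * Pv (a + 1 / 2) vb x).
  { apply (sys_unique a _ _ _ _ (w_sys1 a) (sys_lin a _ _ _ _ (cG1 a * c) (- cG1 a * s) HS PS) 1 0).
    - rewrite <- (w1_0 a). apply tends0_cont. apply continuous_derivable. eexists; apply w1_derive.
    - pose proof (tends0_lin _ _ _ _ (cG1 a * c) (- cG1 a * s) Ta Pa) as Q.
      replace (cG1 a * c * va0 + - cG1 a * s * (- va0 * (s / c))) with 1 in Q; [exact Q | symmetry].
      transitivity (cG1 a * va0 * (s * s + c * c) / c); [field; lra|]. rewrite K1, SC. field. lra.
    - replace 0 with ((a + 1 / 2) * w2 (a + 1) 0) by (rewrite w2_0; ring).
      apply (tends0_cont (fun x => (a + 1 / 2) * w2 (a + 1) x)). apply continuous_derivable.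
      eexists. apply (is_derive_scal (w2 (a + 1))). apply w2_derive.
    - pose proof (tends0_lin _ _ _ _ (cG1 a * c) (- cG1 a * s) Tb Pb) as Q.
      replace (cG1 a * c * vb0 + - cG1 a * s * (vb0 * (c / s))) with 0 in Q; [exact Q | field; lra]. }
  assert (U2 : forall x, 0 < x -> w2 a x = cG2 a * s * va x + (cG2 a * c) * Pv (a - 1 / 2) va x /\
     - w1 (a + 1) x = cG2 a * s * vb x + (cG2 a * c) * Pv (a + 1 / 2) vb x).
  { apply (sys_unique a _ _ _ _ (w_sys2 a) (sys_lin a _ _ _ _ (cG2 a * s) (cG2 a * c) HS PS) 0 (-1)).
    - pose proof (w2_0 a) as W0. rewrite <- W0. clear W0. apply tends0_cont. apply continuous_derivable. eexists; apply w2_derive.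
    - pose proof (tends0_lin _ _ _ _ (cG2 a * s) (cG2 a * c) Ta Pa) as Q.
      replace (cG2 a * s * va0 + cG2 a * c * (- va0 * (s / c))) with 0 in Q; [exact Q | field; lra].
    - replace (-1) with (- w1 (a + 1) 0) by (rewrite w1_0; ring).
      apply (tends0_cont (fun x => - w1 (a + 1) x)). apply continuous_derivable.
      eexists. apply (is_derive_opp (w1 (a + 1))). apply w1_derive.
    - pose proof (tends0_lin _ _ _ _ (cG2 a * s) (cG2 a * c) Tb Pb) as Q.
      replace (cG2 a * s * vb0 + cG2 a * c * (vb0 * (c / s))) with (-1) in Q; [exact Q | symmetry].
      transitivity (cG2 a * vb0 * (s * s + c * c) / s); [field; lra|]. rewrite K2, SC. field. lra. }
  exists va, vb. split; [|split; [|split; [|split; [|split]]]]; auto.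
  exists O. intros m _. 
  pose proof (cH1_cH2 (a + 1)) as C1. pose proof (cH1_pred (a + 1)) as C3.
  pose proof (cG1_cG2 (a + 1)) as C5. pose proof (cG1_pred (a + 1)) as C7.
  replace (a + 1 - 1) with a in * by ring.
  assert (G2 : cG2 (a + 1) = cG1 a / (a + 1 / 2)) by (rewrite C7; field; lra).
  assert (ME : forall n, ec a n * Mel (a + 1 / 2) va = Mel (a + 1 / 2 + 2 * INR n) va) by (intros n; symmetry; apply (Mel_ec a va vb); auto; lra).
  assert (MB : forall n, Mel (a + 1 + 1 / 2 + 2 * INR n) vb = (a + 1 / 2 + 2 * INR n) * (ec a n * Mel (a + 1 / 2) va)).
  { intros n. rewrite ME. replace (a + 1 + 1 / 2 + 2 * INR n) with (a + 1 / 2 + 2 * INR n + 1) by ring. apply (Mel_A a); auto. pose proof (pos_INR n). lra. }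
  assert (EC : forall n, (a + 1 / 2) * ec (a + 1) n = (a + 1 / 2 + 2 * INR n) * ec a n).
  { intros n. unfold ec. pose proof (poch_shift (1 / 2 + a) (2 * n)) as P. cbn [poch] in P. rewrite mult_INR in P. change (INR 2) with 2 in P.
    replace (1 / 2 + (a + 1)) with (1 / 2 + a + 1) by ring. pose proof (INR_fact_neq_0 n). pose proof (pow_nonzero 2 n ltac:(lra)).
    apply Rmult_eq_reg_r with (INR (fact n) * 2 ^ n); [|now apply Rmult_integral_contrapositive].
    transitivity ((1 / 2 + a) * poch (1 / 2 + a + 1) (2 * n)); [field; auto|]. rewrite <- P. field. auto. }
  induction m as [|m (I1 & I2 & I3 & I4)].
  - unfold w1_formula, w2_formula. simpl INR. rewrite Rmult_0_r, !Rplus_0_r. replace (a + 1 - 1 / 2) with (a + 1 / 2) by field.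
    rewrite T1, T2. fold c s. unfold Xs. cbn [sumn].
    split; [|split; [|split]]; intros x Hx; destruct (U1 x Hx) as [W1 W2]; destruct (U2 x Hx) as [W3 W4].
    + rewrite W1. ring.
    + rewrite W3. ring.
    + rewrite C5. lra.
    + rewrite G2. apply Rmult_eq_reg_l with (a + 1 / 2); [|lra]. rewrite W2. field. lra.
  - pose proof (pos_INR m).
    destruct (E_step a va (fun x => - vb x) m ltac:(lra) Ra (rap_opp _ Rb) (sys_dA a va vb HS)) as [S1 S2].
    destruct (E_step (a + 1) vb _ m ltac:(lra) Rb (rap_dB a va vb Ra Rb) (sys_dB a va vb HS)) as [S3 S4].
    fold c s in S1, S2. rewrite T2 in S3. rewrite T1 in S4. rewrite <- ME in S1, S2. rewrite MB in S3, S4.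
    split; [|split; [|split]].
    + apply S1; auto. rewrite K3 at 1. ring.
    + apply S2; auto. rewrite K4 at 1. ring.
    + apply S3; auto. rewrite C1, C5. 
      transitivity (- cH2 a * ((a + 1 / 2) * ec (a + 1) m)); [field|]. rewrite EC, K4 at 1. ring.
    + apply S4; auto. rewrite <- C3, G2. apply Rmult_eq_reg_l with (a + 1 / 2); [|lra].
      transitivity (cH1 a * ((a + 1 / 2) * ec (a + 1) m)); [ring|]. rewrite EC, K3 at 1. field. repeat split; first [lra | apply PI_neq0].
Qed.

Lemma w1_mhalf x : 0 < x -> w1 (- (1 / 2)) x = 1.
Proof.
  intros Hx. assert (HC : sys (- (1 / 2)) (fun _ => 1) (fun _ => 0)).
  { intros y _. split. auto_derive; auto; ring. auto_derive; auto; field. }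
  assert (T : forall c, tends0 (fun _ => c) c).
  { intros c eps He. exists 1. split; [lra|]. intros y _. rewrite Rminus_diag, Rabs_R0. auto. }
  apply (sys_unique (- (1 / 2)) _ _ _ _ (w_sys1 _) HC 1 0); auto.
  - pose proof (tends0_cont (w1 (- (1 / 2))) ltac:(apply continuous_derivable; eexists; apply w1_derive)) as Q.
    rewrite w1_0 in Q. exact Q.
  - intros eps He. destruct (T 0 eps He) as (d & Hd & B). exists d. split; auto.
    intros y Hy. replace ((- (1 / 2) + 1 / 2) * w2 (- (1 / 2) + 1) y) with 0 by field. now apply B with y.
Qed.

Lemma poch_0_S k : poch 0 (S k) = 0.
Proof. rewrite poch_shift. ring. Qed.

Lemma ec_mhalf k : ec (- (1 / 2)) (S k) = 0.
Proof.
  unfold ec. replace (1 / 2 + - (1 / 2)) with 0 by field. replace (2 * S k)%nat with (S (S (2 * k))) by lia.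
  rewrite poch_0_S. unfold Rdiv. ring.
Qed.

Lemma rGamma_0 : rGamma 0 = 0.
Proof. rewrite rGamma_succ. ring. Qed.

Lemma rGamma_1 : rGamma 1 = 1.
Proof. rewrite rGamma_pos, G_1 by lra. field. Qed.

Lemma rGamma_half : rGamma (1 / 2) = / sqrt PI.
Proof. rewrite rGamma_pos, G_half by lra. reflexivity. Qed.

Lemma vB_mhalf x : vB (- (1 / 2)) x = exp (- (x ^ 2 / 2)).
Proof.
  unfold vB. replace (1 / 2 - - (1 / 2)) with 1 by field. rewrite G_1. replace (1 + 1) with 2 by ring. rewrite vh_gauss. field.
Qed.

Lemma sqrt_half_PI_sq : vh 1 0 * vh 1 0 * (2 / PI) = 1.
Proof.
  rewrite vh_1_0. pose proof exp_half_ln2 as SS. pose proof PI_RGT_0 as HP. pose proof (sqrt_sqrt PI ltac:(lra)) as SP.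
  transitivity ((sqrt PI * sqrt PI) * (exp (1 / 2 * ln 2) * exp (1 / 2 * ln 2)) / 2 / PI); [field; lra|].
  rewrite SS, SP. field. lra.
Qed.

(* Here [a + 1/2 = 0] and the Mellin integral defining [Pv (a - 1/2) va] diverges; all functions involved are elementary. *)
Lemma good_mhalf : good (- (1 / 2)).
Proof.
  set (a := - (1 / 2)).
  pose proof (v_sys a ltac:(unfold a; lra)) as HS. pose proof (vA_asy a ltac:(unfold a; lra)) as Aa. pose proof (vB_asy a ltac:(unfold a; lra)) as Ab.
  destruct (v_bdd a ltac:(unfold a; lra)) as [Ba Bb]. destruct (v_near0 a ltac:(unfold a; lra)) as [Na Nb].
  pose proof (vB_mhalf 0) as Vb0. fold a in Vb0. replace (- (0 ^ 2 / 2)) with 0 in Vb0 by field. rewrite exp_0 in Vb0.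
  assert (Va0 : vA a 0 = vh 1 0). { unfold vA, a. replace (1 / 2 - - (1 / 2)) with 1 by field. rewrite G_1. field. }
  set (va := vA a) in *. set (vb := vB a) in *. rewrite Va0 in Na. rewrite Vb0 in Nb.
  set (g := vh 1 0) in *. 
  assert (Ra : rap va) by now apply (bdd_rap a). assert (Rb : rap vb) by now apply (bdd_rap (a + 1)).
  assert (T : forall c, tends0 (fun _ => c) c).
  { intros c eps He. exists 1. split; [lra|]. intros y _. rewrite Rminus_diag, Rabs_R0. auto. }
  assert (HC : sys a (fun _ => 1) (fun _ => 0)).
  { intros y _. unfold a. split. auto_derive; auto; ring. auto_derive; auto; field. }
  assert (sp0 : 0 < sqrt PI) by apply G_half_pos.
  assert (gval : g = Rpower 2 (- (1 / 2)) * sqrt PI).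
  { unfold g. rewrite vh_0, G_half by lra. unfold Rpower. do 2 f_equal. field. }
  assert (U2 : forall x, 0 < x -> w2 a x = g * 1 + -1 * va x /\ - w1 (a + 1) x = g * 0 + -1 * vb x).
  { apply (sys_unique a _ _ _ _ (w_sys2 a) (sys_lin a _ _ _ _ g (-1) HC HS) 0 (-1)).
    - pose proof (w2_0 a) as W0. rewrite <- W0. clear W0. apply tends0_cont. apply continuous_derivable. eexists; apply w2_derive.
    - pose proof (tends0_lin _ _ _ _ g (-1) (T 1) (tends0_near0 _ _ Na)) as Q.
      replace (g * 1 + -1 * g) with 0 in Q by ring. exact Q.
    - replace (-1) with (- w1 (a + 1) 0) by (rewrite w1_0; ring).
      apply (tends0_cont (fun x => - w1 (a + 1) x)). apply continuous_derivable.
      eexists. apply (is_derive_opp (w1 (a + 1))). apply w1_derive.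
    - pose proof (tends0_lin _ _ _ _ g (-1) (T 0) (tends0_near0 _ _ Nb)) as Q.
      replace (g * 0 + -1 * 1) with (-1) in Q by ring. exact Q. }
  assert (th : PI * theta a = - (PI / 2)) by (unfold theta, a; field).
  assert (Ca : cos (PI * theta a) = 0) by (rewrite th, cos_neg; apply cos_PI2).
  assert (Sa : sin (PI * theta a) = -1) by (rewrite th, sin_neg, sin_PI2; ring).
  pose proof (cos_succ a) as Cb. pose proof (sin_succ a) as Sb. rewrite Ca in Sb. rewrite Sa in Cb.
  assert (X1 : forall m x, 0 < x -> (0 < m)%nat -> Xs a m x = 1).
  { intros m x Hx Hm. unfold Xs, a. replace (- - (1 / 2) - 1 / 2) with 0 by field. rewrite Rpower_O by auto.
    destruct m as [|m]; [lia|]. clear Hm. induction m as [|m IH]; [cbn [sumn]; rewrite ec_0; simpl; field|].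
    change (1 * (sumn (fun k => ec (- (1 / 2)) k / x ^ (2 * k)) (S m) + ec (- (1 / 2)) (S m) / x ^ (2 * S m)) = 1).
    rewrite ec_mhalf. unfold Rdiv at 3. rewrite Rmult_0_l, Rplus_0_r. apply IH. }
  assert (cH1a : cH1 a = 1).
  { unfold cH1, a. replace (1 / 4 + - (1 / 2) / 2) with 0 by field. replace (1 / 4 - - (1 / 2) / 2) with (1 / 2) by field.
    rewrite Rpower_O, rGamma_half by lra. field. lra. }
  assert (cG1a : cG1 a = 0).
  { unfold cG1, a. replace (1 / 4 + - (1 / 2) / 2) with 0 by field. rewrite rGamma_0. ring. }
  assert (cH2a : cH2 a = g).
  { unfold cH2, a. replace (3 / 4 - - (1 / 2) / 2) with 1 by field. rewrite rGamma_1, gval.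
    replace (- (1 / 2) / 2 - 1 / 4) with (- (1 / 2)) by field. ring. }
  assert (cG2a : cG2 a = 1).
  { unfold cG2, a. replace (- (- (1 / 2) / 2) - 1 / 4) with 0 by field. replace (3 / 4 + - (1 / 2) / 2) with (1 / 2) by field.
    rewrite Rpower_O, rGamma_half by lra. field. lra. }
  pose proof (cH1_cH2 (a + 1)) as C1. pose proof (cH1_pred (a + 1)) as C3.
  pose proof (cG1_cG2 (a + 1)) as C5.
  replace (a + 1 - 1) with a in * by ring.
  assert (cH1b : cH1 (a + 1) = 0) by (rewrite C1; unfold a; field).
  assert (cG1b : cG1 (a + 1) = 1) by (rewrite C5; auto).
  assert (cH2b : cH2 (a + 1) = 1) by (rewrite <- C3; auto).
  assert (cG2b : cG2 (a + 1) = g).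
  { unfold cG2, a. replace (3 / 4 + (- (1 / 2) + 1) / 2) with 1 by field. rewrite rGamma_1, gval.
    replace (- ((- (1 / 2) + 1) / 2) - 1 / 4) with (- (1 / 2)) by field. ring. }
  exists va, vb. split; [|split; [|split; [|split; [|split]]]]; auto.
  exists 1%nat. intros m Hm.
  split; [|split; [|split]].
  - intros x Hx. rewrite cH1a, cG1a, X1 by (auto; lia). unfold a. rewrite w1_mhalf by auto. ring.
  - intros x Hx. destruct (U2 x Hx) as [W _]. rewrite cH2a, cG2a, X1, Ca, Sa by (auto; lia). rewrite W. ring.
  - intros x Hx. destruct (U2 x Hx) as [_ W]. rewrite cH1b, cG1b, Cb, Sb. lra.
  - assert (DB : forall x, 0 < x -> is_derive vb x ((fun x => - (x * vb x) + (a + 1 / 2) * va x) x)) by apply (sys_dB a va vb HS).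
    assert (M1 : Mel 1 vb = g).
    { unfold Mel, g, vh. apply II_ext. intros t. unfold Kf. unfold vb, a. rewrite vB_mhalf. rewrite <- exp_plus. f_equal. field. }
    assert (MM : forall n, Mel (a + 1 + 1 / 2 + 2 * INR n) vb = ec (a + 1) n * g).
    { induction n as [|n IHn].
      - simpl. rewrite Rmult_0_r, Rplus_0_r, ec_0. unfold a. replace (- (1 / 2) + 1 + 1 / 2) with 1 by field. rewrite M1. ring.
      - pose proof (pos_INR n). rewrite S_INR. replace (a + 1 + 1 / 2 + 2 * (INR n + 1)) with (a + 1 + 1 / 2 + 2 * INR n + 2) by ring.
        rewrite (Mel_B a va vb) by (auto; unfold a; lra). rewrite IHn. replace (a + 1 / 2) with 0 by (unfold a; field).
        pose proof (ec_succ (a + 1) n) as EC. apply Rmult_eq_reg_l with (2 * (INR n + 1)); [|lra].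
        transitivity (ec (a + 1) (S n) * (2 * (INR n + 1)) * g); [rewrite EC; unfold a; field | ring]. }
    clear Hm. induction m as [|m IH].
    + assert (P0 : forall x, 0 < x -> is_derive (Pv 0 vb) x (- x * Pv 0 vb x + 2 / PI * g)).
      { intros x Hx. pose proof (PvB_derive a va vb 0 x HS Ra Rb ltac:(lra) Hx) as D.
        rewrite (Pv_step 0 vb _ x ltac:(lra) Hx Rb (rap_dB a va vb Ra Rb) DB) in D.
        replace (0 + 1) with 1 in D by ring. rewrite M1 in D. replace (a + 1 / 2) with 0 in D by (unfold a; field).
        rewrite Rmult_1_l, exp_Ropp, exp_ln in D by auto.
        replace (- x * Pv 0 vb x + 2 / PI * g) with (- x * (Pv 0 vb x - 2 / PI * / x * g) + 0 * Pv 1 va x); auto.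
        field. split; [apply PI_neq0 | lra]. }
      assert (L0 : tends0 (Pv 0 vb) 0).
      { pose proof (Pv_lim0 0 vb _ 1 ltac:(rewrite Rabs_R0; lra) DB Rb (rap_dB a va vb Ra Rb) Nb) as L.
        replace (PI * 0 / 2) with 0 in L by field. rewrite tan_0, Rmult_0_r in L. exact L. }
      assert (W2 : forall x, 0 < x -> is_derive (w2 (a + 1)) x (1 - x * w2 (a + 1) x)).
      { intros x Hx. replace (1 - x * w2 (a + 1) x) with (w1 (a + 1 + 1) x); [apply w2_derive|].
        pose proof (w_rec1 (a + 1) x) as W. replace (a + 1 - 1) with a in W by ring. unfold a in W at 2. rewrite (w1_mhalf x Hx) in W. lra. }
      (* [Df] solves y' = - x y. Paired with x [Df] it is a solution of the system for a = 1/2 with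
         zero initial values, so [sys_unique0] kills it. *)
      set (Df := fun x => 1 * w2 (a + 1) x + (- g) * Pv 0 vb x).
      pose proof sqrt_half_PI_sq as gg. fold g in gg.
      assert (DD : forall x, 0 < x -> is_derive Df x (- (x * Df x))).
      { intros x Hx. replace (- (x * Df x)) with (plus (1 * (1 - x * w2 (a + 1) x)) ((- g) * (- x * Pv 0 vb x + 2 / PI * g))).
        - apply (is_derive_plus (V := R_NormedModule)); [apply (is_derive_scal (w2 (a + 1))) | apply (is_derive_scal (Pv 0 vb))]; auto.
        - unfold plus, Df; simpl. transitivity (1 - x * w2 (a + 1) x + g * x * Pv 0 vb x - g * g * (2 / PI)); [field; apply PI_neq0|]. rewrite gg. ring. }
      assert (SD : sys (1 / 2) Df (fun x => x * Df x)).
      { intros x Hx. split; auto. replace (- x * (x * Df x) + (1 / 2 + 1 / 2) * Df x) with (Df x + x * - (x * Df x)) by field.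
        apply is_derive_xf. auto. }
      assert (TD : tends0 Df 0).
      { pose proof (tends0_lin _ _ _ _ 1 (- g) (tends0_cont (w2 (a + 1)) ltac:(apply continuous_derivable; eexists; apply w2_derive)) L0) as Q.
        rewrite w2_0 in Q. replace (1 * 0 + - g * 0) with 0 in Q by ring. exact Q. }
      assert (TD2 : tends0 (fun x => x * Df x) 0).
      { intros eps He. destruct (TD eps He) as (d & Hd & B). exists (Rmin 1 d). split; [apply Rmin_pos; lra|]. intros x [Hx Hx2].
        pose proof (Rmin_l 1 d). pose proof (Rmin_r 1 d). specialize (B x ltac:(lra)). rewrite Rminus_0_r in *.
        rewrite Rabs_mult, (Rabs_pos_eq x) by lra. pose proof (Rabs_pos (Df x)). nra. }
      intros x Hx. destruct (sys_unique0 (1 / 2) Df _ SD TD TD2 x Hx) as [Z _].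
      rewrite cH2b, cG2b, Cb, Sb. unfold Xs. cbn [sumn]. simpl INR.
      replace (a + 1 - 1 / 2 + 2 * 0) with 0 by (unfold a; field). unfold Df in Z. lra.
    + pose proof (pos_INR m).
      destruct (E_step (a + 1) vb _ m ltac:(unfold a; lra) Rb (rap_dB a va vb Ra Rb) DB) as [_ S4].
      apply S4; auto. rewrite cH2b, cG2b, Cb, MM.
      pose proof sqrt_half_PI_sq as gg. fold g in gg.
      transitivity (ec (a + 1) m * (g * g * (2 / PI))); [rewrite gg; ring | ring].
Qed.

(** Unit steps from [-1/2, 1/2) reach every real number: upward steps leave from points >= -1/2 and
    downward ones from points < 1/2, so the excluded values are never met. *)
Lemma good_all a : good a.
Proof.
  assert (B : forall c, - (1 / 2) <= c < 1 / 2 -> good c).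
  { intros c [[H1|H1] H2]; [now apply good_strip | rewrite <- H1; apply good_mhalf]. }
  destruct (Rle_lt_dec (- (1 / 2)) a) as [Ha|Ha].
  - assert (W : forall n a, - (1 / 2) <= a < 1 / 2 + INR n -> good a).
    { clear a Ha. induction n as [|n IH]; intros a Ha.
      - apply B. simpl in Ha. lra.
      - rewrite S_INR in Ha. destruct (Rlt_le_dec a (1 / 2)) as [H|H]; [apply B; lra|].
        replace a with (a - 1 + 1) by ring. apply good_up; [lra|]. apply IH. lra. }
    destruct (nfloor_ex (a + 1 / 2)) as [n [_ Hn]]; [lra|]. apply (W (S n)). rewrite S_INR. lra.
  - assert (W : forall n a, - (1 / 2) - INR n <= a < 1 / 2 -> good a).
    { clear a Ha. induction n as [|n IH]; intros a Ha.
      - apply B. simpl in Ha. lra.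
      - rewrite S_INR in Ha. destruct (Rle_lt_dec (- (1 / 2)) a) as [H|H]; [apply B; lra|].
        replace a with (a + 1 - 1) by ring. apply good_down; [lra|]. apply IH. lra. }
    destruct (nfloor_ex (- (1 / 2) - a)) as [n [_ Hn]]; [lra|]. apply (W (S n)). rewrite S_INR. lra.
Qed.

(** * The branch [t(w)] and the coefficients [G] *)

(** Coefficient bounds with explicit constants instead of a radius of convergence: they give tail
    estimates uniform in gamma. *)
Definition geo (C r : R) (a : nat -> R) : Prop := forall n, Rabs (a n) <= C * r ^ n.

Lemma geo_C C r a : geo C r a -> 0 <= C.
Proof. intros H. specialize (H O). simpl in H. pose proof (Rabs_pos (a O)). lra. Qed.

Lemma CV_disk_bounded a C q x : 0 <= q < 1 -> (forall n, Rabs (a n * x ^ n) <= C * q ^ n) -> CV_disk a x.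
Proof.
  intros Hq H. apply (ex_series_le (K := R_AbsRing) (V := R_CompleteNormedModule)) with (b := fun n => C * q ^ n).
  - intros n. unfold norm; simpl; unfold abs; simpl. rewrite Rabs_Rabsolu. apply H.
  - apply (ex_series_scal_l (K := R_AbsRing) C (fun n => q ^ n)). apply ex_series_geom. rewrite Rabs_pos_eq; lra.
Qed.

Lemma geo_radius C r a x : 0 < r -> geo C r a -> Rabs x * r < 1 -> Rbar_lt (Rabs x) (CV_radius a).
Proof.
  intros Hr Ha Hx. set (y := (Rabs x + / r) / 2). pose proof (Rabs_pos x).
  assert (Hi : 0 < / r) by now apply Rinv_0_lt_compat.
  assert (Hxr : Rabs x < / r). { apply Rmult_lt_reg_r with r; auto. rewrite Rinv_l; lra. }
  assert (Hy : 0 < y) by (unfold y; lra).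
  apply Rbar_lt_le_trans with y; [simpl; unfold y; lra|].
  apply CV_radius_ge. apply (CV_disk_bounded a C (r * y)).
  - split; [nra|]. apply Rmult_lt_reg_l with (/ r); auto. rewrite <- Rmult_assoc, Rinv_l, Rmult_1_l, Rmult_1_r by lra. unfold y; lra.
  - intros n. rewrite Rabs_mult, Rpow_mult_distr, <- RPow_abs, (Rabs_pos_eq y) by lra.
    rewrite <- Rmult_assoc. apply Rmult_le_compat_r; [apply pow_le; lra|]. apply Ha.
Qed.

Lemma geo_PSeries_bound C r a x : 0 < r -> geo C r a -> Rabs x * r <= 1 / 2 -> Rabs (PSeries a x) <= 2 * C.
Proof.
  intros Hr Ha Hx. pose proof (geo_C _ _ _ Ha). unfold PSeries.
  assert (Hq : forall n, 0 <= Rabs (a n * x ^ n) <= C * (1 / 2) ^ n).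
  { intros n. split; [apply Rabs_pos|]. rewrite Rabs_mult, <- RPow_abs.
    apply Rle_trans with (C * r ^ n * Rabs x ^ n).
    - apply Rmult_le_compat_r; [apply pow_le, Rabs_pos | apply Ha].
    - rewrite Rmult_assoc, <- Rpow_mult_distr. apply Rmult_le_compat_l; auto. apply pow_incr. pose proof (Rabs_pos x). nra. }
  assert (Hg : ex_series (fun n => C * (1 / 2) ^ n)).
  { apply (ex_series_scal_l (K := R_AbsRing) C (fun n => (1 / 2) ^ n)). apply ex_series_geom. rewrite Rabs_pos_eq; lra. }
  eapply Rle_trans; [apply Series_Rabs|].
  - apply (ex_series_le (K := R_AbsRing) (V := R_CompleteNormedModule)) with (b := fun n => C * (1 / 2) ^ n); auto.
    intros n. unfold norm; simpl; unfold abs; simpl. rewrite Rabs_Rabsolu. apply Hq.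
  - eapply Rle_trans; [apply (Series_le _ _ Hq Hg)|]. rewrite Series_scal_l, Series_geom by (rewrite Rabs_pos_eq; lra). right. field.
Qed.

Lemma geo_tail C r a N x : 0 < r -> geo C r a -> Rabs x * r <= 1 / 2 ->
  Rabs (PSeries a x - sumn (fun n => a n * x ^ n) N) <= 2 * C * r ^ N * Rabs x ^ N.
Proof.
  intros Hr Ha Hx. pose proof (geo_C _ _ _ Ha) as HC.
  destruct N as [|N].
  - simpl. rewrite Rminus_0_r, !Rmult_1_r. now apply (geo_PSeries_bound C r).
  - rewrite (PSeries_decr_n a N x).
    + replace (sum_f_R0 (fun k => a k * x ^ k) N) with (sumn (fun k => a k * x ^ k) (S N)).
      2: { rewrite <- sumn_sum_f_R0 by lia. f_equal. lia. }
      match goal with |- Rabs (?u + ?v - ?u) <= _ => replace (u + v - u) with v by ring end.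
      rewrite Rabs_mult, <- RPow_abs, Rmult_comm. apply Rmult_le_compat_r; [apply pow_le, Rabs_pos|].
      replace (2 * C * r ^ S N) with (2 * (C * r ^ S N)) by ring. apply (geo_PSeries_bound (C * r ^ S N) r); auto.
      intros n. unfold PS_decr_n. rewrite Rmult_assoc, <- pow_add. apply Ha.
    + apply CV_radius_inside. apply (geo_radius C r); auto. lra.
Qed.

Definition local_dep (F : nat -> (nat -> R) -> R) : Prop :=
  forall n u v, (forall k, (k < n)%nat -> u k = v k) -> F n u = F n v.

Fixpoint cov_tab (F : nat -> (nat -> R) -> R) (n : nat) : nat -> R :=
  match n with O => fun _ => 0 | S m => fun k => if Nat.eqb k m then F m (cov_tab F m) else cov_tab F m k end.

(** Course-of-values recursion: [cov_tab] n holds the first n values and 0 beyond them, and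
    [local_dep] guarantees that only the former are read. *)
Lemma cov_exists F : local_dep F -> exists s, forall n, s n = F n s.
Proof.
  intros HF. exists (fun n => cov_tab F (S n) n).
  assert (W : forall m k, (k < m)%nat -> cov_tab F m k = cov_tab F (S k) k).
  { induction m as [|m IH]; intros k Hk; [lia|].
    destruct (Nat.eq_dec k m) as [->|Hne]; auto.
    change (cov_tab F (S m) k) with (if Nat.eqb k m then F m (cov_tab F m) else cov_tab F m k).
    replace (Nat.eqb k m) with false by (symmetry; now apply Nat.eqb_neq). apply IH. lia. }
  intros n. change (cov_tab F (S n) n) with (if Nat.eqb n n then F n (cov_tab F n) else cov_tab F n n).
  rewrite Nat.eqb_refl. apply HF. intros k Hk. now apply W.
Qed.

Lemma strong_ind (P : nat -> Prop) : (forall n, (forall k, (k < n)%nat -> P k) -> P n) -> forall n, P n.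
Proof.
  intros H n. apply (Wf_nat.lt_wf_ind n P). auto.
Qed.

Lemma sumn_rev f n : sumn (fun i => f (n - 1 - i)%nat) n = sumn f n.
Proof.
  induction n as [|n IH]; [reflexivity|]. rewrite sumn_Sl. cbn [sumn]. replace (S n - 1 - 0)%nat with n by lia.
  rewrite (sumn_ext _ (fun i => f (n - 1 - i)%nat)); [rewrite IH; ring|]. intros k Hk. f_equal. lia.
Qed.

Lemma sumn_le f g n : (forall k, (k < n)%nat -> f k <= g k) -> sumn f n <= sumn g n.
Proof.
  induction n as [|n IH]; simpl; intros H; [lra|]. apply Rplus_le_compat; auto.
Qed.

Lemma sumn_abs f n : Rabs (sumn f n) <= sumn (fun k => Rabs (f k)) n.
Proof.
  induction n as [|n IH]; simpl; [rewrite Rabs_R0; lra|]. eapply Rle_trans; [apply Rabs_triang|]. lra.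
Qed.

Lemma sum_inv_sq n : sumn (fun i => / (INR i + 2) ^ 2) n <= 1.
Proof.
  assert (H : sumn (fun i => / (INR i + 2) ^ 2) n <= 1 - / (INR n + 1)).
  { induction n as [|n IH]; [simpl; lra|]. cbn [sumn]. rewrite S_INR. pose proof (pos_INR n).
    assert (Q : / (INR n + 2) ^ 2 <= / (INR n + 1) - / (INR n + 1 + 1)).
    { replace (/ (INR n + 1) - / (INR n + 1 + 1)) with (/ ((INR n + 1) * (INR n + 2))) by (field; lra).
      apply Rinv_le_contravar; nra. }
    lra. }
  pose proof (pos_INR n). assert (0 < / (INR n + 1)) by (apply Rinv_0_lt_compat; lra). lra.
Qed.

(** Inverse squares are stable under convolution: 1 / (p q) = (1/p + 1/q) / (p + q) reduces it to
    two sums of inverse squares. Constant weights would lose a factor m. *)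
Lemma sum_conv_sq m : sumn (fun i => / (INR i + 2) ^ 2 * / (INR (m - i) + 1) ^ 2) m <= 4 / (INR m + 2) ^ 2.
Proof.
  pose proof (pos_INR m) as Hm.
  apply Rle_trans with (sumn (fun i => 2 / (INR m + 2) ^ 2 * (/ (INR i + 2) ^ 2) + 2 / (INR m + 2) ^ 2 * (/ (INR (m - 1 - i) + 2) ^ 2)) m).
  - apply sumn_le. intros i Hi.
    assert (E : INR (m - i) = INR (m - 1 - i) + 1) by (rewrite <- S_INR; f_equal; lia).
    assert (E2 : INR m = INR i + INR (m - 1 - i) + 1) by (rewrite <- plus_INR, <- S_INR; f_equal; lia).
    pose proof (pos_INR i) as Hi0. pose proof (pos_INR (m - 1 - i)) as Hj0. rewrite E, E2.
    set (p := INR i) in *. set (q := INR (m - 1 - i)) in *.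
    replace (q + 1 + 1) with (q + 2) by ring.
    assert (P1 : 0 < / (p + 2)) by (apply Rinv_0_lt_compat; lra). assert (P2 : 0 < / (q + 2)) by (apply Rinv_0_lt_compat; lra).
    assert (P3 : 0 < / (p + q + 1 + 2)) by (apply Rinv_0_lt_compat; lra).
    assert (K : / (p + 2) * / (q + 2) <= / (p + q + 1 + 2) * (/ (p + 2) + / (q + 2))).
    { apply Rmult_le_reg_r with ((p + 2) * (q + 2) * (p + q + 1 + 2)); [apply Rmult_lt_0_compat; nra|].
      replace (/ (p + 2) * / (q + 2) * ((p + 2) * (q + 2) * (p + q + 1 + 2))) with (p + q + 1 + 2) by (field; lra).
      replace (/ (p + q + 1 + 2) * (/ (p + 2) + / (q + 2)) * ((p + 2) * (q + 2) * (p + q + 1 + 2))) with (p + q + 4) by (field; lra). lra. }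
    rewrite <- !pow_inv. unfold Rdiv. rewrite <- !pow_inv.
    set (A1 := / (p + 2)) in *. set (A2 := / (q + 2)) in *. set (A3 := / (p + q + 1 + 2)) in *.
    assert (K2 : (A1 * A2) ^ 2 <= (A3 * (A1 + A2)) ^ 2) by (apply pow_incr; split; [nra|auto]).
    pose proof (pow2_ge_0 (A1 - A2)). pose proof (pow2_ge_0 A3). nra.
  - rewrite sumn_plus, !sumn_scal. rewrite (sumn_rev (fun i => / (INR i + 2) ^ 2)). pose proof (sum_inv_sq m).
    assert (0 < 2 / (INR m + 2) ^ 2) by (apply Rdiv_lt_0_compat; nra).
    replace (4 / (INR m + 2) ^ 2) with (2 / (INR m + 2) ^ 2 * 1 + 2 / (INR m + 2) ^ 2 * 1) by (field; nra).
    apply Rplus_le_compat; apply Rmult_le_compat_l; lra.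
Qed.

(* With [t = 1 + w s(w)] the equation [(t - 1) t' = w t] reads [s^2 = 1 + sum_n 2 s_(n-1) / (n + 2) w^n]. *)
Definition s_rec (n : nat) (u : nat -> R) : R :=
  match n with O => 1 | S m => u m / (INR m + 3) - 1 / 2 * sumn (fun i => u (S i) * u (m - i)%nat) m end.

(** A bare geometric bound does not survive the quadratic convolution, so the induction carries the
    weight 1 / (n + 1)^2. The factor 1/4 lets the convolution use up half of the bound, and the
    ratio 6 leaves the other half to the linear term. *)
Lemma s_exists : exists s, s O = 1 /\ geo 1 6 s /\
  (forall m, 2 * s (S m) + sumn (fun i => s (S i) * s (m - i)%nat) m = 2 * s m / (INR m + 3)).
Proof.
  destruct (cov_exists s_rec) as [s Hs].
  { intros n u v H. destruct n as [|m]; [reflexivity|]. simpl. rewrite H by lia. f_equal. f_equal.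
    apply sumn_ext. intros k Hk. rewrite !H by lia. reflexivity. }
  exists s. assert (S0 : s O = 1) by (rewrite Hs; reflexivity). split; auto.
  assert (SS : forall m, s (S m) = s m / (INR m + 3) - 1 / 2 * sumn (fun i => s (S i) * s (m - i)%nat) m) by (intros m; rewrite Hs; reflexivity).
  split; [|intros m; rewrite SS; field; pose proof (pos_INR m); lra].
  assert (B : forall n, (1 <= n)%nat -> Rabs (s n) <= 1 / 4 * 6 ^ n / (INR n + 1) ^ 2).
  { apply (strong_ind (fun n => (1 <= n)%nat -> Rabs (s n) <= 1 / 4 * 6 ^ n / (INR n + 1) ^ 2)).
    (* s 0 = 1 violates the weighted bound 1/4. From n = 2 on the recurrence refers only to indices
       >= 1; n = 1 is computed. *)
    intros n IH Hn. destruct n as [|[|m']]; [lia| |].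
    { rewrite SS, S0. simpl. rewrite Rabs_pos_eq; lra. }
    remember (S m') as m eqn:Em. rewrite SS, S_INR. pose proof (pos_INR m) as Hm.
    eapply Rle_trans; [apply Rabs_triang|]. rewrite Rabs_Ropp.
    assert (Q1 : Rabs (1 / 2 * sumn (fun i => s (S i) * s (m - i)%nat) m) <= 1 / 8 * 6 ^ S m / (INR m + 1 + 1) ^ 2).
    { rewrite Rabs_mult, (Rabs_pos_eq (1 / 2)) by lra.
      apply Rle_trans with (1 / 2 * sumn (fun i => 1 / 16 * 6 ^ S m * (/ (INR i + 2) ^ 2 * / (INR (m - i) + 1) ^ 2)) m).
      - apply Rmult_le_compat_l; [lra|]. eapply Rle_trans; [apply sumn_abs|]. apply sumn_le. intros i Hi. rewrite Rabs_mult.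
        pose proof (IH (S i) ltac:(lia) ltac:(lia)) as I1. pose proof (IH (m - i)%nat ltac:(lia) ltac:(lia)) as I2.
        rewrite S_INR in I1. replace (INR i + 1 + 1) with (INR i + 2) in I1 by ring.
        eapply Rle_trans; [apply Rmult_le_compat; [apply Rabs_pos | apply Rabs_pos | apply I1 | apply I2]|].
        right. replace (6 ^ S m) with (6 ^ S i * 6 ^ (m - i)) by (rewrite <- pow_add; f_equal; lia).
        pose proof (pos_INR i). pose proof (pos_INR (m - i)). field. lra.
      - rewrite sumn_scal. pose proof (sum_conv_sq m) as Q. pose proof (pow_lt 6 (S m) ltac:(lra)) as P6.
        replace (1 / 8 * 6 ^ S m / (INR m + 1 + 1) ^ 2) with (1 / 2 * (1 / 16 * 6 ^ S m * (4 / (INR m + 2) ^ 2))) by (field; lra).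
        apply Rmult_le_compat_l; [lra|]. apply Rmult_le_compat_l; [lra|]. exact Q. }
    assert (Q2 : Rabs (s m / (INR m + 3)) <= 1 / 8 * 6 ^ S m / (INR m + 1 + 1) ^ 2).
    { unfold Rdiv at 1. rewrite Rabs_mult, (Rabs_pos_eq (/ _)) by (left; apply Rinv_0_lt_compat; lra).
      - pose proof (IH m ltac:(lia) ltac:(lia)) as I1. pose proof (pow_lt 6 m ltac:(lra)) as P6.
        set (k := INR m) in *. assert (Hk : 1 <= k) by (unfold k; subst m; rewrite S_INR; pose proof (pos_INR m'); lra).
        eapply Rle_trans; [apply Rmult_le_compat_r; [left; apply Rinv_0_lt_compat; lra | apply I1]|].
        change (6 ^ S m) with (6 * 6 ^ m).
        replace (1 / 4 * 6 ^ m / (k + 1) ^ 2 * / (k + 3)) with (6 ^ m * (1 / 4 * / ((k + 1) ^ 2 * (k + 3)))) by (field; lra).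
        replace (1 / 8 * (6 * 6 ^ m) / (k + 1 + 1) ^ 2) with (6 ^ m * (3 / 4 * / (k + 2) ^ 2)) by (field; lra).
        apply Rmult_le_compat_l; [lra|].
        apply Rmult_le_reg_r with ((k + 1) ^ 2 * (k + 3) * (k + 2) ^ 2); [apply Rmult_lt_0_compat; nra|].
        replace (1 / 4 * / ((k + 1) ^ 2 * (k + 3)) * ((k + 1) ^ 2 * (k + 3) * (k + 2) ^ 2)) with (1 / 4 * (k + 2) ^ 2) by (field; nra).
        replace (3 / 4 * / (k + 2) ^ 2 * ((k + 1) ^ 2 * (k + 3) * (k + 2) ^ 2)) with (3 / 4 * ((k + 1) ^ 2 * (k + 3))) by (field; nra). nra. }
    replace (1 / 4 * 6 ^ S m / (INR m + 1 + 1) ^ 2) with (1 / 8 * 6 ^ S m / (INR m + 1 + 1) ^ 2 + 1 / 8 * 6 ^ S m / (INR m + 1 + 1) ^ 2) by (field; lra).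
    lra. }
  intros n. destruct n as [|n].
  - rewrite S0, Rabs_R1. simpl. lra.
  - eapply Rle_trans; [apply B; lia|]. pose proof (pow_lt 6 (S n) ltac:(lra)) as P6. pose proof (pos_INR (S n)).
    unfold Rdiv. rewrite Rmult_1_l. assert (0 < / (INR (S n) + 1) ^ 2 <= 1).
    { split; [apply Rinv_0_lt_compat; nra|]. rewrite <- Rinv_1. apply Rinv_le_contravar; nra. }
    nra.
Qed.

Lemma PS_euler (c : nat -> R) x : Rbar_lt (Rabs x) (CV_radius c) ->
  ex_pseries (fun k => INR k * c k) x /\ x * PSeries (PS_derive c) x = PSeries (fun k => INR k * c k) x.
Proof.
  intros H.
  assert (E : forall k, PS_incr_1 (PS_derive c) k = INR k * c k).
  { intros [|k]; [unfold PS_incr_1, zero; simpl; ring | reflexivity]. }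
  split.
  - apply (ex_pseries_ext (PS_incr_1 (PS_derive c)) _ x E).
    apply ex_pseries_incr_1. apply CV_radius_inside. now rewrite CV_radius_derive.
  - rewrite <- PSeries_incr_1. apply PSeries_ext. exact E.
Qed.

Lemma geo_derive C r a x : 0 < r -> geo C r a -> Rabs x * r < 1 -> is_derive (PSeries a) x (PSeries (PS_derive a) x).
Proof. intros Hr Ha Hx. apply is_derive_PSeries. now apply (geo_radius C r). Qed.

Lemma PS_mult_S (a b : nat -> R) m : PS_mult a b (S m) = a O * b (S m) + sumn (fun i => a (S i) * b (m - i)%nat) m + a (S m) * b O.
Proof.
  unfold PS_mult. replace (sum_f_R0 (fun k => a k * b (S m - k)%nat) (S m)) with (sumn (fun k => a k * b (S m - k)%nat) (S (S m))).
  2: { rewrite <- sumn_sum_f_R0 by lia. reflexivity. }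
  rewrite sumn_Sl. cbn [sumn]. replace (S m - 0)%nat with (S m) by lia. replace (S m - S m)%nat with O by lia.
  replace (sumn (fun k => a (S k) * b (S m - S k)%nat) m) with (sumn (fun i => a (S i) * b (m - i)%nat) m); [ring|].
  apply sumn_ext. intros. reflexivity.
Qed.

Lemma PS_mult_sumn a b m : PS_mult a b m = a O * b m + sumn (fun i => a (S i) * b (m - S i)%nat) m.
Proof.
  unfold PS_mult. replace (sum_f_R0 (fun k => a k * b (m - k)%nat) m) with (sumn (fun k => a k * b (m - k)%nat) (S m)).
  2: { rewrite <- sumn_sum_f_R0 by lia. f_equal. lia. }
  rewrite sumn_Sl. now replace (m - 0)%nat with m by lia.
Qed.

Definition sser (s : nat -> R) : Prop := s O = 1 /\ geo 1 6 s /\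
  (forall m, 2 * s (S m) + sumn (fun i => s (S i) * s (m - i)%nat) m = 2 * s m / (INR m + 3)).

Lemma sser_radius s w : sser s -> Rabs w < / 24 -> Rbar_lt (Rabs w) (CV_radius s).
Proof. intros (_ & H & _) Hw. apply (geo_radius 1 6); auto; lra. Qed.

Lemma ball_Rabs (x y e : R) : ball x e y -> Rabs (y - x) < e.
Proof. intros H. exact H. Qed.

Lemma sser_bounds s w : sser s -> Rabs w < / 24 -> 1 / 2 <= PSeries s w <= 2.
Proof.
  intros (H0 & H & _) Hw. pose proof (geo_tail 1 6 s 1 w ltac:(lra) H ltac:(lra)) as K. simpl in K. rewrite H0 in K.
  apply Rabs_le_between in K. lra.
Qed.

(** The coefficients of Q = s^2 are known, so differentiating x^2 Q = (x s)^2 in two ways gives (t -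
    1) t' = w t for t = 1 + w s, divided by w. The point w = 0 is checked directly. *)
Lemma sser_ode s w : sser s -> Rabs w < / 24 ->
  PSeries s w * (PSeries s w + w * PSeries (PS_derive s) w) = 1 + w * PSeries s w.
Proof.
  intros Hs Hw. pose proof (sser_radius s w Hs Hw) as Hr. destruct Hs as (H0 & Hg & Hrec).
  destruct (Req_dec w 0) as [->|Hw0].
  { rewrite !PSeries_0, H0. ring. }
  set (Q := PS_mult s s).
  assert (HQ : Q O = 1) by (unfold Q, PS_mult; simpl; rewrite H0; ring).
  assert (HQS : forall m, Q (S m) = 2 * s m / (INR m + 3)).
  { intros m. unfold Q. rewrite PS_mult_S, H0, <- Hrec. ring. }
  assert (GQ : geo 1 6 Q).
  { intros [|m]; [rewrite HQ, Rabs_R1; simpl; lra|]. rewrite HQS. unfold Rdiv. pose proof (pos_INR m).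
    rewrite !Rabs_mult, (Rabs_pos_eq 2), (Rabs_pos_eq (/ _)) by (try (left; apply Rinv_0_lt_compat); lra).
    specialize (Hg m). change (6 ^ S m) with (6 * 6 ^ m). pose proof (pow_lt 6 m ltac:(lra)).
    assert (0 < / (INR m + 3) <= 1) by (split; [apply Rinv_0_lt_compat; lra | apply Rle_trans with (/ 1); [apply Rinv_le_contravar; lra | rewrite Rinv_1; lra]]).
    pose proof (Rabs_pos (s m)). nra. }
  assert (RQ : Rbar_lt (Rabs w) (CV_radius Q)) by (apply (geo_radius 1 6); auto; lra).
  assert (D1 : is_derive (fun x => x ^ 2 * PSeries Q x) w (2 * w * PSeries Q w + w ^ 2 * PSeries (PS_derive Q) w)).
  { assert (DQ : is_derive (PSeries Q) w (PSeries (PS_derive Q) w)) by now apply is_derive_PSeries.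
    auto_derive; [exists (PSeries (PS_derive Q) w); exact DQ|].
    replace (Derive (fun x => PSeries Q x) w) with (PSeries (PS_derive Q) w) by (symmetry; apply is_derive_unique, DQ). ring. }
  assert (Ds : is_derive (PSeries s) w (PSeries (PS_derive s) w)) by now apply is_derive_PSeries.
  assert (D2 : is_derive (fun x => x ^ 2 * PSeries Q x) w (2 * (w * PSeries s w) * (PSeries s w + w * PSeries (PS_derive s) w))).
  { apply (is_derive_ext_loc (fun x => (x * PSeries s x) ^ 2)).
    - assert (He : 0 < / 24 - Rabs w) by lra. exists (mkposreal _ He). intros x Hx.
      assert (HHx : Rabs x < / 24).
      { apply ball_Rabs in Hx. simpl in Hx. pose proof (Rabs_triang_inv x w). lra. }
      assert (Hrx : Rbar_lt (Rabs x) (CV_radius s)) by (apply (geo_radius 1 6); [lra | exact Hg | lra]).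
      unfold Q. rewrite PSeries_mult by exact Hrx. match goal with |- ?u = ?v => change (@eq R u v) end. ring.
    - auto_derive; [exists (PSeries (PS_derive s) w); exact Ds|].
      replace (Derive (fun x => PSeries s x) w) with (PSeries (PS_derive s) w) by (symmetry; apply is_derive_unique, Ds). ring. }
  pose proof (is_derive_unique _ _ _ D1) as U1. pose proof (is_derive_unique _ _ _ D2) as U2. rewrite U1 in U2.
  destruct (PS_euler Q w RQ) as [E1' E2'].
  assert (E3 : 2 * PSeries Q w + w * PSeries (PS_derive Q) w = 2 + w * (2 * PSeries s w)).
  { rewrite E2', <- PSeries_scal, <- PSeries_scal, <- PSeries_plus; auto.
    2: { apply (ex_pseries_scal (V := R_NormedModule)); [apply Rmult_comm | now apply CV_radius_inside]. }
    rewrite PSeries_decr_1.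
    - f_equal.
      + unfold PS_plus, PS_scal, plus, scal; simpl; unfold mult; simpl. rewrite HQ. ring.
      + f_equal. apply PSeries_ext. intros n. unfold PS_decr_1, PS_plus, PS_scal, plus, scal; simpl; unfold mult; simpl.
        change (match n with O => 1 | S _ => INR n + 1 end) with (INR (S n)).
        rewrite HQS, S_INR. pose proof (pos_INR n). field. lra.
    - apply (ex_pseries_plus (V := R_NormedModule)); auto.
      apply (ex_pseries_scal (V := R_NormedModule)); [apply Rmult_comm | now apply CV_radius_inside]. }
  apply Rmult_eq_reg_l with (2 * w); [|lra].
  transitivity (w * (2 * PSeries Q w + w * PSeries (PS_derive Q) w)); [rewrite <- (Rmult_assoc 2 w) in U2; nra|].
  rewrite E3. ring.
Qed.

(** The variable Y = ln t of the overview as a function of w. *)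
Definition ybr (s : nat -> R) (w : R) : R := ln (1 + w * PSeries s w).

Lemma sser_tau_pos s w : sser s -> Rabs w < / 24 -> 0 < 1 + w * PSeries s w.
Proof.
  intros Hs Hw. pose proof (sser_bounds s w Hs Hw). apply Rabs_lt_between in Hw. nra.
Qed.

Lemma ybr_exp s w : sser s -> Rabs w < / 24 -> exp (ybr s w) = 1 + w * PSeries s w.
Proof. intros Hs Hw. unfold ybr. apply exp_ln. now apply sser_tau_pos. Qed.

Lemma sser_derive s w : sser s -> Rabs w < / 24 -> is_derive (PSeries s) w (PSeries (PS_derive s) w).
Proof. intros Hs Hw. apply is_derive_PSeries. now apply sser_radius. Qed.

Lemma tau_derive s w : sser s -> Rabs w < / 24 ->
  is_derive (fun w => 1 + w * PSeries s w) w ((1 + w * PSeries s w) / PSeries s w).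
Proof.
  intros Hs Hw. pose proof (sser_derive s w Hs Hw) as D. pose proof (sser_bounds s w Hs Hw).
  rewrite <- (sser_ode s w Hs Hw). auto_derive; [exists (PSeries (PS_derive s) w); exact D|].
  replace (Derive (fun x => PSeries s x) w) with (PSeries (PS_derive s) w) by (symmetry; apply is_derive_unique, D). field. lra.
Qed.

Lemma ybr_derive s w : sser s -> Rabs w < / 24 -> is_derive (ybr s) w (/ PSeries s w).
Proof.
  intros Hs Hw. pose proof (tau_derive s w Hs Hw) as D. pose proof (sser_bounds s w Hs Hw). pose proof (sser_tau_pos s w Hs Hw).
  unfold ybr. replace (/ PSeries s w) with (scal ((1 + w * PSeries s w) / PSeries s w) (/ (1 + w * PSeries s w))).
  - apply (is_derive_comp ln (fun w => 1 + w * PSeries s w)); [now apply is_derive_ln | exact D].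
  - unfold scal; simpl; unfold mult; simpl. field. lra.
Qed.

Lemma ybr_0 s : ybr s 0 = 0.
Proof. unfold ybr. rewrite Rmult_0_l, Rplus_0_r. apply ln_1. Qed.

Lemma const_of_zero_derive (f : R -> R) r : (forall w, Rabs w < r -> is_derive f w 0) -> forall w, Rabs w < r -> f w = f 0.
Proof.
  intros H w Hw.
  destruct (MVT_gen f 0 w (fun _ => 0)) as (c & _ & E).
  - intros x Hx. apply H. unfold Rmin, Rmax in Hx. apply Rabs_lt_between in Hw. apply Rabs_def1; destruct (Rle_dec 0 w); lra.
  - intros x Hx. apply continuity_pt_filterlim. apply (ex_derive_continuous (K := R_AbsRing) (V := R_NormedModule)). exists 0.
    apply H. unfold Rmin, Rmax in Hx. apply Rabs_lt_between in Hw. apply Rabs_def1; destruct (Rle_dec 0 w); lra.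
  - lra.
Qed.

(** Both sides vanish at 0 and have derivative (t - 1) / s = w. *)
Lemma ybr_phi s w : sser s -> Rabs w < / 24 -> exp (ybr s w) - 1 - ybr s w = w ^ 2 / 2.
Proof.
  intros Hs Hw. rewrite ybr_exp by auto.
  assert (E : forall w, Rabs w < / 24 -> (fun w => (1 + w * PSeries s w) - 1 - ybr s w - w ^ 2 / 2) w = (fun w => (1 + w * PSeries s w) - 1 - ybr s w - w ^ 2 / 2) 0).
  { apply const_of_zero_derive. intros u Hu. pose proof (tau_derive s u Hs Hu) as D1. pose proof (ybr_derive s u Hs Hu) as D2.
    pose proof (sser_bounds s u Hs Hu).
    evar_last.
    - apply (is_derive_minus (V := R_NormedModule) (fun w => (1 + w * PSeries s w) - 1 - ybr s w) (fun w => w ^ 2 / 2)).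
      + apply (is_derive_minus (V := R_NormedModule) (fun w => (1 + w * PSeries s w) - 1) (ybr s)); [|exact D2].
        apply (is_derive_minus (V := R_NormedModule) (fun w => (1 + w * PSeries s w)) (fun _ => 1)); [exact D1 | apply (is_derive_const (V := R_NormedModule))].
      + instantiate (1 := u). auto_derive; auto. field.
    - unfold minus, plus, opp, zero; simpl. field. lra. }
  specialize (E w Hw). cbv beta in E. rewrite ybr_0 in E. lra.
Qed.

Lemma ln_lt_sub1 x : 0 < x -> x <> 1 -> ln x < x - 1.
Proof.
  intros Hx Hne. assert (ln x <> 0). { intros E. apply Hne. rewrite <- (exp_ln x Hx), E. apply exp_0. }
  pose proof (exp_ineq1 (ln x) H). rewrite exp_ln in H0; lra.
Qed.

Lemma phi_inj_right t1 t2 : 1 <= t1 -> t1 < t2 -> t1 - ln t1 < t2 - ln t2.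
Proof.
  intros H1 H2. pose proof (ln_lt_sub1 (t2 / t1) ltac:(apply Rdiv_lt_0_compat; lra)) as K.
  assert (E : t2 / t1 <> 1). { intros E. apply (f_equal (fun u => u * t1)) in E. field_simplify in E; lra. }
  specialize (K E). unfold Rdiv in K at 1. rewrite ln_mult, ln_Rinv in K by (try apply Rinv_0_lt_compat; lra).
  assert (t2 / t1 - 1 <= t2 - t1).
  { replace (t2 / t1 - 1) with ((t2 - t1) * / t1) by (field; lra). assert (/ t1 <= / 1) by (apply Rinv_le_contravar; lra). rewrite Rinv_1 in H. nra. }
  lra.
Qed.

Lemma phi_inj_left t1 t2 : 0 < t1 -> t1 < t2 -> t2 <= 1 -> t2 - ln t2 < t1 - ln t1.
Proof.
  intros H1 H2 H3. pose proof (ln_lt_sub1 (t1 / t2) ltac:(apply Rdiv_lt_0_compat; lra)) as K.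
  assert (E : t1 / t2 <> 1). { intros E. apply (f_equal (fun u => u * t2)) in E. field_simplify in E; lra. }
  specialize (K E). unfold Rdiv in K at 1. rewrite ln_mult, ln_Rinv in K by (try apply Rinv_0_lt_compat; lra).
  assert (t1 / t2 - 1 <= - (t2 - t1)).
  { replace (t1 / t2 - 1) with (- ((t2 - t1) * / t2)) by (field; lra). assert (/ 1 <= / t2) by (apply Rinv_le_contravar; lra). rewrite Rinv_1 in H. nra. }
  lra.
Qed.

(** t - ln t is injective on either side of 1, and the sign of (t - 1) w selects the side. *)
Lemma phi_inj_sign t1 t2 w : 0 < t1 -> 0 < t2 -> 0 < (t1 - 1) * w -> 0 < (t2 - 1) * w -> t1 - ln t1 = t2 - ln t2 -> t1 = t2.
Proof.
  intros P1 P2 S1 S2 E. destruct (Rtotal_order t1 t2) as [H|[H|H]]; auto; exfalso.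
  - destruct (Rle_dec 1 t1); [pose proof (phi_inj_right t1 t2); lra|].
    destruct (Rle_dec t2 1); [pose proof (phi_inj_left t1 t2); lra|]. nra.
  - destruct (Rle_dec 1 t2); [pose proof (phi_inj_right t2 t1); lra|].
    destruct (Rle_dec t1 1); [pose proof (phi_inj_left t2 t1); lra|]. nra.
Qed.

Lemma tau_is_branch s : sser s -> is_t_branch (fun w => 1 + w * PSeries s w).
Proof.
  intros Hs. assert (H24 : 0 < / 24) by lra.
  split; [|split].
  - exists (fun n => match n with O => 1 | S k => s k end). exists (mkposreal _ H24). intros w Hw. apply ball_Rabs in Hw. simpl in Hw. rewrite Rminus_0_r in Hw.
    assert (E : ex_pseries (fun n => match n with O => 1 | S k => s k end) w).
    { apply CV_radius_inside. apply (geo_radius 1 6); [lra| |lra]. destruct Hs as (_ & Hg & _).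
      intros [|n]; [rewrite Rabs_R1; simpl; lra|]. specialize (Hg n). change (6 ^ S n) with (6 * 6 ^ n). pose proof (pow_lt 6 n ltac:(lra)). lra. }
    replace (1 + w * PSeries s w) with (PSeries (fun n => match n with O => 1 | S k => s k end) w); [now apply PSeries_correct|].
    rewrite PSeries_decr_1 by exact E. reflexivity.
  - exists (mkposreal _ H24). intros w Hw. apply ball_Rabs in Hw. simpl in Hw. rewrite Rminus_0_r in Hw.
    pose proof (ybr_phi s w Hs Hw) as K. rewrite ybr_exp in K by auto. unfold ybr in K. lra.
  - apply (is_lim_ext_loc (PSeries s)).
    + exists (mkposreal _ H24). intros w Hw Hne. field. exact Hne.
    + replace (Finite 1) with (Finite (PSeries s 0)) by (rewrite PSeries_0; f_equal; apply Hs).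
      apply is_lim_continuity. apply PSeries_continuity. apply sser_radius; auto. rewrite Rabs_R0. lra.
Qed.

(** The limit (t - 1) / w -> 1 forces t > 0 near 0, where the total function [ln] is the true
    logarithm, and fixes the sign of t - 1. *)
Lemma branch_pos t : is_t_branch t -> locally' 0 (fun w => 0 < t w /\ 0 < (t w - 1) * w).
Proof.
  intros (_ & _ & Hl). apply is_lim_spec in Hl. destruct (Hl (mkposreal (1 / 2) ltac:(lra))) as [d Hd].
  assert (Hm : 0 < Rmin d (1 / 2)) by (apply Rmin_glb_lt; [apply cond_pos | lra]).
  exists (mkposreal _ Hm). intros w Hw Hne. pose proof Hw as Hw'. apply ball_Rabs in Hw'. simpl in Hw'. rewrite Rminus_0_r in Hw'.
  pose proof (Rmin_l d (1 / 2)). pose proof (Rmin_r d (1 / 2)).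
  assert (B : ball 0 d w). { apply ball_le with (Rmin d (1 / 2)); [lra | exact Hw]. }
  specialize (Hd w B Hne). cbn [pos] in Hd. set (q := (t w - 1) / w) in *.
  assert (E : t w = 1 + q * w) by (unfold q; field; exact Hne). apply Rabs_lt_between in Hd. apply Rabs_lt_between in Hw'.
  rewrite E. split; [nra|]. assert (0 < w ^ 2) by (apply pow2_gt_0; exact Hne). nra.
Qed.

Lemma t_branch_eq s : sser s -> locally' 0 (fun w => t_branch w = 1 + w * PSeries s w).
Proof.
  intros Hs. pose proof (tau_is_branch s Hs) as Ht.
  assert (Hb : is_t_branch t_branch) by (unfold t_branch; apply epsilon_spec; eexists; exact Ht).
  pose proof (branch_pos _ Ht) as P1. pose proof (branch_pos _ Hb) as P2.
  destruct Ht as (_ & I1 & _). destruct Hb as (_ & I2 & _).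
  apply (filter_le_within (fun y : R => y <> 0)) in I1. apply (filter_le_within (fun y : R => y <> 0)) in I2.
  generalize (filter_and _ _ (filter_and _ _ P1 P2) (filter_and _ _ I1 I2)). apply filter_imp.
  intros w (((Q1 & Q2) & Q3 & Q4) & Q5 & Q6). apply (phi_inj_sign _ _ w); auto. lra.
Qed.

(* The power [t^gamma / s^2] is determined by [s p' = (gamma - 2 s') p]. *)
Definition p_rec (s : nat -> R) (g : R) (n : nat) (u : nat -> R) : R :=
  match n with
  | O => 1
  | S m => (g * u m - sumn (fun i => s (S i) * PS_derive u (m - S i)%nat) m
            - 2 * sumn (fun i => PS_derive s i * u (m - i)%nat) (S m)) / (INR m + 1)
  end.

Lemma p_exists s g : exists p, p O = 1 /\ forall m, p (S m) = p_rec s g (S m) p.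
Proof.
  destruct (cov_exists (p_rec s g)) as [p Hp].
  { intros n u v H. destruct n as [|m]; [reflexivity|]. unfold p_rec. rewrite H by lia. f_equal. f_equal.
    - f_equal. apply sumn_ext. intros k Hk. unfold PS_derive. rewrite H by lia. reflexivity.
    - f_equal. apply sumn_ext. intros k Hk. rewrite H by lia. reflexivity. }
  exists p. split; [apply Hp | intros m; apply Hp].
Qed.

(** Successive terms shrink by 6 / R0 <= 1/2, so the sum is at most twice its first term. *)
Lemma geom_conv_bound R0 n : 12 <= R0 -> sumn (fun i => 6 ^ S i * R0 ^ (n - i)) (S n) <= 12 * R0 ^ n.
Proof.
  intros HR. induction n as [|n IH]; [simpl; lra|]. rewrite sumn_Sl.
  rewrite (sumn_ext _ (fun i => 6 * (6 ^ S i * R0 ^ (n - i)))).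
  2: { intros k Hk. change (6 ^ S (S k)) with (6 * 6 ^ S k). change (S n - S k)%nat with (n - k)%nat. ring. }
  rewrite sumn_scal. change (R0 ^ (S n - 0)) with (R0 * R0 ^ n). change (R0 ^ S n) with (R0 * R0 ^ n).
  pose proof (pow_lt R0 n ltac:(lra)). simpl (6 ^ 1). nra.
Qed.

(** The three parts of the recurrence contribute at most Gm, 12 m and 24 (m + 1) times R0^m; after
    division by m + 1 this is at most Gm + 36. *)
Lemma p_bound s g Gm p : sser s -> Rabs g <= Gm -> p O = 1 -> (forall m, p (S m) = p_rec s g (S m) p) -> geo 1 (Gm + 36) p.
Proof.
  intros (_ & Hs & _) Hg H0 Hp n. rewrite Rmult_1_l. pose proof (Rabs_pos g) as Hg0. set (R0 := Gm + 36).
  revert n. apply strong_ind. intros [|m] IH; [rewrite H0, Rabs_R1; simpl; lra|].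
  rewrite Hp. unfold p_rec. pose proof (pos_INR m) as Hm. assert (HR : 0 < R0 ^ m) by (apply pow_lt; unfold R0; lra).
  assert (W : forall i, (i <= m)%nat -> 6 ^ S i * R0 ^ (m - i) >= 0).
  { intros i Hi. apply Rle_ge, Rmult_le_pos; apply pow_le; unfold R0; lra. }
  pose proof (geom_conv_bound R0 m ltac:(unfold R0; lra)) as Gb.
  assert (T1 : Rabs (sumn (fun i => s (S i) * PS_derive p (m - S i)%nat) m) <= INR m * (12 * R0 ^ m)).
  { eapply Rle_trans; [apply sumn_abs|]. apply Rle_trans with (sumn (fun i => INR m * (6 ^ S i * R0 ^ (m - i))) (S m)).
    - cbn [sumn]. assert (0 <= INR m * (6 ^ S m * R0 ^ (m - m))) by (apply Rmult_le_pos; auto; apply Rge_le, W; lia).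
      enough (sumn (fun k => Rabs (s (S k) * PS_derive p (m - S k)%nat)) m <= sumn (fun i => INR m * (6 ^ S i * R0 ^ (m - i))) m) by lra.
      apply sumn_le. intros i Hi. unfold PS_derive. replace (S (m - S i)) with (m - i)%nat by lia.
      rewrite !Rabs_mult, (Rabs_pos_eq (INR (m - i))) by apply pos_INR.
      pose proof (IH (m - i)%nat ltac:(lia)) as I1. specialize (Hs (S i)). rewrite Rmult_1_l in Hs.
      assert (I3 : INR (m - i) <= INR m) by (apply le_INR; lia).
      rewrite <- !Rmult_assoc, (Rmult_comm (INR m)), !Rmult_assoc.
      apply Rmult_le_compat; [apply Rabs_pos | apply Rmult_le_pos; [apply pos_INR | apply Rabs_pos] | exact Hs |].
      apply Rmult_le_compat; [apply pos_INR | apply Rabs_pos | exact I3 | exact I1].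
    - rewrite sumn_scal. apply Rmult_le_compat_l; auto. }
  assert (T2 : Rabs (sumn (fun i => PS_derive s i * p (m - i)%nat) (S m)) <= (INR m + 1) * (12 * R0 ^ m)).
  { eapply Rle_trans; [apply sumn_abs|]. apply Rle_trans with (sumn (fun i => (INR m + 1) * (6 ^ S i * R0 ^ (m - i))) (S m)).
    - apply sumn_le. intros i Hi. unfold PS_derive.
      rewrite !Rabs_mult, (Rabs_pos_eq (INR (S i))) by apply pos_INR.
      pose proof (IH (m - i)%nat ltac:(lia)) as I1. specialize (Hs (S i)). rewrite Rmult_1_l in Hs.
      assert (I3 : INR (S i) <= INR m + 1) by (rewrite <- S_INR; apply le_INR; lia).
      rewrite <- (Rmult_assoc (INR m + 1)).
      apply Rmult_le_compat; [apply Rmult_le_pos; [apply pos_INR | apply Rabs_pos] | apply Rabs_pos | | exact I1].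
      apply Rmult_le_compat; [apply pos_INR | apply Rabs_pos | exact I3 | exact Hs].
    - rewrite sumn_scal. apply Rmult_le_compat_l; lra. }
  pose proof (IH m ltac:(lia)) as T0. unfold Rdiv. rewrite Rabs_mult, (Rabs_pos_eq (/ _)) by (left; apply Rinv_0_lt_compat; lra).
  apply Rmult_le_reg_r with (INR m + 1); [lra|]. rewrite Rmult_assoc, Rinv_l, Rmult_1_r by lra.
  change (R0 ^ S m) with (R0 * R0 ^ m).
  eapply Rle_trans; [apply Rabs_triang|]. rewrite Rabs_Ropp. eapply Rle_trans; [apply Rplus_le_compat_r, Rabs_triang|]. rewrite Rabs_Ropp, !Rabs_mult, (Rabs_pos_eq 2) by lra.
  assert (T3 : Rabs g * Rabs (p m) <= Gm * R0 ^ m) by (apply Rmult_le_compat; auto; apply Rabs_pos).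
  assert (0 <= INR m * R0 ^ m) by (apply Rmult_le_pos; lra). unfold R0 in *. nra.
Qed.

Lemma p_ode s g Gm p w : sser s -> Rabs g <= Gm -> p O = 1 -> (forall m, p (S m) = p_rec s g (S m) p) -> Rabs w * (Gm + 36) < 1 -> Rabs w < / 24 ->
  PSeries s w * PSeries (PS_derive p) w + 2 * (PSeries (PS_derive s) w * PSeries p w) = g * PSeries p w.
Proof.
  intros Hs Hg H0 Hp Hw1 Hw. pose proof (p_bound s g Gm p Hs Hg H0 Hp) as Bp.
  pose proof (Rabs_pos g). assert (Rp : Rbar_lt (Rabs w) (CV_radius p)) by (apply (geo_radius 1 (Gm + 36)); auto; lra).
  pose proof (sser_radius s w Hs Hw) as Rs.
  rewrite <- !PSeries_mult by (try rewrite CV_radius_derive; auto).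
  rewrite <- PSeries_scal, <- PSeries_scal, <- PSeries_plus.
  - apply PSeries_ext. intros n. unfold PS_plus, PS_scal, plus, scal; simpl; unfold mult; simpl. rewrite PS_mult_sumn.
    replace (PS_mult (PS_derive s) p n) with (sumn (fun i => PS_derive s i * p (n - i)%nat) (S n)).
    2: { unfold PS_mult. rewrite <- sumn_sum_f_R0 by lia. f_equal. lia. }
    destruct Hs as (S0 & _). unfold PS_derive at 1. rewrite (Hp n), S0, S_INR. unfold p_rec. pose proof (pos_INR n). field. lra.
  - apply ex_pseries_mult; [|rewrite CV_radius_derive]; auto.
  - apply (ex_pseries_scal (V := R_NormedModule)); [apply Rmult_comm|]. apply ex_pseries_mult; [rewrite CV_radius_derive|]; auto.
Qed.

(** By [p_ode] the product p s^2 exp(- gamma Y) has derivative 0, and it equals 1 at w = 0. *)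
Lemma p_value s g Gm p w : sser s -> Rabs g <= Gm -> p O = 1 -> (forall m, p (S m) = p_rec s g (S m) p) -> Rabs w * (Gm + 36) < 1 -> Rabs w < / 24 ->
  PSeries p w = exp (g * ybr s w) / PSeries s w ^ 2.
Proof.
  intros Hs Hg H0 Hp Hw1 Hw. pose proof (Rabs_pos g).
  set (r := Rmin (/ (Gm + 36)) (/ 24)).
  assert (R1 : forall u, Rabs u < r -> Rabs u * (Gm + 36) < 1 /\ Rabs u < / 24).
  { intros u Hu. pose proof (Rmin_l (/ (Gm + 36)) (/ 24)). pose proof (Rmin_r (/ (Gm + 36)) (/ 24)). fold r in H1, H2. split; [|lra].
    apply Rmult_lt_reg_r with (/ (Gm + 36)); [apply Rinv_0_lt_compat; lra|]. rewrite Rmult_assoc, Rinv_r by lra. lra. }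
  assert (Hwr : Rabs w < r).
  { apply Rmin_glb_lt; auto. apply Rmult_lt_reg_r with (Gm + 36); [lra|]. rewrite Rinv_l by lra. lra. }
  set (h := fun w => PSeries p w * PSeries s w ^ 2 * exp (- (g * ybr s w))).
  assert (E : h w = h 0).
  { apply (const_of_zero_derive h r); auto. intros u Hu. destruct (R1 u Hu) as [U1 U2].
    pose proof (p_ode s g Gm p u Hs Hg H0 Hp U1 U2) as O. pose proof (ybr_derive s u Hs U2) as Dy. pose proof (sser_derive s u Hs U2) as Ds.
    assert (Dp : is_derive (PSeries p) u (PSeries (PS_derive p) u)).
    { apply (geo_derive 1 (Gm + 36)); auto; [lra|]. now apply (p_bound s g Gm p). }
    pose proof (sser_bounds s u Hs U2). unfold h. auto_derive.
    - repeat split; eexists; eassumption.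
    - replace (Derive (fun x => PSeries p x) u) with (PSeries (PS_derive p) u) by (symmetry; apply is_derive_unique, Dp).
      replace (Derive (fun x => PSeries s x) u) with (PSeries (PS_derive s) u) by (symmetry; apply is_derive_unique, Ds).
      replace (Derive (fun x => ybr s x) u) with (/ PSeries s u) by (symmetry; apply is_derive_unique, Dy).
      set (P := PSeries p u) in *. set (S1 := PSeries s u) in *. set (E0 := exp _).
      replace (PSeries (PS_derive p) u) with ((g * P - 2 * (PSeries (PS_derive s) u * P)) / S1) by (rewrite <- O; field; lra).
      field. lra. }
  unfold h in E. rewrite !PSeries_0, ybr_0, H0, Rmult_0_r, Ropp_0, exp_0 in E.
  destruct Hs as (S0 & Hs'). rewrite S0 in E. pose proof (sser_bounds s w (conj S0 Hs') Hw).
  rewrite exp_Ropp in E. pose proof (exp_pos (g * ybr s w)).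
  apply Rmult_eq_reg_r with (PSeries s w ^ 2 * / exp (g * ybr s w)).
  - rewrite <- Rmult_assoc, E. field. split; lra.
  - apply Rgt_not_eq. apply Rmult_lt_0_compat; [nra | now apply Rinv_0_lt_compat].
Qed.

(** Since t' = t / s and 1 - t = - w s, the function to be expanded is (1 - p) / w. The pole
    disappears because p 0 = 1, and G_k = - p (S k). *)
Lemma branch_function s g Gm p w : sser s -> Rabs g <= Gm -> p O = 1 -> (forall m, p (S m) = p_rec s g (S m) p) -> Rabs w * (Gm + 36) < 1 -> Rabs w < / 24 -> w <> 0 ->
  is_pseries (fun k => - p (S k)) w (exp (g * ybr s w) * / PSeries s w / (1 - exp (ybr s w)) + 1 / w).
Proof.
  intros Hs Hg H0 Hp Hw1 Hw Hne. pose proof (Rabs_pos g).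
  assert (E : ex_pseries p w). { apply CV_radius_inside. apply (geo_radius 1 (Gm + 36)); auto; [lra|]. now apply (p_bound s g Gm p). }
  pose proof (p_value s g Gm p w Hs Hg H0 Hp Hw1 Hw) as V. pose proof (PSeries_decr_1 p w E) as E1. rewrite H0 in E1.
  pose proof (sser_bounds s w Hs Hw).
  replace (exp (g * ybr s w) * / PSeries s w / (1 - exp (ybr s w)) + 1 / w) with (opp (PSeries (PS_decr_1 p) w)).
  - apply (is_pseries_ext (PS_opp (PS_decr_1 p))); [reflexivity|]. apply (is_pseries_opp (K := R_AbsRing) (V := R_NormedModule) (PS_decr_1 p) w (PSeries (PS_decr_1 p) w)). apply PSeries_correct.
    apply ex_pseries_decr_1; auto. right. exists (/ w). change (/ w * w = 1). field. exact Hne.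
  - change opp with Ropp. rewrite ybr_exp by auto.
    replace (PSeries (PS_decr_1 p) w) with ((PSeries p w - 1) / w) by (rewrite E1; field; auto). rewrite V. match goal with |- ?u = ?v => change (@eq R u v) end. field. repeat split; try exact Hne; try lra; replace (1 - (1 + w * PSeries s w)) with (- (w * PSeries s w)) by ring; apply Ropp_neq_0_compat, Rmult_integral_contrapositive_currified; auto; lra.
Qed.

Lemma is_G_branch s g Gm p : sser s -> Rabs g <= Gm -> p O = 1 -> (forall m, p (S m) = p_rec s g (S m) p) ->
  locally' 0 (fun w => Rpower (t_branch w) (g - 1) / (1 - t_branch w) * Derive t_branch w + 1 / w
    = exp (g * ybr s w) * / PSeries s w / (1 - exp (ybr s w)) + 1 / w) /\ is_G g (fun k => - p (S k)).
Proof.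
  intros Hs Hg H0 Hp. destruct (t_branch_eq s Hs) as [d Hd]. pose proof (Rabs_pos g) as Hg0.
  assert (L : locally' 0 (fun w => Rpower (t_branch w) (g - 1) / (1 - t_branch w) * Derive t_branch w + 1 / w
    = exp (g * ybr s w) * / PSeries s w / (1 - exp (ybr s w)) + 1 / w)).
  { assert (Hm : 0 < Rmin d (/ 24)) by (apply Rmin_glb_lt; [apply cond_pos | lra]).
    exists (mkposreal _ Hm). intros w Hw Hne. cbn [pos] in Hw. pose proof (Rmin_l d (/ 24)). pose proof (Rmin_r d (/ 24)).
    assert (Hw2 : Rabs w < / 24). { apply ball_Rabs in Hw. rewrite Rminus_0_r in Hw. lra. }
    assert (Hwd : ball 0 d w) by (apply ball_le with (Rmin d (/ 24)); auto).
    assert (Ed : Derive t_branch w = (1 + w * PSeries s w) / PSeries s w).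
    { transitivity (Derive (fun w => 1 + w * PSeries s w) w).
      - apply Derive_ext_loc. apply (filter_imp (fun u => ball 0 d u /\ u <> 0)).
        + intros u [Hu1 Hu2]. now apply Hd.
        + apply filter_and; [|now apply locally_neq].
          { apply ball_Rabs in Hwd. simpl in Hwd. rewrite Rminus_0_r in Hwd. assert (Hp0 : 0 < d - Rabs w) by lra.
            exists (mkposreal _ Hp0). intros u Hu. apply ball_Rabs in Hu. simpl in Hu. pose proof (Rabs_triang_inv u w).
            change (Rabs (u - 0) < d). rewrite Rminus_0_r. lra. }
      - apply is_derive_unique. now apply tau_derive. }
    rewrite Ed, (Hd w Hwd Hne). pose proof (sser_bounds s w Hs Hw2). pose proof (sser_tau_pos s w Hs Hw2).
    rewrite ybr_exp by auto. unfold Rpower. fold (ybr s w). replace ((g - 1) * ybr s w) with (g * ybr s w + - ybr s w) by ring.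
    rewrite exp_plus, exp_Ropp, ybr_exp by auto. field. repeat split; try lra.
    intro Z. apply Hne. replace (1 - (1 + w * PSeries s w)) with (- (w * PSeries s w)) in Z by ring.
    assert (Z2 : w * PSeries s w = 0) by lra. apply Rmult_integral in Z2. lra. }
  split; [exact L|].
  unfold is_G. destruct L as [d2 L].
  set (r := Rmin (/ (Gm + 37)) (/ 24)). assert (Hr : 0 < r) by (apply Rmin_glb_lt; [apply Rinv_0_lt_compat|]; lra).
  assert (Hm : 0 < Rmin d2 r) by (apply Rmin_glb_lt; [apply cond_pos | lra]).
  exists (mkposreal _ Hm). intros w Hw Hne. cbn [pos] in Hw. pose proof (Rmin_l d2 r). pose proof (Rmin_r d2 r).
  pose proof (Rmin_l (/ (Gm + 37)) (/ 24)). pose proof (Rmin_r (/ (Gm + 37)) (/ 24)). fold r in H2, H3.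
  rewrite L; auto; [|apply ball_le with (Rmin d2 r); auto]. apply ball_Rabs in Hw. rewrite Rminus_0_r in Hw.
  assert (Hw2 : Rabs w < / (Gm + 37) /\ Rabs w < / 24) by lra. destruct Hw2 as [Hw2 Hw3].
  apply branch_function with (Gm := Gm); auto.
  apply Rle_lt_trans with (/ (Gm + 37) * (Gm + 36)); [apply Rmult_le_compat_r; lra|].
  apply Rmult_lt_reg_l with (Gm + 37); [lra|]. rewrite <- Rmult_assoc, Rinv_r by lra. lra.
Qed.

Lemma pos_radius_of_punctured (g : nat -> R) (f : R -> R) : locally' 0 (fun w => is_pseries g w (f w)) -> Rbar_lt 0 (CV_radius g).
Proof.
  intros [d Hd]. pose proof (cond_pos d) as Hd0.
  destruct (Rbar_lt_dec 0 (CV_radius g)) as [|N]; auto. exfalso. apply Rbar_not_lt_le in N.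
  assert (B : ball 0 d (d / 2)). { change (Rabs (d / 2 - 0) < d). rewrite Rminus_0_r, Rabs_pos_eq; lra. }
  specialize (Hd _ B ltac:(lra)).
  apply (CV_disk_outside g (d / 2)).
  - apply Rbar_le_lt_trans with 0; auto. simpl. rewrite Rabs_pos_eq; lra.
  - assert (E : ex_series (fun n => g n * (d / 2) ^ n)). { apply ex_pseries_R. eexists; exact Hd. }
    now apply ex_series_lim_0.
Qed.

(** Both sums are continuous at 0, so agreement off 0 extends to 0 and forces equal coefficients.
    This pins down the coefficients chosen by [epsilon] in [Gcoef]. *)
Lemma pseries_punctured_unique (g1 g2 : nat -> R) (f : R -> R) :
  locally' 0 (fun w => is_pseries g1 w (f w)) -> locally' 0 (fun w => is_pseries g2 w (f w)) -> forall n, g1 n = g2 n.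
Proof.
  intros H1 H2 n. pose proof (pos_radius_of_punctured _ _ H1) as P1. pose proof (pos_radius_of_punctured _ _ H2) as P2.
  assert (L : locally' 0 (fun w => PSeries g1 w = PSeries g2 w)).
  { generalize (filter_and _ _ H1 H2). apply filter_imp. intros w [A1 A2]. rewrite (is_pseries_unique _ _ _ A1), (is_pseries_unique _ _ _ A2). reflexivity. }
  assert (L0 : PSeries g1 0 = PSeries g2 0).
  { assert (C1 : is_lim (PSeries g1) 0 (PSeries g1 0)) by (apply is_lim_continuity, PSeries_continuity; rewrite Rabs_R0; exact P1).
    assert (C2 : is_lim (PSeries g2) 0 (PSeries g2 0)) by (apply is_lim_continuity, PSeries_continuity; rewrite Rabs_R0; exact P2).
    apply (is_lim_ext_loc _ (PSeries g2)) in C1; [|exact L]. apply is_lim_unique in C1. apply is_lim_unique in C2. rewrite C1 in C2. now injection C2. }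
  apply PSeries_ext_recip; auto. destruct L as [d L]. exists d. intros w Hw. destruct (Req_dec w 0) as [->|Hne]; [exact L0 | now apply L].
Qed.

Lemma Gcoef_p s g Gm p : sser s -> Rabs g <= Gm -> p O = 1 -> (forall m, p (S m) = p_rec s g (S m) p) -> forall n, Gcoef g n = - p (S n).
Proof.
  intros Hs Hg H0 Hp. destruct (is_G_branch s g Gm p Hs Hg H0 Hp) as [_ HG].
  assert (HG2 : is_G g (Gcoef g)) by (unfold Gcoef; apply epsilon_spec; eexists; exact HG).
  exact (pseries_punctured_unique _ _ _ HG2 HG).
Qed.

(** The bound depends on gamma only through Gm, so it stays valid while alpha varies with x. *)
Lemma Gcoef_geo g Gm : Rabs g <= Gm -> geo (Gm + 36) (Gm + 36) (Gcoef g).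
Proof.
  intros Hg. destruct s_exists as [s Hs]. destruct (p_exists s g) as (p & H0 & Hp). intros n.
  rewrite (Gcoef_p s g Gm p Hs Hg H0 Hp), Rabs_Ropp. pose proof (p_bound s g Gm p Hs Hg H0 Hp (S n)). simpl in H. lra.
Qed.

Lemma Gcoef_function s g Gm w : sser s -> Rabs g <= Gm -> Rabs w * (Gm + 36) < 1 -> Rabs w < / 24 -> w <> 0 ->
  exp (g * ybr s w) * / PSeries s w / (1 - exp (ybr s w)) + 1 / w = PSeries (Gcoef g) w.
Proof.
  intros Hs Hg Hw1 Hw Hne. destruct (p_exists s g) as (p & H0 & Hp).
  rewrite (PSeries_ext _ _ w (Gcoef_p s g Gm p Hs Hg H0 Hp)). symmetry. apply is_pseries_unique.
  now apply branch_function with (Gm := Gm).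
Qed.

(** * Local asymptotics of the principal value *)

Definition phi (Y : R) : R := exp Y - 1 - Y.

Lemma phi_pos Y : 0 <= phi Y.
Proof. unfold phi. pose proof (exp_ineq1_le Y). lra. Qed.

Lemma phi_tangent Y0 Y : phi Y0 + (exp Y0 - 1) * (Y - Y0) <= phi Y.
Proof.
  unfold phi. pose proof (exp_ineq1_le (Y - Y0)) as H. pose proof (exp_pos Y0).
  replace (exp Y) with (exp Y0 * exp (Y - Y0)) by (rewrite <- exp_plus; f_equal; ring). nra.
Qed.

Lemma phi_mono_r Y0 Y : 0 <= Y0 <= Y -> phi Y0 <= phi Y.
Proof.
  intros H. pose proof (phi_tangent Y0 Y). pose proof (exp_ineq1_le Y0). nra.
Qed.

Lemma phi_mono_l Y0 Y : Y <= Y0 <= 0 -> phi Y0 <= phi Y.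
Proof.
  intros H. pose proof (phi_tangent Y0 Y). assert (exp Y0 <= 1) by (rewrite <- exp_0; apply exp_le_exp; lra). nra.
Qed.

Lemma phi_pos_strict Y : Y <> 0 -> 0 < phi Y.
Proof. intros H. unfold phi. pose proof (exp_ineq1 Y H). lra. Qed.

(** By convexity [phi] lies above its tangents at d and - d; c is chosen below their slopes and
    below the chord slopes phi(d) / d and phi(- d) / d. *)
Lemma phi_linear d : 0 < d -> exists c, 0 < c /\ forall Y, d <= Rabs Y -> c * Rabs Y <= phi Y.
Proof.
  intros Hd.
  assert (P1 : 0 < phi d) by (apply phi_pos_strict; lra). assert (P2 : 0 < phi (- d)) by (apply phi_pos_strict; lra).
  assert (E1 : 0 < exp d - 1) by (pose proof (exp_ineq1 d ltac:(lra)); lra).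
  assert (E2 : 0 < 1 - exp (- d)) by (assert (exp (- d) < exp 0) by (apply exp_increasing; lra); rewrite exp_0 in H; lra).
  set (c1 := Rmin (phi d / d) (phi (- d) / d)). set (c2 := Rmin (exp d - 1) (1 - exp (- d))).
  assert (C1 : 0 < c1) by (apply Rmin_glb_lt; apply Rdiv_lt_0_compat; auto).
  assert (C2 : 0 < c2) by (apply Rmin_glb_lt; auto).
  assert (Q1 : c1 * d <= phi d). { pose proof (Rmin_l (phi d / d) (phi (- d) / d)). fold c1 in H. apply (Rmult_le_compat_r d) in H; [|lra]. field_simplify in H; lra. }
  assert (Q2 : c1 * d <= phi (- d)). { pose proof (Rmin_r (phi d / d) (phi (- d) / d)). fold c1 in H. apply (Rmult_le_compat_r d) in H; [|lra]. field_simplify in H; lra. }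
  pose proof (Rmin_l (exp d - 1) (1 - exp (- d))) as Q3. pose proof (Rmin_r (exp d - 1) (1 - exp (- d))) as Q4. fold c2 in Q3, Q4.
  exists (Rmin c1 c2). split; [now apply Rmin_glb_lt|]. intros Y HY. pose proof (Rmin_l c1 c2). pose proof (Rmin_r c1 c2).
  set (c := Rmin c1 c2) in *. assert (Hc : c * d <= c1 * d) by (apply Rmult_le_compat_r; lra).
  destruct (Rle_dec 0 Y) as [Hp|Hn].
  - rewrite Rabs_pos_eq in * by auto. pose proof (phi_tangent d Y).
    assert (c * (Y - d) <= (exp d - 1) * (Y - d)) by (apply Rmult_le_compat_r; lra). lra.
  - rewrite Rabs_left in * by lra. pose proof (phi_tangent (- d) Y).
    assert (c * (- Y - d) <= (1 - exp (- d)) * (- Y - d)) by (apply Rmult_le_compat_r; lra). lra.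
Qed.

Lemma RInt_FTC (f f' : R -> R) a b : (forall w, is_derive f w (f' w)) -> (forall w, continuous f' w) -> RInt f' a b = f b - f a.
Proof.
  intros H Hc. apply is_RInt_unique. apply (is_RInt_derive (V := R_CompleteNormedModule) f f'); auto.
Qed.

(** The exponential factor after the substitution: (x^2 / 2) phi(Y) = x^2 w^2 / 4. *)
Definition gw (x w : R) : R := exp (- (x ^ 2 / 4 * w ^ 2)).

Lemma gw_derive x w : is_derive (gw x) w (- (x ^ 2 / 2) * w * gw x w).
Proof. unfold gw. auto_derive; auto. change (exp (- (x * (x * 1) / 4 * (w * (w * 1))))) with (exp (- (x ^ 2 / 4 * w ^ 2))). simpl. field. Qed.

Lemma gw_mono_cont x (p : R -> R) w : continuous p w -> continuous (fun w => gw x w * p w) w.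
Proof.
  intros H. apply (continuous_mult (K := R_AbsRing) (gw x) p); auto. apply continuous_derivable. eexists. apply gw_derive.
Qed.

Lemma pow_cont n (w : R) : continuous (fun w => w ^ n) w.
Proof. apply continuous_derivable. auto_derive; auto. Qed.

Definition mom (k : nat) (x d : R) : R := RInt (fun w => gw x w * w ^ (2 * k)) 0 d.

(** The moment over the whole half line, (1/2) Gamma(k + 1/2) (2/x)^(2k+1). *)
Definition mmain (k : nat) (x : R) : R := 1 / 2 * sqrt PI * poch (1 / 2) k * (2 / x) ^ (2 * k + 1).

Lemma mom_S k x d : 0 < x -> mom (S k) x d = 2 / x ^ 2 * ((2 * INR k + 1) * mom k x d - d ^ (2 * k + 1) * gw x d).
Proof.
  intros Hx.
  assert (E : RInt (fun w => (2 * INR k + 1) * (gw x w * w ^ (2 * k)) - x ^ 2 / 2 * (gw x w * w ^ (2 * S k))) 0 d = d ^ (2 * k + 1) * gw x d).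
  { rewrite (RInt_FTC (fun w => w ^ (2 * k + 1) * gw x w)).
    - replace (2 * k + 1)%nat with (S (2 * k)) by lia. simpl (0 ^ _). match goal with |- ?u = ?v => change (@eq R u v) end. ring.
    - intros w. pose proof (gw_derive x w) as D.
      assert (Dp : is_derive (fun w : R => w ^ (2 * k + 1)) w ((2 * INR k + 1) * w ^ (2 * k))).
      { evar_last; [apply (is_derive_pow (fun w => w) (2 * k + 1) w 1), (is_derive_id (K := R_AbsRing))|].
        replace (Init.Nat.pred (2 * k + 1)) with (2 * k)%nat by lia. rewrite plus_INR, mult_INR. simpl (INR 2). simpl (INR 1). match goal with |- ?u = ?v => change (@eq R u v) end. ring. }
      evar_last; [apply (is_derive_mult (K := R_AbsRing) _ _ w _ _ Dp D); apply Rmult_comm|].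
      unfold plus, mult; simpl plus; simpl mult. cbv beta.
      replace (2 * S k)%nat with (S (S (2 * k))) by lia. replace (2 * k + 1)%nat with (S (2 * k)) by lia.
      change (w ^ S (S (2 * k))) with (w * (w * w ^ (2 * k))). change (w ^ S (2 * k)) with (w * w ^ (2 * k)). 
      match goal with |- ?u = ?v => change (@eq R u v) end. simpl. field.
    - intros w. apply (continuous_minus (V := R_NormedModule)); apply (continuous_scal_r (K := R_AbsRing) (V := R_NormedModule) _ (fun w => gw x w * _)); apply gw_mono_cont, pow_cont. }
  assert (Ex : forall n, ex_RInt (fun w => gw x w * w ^ n) 0 d) by (intros n; apply cont_ex_RInt; intros w; apply gw_mono_cont, pow_cont).
  assert (E2 : RInt (fun w => (2 * INR k + 1) * (gw x w * w ^ (2 * k)) - x ^ 2 / 2 * (gw x w * w ^ (2 * S k))) 0 d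
    = (2 * INR k + 1) * RInt (fun w => gw x w * w ^ (2 * k)) 0 d - x ^ 2 / 2 * RInt (fun w => gw x w * w ^ (2 * S k)) 0 d).
  { rewrite (RInt_minus (V := R_CompleteNormedModule) (fun w => (2 * INR k + 1) * (gw x w * w ^ (2 * k))) (fun w => x ^ 2 / 2 * (gw x w * w ^ (2 * S k)))).
    - rewrite (RInt_scal (V := R_CompleteNormedModule) (fun w => gw x w * w ^ (2 * k))) by auto.
      rewrite (RInt_scal (V := R_CompleteNormedModule) (fun w => gw x w * w ^ (2 * S k))) by auto. reflexivity.
    - apply (ex_RInt_scal (V := R_NormedModule)); auto.
    - apply (ex_RInt_scal (V := R_NormedModule)); auto. }
  assert (E3 : d ^ (2 * k + 1) * gw x d = (2 * INR k + 1) * mom k x d - x ^ 2 / 2 * mom (S k) x d) by (rewrite <- E; exact E2).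
  rewrite E3. field. lra.
Qed.

(** [vh] 1 is a Gaussian tail integral, so rescaled by r = x / sqrt 2 it is minus a primitive of
    [gw], up to the factor r. [vh_gauss] bounds its tail at d, where x d >= 2 and x >= 1 make r^2 d
    >= 1. *)
Lemma mom_0 x d : 0 < x -> 0 < d -> 2 <= x * d -> 1 <= x -> d <= 1 -> Rabs (mom 0 x d - mmain 0 x) <= gw x d.
Proof.
  intros Hx Hd Hxd Hx1 Hd1. set (c := exp (1 / 2 * ln 2)). pose proof exp_half_ln2 as Hc. fold c in Hc. assert (Hc0 : 0 < c) by apply exp_pos.
  assert (Hcs : c < 2) by nra. assert (Hcb : 1 < c) by nra.
  set (r := x / c). assert (Hr : 0 < r) by (apply Rdiv_lt_0_compat; lra).
  assert (Er : r * r = x ^ 2 / 2). { unfold r. replace (x / c * (x / c)) with (x ^ 2 / (c * c)) by (field; lra). rewrite Hc. reflexivity. }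
  assert (E : mom 0 x d = (vh 1 0 - vh 1 (r * d)) / r).
  { unfold mom. rewrite (RInt_ext _ (fun w => gw x w)) by (intros; simpl; apply Rmult_1_r).
    rewrite (RInt_FTC (fun w => - / r * vh 1 (r * w))).
    - rewrite Rmult_0_r. field. lra.
    - intros w. pose proof (vh1_derive (r * w)) as D. auto_derive; [eexists; exact D|].
      replace (Derive (fun x0 => vh 1 x0) (r * w)) with (- exp (- ((r * w) ^ 2 / 2))) by (symmetry; apply is_derive_unique, D).
      unfold gw. replace (- ((r * w) ^ 2 / 2)) with (- (x ^ 2 / 4 * w ^ 2)) by (replace ((r * w) ^ 2) with (r * r * w ^ 2) by ring; rewrite Er; field).
      field. lra.
    - intros w. apply continuous_derivable. eexists. apply gw_derive. }
  rewrite E, vh_1_0. fold c. unfold mmain. simpl (poch _ 0). simpl ((2 / x) ^ _).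
  replace ((sqrt PI * c / 2 - vh 1 (r * d)) / r - 1 / 2 * sqrt PI * 1 * (2 / x * 1)) with (- (vh 1 (r * d) / r)).
  2: { assert (Q : sqrt PI * c / 2 / r = sqrt PI / x). { unfold r. replace (sqrt PI * c / 2 / (x / c)) with (sqrt PI * (c * c) / 2 / x) by (field; lra). rewrite Hc. field. lra. }
       set (V := vh 1 (r * d)). replace ((sqrt PI * c / 2 - V) / r) with (sqrt PI * c / 2 / r - V / r) by (field; lra). rewrite Q. field. lra. }
  rewrite Rabs_Ropp. pose proof (vh_gauss (r * d)) as Hg. pose proof (vh_pos_le 2 (r * d) ltac:(lra) ltac:(nra)) as Hv2. pose proof (vh_pos_le 1 (r * d) ltac:(lra) ltac:(nra)) as Hv1.
  rewrite Rabs_pos_eq. 2: { apply Rmult_le_pos; [lra | left; now apply Rinv_0_lt_compat]. }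
  replace (gw x d) with (exp (- ((r * d) ^ 2 / 2))).
  2: { unfold gw. f_equal. replace ((r * d) ^ 2) with (r * r * d ^ 2) by ring. rewrite Er. field. }
  rewrite <- Hg.
  assert (Hrd : r * d * r >= 1). { replace (r * d * r) with (r * r * d) by ring. rewrite Er. nra. }
  apply Rmult_le_reg_r with r; auto. replace (vh 1 (r * d) / r * r) with (vh 1 (r * d)) by (field; lra). nra.
Qed.

Lemma mom_main k : exists C, 0 <= C /\ forall x d, 0 < d <= 1 -> 2 <= x * d -> 1 <= x -> Rabs (mom k x d - mmain k x) <= C * gw x d.
Proof.
  induction k as [|k (C & HC & IH)].
  - exists 1. split; [lra|]. intros x d Hd Hxd Hx. rewrite Rmult_1_l. apply mom_0; lra.
  - exists (2 * ((2 * INR k + 1) * C + 1)). pose proof (pos_INR k). split; [nra|]. intros x d Hd Hxd Hx. specialize (IH x d Hd Hxd Hx).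
    rewrite mom_S by lra.
    replace (mmain (S k) x) with (2 / x ^ 2 * ((2 * INR k + 1) * mmain k x)).
    2: { unfold mmain. replace (2 * S k + 1)%nat with (S (S (2 * k + 1))) by lia. cbn [poch]. change ((2 / x) ^ S (S (2 * k + 1))) with (2 / x * (2 / x * (2 / x) ^ (2 * k + 1))). field. lra. }
    rewrite <- Rmult_minus_distr_l, Rabs_mult.
    assert (Hx2 : 0 < / x ^ 2 <= 1) by (apply pow_inv_le; lra).
    rewrite (Rabs_pos_eq (2 / x ^ 2)) by (unfold Rdiv; lra).
    assert (Hg : 0 < gw x d) by apply exp_pos.
    apply Rle_trans with (2 * ((2 * INR k + 1) * (C * gw x d) + gw x d)); [|right; ring].
    apply Rmult_le_compat; [unfold Rdiv; lra | apply Rabs_pos | unfold Rdiv; lra |].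
    replace ((2 * INR k + 1) * mom k x d - d ^ (2 * k + 1) * gw x d - (2 * INR k + 1) * mmain k x) with ((2 * INR k + 1) * (mom k x d - mmain k x) + - (d ^ (2 * k + 1) * gw x d)) by ring.
    eapply Rle_trans; [apply Rabs_triang|]. rewrite Rabs_Ropp, !Rabs_mult, (Rabs_pos_eq (2 * INR k + 1)), (Rabs_pos_eq (gw x d)) by lra.
    assert (Hp : Rabs (d ^ (2 * k + 1)) <= 1).
    { rewrite <- RPow_abs, Rabs_pos_eq by lra. rewrite <- (pow1 (2 * k + 1)). apply pow_incr. lra. }
    apply Rplus_le_compat; [apply Rmult_le_compat_l; lra|]. nra.
Qed.

(** * Change of variable in the local principal value *)

Lemma ybr_quad s w : sser s -> Rabs w < / 24 -> Rabs (ybr s w - w) <= 24 * w ^ 2.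
Proof.
  intros Hs Hw. pose proof (mvt_bound (fun w => ybr s w - w) (fun w => / PSeries s w - 1) 0 w (24 * Rabs w)) as M.
  cbv beta in M. rewrite ybr_0, !Rminus_0_r in M. replace (24 * w ^ 2) with (24 * Rabs w * Rabs w).
  2: { rewrite <- (pow2_abs w). ring. }
  assert (A0 : forall t, Rmin 0 w <= t <= Rmax 0 w -> Rabs t <= Rabs w).
  { intros t Ht. unfold Rmin, Rmax in Ht. unfold Rabs. destruct (Rle_dec 0 w), (Rcase_abs t), (Rcase_abs w); lra. }
  apply M.
  - intros t Ht. specialize (A0 t Ht). pose proof (ybr_derive s t Hs ltac:(lra)) as D. auto_derive; [eexists; exact D|].
    replace (Derive (fun x => ybr s x) t) with (/ PSeries s t) by (symmetry; apply is_derive_unique, D). ring.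
  - intros t Ht. specialize (A0 t Ht). pose proof (sser_bounds s t Hs ltac:(lra)) as B.
    destruct Hs as (S0 & Hg & _). pose proof (geo_tail 1 6 s 1 t ltac:(lra) Hg ltac:(lra)) as K. simpl in K. rewrite S0 in K.
    replace (/ PSeries s t - 1) with ((1 - PSeries s t) * / PSeries s t) by (field; lra). rewrite Rabs_mult, Rabs_minus_sym.
    rewrite (Rabs_pos_eq (/ _)) by (left; apply Rinv_0_lt_compat; lra).
    assert (Hi : 0 < / PSeries s t <= 2). { split; [apply Rinv_0_lt_compat; lra|]. apply Rle_trans with (/ (1 / 2)); [apply Rinv_le_contravar; lra|]. lra. }
    assert (K2 : Rabs (PSeries s t - 1) <= 12 * Rabs t).
    { replace (PSeries s t - 1) with (PSeries s t - (0 + 1 * 1)) by ring. eapply Rle_trans; [apply K|]. right. ring. }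
    pose proof (Rabs_pos (PSeries s t - 1)). nra.
Qed.

Lemma ybr_lin s w : sser s -> Rabs w <= / 48 -> Rabs (ybr s w - w) <= Rabs w / 2.
Proof.
  intros Hs Hw. eapply Rle_trans; [apply ybr_quad; auto; lra|]. rewrite <- (pow2_abs w). pose proof (Rabs_pos w). nra.
Qed.

(** exp(g Y - (x^2/2) phi(Y)) at Y = 2 y, times the factor exp(- y) of 1 / (1 - exp Y) = - exp(- y)
    / (2 sinh y). This half-angle form matches the kernel of [T]. *)
Definition Kg (g x y : R) : R := exp ((2 * g - 1) * y - x ^ 2 / 2 * phi (2 * y)).
Definition kf (g x y : R) : R := Kg g x y / - sinh y.
(* With [Y = 2 y], [int_0^d kk] is the principal value near [0] of the integral of [exp (g Y - x^2/2 phi Y) / (1 - exp Y)]. *)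
Definition kk (g x : R) : R -> R := sq (fun y => Kg g x (- y) - Kg g x y) (- 2 * (2 * g - 1)).

Lemma Kg_derive g x y : is_derive (Kg g x) y ((2 * g - 1 - x ^ 2 * (exp (2 * y) - 1)) * Kg g x y).
Proof.
  unfold Kg, phi. evar_last.
  - apply (is_derive_comp exp (fun y => (2 * g - 1) * y - x ^ 2 / 2 * (exp (2 * y) - 1 - 2 * y))); [apply is_derive_exp|].
    instantiate (1 := 2 * g - 1 - x ^ 2 * (exp (2 * y) - 1)). auto_derive; auto. simpl. field.
  - reflexivity.
Qed.

Lemma Kg_cont g x y : continuous (Kg g x) y.
Proof. apply continuous_derivable. eexists. apply Kg_derive. Qed.

Lemma Kg_0 g x : Kg g x 0 = 1.
Proof. unfold Kg, phi. rewrite !Rmult_0_r, exp_0. replace (0 - x ^ 2 / 2 * (1 - 1 - 0)) with 0 by ring. apply exp_0. Qed.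

Lemma odd_part_derive (K : R -> R) l : is_derive K 0 l -> is_derive (fun y => K (- y) - K y) 0 (- 2 * l).
Proof.
  intros D. assert (D' : is_derive K (- 0) l) by now rewrite Ropp_0. auto_derive; [split; [exists l; exact D'| split; [exists l; exact D | auto]]|].
  replace (Derive (fun x => K x) (- 0)) with l by (symmetry; apply is_derive_unique, D').
  replace (Derive (fun x => K x) 0) with l by (symmetry; apply is_derive_unique, D). ring.
Qed.

Lemma kk_cont g x y : continuous (kk g x) y.
Proof.
  apply sq_cont.
  - apply odd_part_derive. evar_last; [apply Kg_derive|]. rewrite Kg_0, Rmult_0_r, exp_0. match goal with |- ?u = ?v => change (@eq R u v) end. ring.
  - rewrite Ropp_0. ring.
  - intros t. apply (continuous_minus (V := R_NormedModule)); [|apply Kg_cont].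
    apply (continuous_comp (fun t => - t) (Kg g x)); [|apply Kg_cont]. apply (continuous_opp (V := R_NormedModule)), continuous_id.
Qed.

Lemma kk_kf g x y : y <> 0 -> kk g x y = kf g x y + kf g x (- y).
Proof.
  intros H. unfold kk, sq, kf. destruct (Req_EM_T y 0); [contradiction|]. rewrite sinh_opp. pose proof (sinh_neq y H). field. auto.
Qed.

Lemma kf_cont g x y : y <> 0 -> continuous (kf g x) y.
Proof.
  intros H. unfold kf, Rdiv. apply (continuous_mult (K := R_AbsRing) (Kg g x) (fun y => / - sinh y)); [apply Kg_cont|].
  apply continuous_Rinv_comp.
  - apply (continuous_opp (V := R_NormedModule)). apply continuous_derivable. eexists. apply is_derive_sinh.
  - pose proof (sinh_neq y H). lra.
Qed.

Lemma sinh_abs_ge y : Rabs y <= Rabs (sinh y).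
Proof.
  assert (P : forall y, 0 <= y -> y <= sinh y).
  { intros t Ht. destruct (Req_dec t 0) as [->|Hne]; [rewrite sinh_0; lra|].
    destruct (MVT_gen sinh 0 t cosh) as (c & _ & E).
    - intros u _. apply is_derive_sinh.
    - intros u _. apply derivable_continuous_pt. apply derivable_pt_sinh.
    - rewrite sinh_0, !Rminus_0_r in E. rewrite E. assert (1 <= cosh c).
      { unfold cosh. pose proof (exp_pos c). rewrite exp_Ropp. assert (exp c * / exp c = 1) by (field; lra). pose proof (pow2_ge_0 (exp c - 1)).
        apply Rmult_le_reg_l with (exp c); auto. field_simplify; [|lra]. nra. }
      nra. }
  destruct (Rle_dec 0 y) as [H|H].
  - specialize (P y H). rewrite !Rabs_pos_eq; lra.
  - specialize (P (- y) ltac:(lra)). rewrite sinh_opp in P. rewrite !Rabs_left; lra.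
Qed.

Lemma kf_bound g Gm x y p P : Rabs g <= Gm -> 0 < p -> p <= Rabs y <= 1 -> P <= phi (2 * y) ->
  Rabs (kf g x y) <= exp (2 * Gm + 1) / p * exp (- (x ^ 2 / 2 * P)).
Proof.
  intros Hg Hp Hy HP. unfold kf, Rdiv at 1. rewrite Rabs_mult, Rabs_inv, Rabs_Ropp. unfold Kg. rewrite (Rabs_pos_eq (exp _)) by (left; apply exp_pos).
  pose proof (sinh_abs_ge y). replace (exp (2 * Gm + 1) / p * exp (- (x ^ 2 / 2 * P))) with (exp (2 * Gm + 1 + - (x ^ 2 / 2 * P)) * / p) by (rewrite exp_plus; field; lra).
  apply Rmult_le_compat; [left; apply exp_pos | left; apply Rinv_0_lt_compat; lra | | apply Rinv_le_contravar; lra].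
  apply exp_le_exp. assert (x ^ 2 / 2 * P <= x ^ 2 / 2 * phi (2 * y)) by (apply Rmult_le_compat_l; auto; pose proof (pow2_ge_0 x); lra).
  assert ((2 * g - 1) * y <= 2 * Gm + 1).
  { eapply Rle_trans; [apply Rle_abs|]. rewrite Rabs_mult. assert (Rabs (2 * g - 1) <= 2 * Gm + 1).
    { eapply Rle_trans; [apply Rabs_triang|]. rewrite Rabs_Ropp, Rabs_R1, Rabs_mult, (Rabs_pos_eq 2); lra. }
    pose proof (Rabs_pos (2 * g - 1)). nra. }
  lra.
Qed.

Lemma RInt_bound_any (f : R -> R) a b M : (forall t, Rmin a b <= t <= Rmax a b -> continuous f t) ->
  (forall t, Rmin a b <= t <= Rmax a b -> Rabs (f t) <= M) -> Rabs (RInt f a b) <= M * Rabs (b - a).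
Proof.
  intros Hc Hb. assert (E : ex_RInt f a b) by now apply (ex_RInt_continuous (V := R_CompleteNormedModule)).
  destruct (Rle_dec a b) as [H|H].
  - rewrite Rmin_left, Rmax_right in Hb by lra. rewrite (Rabs_pos_eq (b - a)), Rmult_comm by lra. apply abs_RInt_le_const; auto.
  - rewrite Rmin_right, Rmax_left in Hb by lra. rewrite <- (opp_RInt_swap (V := R_CompleteNormedModule)) by now apply ex_RInt_swap. change opp with Ropp. rewrite Rabs_Ropp.
    rewrite (Rabs_left (b - a)), Rmult_comm by lra. replace (- (b - a)) with (a - b) by ring. apply abs_RInt_le_const; auto; [lra|]. now apply ex_RInt_swap.
Qed.

Definition yb (s : nat -> R) (w : R) : R := ybr s w / 2.
(** The function of [is_G] without its term 1 / w, written in Y. *)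
Definition fbr (s : nat -> R) (g w : R) : R := exp (g * ybr s w) * / PSeries s w / (1 - exp (ybr s w)).

Lemma yb_near s w : sser s -> Rabs w <= / 48 -> w <> 0 -> Rabs (yb s w - w / 2) <= Rabs w / 4.
Proof.
  intros Hs Hw Hne. pose proof (ybr_lin s w Hs Hw) as L. unfold yb. replace (ybr s w / 2 - w / 2) with ((ybr s w - w) * / 2) by field.
  rewrite Rabs_mult, (Rabs_pos_eq (/ 2)); lra.
Qed.

Lemma yb_sign s w : sser s -> Rabs w <= / 48 -> w <> 0 ->
  (0 < w -> w / 4 <= yb s w <= w) /\ (w < 0 -> w <= yb s w <= w / 4).
Proof.
  intros Hs Hw Hne. pose proof (yb_near s w Hs Hw Hne) as L. split; intros H.
  - rewrite (Rabs_pos_eq w) in L by lra. apply Rabs_le_between in L. lra.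
  - rewrite (Rabs_left w) in L by lra. apply Rabs_le_between in L. lra.
Qed.

Lemma yb_neq s w : sser s -> Rabs w <= / 48 -> w <> 0 -> yb s w <> 0.
Proof. intros Hs Hw Hne. destruct (yb_sign s w Hs Hw Hne) as [A1 A2]. destruct (Rtotal_order w 0) as [|[|]]; lra. Qed.

Lemma fbr_kf s g x w : sser s -> Rabs w <= / 48 -> w <> 0 -> gw x w * fbr s g w = / (2 * PSeries s w) * kf g x (yb s w).
Proof.
  intros Hs Hw Hne. pose proof (yb_neq s w Hs Hw Hne) as Hy. pose proof (sser_bounds s w Hs ltac:(lra)) as B.
  unfold kf, fbr, Kg. replace (2 * yb s w) with (ybr s w) by (unfold yb; field).
  unfold phi. rewrite (ybr_phi s w Hs ltac:(lra)). unfold gw.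
  replace ((2 * g - 1) * yb s w - x ^ 2 / 2 * (w ^ 2 / 2)) with (- (x ^ 2 / 4 * w ^ 2) + g * ybr s w + - yb s w) by (unfold yb; field).
  rewrite !exp_plus. pose proof (sinh_neq _ Hy) as Hn. unfold sinh in *.
  replace (ybr s w) with (yb s w + yb s w) by (unfold yb; field). rewrite !Rmult_plus_distr_l, !exp_plus. rewrite (exp_Ropp (yb s w)) in *.
  set (u := exp (yb s w)) in *. assert (Hu : 0 < u) by apply exp_pos.
  assert (N1 : u * u <> 1). { intros E. apply Hn. replace (/ u) with u; [field|]. apply Rmult_eq_reg_r with u; [|lra]. rewrite Rinv_l; lra. }
  field. repeat split; try lra.
Qed.

Lemma yb_derive s w : sser s -> Rabs w <= / 48 -> is_derive (yb s) w (/ (2 * PSeries s w)).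
Proof.
  intros Hs Hw. pose proof (ybr_derive s w Hs ltac:(lra)) as D. pose proof (sser_bounds s w Hs ltac:(lra)). unfold yb.
  auto_derive; [eexists; exact D|]. replace (Derive (fun x => ybr s x) w) with (/ PSeries s w) by (symmetry; apply is_derive_unique, D). field. lra.
Qed.

Lemma inv_sf_cont s w : sser s -> Rabs w <= / 48 -> continuous (fun w => / (2 * PSeries s w)) w.
Proof.
  intros Hs Hw. pose proof (sser_derive s w Hs ltac:(lra)) as D. pose proof (sser_bounds s w Hs ltac:(lra)).
  apply continuous_derivable. auto_derive. split; [eexists; exact D|]. split; auto. lra.
Qed.

Lemma range_pos a b t d : 0 < a -> 0 < b -> a <= d -> b <= d -> Rmin a b <= t <= Rmax a b -> 0 < t <= d.
Proof. intros. unfold Rmin, Rmax in *. destruct (Rle_dec a b); lra. Qed.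

Lemma cov_pos s g x a b : sser s -> 0 < a <= / 48 -> 0 < b <= / 48 ->
  RInt (fun w => gw x w * fbr s g w) a b = RInt (kf g x) (yb s a) (yb s b).
Proof.
  intros Hs Ha Hb.
  assert (RG : forall t, Rmin a b <= t <= Rmax a b -> Rabs t <= / 48 /\ t <> 0).
  { intros t Ht. pose proof (range_pos a b t (/ 48) ltac:(lra) ltac:(lra) ltac:(lra) ltac:(lra) Ht). rewrite Rabs_pos_eq; lra. }
  rewrite <- (RInt_comp (V := R_CompleteNormedModule) (kf g x) (yb s) (fun w => / (2 * PSeries s w))).
  - apply RInt_ext. intros t Ht. destruct (RG t ltac:(lra)). now apply fbr_kf.
  - intros t Ht. destruct (RG t Ht). apply kf_cont. now apply yb_neq.
  - intros t Ht. destruct (RG t Ht). split; [now apply yb_derive | now apply inv_sf_cont].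
Qed.

Lemma cov_neg s g x a b : sser s -> 0 < a <= / 48 -> 0 < b <= / 48 ->
  RInt (fun w => gw x w * fbr s g (- w)) a b = - RInt (kf g x) (yb s (- a)) (yb s (- b)).
Proof.
  intros Hs Ha Hb.
  assert (RG : forall t, Rmin a b <= t <= Rmax a b -> Rabs (- t) <= / 48 /\ - t <> 0).
  { intros t Ht. pose proof (range_pos a b t (/ 48) ltac:(lra) ltac:(lra) ltac:(lra) ltac:(lra) Ht). rewrite Rabs_Ropp, Rabs_pos_eq; lra. }
  assert (Cd : forall t, Rmin a b <= t <= Rmax a b -> continuous (fun w => - / (2 * PSeries s (- w))) t).
  { intros t Ht. destruct (RG t Ht). apply (continuous_opp (V := R_NormedModule)).
    apply (continuous_comp (fun t => - t) (fun w => / (2 * PSeries s w))); [|now apply inv_sf_cont]. apply (continuous_opp (V := R_NormedModule)), continuous_id. }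
  assert (Dd : forall t, Rmin a b <= t <= Rmax a b -> is_derive (fun w => yb s (- w)) t (- / (2 * PSeries s (- t)))).
  { intros t Ht. destruct (RG t Ht) as [R1 R2]. pose proof (yb_derive s (- t) Hs R1) as D. auto_derive; [eexists; exact D|].
    replace (Derive (fun x => yb s x) (- t)) with (/ (2 * PSeries s (- t))) by (symmetry; apply is_derive_unique, D). ring. }
  rewrite <- (RInt_comp (V := R_CompleteNormedModule) (kf g x) (fun w => yb s (- w)) (fun w => - / (2 * PSeries s (- w)))).
  - change Ropp with (@opp R_CompleteNormedModule) at 2. rewrite <- (RInt_opp (V := R_CompleteNormedModule)).
    + apply RInt_ext. intros t Ht. destruct (RG t ltac:(lra)) as [R1 R2]. replace (gw x t) with (gw x (- t)) by (unfold gw; f_equal; f_equal; ring).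
      rewrite fbr_kf by auto. unfold scal, opp; simpl; unfold mult; simpl. match goal with |- ?u = ?v => change (@eq R u v) end. ring.
    + apply (ex_RInt_continuous (V := R_CompleteNormedModule)). intros t Ht. destruct (RG t Ht).
      apply (continuous_scal (K := R_AbsRing) (V := R_NormedModule)); [now apply Cd|].
      apply (continuous_comp (fun w => yb s (- w)) (kf g x)); [|apply kf_cont; now apply yb_neq]. apply continuous_derivable. eexists. now apply Dd.
  - intros t Ht. destruct (RG t Ht). apply kf_cont. now apply yb_neq.
  - intros t Ht. split; [now apply Dd | now apply Cd].
Qed.

Lemma kk_split g x a b : 0 < a -> 0 < b -> RInt (kk g x) a b = RInt (kf g x) a b - RInt (kf g x) (- a) (- b).
Proof.
  intros Ha Hb.
  assert (RG : forall t, Rmin a b <= t <= Rmax a b -> t <> 0 /\ - t <> 0).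
  { intros t Ht. unfold Rmin, Rmax in Ht. destruct (Rle_dec a b); lra. }
  assert (E1 : ex_RInt (kf g x) a b) by (apply (ex_RInt_continuous (V := R_CompleteNormedModule)); intros t Ht; apply kf_cont; now apply RG).
  assert (Cm : forall t, Rmin a b <= t <= Rmax a b -> continuous (fun t => kf g x (- t)) t).
  { intros t Ht. apply (continuous_comp (fun t => - t) (kf g x)); [|apply kf_cont; now apply RG]. apply (continuous_opp (V := R_NormedModule)), continuous_id. }
  assert (E2 : ex_RInt (fun t => kf g x (- t)) a b) by now apply (ex_RInt_continuous (V := R_CompleteNormedModule)).
  rewrite (RInt_ext _ (fun t => kf g x t + kf g x (- t))) by (intros t Ht; apply kk_kf; apply RG; lra).
  rewrite (RInt_plus (V := R_CompleteNormedModule) (kf g x) (fun t => kf g x (- t))) by auto.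
  change plus with Rplus. unfold Rminus. f_equal.
  rewrite <- (RInt_comp (V := R_CompleteNormedModule) (kf g x) (fun t => - t) (fun _ => - 1)).
  - rewrite <- (RInt_opp (V := R_CompleteNormedModule)).
    + apply RInt_ext. intros t Ht. unfold scal, opp; simpl; unfold mult; simpl. match goal with |- ?u = ?v => change (@eq R u v) end. ring.
    + apply (ex_RInt_continuous (V := R_CompleteNormedModule)). intros t Ht. apply (continuous_scal_r (K := R_AbsRing) (V := R_NormedModule)). now apply Cm.
  - intros t Ht. apply kf_cont. now apply RG.
  - intros t Ht. split; [auto_derive; auto; ring | apply continuous_const].
Qed.

(** Folding w and - w keeps the even powers only. *)
Definition Gs (g w : R) : R := PSeries (Gcoef g) w + PSeries (Gcoef g) (- w).

(** The window is half the radius granted by [Gcoef_geo], so that tails of the series are geometric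
    with ratio 1/2. *)
Lemma window_small Gm : 0 <= Gm -> 0 < / (2 * (Gm + 36)) /\ / (2 * (Gm + 36)) <= / 72 /\ / (2 * (Gm + 36)) * (Gm + 36) = 1 / 2.
Proof.
  intros H. split; [apply Rinv_0_lt_compat; lra|]. split; [apply Rinv_le_contravar; lra | field; lra].
Qed.

Lemma window_le Gm w : 0 <= Gm -> Rabs w <= / (2 * (Gm + 36)) -> Rabs w * (Gm + 36) <= 1 / 2 /\ Rabs w <= / 72.
Proof.
  intros H Hw. destruct (window_small Gm H) as (P1 & P2 & P3). split; [|lra]. rewrite <- P3. apply Rmult_le_compat_r; lra.
Qed.

Lemma Gs_cont g Gm w : Rabs g <= Gm -> Rabs w <= / (2 * (Gm + 36)) -> continuous (Gs g) w.
Proof.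
  intros Hg Hw. pose proof (Rabs_pos g). destruct (window_le Gm w ltac:(lra) Hw) as [W1 W2].
  assert (C : forall t, Rabs t = Rabs w -> continuous (PSeries (Gcoef g)) t).
  { intros t Ht. apply continuity_pt_filterlim. apply PSeries_continuity. apply (geo_radius (Gm + 36) (Gm + 36)); [lra | now apply Gcoef_geo | rewrite Ht; lra]. }
  unfold Gs. apply (continuous_plus (V := R_NormedModule)); [now apply C|].
  apply (continuous_comp (fun t => - t) (PSeries (Gcoef g))); [|apply C; apply Rabs_Ropp]. apply (continuous_opp (V := R_NormedModule)), continuous_id.
Qed.

Lemma Gs_bound g Gm w : Rabs g <= Gm -> Rabs w <= / (2 * (Gm + 36)) -> Rabs (Gs g w) <= 4 * (Gm + 36).
Proof.
  intros Hg Hw. pose proof (Rabs_pos g). destruct (window_le Gm w ltac:(lra) Hw) as [W1 W2]. unfold Gs.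
  eapply Rle_trans; [apply Rabs_triang|].
  pose proof (geo_PSeries_bound (Gm + 36) (Gm + 36) (Gcoef g) w ltac:(lra) (Gcoef_geo g Gm Hg) W1).
  pose proof (geo_PSeries_bound (Gm + 36) (Gm + 36) (Gcoef g) (- w) ltac:(lra) (Gcoef_geo g Gm Hg) ltac:(rewrite Rabs_Ropp; exact W1)). lra.
Qed.

Lemma gw_le1 x w : gw x w <= 1.
Proof.
  unfold gw. rewrite <- exp_0. apply exp_le_exp. assert (0 <= x ^ 2 / 4 * w ^ 2) by (pose proof (pow2_ge_0 x); pose proof (pow2_ge_0 w); nra). lra.
Qed.

Lemma gw_cont x w : continuous (gw x) w.
Proof. apply continuous_derivable. eexists. apply gw_derive. Qed.

(** The terms 1 / w and 1 / (- w) added by [Gcoef_function] cancel in the folded sum, which is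
    therefore regular at 0. *)
Lemma cov_J s g Gm x a b : sser s -> Rabs g <= Gm -> 0 < a <= / (2 * (Gm + 36)) -> 0 < b <= / (2 * (Gm + 36)) ->
  RInt (fun w => gw x w * Gs g w) a b = RInt (kf g x) (yb s a) (yb s b) - RInt (kf g x) (yb s (- a)) (yb s (- b)).
Proof.
  intros Hs Hg Ha Hb. pose proof (Rabs_pos g) as Hg0. destruct (window_small Gm ltac:(lra)) as (P1 & P2 & P3).
  set (d := / (2 * (Gm + 36))) in *.
  rewrite <- (cov_pos s g x a b) by (auto; lra). unfold Rminus. rewrite <- (cov_neg s g x a b) by (auto; lra).
  assert (RG : forall t, Rmin a b <= t <= Rmax a b -> 0 < t <= d).
  { intros t Ht. apply (range_pos a b t d); lra. }
  assert (Cy : forall t, Rmin a b <= t <= Rmax a b -> continuous (fun w => gw x w * fbr s g w) t /\ continuous (fun w => gw x w * fbr s g (- w)) t).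
  { intros t Ht. specialize (RG t Ht).
    assert (Cb : forall u, u <> 0 -> Rabs u <= / 48 -> continuous (fbr s g) u).
    { intros u Hu Hu2. pose proof (ybr_derive s u Hs ltac:(lra)) as D1. pose proof (sser_derive s u Hs ltac:(lra)) as D2. pose proof (sser_bounds s u Hs ltac:(lra)).
      apply continuous_derivable. unfold fbr. auto_derive. repeat split; try (eexists; eassumption); try lra.
      intros E. apply (yb_neq s u Hs Hu2 Hu). unfold yb. replace (ybr s u) with 0; [field|]. symmetry.
      destruct (Req_dec (ybr s u) 0) as [|N]; auto. pose proof (exp_ineq1 (ybr s u) N).
      assert (E1 : exp (ybr s u) = exp 0) by (rewrite exp_0; lra). now apply exp_inv in E1. }
    split; (apply (continuous_mult (K := R_AbsRing) (gw x)); [apply gw_cont|]).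
    - apply Cb; [lra | rewrite Rabs_pos_eq; lra].
    - apply (continuous_comp (fun t => - t) (fbr s g)); [|apply Cb; [lra | rewrite Rabs_Ropp, Rabs_pos_eq; lra]]. apply (continuous_opp (V := R_NormedModule)), continuous_id. }
  rewrite <- (RInt_plus (V := R_CompleteNormedModule)).
  - apply RInt_ext. intros t Ht. specialize (RG t ltac:(lra)). unfold Gs, fbr.
    assert (Hw : Rabs t <= d) by (rewrite Rabs_pos_eq; lra). destruct (window_le Gm t ltac:(lra) Hw) as [W1 W2].
    rewrite <- (Gcoef_function s g Gm t Hs Hg) by lra. rewrite <- (Gcoef_function s g Gm (- t) Hs Hg) by (rewrite ?Rabs_Ropp; lra).
    change plus with Rplus. match goal with |- ?u = ?v => change (@eq R u v) end.
    set (X1 := exp (g * ybr s t) * / PSeries s t / _). set (X2 := exp (g * ybr s (- t)) * / PSeries s (- t) / _). field. lra.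
  - apply (ex_RInt_continuous (V := R_CompleteNormedModule)). intros t Ht. exact (proj1 (Cy t Ht)).
  - apply (ex_RInt_continuous (V := R_CompleteNormedModule)). intros t Ht. exact (proj2 (Cy t Ht)).
Qed.

Lemma RInt_Chasles_R (f : R -> R) a b c : ex_RInt f a b -> ex_RInt f b c -> RInt f a c = RInt f a b + RInt f b c.
Proof. intros H1 H2. symmetry. apply (RInt_Chasles (V := R_CompleteNormedModule)); auto. Qed.

Lemma kf_ex_RInt_pos g x a b : 0 < a -> 0 < b -> ex_RInt (kf g x) a b.
Proof.
  intros Ha Hb. apply (ex_RInt_continuous (V := R_CompleteNormedModule)). intros t Ht. apply kf_cont. unfold Rmin, Rmax in Ht. destruct (Rle_dec a b); lra.
Qed.

Lemma kf_ex_RInt_neg g x a b : a < 0 -> b < 0 -> ex_RInt (kf g x) a b.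
Proof.
  intros Ha Hb. apply (ex_RInt_continuous (V := R_CompleteNormedModule)). intros t Ht. apply kf_cont. unfold Rmin, Rmax in Ht. destruct (Rle_dec a b); lra.
Qed.

(* The substitution [y = yb w] is not symmetric at [0]; the mismatch of the excised intervals has length O(eta^2) against an integrand O(1/eta). *)
Lemma cov_eta s g Gm x eta : sser s -> Rabs g <= Gm -> 0 < eta <= / (2 * (Gm + 36)) ->
  Rabs (RInt (fun w => gw x w * Gs g w) eta (/ (2 * (Gm + 36))) - RInt (kk g x) (yb s eta) (/ (2 * (Gm + 36))))
  <= 8 * exp (2 * Gm + 1) * gw x (/ (2 * (Gm + 36))) + 96 * exp (2 * Gm + 1) * eta.
Proof.
  intros Hs Hg He. pose proof (Rabs_pos g) as Hg0. destruct (window_small Gm ltac:(lra)) as (P1 & P2 & P3).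
  set (d := / (2 * (Gm + 36))) in *. set (Ex := exp (2 * Gm + 1)).
  destruct (yb_sign s eta Hs ltac:(rewrite Rabs_pos_eq; lra) ltac:(lra)) as [Y1 _]. specialize (Y1 ltac:(lra)).
  destruct (yb_sign s d Hs ltac:(rewrite Rabs_pos_eq; lra) ltac:(lra)) as [Y2 _]. specialize (Y2 ltac:(lra)).
  destruct (yb_sign s (- eta) Hs ltac:(rewrite Rabs_Ropp, Rabs_pos_eq; lra) ltac:(lra)) as [_ Y3]. specialize (Y3 ltac:(lra)).
  destruct (yb_sign s (- d) Hs ltac:(rewrite Rabs_Ropp, Rabs_pos_eq; lra) ltac:(lra)) as [_ Y4]. specialize (Y4 ltac:(lra)).
  rewrite (cov_J s g Gm) by (auto; unfold d in *; lra). rewrite kk_split by lra.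
  rewrite (RInt_Chasles_R (kf g x) (yb s eta) (yb s d) d) by (apply kf_ex_RInt_pos; lra).
  rewrite (RInt_Chasles_R (kf g x) (- yb s eta) (yb s (- eta)) (- d)) by (apply kf_ex_RInt_neg; lra).
  rewrite (RInt_Chasles_R (kf g x) (yb s (- eta)) (yb s (- d)) (- d)) by (apply kf_ex_RInt_neg; lra).
  set (I1 := RInt (kf g x) (yb s eta) (yb s d)). set (I2 := RInt (kf g x) (yb s (- eta)) (yb s (- d))).
  assert (Ed : forall u, Rabs u <= d -> u <> 0 -> phi (2 * yb s u) = u ^ 2 / 2).
  { intros u Hu Hu0. replace (2 * yb s u) with (ybr s u) by (unfold yb; field). apply ybr_phi; auto; lra. }
  assert (Gd : exp (- (x ^ 2 / 2 * (d ^ 2 / 2))) = gw x d) by (unfold gw; f_equal; field).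
  assert (T1 : Rabs (RInt (kf g x) (yb s d) d) <= 4 * Ex * gw x d).
  { eapply Rle_trans; [apply (RInt_bound_any _ _ _ (Ex / (d / 4) * gw x d))|].
    - intros t Ht. apply kf_cont. rewrite Rmin_left, Rmax_right in Ht by lra. lra.
    - intros t Ht. rewrite Rmin_left, Rmax_right in Ht by lra. rewrite <- Gd. apply (kf_bound g Gm x t (d / 4) (d ^ 2 / 2)); auto; [lra | rewrite Rabs_pos_eq; lra |].
      replace (d ^ 2 / 2) with (phi (2 * yb s d)) by (apply Ed; [rewrite Rabs_pos_eq|]; lra). apply phi_mono_r. lra.
    - rewrite (Rabs_pos_eq (d - yb s d)) by lra. replace (4 * Ex * gw x d) with (Ex / (d / 4) * gw x d * d) by (field; lra).
      apply Rmult_le_compat_l; [|lra]. apply Rmult_le_pos; [|left; apply exp_pos]. apply Rlt_le, Rdiv_lt_0_compat; [apply exp_pos | lra]. }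
  assert (T2 : Rabs (RInt (kf g x) (yb s (- d)) (- d)) <= 4 * Ex * gw x d).
  { eapply Rle_trans; [apply (RInt_bound_any _ _ _ (Ex / (d / 4) * gw x d))|].
    - intros t Ht. apply kf_cont. rewrite Rmin_right, Rmax_left in Ht by lra. lra.
    - intros t Ht. rewrite Rmin_right, Rmax_left in Ht by lra. rewrite <- Gd. apply (kf_bound g Gm x t (d / 4) (d ^ 2 / 2)); auto; [lra | rewrite Rabs_left; lra |].
      replace (d ^ 2 / 2) with (phi (2 * yb s (- d))) by (rewrite Ed; [field | rewrite Rabs_Ropp, Rabs_pos_eq; lra | lra]). apply phi_mono_l. lra.
    - rewrite (Rabs_left1 (- d - yb s (- d))) by lra. replace (4 * Ex * gw x d) with (Ex / (d / 4) * gw x d * d) by (field; lra).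
      apply Rmult_le_compat_l; [|lra]. apply Rmult_le_pos; [|left; apply exp_pos]. apply Rlt_le, Rdiv_lt_0_compat; [apply exp_pos | lra]. }
  assert (T3 : Rabs (RInt (kf g x) (- yb s eta) (yb s (- eta))) <= 96 * Ex * eta).
  { assert (RG : forall t, Rmin (- yb s eta) (yb s (- eta)) <= t <= Rmax (- yb s eta) (yb s (- eta)) -> - eta <= t <= - (eta / 4)).
    { intros t Ht. unfold Rmin, Rmax in Ht. destruct (Rle_dec (- yb s eta) (yb s (- eta))); lra. }
    eapply Rle_trans; [apply (RInt_bound_any _ _ _ (Ex / (eta / 4) * exp (- (x ^ 2 / 2 * 0))))|].
    - intros t Ht. specialize (RG t Ht). apply kf_cont. lra.
    - intros t Ht. specialize (RG t Ht). apply (kf_bound g Gm x t (eta / 4) 0); auto; [lra | rewrite Rabs_left; lra | apply phi_pos].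
    - rewrite Rmult_0_r, Ropp_0, exp_0, Rmult_1_r.
      pose proof (ybr_quad s eta Hs ltac:(rewrite Rabs_pos_eq; lra)) as Q1. pose proof (ybr_quad s (- eta) Hs ltac:(rewrite Rabs_Ropp, Rabs_pos_eq; lra)) as Q2.
      replace ((- eta) ^ 2) with (eta ^ 2) in Q2 by ring.
      assert (L : Rabs (yb s (- eta) - - yb s eta) <= 24 * eta ^ 2).
      { replace (yb s (- eta) - - yb s eta) with (/ 2 * ((ybr s (- eta) - - eta) + (ybr s eta - eta))) by (unfold yb; field).
        rewrite Rabs_mult, (Rabs_pos_eq (/ 2)) by lra. pose proof (Rabs_triang (ybr s (- eta) - - eta) (ybr s eta - eta)). lra. }
      apply Rle_trans with (Ex / (eta / 4) * (24 * eta ^ 2)); [|right; field; lra].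
      apply Rmult_le_compat_l; auto. apply Rlt_le, Rdiv_lt_0_compat; [apply exp_pos | lra]. }
  set (R1 := RInt (kf g x) (yb s d) d) in *. set (R2 := RInt (kf g x) (yb s (- d)) (- d)) in *. set (R3 := RInt (kf g x) (- yb s eta) (yb s (- eta))) in *.
  replace (I1 - I2 - (I1 + R1 - (R3 + (I2 + R2)))) with (R3 + (R2 + - R1)) by ring.
  pose proof (Rabs_triang R3 (R2 + - R1)). pose proof (Rabs_triang R2 (- R1)). rewrite Rabs_Ropp in H0. lra.
Qed.

(** The limit eta -> 0 of [cov_eta], argued by contradiction: the error is at most Er + D eta for
    all small eta. What remains is the mismatch of the outer endpoints, which is exponentially small
    in x^2. *)
Lemma cov_local g Gm x : Rabs g <= Gm ->
  Rabs (RInt (fun w => gw x w * Gs g w) 0 (/ (2 * (Gm + 36))) - RInt (kk g x) 0 (/ (2 * (Gm + 36))))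
  <= 8 * exp (2 * Gm + 1) * gw x (/ (2 * (Gm + 36))).
Proof.
  intros Hg. destruct s_exists as [s Hs]. pose proof (Rabs_pos g) as Hg0. destruct (window_small Gm ltac:(lra)) as (P1 & P2 & P3).
  set (d := / (2 * (Gm + 36))) in *.
  pose proof (proj1 (continuity_pt_locally (kk g x) 0) (proj2 (continuity_pt_filterlim (kk g x) 0) (kk_cont g x 0)) (mkposreal 1 Rlt_0_1)) as Ck. destruct Ck as [dk Hdk]. cbn [pos] in Hdk.
  set (D := 4 * (Gm + 36) + (Rabs (kk g x 0) + 1) + 96 * exp (2 * Gm + 1)).
  assert (HD : 0 < D) by (unfold D; pose proof (Rabs_pos (kk g x 0)); pose proof (exp_pos (2 * Gm + 1)); lra).
  apply Rnot_lt_le. intros HN.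
  set (L := Rabs _) in HN. set (Er := 8 * exp (2 * Gm + 1) * gw x d) in *.
  set (eta := Rmin (Rmin d (dk / 2)) ((L - Er) / (2 * D))).
  assert (He : 0 < eta). { apply Rmin_glb_lt; [apply Rmin_glb_lt; [auto | pose proof (cond_pos dk); lra] | apply Rdiv_lt_0_compat; lra]. }
  assert (He1 : eta <= d). { unfold eta. eapply Rle_trans; [apply Rmin_l | apply Rmin_l]. }
  assert (He2 : eta <= dk / 2). { unfold eta. eapply Rle_trans; [apply Rmin_l | apply Rmin_r]. }
  assert (He3 : eta * (2 * D) <= L - Er).
  { apply Rle_trans with ((L - Er) / (2 * D) * (2 * D)); [apply Rmult_le_compat_r; [lra | apply Rmin_r] | right; field; lra]. }
  pose proof (cov_eta s g Gm x eta Hs Hg ltac:(unfold d in *; lra)) as C. fold d in C. fold Er in C.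
  destruct (yb_sign s eta Hs ltac:(rewrite Rabs_pos_eq; lra) ltac:(lra)) as [Y1 _]. specialize (Y1 He).
  assert (CG : forall t, 0 <= t <= d -> continuous (fun w => gw x w * Gs g w) t).
  { intros t Ht. apply (continuous_mult (K := R_AbsRing) (gw x)); [apply gw_cont|]. apply (Gs_cont g Gm); auto. rewrite Rabs_pos_eq by lra. fold d. lra. }
  assert (I1 : Rabs (RInt (fun w => gw x w * Gs g w) 0 eta) <= 4 * (Gm + 36) * eta).
  { eapply Rle_trans; [apply (RInt_bound_any _ _ _ (4 * (Gm + 36)))|].
    - intros t Ht. rewrite Rmin_left, Rmax_right in Ht by lra. apply CG. lra.
    - intros t Ht. rewrite Rmin_left, Rmax_right in Ht by lra. rewrite Rabs_mult. pose proof (Gs_bound g Gm t Hg) as B. fold d in B. rewrite (Rabs_pos_eq t) in B by lra. specialize (B ltac:(lra)).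
      pose proof (gw_le1 x t). rewrite (Rabs_pos_eq (gw x t)) by (left; apply exp_pos). pose proof (Rabs_pos (Gs g t)). assert (0 < gw x t) by apply exp_pos. nra.
    - rewrite Rminus_0_r, (Rabs_pos_eq eta) by lra. lra. }
  assert (I2 : Rabs (RInt (kk g x) 0 (yb s eta)) <= (Rabs (kk g x 0) + 1) * eta).
  { eapply Rle_trans; [apply (RInt_bound_any _ _ _ (Rabs (kk g x 0) + 1))|].
    - intros t Ht. apply kk_cont.
    - intros t Ht. rewrite Rmin_left, Rmax_right in Ht by lra.
      assert (Bt : ball 0 dk t). { change (Rabs (t - 0) < dk). rewrite Rminus_0_r, Rabs_pos_eq by lra. pose proof (cond_pos dk). lra. }
      specialize (Hdk t Bt). pose proof (Rabs_triang_inv (kk g x t) (kk g x 0)). lra.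
    - rewrite Rminus_0_r, (Rabs_pos_eq (yb s eta)) by lra. apply Rmult_le_compat_l; [pose proof (Rabs_pos (kk g x 0))|]; lra. }
  assert (Z : L <= Er + D * eta); [|nra]. unfold L.
  assert (X1 : ex_RInt (fun w => gw x w * Gs g w) 0 eta /\ ex_RInt (fun w => gw x w * Gs g w) eta d).
  { split; (apply (ex_RInt_continuous (V := R_CompleteNormedModule)); intros t Ht; rewrite Rmin_left, Rmax_right in Ht by lra; apply CG; lra). }
  rewrite (RInt_Chasles_R (fun w => gw x w * Gs g w) 0 eta d) by apply X1.
  rewrite (RInt_Chasles_R (kk g x) 0 (yb s eta) d) by (apply cont_ex_RInt; apply kk_cont).
  set (J1 := RInt (fun w => gw x w * Gs g w) 0 eta) in *. set (J2 := RInt (fun w => gw x w * Gs g w) eta d) in *.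
  set (S1 := RInt (kk g x) 0 (yb s eta)) in *. set (S2 := RInt (kk g x) (yb s eta) d) in *.
  replace (J1 + J2 - (S1 + S2)) with (J1 + (- S1 + (J2 - S2))) by ring.
  pose proof (Rabs_triang J1 (- S1 + (J2 - S2))) as Z1. pose proof (Rabs_triang (- S1) (J2 - S2)) as Z2. rewrite (Rabs_Ropp S1) in Z2.
  unfold D. lra.
Qed.

Lemma gauss_small N : exists C, 0 <= C /\ forall u, 0 < u -> exp (- (u ^ 2 / 2)) <= C / u ^ N.
Proof.
  assert (Hg : gb (fun u => exp (- (u ^ 2 / 2)))).
  { exists 1, O. split; [lra|]. intros u Hu. rewrite Rabs_pos_eq by (left; apply exp_pos). simpl. lra. }
  destruct (gb_rap _ Hg N) as (C & HC & H). exists C. split; auto. intros u Hu. specialize (H u Hu).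
  rewrite Rabs_pos_eq in H by (left; apply exp_pos). pose proof (pow_lt u N Hu) as P.
  apply Rmult_le_reg_r with (u ^ N); auto. unfold Rdiv. rewrite Rmult_assoc, Rinv_l, Rmult_1_r by lra.
  eapply Rle_trans; [|apply H]. rewrite Rmult_comm. apply Rmult_le_compat_r; [left; apply exp_pos|]. apply pow_incr. lra.
Qed.

Lemma gw_small d N : 0 < d -> exists C, 0 <= C /\ forall x, 0 < x -> gw x d <= C / x ^ N.
Proof.
  intros Hd. destruct (gauss_small N) as (C & HC & H). exists (C * (2 / d) ^ N). assert (H2 : 0 < 2 / d) by (apply Rdiv_lt_0_compat; lra).
  split; [apply Rmult_le_pos; auto; left; now apply pow_lt|]. intros x Hx.
  apply Rle_trans with (exp (- ((d * x / 2) ^ 2 / 2))).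
  - apply exp_le_exp. pose proof (pow2_ge_0 (x * d)). nra.
  - eapply Rle_trans; [apply H; nra|]. right. replace (d * x / 2) with (x / (2 / d)) by (field; lra). unfold Rdiv at 2 4. rewrite Rpow_mult_distr, pow_inv. pose proof (pow_lt x N Hx). pose proof (pow_lt (2 / d) N H2). field. lra.
Qed.

Lemma even_split (a : nat -> R) w K : sumn (fun n => a n * w ^ n) (2 * K) + sumn (fun n => a n * (- w) ^ n) (2 * K)
  = sumn (fun k => 2 * a (2 * k)%nat * w ^ (2 * k)) K.
Proof.
  induction K as [|K IH]; [simpl; ring|]. replace (2 * S K)%nat with (S (S (2 * K))) by lia. cbn [sumn]. rewrite <- IH.
  change ((- w) ^ S (2 * K)) with (- w * (- w) ^ (2 * K)). change (w ^ S (2 * K)) with (w * w ^ (2 * K)).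
  replace ((- w) ^ (2 * K)) with (w ^ (2 * K)) by (rewrite !pow_mult; f_equal; ring). ring.
Qed.

Lemma Gs_tail g Gm w K : Rabs g <= Gm -> Rabs w <= / (2 * (Gm + 36)) ->
  Rabs (Gs g w - sumn (fun k => 2 * Gcoef g (2 * k)%nat * w ^ (2 * k)) K) <= 4 * (Gm + 36) * (Gm + 36) ^ (2 * K) * Rabs w ^ (2 * K).
Proof.
  intros Hg Hw. pose proof (Rabs_pos g). destruct (window_le Gm w ltac:(lra) Hw) as [W1 W2]. rewrite <- even_split. unfold Gs.
  pose proof (geo_tail (Gm + 36) (Gm + 36) (Gcoef g) (2 * K) w ltac:(lra) (Gcoef_geo g Gm Hg) W1) as T1.
  pose proof (geo_tail (Gm + 36) (Gm + 36) (Gcoef g) (2 * K) (- w) ltac:(lra) (Gcoef_geo g Gm Hg) ltac:(rewrite Rabs_Ropp; exact W1)) as T2.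
  rewrite Rabs_Ropp in T2.
  match type of T1 with Rabs ?u <= _ => match type of T2 with Rabs ?v <= _ => pose proof (Rabs_triang u v) as T3; match goal with |- Rabs ?q <= _ => replace q with (u + v) by ring end end end.
  lra.
Qed.

Lemma gw_pow_ex_RInt x d n : ex_RInt (fun w => gw x w * w ^ n) 0 d.
Proof. apply cont_ex_RInt. intros w. apply gw_mono_cont, pow_cont. Qed.

Lemma RInt_gw_sumn (c : nat -> R) x d K : ex_RInt (fun w => gw x w * sumn (fun k => c k * w ^ (2 * k)) K) 0 d /\
  RInt (fun w => gw x w * sumn (fun k => c k * w ^ (2 * k)) K) 0 d = sumn (fun k => c k * mom k x d) K.
Proof.
  induction K as [|K [E IH]].
  - cbn [sumn]. assert (F : forall w, 0 = gw x w * 0) by (intros; ring). split.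
    + apply (ex_RInt_ext (fun _ => 0)); [intros; apply F | apply ex_RInt_const].
    + rewrite <- (RInt_ext (fun _ => 0)) by (intros; apply F). rewrite (RInt_const (V := R_CompleteNormedModule)). apply Rmult_0_r.
  - cbn [sumn]. 
    assert (Es : ex_RInt (fun w => c K * (gw x w * w ^ (2 * K))) 0 d) by (apply (ex_RInt_scal (V := R_NormedModule)); apply gw_pow_ex_RInt).
    assert (F : forall w, gw x w * sumn (fun k => c k * w ^ (2 * k)) K + c K * (gw x w * w ^ (2 * K)) = gw x w * (sumn (fun k => c k * w ^ (2 * k)) K + c K * w ^ (2 * K))) by (intros; ring).
    split.
    + apply (ex_RInt_ext (fun w => gw x w * sumn (fun k => c k * w ^ (2 * k)) K + c K * (gw x w * w ^ (2 * K)))); [intros; apply F|].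
      now apply (ex_RInt_plus (V := R_NormedModule)).
    + rewrite <- (RInt_ext (fun w => gw x w * sumn (fun k => c k * w ^ (2 * k)) K + c K * (gw x w * w ^ (2 * K)))) by (intros; apply F).
      rewrite (RInt_plus (V := R_CompleteNormedModule) (fun w => gw x w * sumn (fun k => c k * w ^ (2 * k)) K)) by auto.
      rewrite (RInt_scal (V := R_CompleteNormedModule) (fun w => gw x w * w ^ (2 * K))) by apply gw_pow_ex_RInt. rewrite IH. reflexivity.
Qed.

Lemma mmain_bound k : exists C, 0 <= C /\ forall x, 0 < x -> 0 <= mmain k x <= C / x ^ (2 * k + 1).
Proof.
  pose proof PI_RGT_0. assert (Hs : 0 <= sqrt PI) by apply sqrt_pos. assert (Hp : 0 < poch (1 / 2) k) by (apply poch_pos; lra).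
  exists (1 / 2 * sqrt PI * poch (1 / 2) k * 2 ^ (2 * k + 1)).
  assert (0 <= 1 / 2 * sqrt PI * poch (1 / 2) k) by (apply Rmult_le_pos; lra).
  split; [apply Rmult_le_pos; auto; apply pow_le; lra|]. intros x Hx. unfold mmain. split.
  - apply Rmult_le_pos; auto. apply pow_le. left. apply Rdiv_lt_0_compat; lra.
  - right. unfold Rdiv at 2 3. rewrite Rpow_mult_distr, pow_inv. unfold Rdiv. ring.
Qed.

Lemma mom_sum_main Gm K : exists C, 0 <= C /\ forall g x, Rabs g <= Gm -> 1 <= x -> 2 <= x * / (2 * (Gm + 36)) ->
  Rabs (sumn (fun k => 2 * Gcoef g (2 * k)%nat * mom k x (/ (2 * (Gm + 36)))) K - sumn (fun k => 2 * Gcoef g (2 * k)%nat * mmain k x) K) <= C * gw x (/ (2 * (Gm + 36))).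
Proof.
  destruct (Rle_dec 0 Gm) as [HG|HG].
  2: { exists 0. split; [lra|]. intros g x Hg. exfalso. pose proof (Rabs_pos g). lra. }
  destruct (window_small Gm HG) as (P1 & P2 & P3). set (d := / (2 * (Gm + 36))) in *.
  induction K as [|K (C & HC & IH)].
  - exists 0. split; [lra|]. intros. simpl. rewrite Rminus_0_r, Rabs_R0. lra.
  - destruct (mom_main K) as (C1 & HC1 & H1). set (q := 2 * (Gm + 36) * (Gm + 36) ^ (2 * K)).
    assert (Hq : 0 <= q) by (unfold q; apply Rmult_le_pos; [|apply pow_le]; lra).
    exists (C + q * C1). split; [nra|]. intros g x Hg Hx Hxd. cbn [sumn]. specialize (IH g x Hg Hx Hxd). specialize (H1 x d ltac:(lra) Hxd Hx).
    match goal with |- Rabs (?a + ?b - (?c + ?e)) <= _ => replace (a + b - (c + e)) with ((a - c) + 2 * Gcoef g (2 * K)%nat * (mom K x d - mmain K x)) by ring end.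
    eapply Rle_trans; [apply Rabs_triang|]. rewrite Rmult_plus_distr_r. apply Rplus_le_compat; auto.
    rewrite Rabs_mult, (Rmult_assoc q). apply Rmult_le_compat; try apply Rabs_pos; auto.
    rewrite Rabs_mult, (Rabs_pos_eq 2) by lra. unfold q. pose proof (Gcoef_geo g Gm Hg (2 * K)%nat). lra.
Qed.

Lemma div_le_pow C x n m : 0 <= C -> 1 <= x -> (m <= n)%nat -> C / x ^ n <= C / x ^ m.
Proof.
  intros HC Hx Hnm. apply Rmult_le_compat_l; auto. apply Rinv_le_contravar; [apply pow_lt; lra | now apply Rle_pow].
Qed.

(** [Gs] is truncated after K even terms, and the truncated moments are replaced by full ones. The
    power x^(- (2 K + 1)) is the size of the first omitted moment; all other errors are multiples of
    [gw] at the end of the window. *)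
Lemma local_I Gm K : exists C, 0 <= C /\ forall g x, Rabs g <= Gm -> 1 <= x -> 2 <= x * / (2 * (Gm + 36)) ->
  Rabs (RInt (kk g x) 0 (/ (2 * (Gm + 36))) - sumn (fun k => 2 * Gcoef g (2 * k)%nat * mmain k x) K) <= C / x ^ (2 * K + 1).
Proof.
  destruct (Rle_dec 0 Gm) as [HG|HG].
  2: { exists 0. split; [lra|]. intros g x Hg. exfalso. pose proof (Rabs_pos g). lra. }
  destruct (window_small Gm HG) as (P1 & P2 & P3).
  destruct (mom_sum_main Gm K) as (C1 & HC1 & H1). destruct (mom_main K) as (C2 & HC2 & H2). destruct (mmain_bound K) as (C3 & HC3 & H3).
  set (d := / (2 * (Gm + 36))) in *. destruct (gw_small d (2 * K + 1) P1) as (C4 & HC4 & H4).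
  set (q := 4 * (Gm + 36) * (Gm + 36) ^ (2 * K)). assert (Hq : 0 <= q) by (unfold q; apply Rmult_le_pos; [|apply pow_le]; lra).
  set (Ex := exp (2 * Gm + 1)). assert (HE : 0 < Ex) by apply exp_pos.
  assert (Hco : 0 <= 8 * Ex + q * C2 + C1) by (pose proof (Rmult_le_pos q C2 Hq HC2); lra).
  exists ((8 * Ex + q * C2 + C1) * C4 + q * C3). split; [apply Rplus_le_le_0_compat; now apply Rmult_le_pos|]. intros g x Hg Hx Hxd.
  specialize (H1 g x Hg Hx Hxd). specialize (H2 x d ltac:(lra) Hxd Hx). specialize (H3 x ltac:(lra)). specialize (H4 x ltac:(lra)).
  pose proof (cov_local g Gm x Hg) as L. fold d in L. fold Ex in L.
  assert (CG : forall t, Rmin 0 d <= t <= Rmax 0 d -> continuous (fun w => gw x w * Gs g w) t).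
  { intros t Ht. rewrite Rmin_left, Rmax_right in Ht by lra. apply (continuous_mult (K := R_AbsRing) (gw x)); [apply gw_cont|]. apply (Gs_cont g Gm); auto. rewrite Rabs_pos_eq by lra. fold d. lra. }
  set (S0 := sumn (fun k => 2 * Gcoef g (2 * k)%nat * mmain k x) K) in *.
  set (S1 := sumn (fun k => 2 * Gcoef g (2 * k)%nat * mom k x d) K) in *.
  set (J := RInt (fun w => gw x w * Gs g w) 0 d) in *. set (S2 := RInt (kk g x) 0 d) in *.
  assert (T : Rabs (J - S1) <= q * mom K x d).
  { destruct (RInt_gw_sumn (fun k => 2 * Gcoef g (2 * k)%nat) x d K) as [X1 X2]. unfold S1. rewrite <- X2. unfold J.
    assert (E1 : is_RInt (fun w => minus (gw x w * Gs g w) (gw x w * sumn (fun k => 2 * Gcoef g (2 * k)%nat * w ^ (2 * k)) K)) 0 d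
      (minus (RInt (fun w => gw x w * Gs g w) 0 d) (RInt (fun w => gw x w * sumn (fun k => 2 * Gcoef g (2 * k)%nat * w ^ (2 * k)) K) 0 d))).
    { apply (is_RInt_minus (V := R_NormedModule)); apply (RInt_correct (V := R_CompleteNormedModule)); auto.
      now apply (ex_RInt_continuous (V := R_CompleteNormedModule)). }
    assert (E2 : is_RInt (fun w => q * (gw x w * w ^ (2 * K))) 0 d (q * mom K x d)).
    { apply (is_RInt_scal (V := R_NormedModule)). apply (RInt_correct (V := R_CompleteNormedModule)). apply gw_pow_ex_RInt. }
    refine (norm_RInt_le _ _ 0 d _ _ _ _ E1 E2); [lra|]. intros w Hw.
    change (Rabs (gw x w * Gs g w - gw x w * sumn (fun k => 2 * Gcoef g (2 * k)%nat * w ^ (2 * k)) K) <= q * (gw x w * w ^ (2 * K))).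
    rewrite <- Rmult_minus_distr_l, Rabs_mult, (Rabs_pos_eq (gw x w)) by (left; apply exp_pos).
    replace (q * (gw x w * w ^ (2 * K))) with (gw x w * (q * w ^ (2 * K))) by ring. apply Rmult_le_compat_l; [left; apply exp_pos|].
    pose proof (Gs_tail g Gm w K Hg) as Tl. rewrite (Rabs_pos_eq w) in Tl by lra. apply Tl. fold d. lra. }
  assert (Hm : mom K x d <= mmain K x + C2 * gw x d) by (apply Rabs_le_between in H2; lra).
  replace (S2 - S0) with (- (J - S2) + ((J - S1) + (S1 - S0))) by ring.
  pose proof (Rabs_triang (- (J - S2)) ((J - S1) + (S1 - S0))) as Z1. pose proof (Rabs_triang (J - S1) (S1 - S0)) as Z2. rewrite (Rabs_Ropp (J - S2)) in Z1.
  assert (Z : Rabs (- (J - S2) + (J - S1 + (S1 - S0))) <= (8 * Ex + q * C2 + C1) * gw x d + q * mmain K x).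
  { pose proof (Rmult_le_compat_l q _ _ Hq Hm). lra. }
  eapply Rle_trans; [apply Z|]. set (A0 := 8 * Ex + q * C2 + C1) in *.
  replace ((A0 * C4 + q * C3) / x ^ (2 * K + 1)) with (A0 * (C4 / x ^ (2 * K + 1)) + q * (C3 / x ^ (2 * K + 1))) by (unfold Rdiv; ring). apply Rplus_le_compat.
  - apply Rmult_le_compat_l; auto.
  - apply Rmult_le_compat_l; auto. apply H3.
Qed.

(** * The remainder at optimal truncation *)

(* Remainder of the expansion of the recessive solution; its derivative is needed because the principal value sees differences. *)
Definition rho (a : R) (v : R -> R) (J : nat) (t : R) : R := scaled a v t - sumn (fun j => dcoef a j / t ^ (2 * j)) J.

Lemma sumn_inv_pow_derive (c : nat -> R) J t : 0 < t ->
  is_derive (fun t => sumn (fun j => c j / t ^ (2 * j)) J) t (sumn (fun j => - 2 * INR j * c j / t ^ (2 * j + 1)) J).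
Proof.
  intros Ht. induction J as [|J IH]; cbn [sumn]; [apply (is_derive_const (V := R_NormedModule))|].
  apply (is_derive_plus (V := R_NormedModule)); auto.
  assert (Hp : forall n, 0 < t ^ n) by (intros; now apply pow_lt).
  apply (is_derive_ext_loc (fun t => c J * exp (- INR (2 * J) * ln t))).
  - assert (Hl : locally t (fun u => 0 < u)) by now apply open_gt.
    revert Hl. apply filter_imp. intros u Hu. rewrite (pow_exp_ln u (2 * J) Hu). unfold Rdiv. rewrite <- exp_Ropp. do 2 f_equal. ring.
  - assert (Ec : INR (2 * J) = 2 * INR J) by (rewrite mult_INR; reflexivity). assert (Ee : exp (- INR (2 * J) * ln t) = / t ^ (2 * J)) by (rewrite (pow_exp_ln t (2 * J) Ht), <- exp_Ropp; f_equal; ring).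
    rewrite Ec in *. auto_derive; auto. rewrite Ee. rewrite pow_add, pow_1. specialize (Hp (2 * J)%nat). field. lra.
Qed.

Lemma dcoef_pred a j : (a - 1 / 2) * dcoef (a - 1) j = - (1 / 2 - a + 2 * INR j) * dcoef a j.
Proof.
  unfold dcoef. pose proof (poch_shift (1 / 2 - a) (2 * j)) as P. cbn [poch] in P. rewrite mult_INR in P. simpl (INR 2) in P.
  replace (1 / 2 - a + 1) with (1 / 2 - (a - 1)) in P by ring.
  assert (Hf : INR (fact j) <> 0) by apply INR_fact_neq_0. assert (H2 : 2 ^ j <> 0) by (apply pow_nonzero; lra).
  transitivity (- ((-1) ^ j / (INR (fact j) * 2 ^ j)) * ((1 / 2 - a) * poch (1 / 2 - (a - 1)) (2 * j))); [field; auto|]. rewrite <- P. field. auto.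
Qed.

(** The derivative of the scaled solution is t (Sa - Sb) + (1/2 - a) Sa / t, where Sb is vb scaled
    for a + 1. Both expansions are known and combine into the termwise derivative ([E]); the factor
    t is why they are used with S J terms. *)
Lemma rho_derive a va vb J : sys a va vb -> asy a va -> asy (a + 1) vb ->
  exists C, 0 <= C /\ forall t, 1 <= t -> exists l, is_derive (rho a va J) t l /\ Rabs l <= C / t ^ (2 * J + 1).
Proof.
  intros HS Ha Hb. destruct (Ha (S J)) as [C1 H1]. destruct (Hb (S J)) as [C2 H2]. destruct (Ha J) as [C3 H3].
  exists (Rabs C1 + Rabs C2 + Rabs (1 / 2 - a) * Rabs C3).
  pose proof (Rabs_pos C1). pose proof (Rabs_pos C2). pose proof (Rabs_pos C3). pose proof (Rabs_pos (1 / 2 - a)). split; [nra|].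
  intros t Ht. specialize (H1 t Ht). specialize (H2 t Ht). specialize (H3 t Ht). destruct (HS t ltac:(lra)) as [D _].
  set (Sa := scaled a va t) in *. set (Sb := scaled (a + 1) vb t) in *.
  exists (t * (Sa - Sb) + (1 / 2 - a) / t * Sa - sumn (fun j => - 2 * INR j * dcoef a j / t ^ (2 * j + 1)) J). split.
  - unfold rho. apply (is_derive_minus (V := R_NormedModule)); [|apply sumn_inv_pow_derive; lra].
    unfold scaled. auto_derive; [repeat split; [eexists; exact D | lra]|].
    replace (Derive (fun x => va x) t) with (- vb t) by (symmetry; apply is_derive_unique, D).
    unfold Sa, Sb, scaled. replace ((1 / 2 - (a + 1)) * ln t + t ^ 2 / 2) with ((1 / 2 - a) * ln t + t ^ 2 / 2 + - ln t) by ring.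
    rewrite (exp_plus _ (- ln t)), exp_Ropp, exp_ln by lra.
    change ((1 / 2 - a) * ln t + t * (t * 1) / 2) with ((1 / 2 - a) * ln t + t ^ 2 / 2). replace ((1 / 2 + - a) * ln t + t * (t * 1) * / 2) with ((1 / 2 - a) * ln t + t ^ 2 / 2) by (simpl; field).
    set (E0 := exp _). field. lra.
  - assert (Hp : forall n, 0 < t ^ n) by (intros; apply pow_lt; lra).
    assert (E : t * (sumn (fun j => dcoef a j / t ^ (2 * j)) (S J) - sumn (fun j => dcoef (a + 1) j / t ^ (2 * j)) (S J))
      + (1 / 2 - a) / t * sumn (fun j => dcoef a j / t ^ (2 * j)) J = sumn (fun j => - 2 * INR j * dcoef a j / t ^ (2 * j + 1)) J).
    { rewrite !sumn_Sl, !dcoef_0.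
      replace (sumn (fun j => - 2 * INR j * dcoef a j / t ^ (2 * j + 1)) J) with
        (sumn (fun j => t * (dcoef a (S j) / t ^ (2 * S j)) + (- t) * (dcoef (a + 1) (S j) / t ^ (2 * S j)) + (1 / 2 - a) / t * (dcoef a j / t ^ (2 * j))) J).
      - rewrite !sumn_plus, !sumn_scal. change (t ^ (2 * 0)) with 1. field. lra.
      - apply sumn_ext. intros j Hj. rewrite dcoef_succ. pose proof (dcoef_pred a j) as P. pose proof (Hp (2 * j)%nat).
        replace (2 * S j)%nat with (S (S (2 * j))) by lia. replace (2 * j + 1)%nat with (S (2 * j)) by lia.
        change (t ^ S (S (2 * j))) with (t * (t * t ^ (2 * j))). change (t ^ S (2 * j)) with (t * t ^ (2 * j)).
        transitivity (((a - 1 / 2) * dcoef (a - 1) j + (1 / 2 - a) * dcoef a j) / (t * t ^ (2 * j))); [field; lra|]. rewrite P. field. lra. }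
    rewrite <- E. set (P1 := sumn (fun j => dcoef a j / t ^ (2 * j)) (S J)) in *. set (P2 := sumn (fun j => dcoef (a + 1) j / t ^ (2 * j)) (S J)) in *.
    set (P3 := sumn (fun j => dcoef a j / t ^ (2 * j)) J) in *.
    replace (t * (Sa - Sb) + (1 / 2 - a) / t * Sa - (t * (P1 - P2) + (1 / 2 - a) / t * P3)) with (t * (Sa - P1) + (- (t * (Sb - P2)) + (1 / 2 - a) / t * (Sa - P3))) by ring.
    eapply Rle_trans; [apply Rabs_triang|]. eapply Rle_trans; [apply Rplus_le_compat_l, Rabs_triang|]. rewrite Rabs_Ropp.
    unfold Rdiv at 1. rewrite !Rabs_mult, (Rabs_pos_eq t), (Rabs_pos_eq (/ t)) by (try (left; apply Rinv_0_lt_compat); lra).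
    assert (W1 : t * Rabs (Sa - P1) <= Rabs C1 / t ^ (2 * J + 1)).
    { apply Rle_trans with (t * (Rabs C1 / t ^ (2 * S J))).
      - apply Rmult_le_compat_l; [lra|]. eapply Rle_trans; [apply H1|]. apply Rmult_le_compat_r; [left; apply Rinv_0_lt_compat, Hp | apply Rle_abs].
      - right. replace (2 * S J)%nat with (S (2 * J + 1)) by lia. change (t ^ S (2 * J + 1)) with (t * t ^ (2 * J + 1)). pose proof (Hp (2 * J + 1)%nat). field. lra. }
    assert (W2 : t * Rabs (Sb - P2) <= Rabs C2 / t ^ (2 * J + 1)).
    { apply Rle_trans with (t * (Rabs C2 / t ^ (2 * S J))).
      - apply Rmult_le_compat_l; [lra|]. eapply Rle_trans; [apply H2|]. apply Rmult_le_compat_r; [left; apply Rinv_0_lt_compat, Hp | apply Rle_abs].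
      - right. replace (2 * S J)%nat with (S (2 * J + 1)) by lia. change (t ^ S (2 * J + 1)) with (t * t ^ (2 * J + 1)). pose proof (Hp (2 * J + 1)%nat). field. lra. }
    assert (W3 : Rabs (1 / 2 - a) * / t * Rabs (Sa - P3) <= Rabs (1 / 2 - a) * Rabs C3 / t ^ (2 * J + 1)).
    { apply Rle_trans with (Rabs (1 / 2 - a) * / t * (Rabs C3 / t ^ (2 * J))).
      - apply Rmult_le_compat_l; [apply Rmult_le_pos; auto; left; apply Rinv_0_lt_compat; lra|]. eapply Rle_trans; [apply H3|]. apply Rmult_le_compat_r; [left; apply Rinv_0_lt_compat, Hp | apply Rle_abs].
      - right. replace (2 * J + 1)%nat with (S (2 * J)) by lia. change (t ^ S (2 * J)) with (t * t ^ (2 * J)). pose proof (Hp (2 * J)%nat). field. lra. }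
    unfold Rdiv in *. lra.
Qed.

(* The common factor [x^(a-1/2) exp (-x^2/2)] of [E_1] and [E_2]. *)
Definition PF (a x : R) : R := exp ((a - 1 / 2) * ln x - x ^ 2 / 2).

Lemma v_scaled a v x : v x = PF a x * scaled a v x.
Proof.
  unfold PF, scaled. rewrite (Rmult_comm (v x)), <- Rmult_assoc, <- exp_plus.
  replace ((a - 1 / 2) * ln x - x ^ 2 / 2 + ((1 / 2 - a) * ln x + x ^ 2 / 2)) with 0 by ring. rewrite exp_0. ring.
Qed.

(** Optimal truncation enters here: for m = x^2/2 - a + al the factor exp(kappa y) turns the
    Gaussian of v(x exp y) into exp(- (x^2/2) phi(2 y)), stationary at the pole y = 0. *)
Lemma Kf_scaled a al m v x y : 0 < x -> INR m = x ^ 2 / 2 - a + al ->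
  Kf (a - 1 / 2 + 2 * INR m) v (ln x + y) = exp ((a - 1 / 2 + 2 * INR m) * ln x) * PF a x * (Kg al x y * scaled a v (x * exp y)).
Proof.
  intros Hx Hm. unfold Kf. rewrite (exp_plus (ln x)), exp_ln by auto. pose proof (exp_pos y) as He.
  assert (Hl : ln (x * exp y) = ln x + y) by (rewrite ln_mult, ln_exp by auto; reflexivity).
  rewrite (v_scaled a v (x * exp y)). unfold PF, Kg, phi. rewrite Hl.
  rewrite <- !Rmult_assoc. f_equal. rewrite <- !exp_plus. f_equal.
  replace (exp (2 * y)) with (exp y ^ 2) by (replace (2 * y) with (y + y) by ring; rewrite exp_plus; ring). rewrite Hm. field.
Qed.

(** The origin of gamma_j = alpha - j: the j-th term of the expansion of v at x exp y carries exp(-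
    j Y). *)
Lemma Kg_shift al x y j : Kg al x y / exp y ^ (2 * j) = Kg (al - INR j) x y.
Proof.
  rewrite <- exp_INR_mult. unfold Rdiv. rewrite <- exp_Ropp. unfold Kg. rewrite <- exp_plus. f_equal. rewrite mult_INR. simpl (INR 2). ring.
Qed.

Lemma Kf_expansion a al m v x y J : 0 < x -> INR m = x ^ 2 / 2 - a + al ->
  Kf (a - 1 / 2 + 2 * INR m) v (ln x + y) = exp ((a - 1 / 2 + 2 * INR m) * ln x) * PF a x *
    (sumn (fun j => dcoef a j / x ^ (2 * j) * Kg (al - INR j) x y) J + Kg al x y * rho a v J (x * exp y)).
Proof.
  intros Hx Hm. rewrite (Kf_scaled a al) by auto. f_equal. unfold rho.
  replace (sumn (fun j => dcoef a j / x ^ (2 * j) * Kg (al - INR j) x y) J) with (Kg al x y * sumn (fun j => dcoef a j / (x * exp y) ^ (2 * j)) J); [ring|].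
  rewrite <- sumn_scal. apply sumn_ext. intros j Hj. rewrite <- Kg_shift, Rpow_mult_distr.
  pose proof (pow_lt x (2 * j) Hx). pose proof (pow_lt (exp y) (2 * j) (exp_pos y)). field. lra.
Qed.

Lemma Kg_small al x y : Rabs al <= 1 -> Rabs y <= / 4 -> 0 < Kg al x y <= 3.
Proof.
  intros Ha Hy. split; [apply exp_pos|]. apply Rle_trans with (exp 1); [|apply exp_le_3]. apply exp_le_exp.
  pose proof (phi_pos (2 * y)). pose proof (pow2_ge_0 x). assert (0 <= x ^ 2 / 2 * phi (2 * y)) by nra.
  apply Rabs_le_between in Ha. apply Rabs_le_between in Hy. nra.
Qed.

(** The numerator is f(- y) - f(y), so the derivative of f decides. Differentiating [Kg] costs a
    factor x^2, which is paid for in [Pv_local] by one extra term of the expansion. *)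
Lemma remainder_bound a va vb J : sys a va vb -> asy a va -> asy (a + 1) vb ->
  exists C, 0 <= C /\ forall al x y, Rabs al <= 1 -> 2 <= x -> 0 < y <= / 4 ->
    Rabs ((Kg al x (- y) * rho a va J (x * exp (- y)) - Kg al x y * rho a va J (x * exp y)) / sinh y) <= C * x ^ 2 / x ^ (2 * J).
Proof.
  intros HS Ha Hb. destruct (rho_derive a va vb J HS Ha Hb) as (C1 & HC1 & H1). destruct (Ha J) as [C2' H2'].
  set (C2 := Rabs C2'). assert (HC2 : 0 <= C2) by apply Rabs_pos.
  set (M0 := (15 * C2 + 3 * C1) * 2 ^ (2 * J)). assert (HM0 : 0 <= M0) by (apply Rmult_le_pos; [nra | apply pow_le; lra]).
  exists (2 * M0). split; [lra|]. intros al x y Hal Hx Hy.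
  assert (Hp : 0 < x ^ (2 * J)) by (apply pow_lt; lra).
  assert (ND : forall t, Rabs t <= / 4 -> exists l, is_derive (fun t => Kg al x t * rho a va J (x * exp t)) t l /\ Rabs l <= M0 * x ^ 2 / x ^ (2 * J)).
  { intros t Ht. pose proof (exp_ineq1_le t) as He. pose proof Ht as Ht'. apply Rabs_le_between in Ht'.
    assert (Hu : x / 2 <= x * exp t) by nra. assert (Hu1 : 1 <= x * exp t) by lra.
    destruct (H1 _ Hu1) as (l & Dl & Bl). exists ((2 * al - 1 - x ^ 2 * (exp (2 * t) - 1)) * Kg al x t * rho a va J (x * exp t) + Kg al x t * (l * (x * exp t))). split.
    - pose proof (Kg_derive al x t) as Dk. auto_derive; [repeat split; eexists; eassumption|].
      replace (Derive (fun x0 => Kg al x x0) t) with ((2 * al - 1 - x ^ 2 * (exp (2 * t) - 1)) * Kg al x t) by (symmetry; apply is_derive_unique, Dk).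
      replace (Derive (fun x0 => rho a va J x0) (x * exp t)) with l by (symmetry; apply is_derive_unique, Dl). ring.
    - set (u := x * exp t) in *. pose proof (Kg_small al x t Hal Ht) as Kb.
      assert (Hpu : 0 < u ^ (2 * J)) by (apply pow_lt; lra).
      assert (Iu : / u ^ (2 * J) <= 2 ^ (2 * J) / x ^ (2 * J)).
      { replace (2 ^ (2 * J) / x ^ (2 * J)) with (/ (x / 2) ^ (2 * J)).
        - apply Rinv_le_contravar; [apply pow_lt; lra | apply pow_incr; lra].
        - unfold Rdiv. rewrite Rpow_mult_distr, pow_inv. pose proof (pow_lt 2 (2 * J) ltac:(lra)). field. lra. }
      assert (Br : Rabs (rho a va J u) <= C2 * (2 ^ (2 * J) / x ^ (2 * J))).
      { eapply Rle_trans; [apply (H2' u Hu1)|]. apply Rle_trans with (C2 / u ^ (2 * J)).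
        - apply Rmult_le_compat_r; [left; now apply Rinv_0_lt_compat | apply Rle_abs].
        - apply Rmult_le_compat_l; auto. }
      assert (Bl2 : Rabs (l * u) <= C1 * (2 ^ (2 * J) / x ^ (2 * J))).
      { rewrite Rabs_mult, (Rabs_pos_eq u) by lra. apply Rle_trans with (C1 / u ^ (2 * J)).
        - apply Rle_trans with (C1 / u ^ (2 * J + 1) * u); [apply Rmult_le_compat_r; lra|]. right. rewrite pow_add, pow_1. field. lra.
        - apply Rmult_le_compat_l; auto. }
      assert (Bk : Rabs (2 * al - 1 - x ^ 2 * (exp (2 * t) - 1)) <= 5 * x ^ 2).
      { assert (E1 : -1 <= exp (2 * t) - 1 <= 2).
        { split; [pose proof (exp_pos (2 * t)); lra|]. assert (exp (2 * t) <= exp 1) by (apply exp_le_exp; lra). pose proof exp_le_3. lra. }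
        apply Rabs_le_between in Hal. apply Rabs_le. nra. }
      eapply Rle_trans; [apply Rabs_triang|]. rewrite (Rabs_mult (_ * _)), (Rabs_mult _ (Kg al x t)), (Rabs_mult (Kg al x t)), (Rabs_pos_eq (Kg al x t)) by lra.
      set (Q := 2 ^ (2 * J) / x ^ (2 * J)) in *. assert (HQ : 0 < Q) by (apply Rdiv_lt_0_compat; auto; apply pow_lt; lra).
      replace (M0 * x ^ 2 / x ^ (2 * J)) with (5 * x ^ 2 * 3 * (C2 * Q) + 3 * (x ^ 2 * (C1 * Q))) by (unfold M0, Q; field; lra).
      apply Rplus_le_compat.
      + apply Rmult_le_compat; auto; [apply Rmult_le_pos; [apply Rabs_pos | lra] | apply Rabs_pos|].
        apply Rmult_le_compat; auto; [apply Rabs_pos | lra | lra].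
      + apply Rmult_le_compat; try lra; [apply Rabs_pos|]. assert (1 <= x ^ 2) by nra. pose proof (Rmult_le_pos C1 Q HC1 ltac:(lra)). nra. }
  set (f := fun t => Kg al x t * rho a va J (x * exp t)) in *.
  assert (Mv : Rabs (f (- y) - f y) <= M0 * x ^ 2 / x ^ (2 * J) * Rabs (- y - y)).
  { apply (mvt_bound f (Derive f)).
    - intros t Ht. rewrite Rmin_right, Rmax_left in Ht by lra. destruct (ND t ltac:(apply Rabs_le; lra)) as (l & Dl & _). apply Derive_correct. eexists; exact Dl.
    - intros t Ht. rewrite Rmin_right, Rmax_left in Ht by lra. destruct (ND t ltac:(apply Rabs_le; lra)) as (l & Dl & Bl). replace (Derive f t) with l by (symmetry; apply is_derive_unique; exact Dl). exact Bl. }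
  unfold f in Mv. cbv beta in Mv. pose proof (sinh_abs_ge y) as Hs. rewrite (Rabs_pos_eq y) in Hs by lra.
  unfold Rdiv at 1. rewrite Rabs_mult, Rabs_inv. replace (Rabs (- y - y)) with (2 * y) in Mv by (rewrite Rabs_left; lra).
  apply Rmult_le_reg_r with (Rabs (sinh y)); [lra|]. rewrite Rmult_assoc, Rinv_l, Rmult_1_r by lra.
  eapply Rle_trans; [apply Mv|]. replace (2 * M0 * x ^ 2 / x ^ (2 * J) * Rabs (sinh y)) with (M0 * x ^ 2 / x ^ (2 * J) * (2 * Rabs (sinh y))) by (unfold Rdiv; ring).
  apply Rmult_le_compat_l; [|lra]. apply Rmult_le_pos; [|left; now apply Rinv_0_lt_compat]. apply Rmult_le_pos; auto. nra.
Qed.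

Lemma nat_above r : exists N : nat, r <= INR N.
Proof. destruct (nfloor_ex (Rabs r) (Rabs_pos r)) as [N [_ HN]]. exists (S N). rewrite S_INR. pose proof (Rle_abs r). lra. Qed.

(** Away from the saddle [phi_linear] supplies x^2 c |y| in the exponent. One half absorbs the
    polynomial growth and leaves exp(- |y|), the other half becomes [gw] x d', smaller than any
    power of x. *)
Lemma Kf_tail a v N d : gb v -> 0 < d -> exists C X0, 0 <= C /\ 1 <= X0 /\ forall al m x y, X0 <= x -> Rabs al <= 1 ->
  INR m = x ^ 2 / 2 - a + al -> d <= Rabs y ->
  Rabs (Kf (a - 1 / 2 + 2 * INR m) v (ln x + y)) <= exp ((a - 1 / 2 + 2 * INR m) * ln x) * PF a x * (C / x ^ N) * exp (- Rabs y).
Proof.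
  intros (Cv & Nv & HCv & Hv) Hd. destruct (phi_linear (2 * d) ltac:(lra)) as (c & Hc & Hphi).
  (* x^N2 compensates the power x^(a - 1/2) in [PF], so that exp(- x^2 / 2) <= [PF] a x times
     x^N2. *)
  destruct (nat_above (1 / 2 - a)) as [N2 HN2]. set (d' := Rmin 1 (c * d)).
  assert (Hd' : 0 < d') by (apply Rmin_glb_lt; [lra | now apply Rmult_lt_0_compat]).
  assert (Hd2 : d' ^ 2 <= c * d). { pose proof (Rmin_l 1 (c * d)). pose proof (Rmin_r 1 (c * d)). fold d' in H, H0. nra. }
  destruct (gw_small d' (N + Nv + N2) Hd') as (C4 & HC4 & H4).
  set (b := INR Nv + Rabs a + 5 / 2). pose proof (pos_INR Nv). pose proof (Rabs_pos a). assert (Hb : 0 < b) by (unfold b; lra).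
  exists (Cv * 2 ^ Nv * C4), (1 + 2 * (b + 1) / c).
  assert (HX : 0 < 2 * (b + 1) / c) by (apply Rdiv_lt_0_compat; lra).
  split; [repeat apply Rmult_le_pos; auto; apply pow_le; lra|]. split; [lra|].
  intros al m x y Hx Hal Hm Hy.
  assert (Hx1 : 1 <= x) by lra. assert (Hcx : b + 1 <= x ^ 2 * c / 2).
  { assert (2 * (b + 1) / c <= x ^ 2) by nra. apply (Rmult_le_compat_r (c / 2)) in H1; [|lra]. replace (2 * (b + 1) / c * (c / 2)) with (b + 1) in H1 by (field; lra). lra. }
  unfold Kf. rewrite (exp_plus (ln x)), exp_ln by lra.
  set (k := a - 1 / 2 + 2 * INR m). assert (Hk : k = x ^ 2 - a - 1 / 2 + 2 * al) by (unfold k; rewrite Hm; field).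
  rewrite Rabs_mult, (Rabs_pos_eq (exp _)) by (left; apply exp_pos). replace (k * (ln x + y)) with (k * ln x + k * y) by ring. rewrite exp_plus.
  pose proof (exp_pos y) as Hey. assert (Hxy : 0 < x * exp y) by nra.
  specialize (Hv (x * exp y) Hxy).
  assert (E1 : 1 + x * exp y <= 2 * x * exp (Rabs y)).
  { assert (exp y <= exp (Rabs y)) by (apply exp_le_exp, Rle_abs). assert (1 <= exp (Rabs y)) by (rewrite <- exp_0 at 1; apply exp_le_exp, Rabs_pos). nra. }
  assert (E2 : (1 + x * exp y) ^ Nv <= 2 ^ Nv * x ^ Nv * exp (INR Nv * Rabs y)).
  { rewrite exp_INR_mult, <- !Rpow_mult_distr. apply pow_incr. lra. }
  assert (E3 : exp (k * y) * exp (- ((x * exp y) ^ 2 / 2)) * exp (INR Nv * Rabs y) <= exp (- (x ^ 2 / 2)) * (exp (- Rabs y) * gw x d')).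
  { unfold gw. rewrite <- !exp_plus. apply exp_le_exp.
    specialize (Hphi (2 * y)). rewrite Rabs_mult, (Rabs_pos_eq 2) in Hphi by lra. specialize (Hphi ltac:(lra)). unfold phi in Hphi.
    replace ((x * exp y) ^ 2) with (x ^ 2 * exp (2 * y)) by (replace (2 * y) with (y + y) by ring; rewrite exp_plus; ring).
    assert (L1 : (2 * al - a - 1 / 2) * y <= (Rabs a + 5 / 2) * Rabs y).
    { eapply Rle_trans; [apply Rle_abs|]. rewrite Rabs_mult. apply Rmult_le_compat_r; [apply Rabs_pos|].
      apply Rabs_le. apply Rabs_le_between in Hal. pose proof (Rle_abs a). pose proof (Rle_abs (- a)). rewrite Rabs_Ropp in H2. lra. }
    assert (L2 : x ^ 2 * (c * Rabs y) <= x ^ 2 / 2 * (exp (2 * y) - 1 - 2 * y)) by (pose proof (pow2_ge_0 x); nra).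
    assert (L3 : (b + 1) * Rabs y <= x ^ 2 * c / 2 * Rabs y) by (apply Rmult_le_compat_r; [apply Rabs_pos | lra]).
    assert (L4 : x ^ 2 / 4 * d' ^ 2 <= x ^ 2 * c / 2 * Rabs y).
    { assert (d' ^ 2 <= 2 * c * Rabs y) by nra. pose proof (pow2_ge_0 x). nra. }
    rewrite Hk. unfold b in L3. nra. }
  assert (E4 : exp (- (x ^ 2 / 2)) <= PF a x * x ^ N2).
  { unfold PF. rewrite (pow_exp_ln x N2) by lra. rewrite <- exp_plus. apply exp_le_exp.
    assert (0 <= ln x). { rewrite <- ln_1. destruct (Req_dec x 1) as [->|]; [lra|]. left. apply ln_increasing; lra. } nra. }
  specialize (H4 x ltac:(lra)).
  assert (HP : 0 < PF a x) by apply exp_pos. assert (Hg : 0 < gw x d') by apply exp_pos. assert (Hex : 0 < exp (- Rabs y)) by apply exp_pos.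
  assert (Hxn : forall n, 0 < x ^ n) by (intros; apply pow_lt; lra).
  apply Rle_trans with (exp (k * ln x) * (Cv * (2 ^ Nv * x ^ Nv) * (PF a x * x ^ N2 * (exp (- Rabs y) * (C4 / x ^ (N + Nv + N2)))))).
  - rewrite Rmult_assoc. apply Rmult_le_compat_l; [left; apply exp_pos|].
    apply Rle_trans with (exp (k * y) * (Cv * (2 ^ Nv * x ^ Nv * exp (INR Nv * Rabs y)) * exp (- ((x * exp y) ^ 2 / 2)))).
    + apply Rmult_le_compat_l; [left; apply exp_pos|]. eapply Rle_trans; [apply Hv|]. apply Rmult_le_compat_r; [left; apply exp_pos|]. apply Rmult_le_compat_l; auto.
    + replace (exp (k * y) * (Cv * (2 ^ Nv * x ^ Nv * exp (INR Nv * Rabs y)) * exp (- ((x * exp y) ^ 2 / 2)))) with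
        (Cv * (2 ^ Nv * x ^ Nv) * (exp (k * y) * exp (- ((x * exp y) ^ 2 / 2)) * exp (INR Nv * Rabs y))) by ring.
      apply Rmult_le_compat_l; [apply Rmult_le_pos; auto; apply Rmult_le_pos; [apply pow_le; lra | left; apply Hxn]|].
      eapply Rle_trans; [apply E3|]. apply Rmult_le_compat; [left; apply exp_pos | apply Rmult_le_pos; lra | exact E4 |]. apply Rmult_le_compat_l; lra.
  - right. rewrite !pow_add. pose proof (Hxn N). pose proof (Hxn Nv). pose proof (Hxn N2). field. lra.
Qed.

Lemma Tint_tail a v N d : gb v -> 0 < d -> exists C X0, 0 <= C /\ 1 <= X0 /\ forall al m x y, X0 <= x -> Rabs al <= 1 ->
  INR m = x ^ 2 / 2 - a + al -> d <= Rabs y ->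
  Rabs (Tint (Kf (a - 1 / 2 + 2 * INR m) v) (ln x) y) <= exp ((a - 1 / 2 + 2 * INR m) * ln x) * PF a x * (C / x ^ N) * exp (- Rabs y).
Proof.
  intros Hg Hd. destruct (Kf_tail a v N d Hg Hd) as (C & X0 & HC & HX & H). exists (2 * C / d), X0.
  split; [apply Rmult_le_pos; [lra | left; now apply Rinv_0_lt_compat]|]. split; auto. intros al m x y Hx Hal Hm Hy.
  pose proof (H al m x y Hx Hal Hm Hy) as H1. pose proof (H al m x (- y) Hx Hal Hm ltac:(now rewrite Rabs_Ropp)) as H2. rewrite (Rabs_Ropp y) in H2.
  assert (Hy0 : y <> 0) by (intros ->; rewrite Rabs_R0 in Hy; lra).
  unfold Tint, sq. destruct (Req_EM_T y 0); [contradiction|]. unfold Rdiv at 1. rewrite Rabs_mult, Rabs_inv. pose proof (sinh_abs_ge y) as Hs.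
  set (Q := exp ((a - 1 / 2 + 2 * INR m) * ln x) * PF a x * (C / x ^ N) * exp (- Rabs y)) in *.
  apply Rle_trans with (2 * Q * / d).
  - apply Rmult_le_compat; [apply Rabs_pos | left; apply Rinv_0_lt_compat; lra | | apply Rinv_le_contravar; lra].
    eapply Rle_trans; [apply Rabs_triang|]. rewrite Rabs_Ropp. change (ln x - y) with (ln x + - y). lra.
  - right. unfold Q. assert (0 < x ^ N) by (apply pow_lt; lra). field. lra.
Qed.

Lemma Tint_dom a va vb k xi : sys a va vb -> rap va -> rap vb -> -1 < k -> dom (Tint (Kf k va) xi).
Proof.
  intros HS Ra Rb Hk. set (e := Rmin (1 / 2) (1 + k)).
  assert (He : 0 < e < 1). { unfold e. split; [apply Rmin_pos; lra | pose proof (Rmin_l (1 / 2) (1 + k)); lra]. }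
  assert (Hke : - (1 - e) <= k) by (unfold e; pose proof (Rmin_r (1 / 2) (1 + k)); lra).
  destruct (proj1 (Kf_smooth a va vb e 1 HS Ra Rb He k Hke)) as (_ & K1 & D1 & (C & B) & _).
  eexists. eexists. apply (Tint_edom (Kf k va) K1 e C xi He D1 B).
Qed.

Lemma Tint_opp K xi y : Tint K xi (- y) = Tint K xi y.
Proof.
  unfold Tint, sq. destruct (Req_EM_T (- y) 0) as [E|E], (Req_EM_T y 0) as [F|F]; try reflexivity; try (exfalso; lra).
  rewrite sinh_opp. replace (xi - - y) with (xi + y) by ring. replace (xi + - y) with (xi - y) by ring. pose proof (sinh_neq y F). field. auto.
Qed.

Lemma RInt_even (f : R -> R) d : (forall y, continuous f y) -> (forall y, f (- y) = f y) -> RInt f (- d) d = 2 * RInt f 0 d.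
Proof.
  intros Hc He. rewrite (RInt_Chasles_R f (- d) 0 d) by (apply cont_ex_RInt; auto).
  assert (E : RInt f (- d) 0 = RInt f 0 d :> R); [|rewrite E; match goal with |- ?u = ?v => change (@eq R u v) end; ring].
  rewrite <- (opp_RInt_swap (V := R_CompleteNormedModule)) by (apply cont_ex_RInt; auto).
  rewrite <- (Ropp_0) at 1. pose proof (RInt_scale f (-1) 0 d Hc) as S. replace (-1 * 0) with (-0) in S by ring. replace (-1 * d) with (- d) in S by ring.
  rewrite <- S. rewrite (RInt_ext _ f). { change opp with Ropp. ring. }
  intros t _. replace (-1 * t) with (- t) by ring. apply He.
Qed.

Lemma RInt_abs_open (f : R -> R) a b M : a <= b -> ex_RInt f a b -> (forall t, a < t < b -> Rabs (f t) <= M) -> Rabs (RInt f a b) <= M * (b - a).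
Proof.
  intros Hab Hf HM.
  assert (C : forall c, RInt (fun _ => c) a b = c * (b - a)) by (intros c; rewrite (RInt_const (V := R_CompleteNormedModule)); apply Rmult_comm).
  apply Rabs_le. split.
  - replace (- (M * (b - a))) with (- M * (b - a)) by ring. rewrite <- C. apply RInt_le; auto; [apply ex_RInt_const|].
    intros t Ht. specialize (HM t Ht). apply Rabs_le_between in HM. lra.
  - rewrite <- C. apply RInt_le; auto; [apply ex_RInt_const|]. intros t Ht. specialize (HM t Ht). apply Rabs_le_between in HM. lra.
Qed.

Lemma RInt_kk_sumn (c : nat -> R) al x d J :
  (forall y, continuous (fun y => sumn (fun j => c j * kk (al - INR j) x y) J) y) /\
  RInt (fun y => sumn (fun j => c j * kk (al - INR j) x y) J) 0 d = sumn (fun j => c j * RInt (kk (al - INR j) x) 0 d) J.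
Proof.
  induction J as [|J [E IH]]; cbn [sumn].
  - split; [intros; apply continuous_const|]. rewrite (RInt_const (V := R_CompleteNormedModule)). apply Rmult_0_r.
  - assert (Ek : forall y, continuous (fun y => c J * kk (al - INR J) x y) y).
    { intros y. apply (continuous_scal_r (K := R_AbsRing) (V := R_NormedModule) (c J) (kk (al - INR J) x)), kk_cont. }
    split; [intros y; now apply (continuous_plus (V := R_NormedModule))|].
    rewrite (RInt_plus (V := R_CompleteNormedModule) (fun y => sumn (fun j => c j * kk (al - INR j) x y) J)) by (apply cont_ex_RInt; auto).
    rewrite (RInt_scal (V := R_CompleteNormedModule) (kk (al - INR J) x)) by (apply cont_ex_RInt; apply kk_cont). rewrite IH. reflexivity.
Qed.

(** Inside |y| <= d the solution is expanded to S M terms, so that the loss x^2 of [remainder_bound]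
    leaves x^(- 2 M); outside, [Tint_tail] applies. *)
Lemma Pv_local a va vb M d : sys a va vb -> bdd va -> bdd vb -> asy a va -> asy (a + 1) vb -> 0 < d <= / 4 ->
  exists C X0, 0 <= C /\ 2 <= X0 /\ forall al m x, X0 <= x -> Rabs al <= 1 -> INR m = x ^ 2 / 2 - a + al ->
  Rabs (Pv (a - 1 / 2 + 2 * INR m) va x / PF a x - / PI * sumn (fun j => dcoef a j / x ^ (2 * j) * RInt (kk (al - INR j) x) 0 d) (S M)) <= C / x ^ (2 * M).
Proof.
  intros HS Ba Bb Ha Hb Hd. pose proof (bdd_rap a va Ha Ba) as Ra. pose proof (bdd_rap (a + 1) vb Hb Bb) as Rb.
  destruct (Tint_tail a va (2 * M) d (asy_gb a va Ha Ba) ltac:(lra)) as (C1 & X1 & HC1 & HX1 & H1).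
  destruct (remainder_bound a va vb (S M) HS Ha Hb) as (C2 & HC2 & H2).
  exists (C1 + C2), (X1 + 2 + Rabs a). pose proof (Rabs_pos a) as Ha0. split; [lra|]. split; [lra|].
  intros al m x Hx Hal Hm. pose proof (Rle_abs a) as Hal1. pose proof (Rle_abs (- a)) as Hal2. rewrite Rabs_Ropp in Hal2.
  set (k := a - 1 / 2 + 2 * INR m). assert (Hk : -1 < k). { unfold k. rewrite Hm. apply Rabs_le_between in Hal. nra. }
  set (E := exp (k * ln x)). set (P := PF a x). assert (HE : 0 < E) by apply exp_pos. assert (HP : 0 < P) by apply exp_pos.
  assert (Hxn : 0 < x ^ (2 * M)) by (apply pow_lt; lra).
  set (f := Tint (Kf k va) (ln x)). pose proof (Tint_dom a va vb k (ln x) HS Ra Rb Hk) as Df. fold f in Df.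
  set (c := fun j => dcoef a j / x ^ (2 * j)).
  set (Sm := sumn (fun j => c j * RInt (kk (al - INR j) x) 0 d) (S M)).
  assert (B1 : Rabs (II f - 2 * RInt f 0 d) <= 2 * (E * P * (C1 / x ^ (2 * M)))).
  { rewrite <- RInt_even; [|now apply dom_cont | intros; apply Tint_opp].
    assert (HQ : 0 <= E * P * (C1 / x ^ (2 * M))) by (apply Rmult_le_pos; [nra | apply Rmult_le_pos; [auto | left; now apply Rinv_0_lt_compat]]).
    eapply Rle_trans; [apply (II_tail f (E * P * (C1 / x ^ (2 * M))) 1 d d); auto; try lra|].
    - intros y Hy. rewrite Rmult_1_l. apply (H1 al m x y); auto; [lra|]. destruct Hy; [rewrite Rabs_left | rewrite Rabs_pos_eq]; lra.
    - assert (exp (- (1 * d)) <= 1) by (apply Rle_trans with (exp 0); [apply exp_le_exp; lra | rewrite exp_0; lra]). pose proof (exp_pos (- (1 * d))). unfold Rdiv at 1. rewrite Rinv_1. nra. }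
  assert (B2 : Rabs (RInt f 0 d - E * P * Sm) <= E * P * (C2 / x ^ (2 * M))).
  { destruct (RInt_kk_sumn c al x d (S M)) as [Cs Is]. unfold Sm. rewrite <- Is.
    assert (X1' : ex_RInt f 0 d) by (apply cont_ex_RInt; now apply dom_cont).
    assert (X2' : ex_RInt (fun y => E * P * sumn (fun j => c j * kk (al - INR j) x y) (S M)) 0 d).
    { apply (ex_RInt_scal (V := R_NormedModule)). now apply cont_ex_RInt. }
    assert (Es : RInt f 0 d - E * P * RInt (fun y => sumn (fun j => c j * kk (al - INR j) x y) (S M)) 0 d
      = RInt (fun y => f y - E * P * sumn (fun j => c j * kk (al - INR j) x y) (S M)) 0 d).
    { rewrite (RInt_minus (V := R_CompleteNormedModule) f (fun y => E * P * sumn (fun j => c j * kk (al - INR j) x y) (S M))) by auto.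
      rewrite (RInt_scal (V := R_CompleteNormedModule) (fun y => sumn (fun j => c j * kk (al - INR j) x y) (S M))) by now apply cont_ex_RInt. reflexivity. }
    rewrite Es. eapply Rle_trans; [apply (RInt_abs_open _ 0 d (E * P * (C2 / x ^ (2 * M)))); [lra | now apply (ex_RInt_minus (V := R_NormedModule) f) |]|].
    - intros y Hy. specialize (H2 al x y Hal ltac:(lra) ltac:(lra)).
      replace (f y - E * P * sumn (fun j => c j * kk (al - INR j) x y) (S M)) with
        (E * P * ((Kg al x (- y) * rho a va (S M) (x * exp (- y)) - Kg al x y * rho a va (S M) (x * exp y)) / sinh y)).
      + rewrite Rabs_mult, (Rabs_pos_eq (E * P)) by nra. apply Rmult_le_compat_l; [nra|]. eapply Rle_trans; [apply H2|]. right.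
        replace (2 * S M)%nat with (2 + 2 * M)%nat by lia. rewrite pow_add. field. lra.
      + unfold f, Tint, sq. destruct (Req_EM_T y 0); [lra|]. change (ln x - y) with (ln x + - y). unfold k.
        rewrite !(Kf_expansion a al m va x _ (S M)) by (auto; lra). fold k. fold E. fold P.
        replace (sumn (fun j => c j * kk (al - INR j) x y) (S M)) with
          ((sumn (fun j => dcoef a j / x ^ (2 * j) * Kg (al - INR j) x (- y)) (S M) + -1 * sumn (fun j => dcoef a j / x ^ (2 * j) * Kg (al - INR j) x y) (S M)) * / sinh y).
        * pose proof (sinh_neq y n). field. auto.
        * rewrite <- sumn_scal, <- sumn_plus, Rmult_comm, <- sumn_scal. apply sumn_ext. intros j Hj. unfold c, kk, sq. destruct (Req_EM_T y 0); [lra|]. pose proof (sinh_neq y n).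
          assert (0 < x ^ (2 * j)) by (apply pow_lt; lra). field. lra.
    - assert (0 <= E * P * (C2 / x ^ (2 * M))) by (apply Rmult_le_pos; [nra | apply Rmult_le_pos; [auto | left; now apply Rinv_0_lt_compat]]). nra. }
  fold k P. change (sumn (fun j => dcoef a j / x ^ (2 * j) * RInt (kk (al - INR j) x) 0 d) (S M)) with Sm.
  unfold Pv, T. fold f. replace (exp (- (k * ln x))) with (/ E) by (unfold E; rewrite exp_Ropp; reflexivity). pose proof PI_RGT_0 as Hpi.
  replace (/ E / PI * (/ 2 * II f) / P - / PI * Sm) with (/ (E * P * PI) * (/ 2 * (II f - 2 * RInt f 0 d) + (RInt f 0 d - E * P * Sm))) by (field; lra).
  assert (HEP : 0 < E * P) by nra.
  assert (Hpi1 : 1 <= PI) by (pose proof PI2_1; lra).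
  rewrite Rabs_mult, Rabs_pos_eq by (left; apply Rinv_0_lt_compat; nra).
  assert (B3 : Rabs (/ 2 * (II f - 2 * RInt f 0 d) + (RInt f 0 d - E * P * Sm)) <= E * P * ((C1 + C2) / x ^ (2 * M))).
  { eapply Rle_trans; [apply Rabs_triang|]. rewrite Rabs_mult, (Rabs_pos_eq (/ 2)) by lra.
    replace (E * P * ((C1 + C2) / x ^ (2 * M))) with (E * P * (C1 / x ^ (2 * M)) + E * P * (C2 / x ^ (2 * M))) by (field; lra). lra. }
  apply Rmult_le_reg_l with (E * P * PI); [nra|]. rewrite <- Rmult_assoc, Rinv_r, Rmult_1_l by nra.
  eapply Rle_trans; [apply B3|]. assert (0 <= (C1 + C2) / x ^ (2 * M)) by (apply Rmult_le_pos; [lra | left; now apply Rinv_0_lt_compat]).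
  assert (0 <= E * P * ((C1 + C2) / x ^ (2 * M))) by (apply Rmult_le_pos; lra). nra.
Qed.

(** * Assembling the coefficients [B] *)

Lemma sumn_triangle (f : nat -> nat -> R) M :
  sumn (fun j => sumn (f j) (M - j)) M = sumn (fun n => sumn (fun k => f (n - k)%nat k) (S n)) M.
Proof.
  induction M as [|M IH]; [reflexivity|]. cbn [sumn] in *. rewrite <- IH.
  replace (S M - M)%nat with 1%nat by lia. cbn [sumn].
  rewrite (sumn_ext _ (fun j => sumn (f j) (M - j) + f j (M - j)%nat)).
  2: { intros j Hj. replace (S M - j)%nat with (S (M - j)) by lia. reflexivity. }
  rewrite sumn_plus. replace (M - M)%nat with O by lia.
  assert (E : sumn (fun k => f (M - k)%nat k) (S M) = sumn (fun j => f j (M - j)%nat) (S M)).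
  { rewrite <- (sumn_rev (fun j => f j (M - j)%nat)). apply sumn_ext. intros k Hk. f_equal; lia. }
  cbn [sumn] in E. replace (M - M)%nat with O in E by lia. rewrite Rplus_assoc. f_equal. lra.
Qed.

Lemma poch_dup c j : poch c (2 * j) = 4 ^ j * poch (c / 2) j * poch ((c + 1) / 2) j.
Proof.
  induction j as [|j IH]; [simpl; ring|]. replace (2 * S j)%nat with (S (S (2 * j))) by lia. cbn [poch].
  rewrite IH, S_INR, mult_INR. simpl (INR 2). change (4 ^ S j) with (4 * 4 ^ j). field.
Qed.

Lemma dcoef_A a j : dcoef a j = (-1) ^ j * 2 ^ j * A a j.
Proof.
  unfold dcoef, A. rewrite poch_dup. replace ((1 / 2 - a) / 2) with (1 / 4 - a / 2) by field. replace ((1 / 2 - a + 1) / 2) with (3 / 4 - a / 2) by field.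
  replace (4 ^ j) with (2 ^ j * 2 ^ j) by (rewrite <- Rpow_mult_distr; f_equal; ring).
  assert (INR (fact j) <> 0) by apply INR_fact_neq_0. assert (2 ^ j <> 0) by (apply pow_nonzero; lra). field. auto.
Qed.

Lemma pow_m1_sq k : (-1) ^ k * (-1) ^ k = 1.
Proof. rewrite <- Rpow_mult_distr. replace (-1 * -1) with 1 by ring. apply pow1. Qed.

(** Regrouping by n = j + k. The factor (-1)^j 2^j of [dcoef_A] and the power 2^(2k+1) of the
    moments make up (-1)^n 2^n (-2)^k, and sqrt PI from the moments against 1 / PI leaves 2 / sqrt
    PI. *)
Lemma main_sum a al M x : 0 < x ->
  / PI * sumn (fun j => dcoef a j / x ^ (2 * j) * sumn (fun k => 2 * Gcoef (al - INR j) (2 * k)%nat * mmain k x) (M - j)) M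
  = 2 / sqrt PI * sumn (fun n => (- 1) ^ n * 2 ^ n * B a al n / x ^ (2 * n + 1)) M.
Proof.
  intros Hx. pose proof PI_RGT_0 as Hpi. assert (Hs : 0 < sqrt PI) by now apply sqrt_lt_R0. assert (Hss : sqrt PI * sqrt PI = PI) by (apply sqrt_sqrt; lra).
  set (f := fun j k => dcoef a j / x ^ (2 * j) * (2 * Gcoef (al - INR j) (2 * k)%nat * mmain k x)).
  rewrite (sumn_ext _ (fun j => sumn (f j) (M - j))) by (intros j Hj; rewrite <- sumn_scal; reflexivity).
  rewrite sumn_triangle, <- !sumn_scal. apply sumn_ext. intros n Hn.
  unfold B. replace (sum_f_R0 (fun k => (-2) ^ k * poch (1 / 2) k * A a (n - k) * Gcoef (al - INR (n - k)) (2 * k)) n)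
    with (sumn (fun k => (-2) ^ k * poch (1 / 2) k * A a (n - k) * Gcoef (al - INR (n - k)) (2 * k)) (S n)).
  2: { rewrite <- sumn_sum_f_R0 by lia. f_equal. lia. }
  rewrite <- sumn_scal.
  replace (2 / sqrt PI * ((-1) ^ n * 2 ^ n * sumn (fun k => (-2) ^ k * poch (1 / 2) k * A a (n - k) * Gcoef (al - INR (n - k)) (2 * k)) (S n) / x ^ (2 * n + 1)))
    with (2 / sqrt PI * ((-1) ^ n * 2 ^ n / x ^ (2 * n + 1)) * sumn (fun k => (-2) ^ k * poch (1 / 2) k * A a (n - k) * Gcoef (al - INR (n - k)) (2 * k)) (S n))
    by (unfold Rdiv; ring).
  rewrite <- sumn_scal. apply sumn_ext. intros k Hk. unfold f, mmain. rewrite dcoef_A.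
  remember (n - k)%nat as j eqn:Ej. assert (En : n = (j + k)%nat) by lia. rewrite En.
  set (Gc := Gcoef (al - INR j) (2 * k)%nat). replace (/ PI) with (/ (sqrt PI * sqrt PI)) by (now rewrite Hss).
  replace (2 * (j + k) + 1)%nat with (2 * j + (2 * k + 1))%nat by lia. rewrite !(pow_add _ j k), (pow_add x).
  unfold Rdiv at 4. rewrite (Rpow_mult_distr 2 (/ x)), pow_inv. 
  replace ((-2) ^ k) with ((-1) ^ k * 2 ^ k) by (rewrite <- Rpow_mult_distr; f_equal; ring).
  replace (2 ^ (2 * k + 1)) with (2 ^ k * 2 ^ k * 2) by (rewrite pow_add, (Nat.mul_comm 2 k), pow_mult, pow_1; ring).
  pose proof (pow_m1_sq k) as Hm. pose proof (pow_lt x (2 * j) Hx). pose proof (pow_lt x (2 * k + 1) Hx).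
  set (e := (-1) ^ k) in *. set (P := poch (1 / 2) k). set (Aj := A a j). set (X1 := x ^ (2 * j)) in *. set (X2 := x ^ (2 * k + 1)) in *. set (t := 2 ^ k). set (s := sqrt PI) in *.
  transitivity (2 / s * ((-1) ^ j * 2 ^ j / (X1 * X2)) * (t * t) * P * Aj * Gc * (e * e)).
  - rewrite Hm. field. lra.
  - field. lra.
Qed.

(** The j-th term already carries x^(- 2 j), so M - j even coefficients are enough for a total error
    x^(- 2 M). *)
Lemma local_sum a M J : (J <= S M)%nat -> exists C, 0 <= C /\ forall al x, Rabs al <= 1 -> 1 <= x -> 2 <= x * / (2 * (INR M + 2 + 36)) ->
  Rabs (sumn (fun j => dcoef a j / x ^ (2 * j) * RInt (kk (al - INR j) x) 0 (/ (2 * (INR M + 2 + 36)))) J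
    - sumn (fun j => dcoef a j / x ^ (2 * j) * sumn (fun k => 2 * Gcoef (al - INR j) (2 * k)%nat * mmain k x) (M - j)) J) <= C / x ^ (2 * M).
Proof.
  induction J as [|J IH]; intros HJ.
  - exists 0. split; [lra|]. intros al x _ Hx _. cbn [sumn]. rewrite Rminus_0_r, Rabs_R0. unfold Rdiv. lra.
  - destruct (IH ltac:(lia)) as (C & HC & H). destruct (local_I (INR M + 2) (M - J)) as (C1 & HC1 & H1).
    exists (C + Rabs (dcoef a J) * C1). pose proof (Rabs_pos (dcoef a J)) as Hd. split; [nra|]. intros al x Hal Hx Hxd.
    specialize (H al x Hal Hx Hxd). cbn [sumn].
    assert (Hg : Rabs (al - INR J) <= INR M + 2).
    { eapply Rle_trans; [apply Rabs_triang|]. rewrite Rabs_Ropp, (Rabs_pos_eq (INR J)) by apply pos_INR. assert (INR J <= INR (S M)) by (apply le_INR; lia). rewrite S_INR in H0. lra. }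
    specialize (H1 (al - INR J) x Hg Hx Hxd).
    set (I := RInt (kk (al - INR J) x) 0 (/ (2 * (INR M + 2 + 36)))) in *. set (S0 := sumn (fun k => 2 * Gcoef (al - INR J) (2 * k)%nat * mmain k x) (M - J)) in *.
    match goal with |- Rabs (?u + ?v - (?w + ?z)) <= _ => replace (u + v - (w + z)) with ((u - w) + dcoef a J / x ^ (2 * J) * (I - S0)) by ring end.
    eapply Rle_trans; [apply Rabs_triang|]. replace ((C + Rabs (dcoef a J) * C1) / x ^ (2 * M)) with (C / x ^ (2 * M) + Rabs (dcoef a J) * C1 / x ^ (2 * M)) by (unfold Rdiv; ring).
    apply Rplus_le_compat; auto. assert (Hp : forall n, 0 < x ^ n) by (intros; apply pow_lt; lra).
    rewrite Rabs_mult. unfold Rdiv at 1. rewrite Rabs_mult, (Rabs_pos_eq (/ _)) by (left; apply Rinv_0_lt_compat, Hp).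
    apply Rle_trans with (Rabs (dcoef a J) * C1 / x ^ (2 * M + 1)); [|apply div_le_pow; [now apply Rmult_le_pos | auto | lia]].
    apply Rle_trans with (Rabs (dcoef a J) * / x ^ (2 * J) * (C1 / x ^ (2 * (M - J) + 1))).
    + apply Rmult_le_compat_l; auto. apply Rmult_le_pos; auto. left; apply Rinv_0_lt_compat, Hp.
    + right. replace (2 * M + 1)%nat with (2 * J + (2 * (M - J) + 1))%nat by lia. rewrite (pow_add x (2 * J)). pose proof (Hp (2 * J)%nat). pose proof (Hp (2 * (M - J) + 1)%nat). field. lra.
Qed.

Lemma Pv_asymptotics a va vb M : sys a va vb -> bdd va -> bdd vb -> asy a va -> asy (a + 1) vb ->
  exists C X0, 0 <= C /\ 2 <= X0 /\ forall al m x, X0 <= x -> Rabs al <= 1 -> INR m = x ^ 2 / 2 - a + al ->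
  Rabs (Pv (a - 1 / 2 + 2 * INR m) va x / PF a x - 2 / sqrt PI * sumn (fun n => (- 1) ^ n * 2 ^ n * B a al n / x ^ (2 * n + 1)) M) <= C / x ^ (2 * M).
Proof.
  intros HS Ba Bb Ha Hb. pose proof (pos_INR M) as HM. destruct (window_small (INR M + 2) ltac:(lra)) as (P1 & P2 & _).
  destruct (Pv_local a va vb M (/ (2 * (INR M + 2 + 36))) HS Ba Bb Ha Hb ltac:(lra)) as (C1 & X1 & HC1 & HX1 & H1).
  destruct (local_sum a M (S M) (le_n _)) as (C2 & HC2 & H2). set (d := / (2 * (INR M + 2 + 36))) in *.
  exists (C1 + C2), (X1 + 2 / d). assert (Hd : 0 < 2 / d) by (apply Rdiv_lt_0_compat; lra). split; [lra|]. split; [lra|].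
  intros al m x Hx Hal Hm. specialize (H1 al m x ltac:(lra) Hal Hm).
  assert (Hxd : 2 <= x * d). { apply Rle_trans with (2 / d * d); [right; field; lra | apply Rmult_le_compat_r; lra]. }
  specialize (H2 al x Hal ltac:(lra) Hxd). rewrite <- main_sum by lra.
  set (S1 := sumn (fun j => dcoef a j / x ^ (2 * j) * RInt (kk (al - INR j) x) 0 d) (S M)) in *.
  set (f := fun j => dcoef a j / x ^ (2 * j) * sumn (fun k => 2 * Gcoef (al - INR j) (2 * k)%nat * mmain k x) (M - j)) in *.
  (* The inner sum of the term j = M is empty. *)
  replace (sumn f (S M)) with (sumn f M) in H2.
  2: { cbn [sumn]. unfold f at 3. replace (M - M)%nat with O by lia. cbn [sumn]. ring. }
  set (Q := Pv (a - 1 / 2 + 2 * INR m) va x / PF a x) in *.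
  replace (Q - / PI * sumn f M) with ((Q - / PI * S1) + / PI * (S1 - sumn f M)) by ring.
  eapply Rle_trans; [apply Rabs_triang|]. replace ((C1 + C2) / x ^ (2 * M)) with (C1 / x ^ (2 * M) + C2 / x ^ (2 * M)) by (unfold Rdiv; ring).
  apply Rplus_le_compat; auto. pose proof PI2_1. rewrite Rabs_mult, (Rabs_pos_eq (/ PI)) by (left; apply Rinv_0_lt_compat; lra).
  assert (/ PI <= 1) by (rewrite <- Rinv_1; apply Rinv_le_contravar; lra). assert (0 < / PI) by (apply Rinv_0_lt_compat; lra).
  pose proof (Rabs_pos (S1 - sumn f M)). nra.
Qed.

Lemma PF_Rpower a x : Rpower x (a - 1 / 2) * exp (- (x ^ 2 / 2)) = PF a x.
Proof. unfold PF, Rpower. rewrite <- exp_plus. f_equal. Qed.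

Lemma Xs_sum a m x : (0 < m)%nat ->
  Rpower x (- a - 1 / 2) * sum_f_R0 (fun k => poch (1 / 2 + a) (2 * k) / (INR (fact k) * (2 * x ^ 2) ^ k)) (m - 1) = Xs a m x.
Proof.
  intros Hm. rewrite sumn_sum_f_R0 by auto. unfold Xs. f_equal. apply sumn_ext. intros k _. unfold ec.
  rewrite Rpow_mult_distr, <- pow_mult. unfold Rdiv. rewrite !Rinv_mult. ring.
Qed.

Lemma dcoef_sum a M x : (0 < M)%nat ->
  sum_f_R0 (fun j => (- 1) ^ j * poch (1 / 2 - a) (2 * j) / (INR (fact j) * (2 * x ^ 2) ^ j)) (M - 1) = sumn (fun j => dcoef a j / x ^ (2 * j)) M.
Proof.
  intros HM. rewrite sumn_sum_f_R0 by auto. apply sumn_ext. intros k _. unfold dcoef.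
  rewrite Rpow_mult_distr, <- pow_mult. unfold Rdiv. rewrite !Rinv_mult. ring.
Qed.

Lemma trig_combination_bigO (c s : R) (f g : R -> R) (M : nat) C1 C2 : Rabs c <= 1 -> Rabs s <= 1 ->
  Rbar_locally p_infty (fun x => 0 < x /\ Rabs (f x) <= C1 / x ^ (2 * M) /\ Rabs (g x) <= C2 / x ^ (2 * M)) ->
  is_bigO_infty (fun x => c * f x + s * g x) (fun x => / x ^ (2 * M)).
Proof.
  intros Hc Hs H. exists (C1 + C2). revert H. apply filter_imp. intros x (Hx & H1 & H2).
  assert (Hp : 0 < x ^ (2 * M)) by now apply pow_lt. rewrite (Rabs_pos_eq (/ _)) by (left; now apply Rinv_0_lt_compat).
  eapply Rle_trans; [apply Rabs_triang|]. rewrite !Rabs_mult, Rmult_plus_distr_r. unfold Rdiv in *.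
  pose proof (Rabs_pos (f x)). pose proof (Rabs_pos (g x)). pose proof (Rabs_pos c). pose proof (Rabs_pos s). nra.
Qed.

Theorem theorem1 (a : R) (M : nat) (hM : (0 < M)%nat)
  (mo : R -> nat) (alpha : R -> R)
  (hmo : Rbar_locally p_infty (fun x =>
     (0 < mo x)%nat /\
     INR (mo x) = x ^ 2 / 2 - a + alpha x /\
     Rabs (alpha x) < 1)) :
  exists r1 r2 : R -> R,
    is_bigO_infty r1 (fun x => / x ^ (2 * M)) /\
    is_bigO_infty r2 (fun x => / x ^ (2 * M)) /\
    Rbar_locally p_infty (fun x =>
      w1 a x
      - Rpower 2 (1 / 4 + a / 2) * sqrt PI * rGamma (1 / 4 - a / 2)
        * Rpower x (- a - 1 / 2)
        * sum_f_R0 (fun k =>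
            poch (1 / 2 + a) (2 * k) / (INR (fact k) * (2 * x ^ 2) ^ k))
            (mo x - 1)
      = Rpower 2 (1 / 4 - a / 2) * sqrt PI * rGamma (1 / 4 + a / 2)
        * Rpower x (a - 1 / 2) * exp (- (x ^ 2 / 2))
        * (cos (PI * theta a)
           * sum_f_R0 (fun j =>
               (- 1) ^ j * poch (1 / 2 - a) (2 * j)
               / (INR (fact j) * (2 * x ^ 2) ^ j)) (M - 1)
           - 2 * sin (PI * theta a) / sqrt PI
             * sum_f_R0 (fun j =>
                 (- 1) ^ j * 2 ^ j * B a (alpha x) j / x ^ (2 * j + 1)) (M - 1)
           + r1 x)) /\
    Rbar_locally p_infty (fun x =>
      w2 a x
      - Rpower 2 (a / 2 - 1 / 4) * sqrt PI * rGamma (3 / 4 - a / 2)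
        * Rpower x (- a - 1 / 2)
        * sum_f_R0 (fun k =>
            poch (1 / 2 + a) (2 * k) / (INR (fact k) * (2 * x ^ 2) ^ k))
            (mo x - 1)
      = Rpower 2 (- (a / 2) - 1 / 4) * sqrt PI * rGamma (3 / 4 + a / 2)
        * Rpower x (a - 1 / 2) * exp (- (x ^ 2 / 2))
        * (sin (PI * theta a)
           * sum_f_R0 (fun j =>
               (- 1) ^ j * poch (1 / 2 - a) (2 * j)
               / (INR (fact j) * (2 * x ^ 2) ^ j)) (M - 1)
           + 2 * cos (PI * theta a) / sqrt PI
             * sum_f_R0 (fun j =>
                 (- 1) ^ j * 2 ^ j * B a (alpha x) j / x ^ (2 * j + 1)) (M - 1)
           + r2 x)).
Proof.
  destruct (good_all a) as (va & vb & HS & Ba & Bb & Ha & Hb & m0 & HF).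
  destruct (Pv_asymptotics a va vb M HS Ba Bb Ha Hb) as (C & X0 & HC & HX0 & HP). destruct (Ha M) as [C1 HC1].
  set (dv := fun x => scaled a va x - sumn (fun j => dcoef a j / x ^ (2 * j)) M).
  set (mn := fun x => 2 / sqrt PI * sumn (fun n => (- 1) ^ n * 2 ^ n * B a (alpha x) n / x ^ (2 * n + 1)) M).
  set (dp := fun x => Pv (a - 1 / 2 + 2 * INR (mo x)) va x / PF a x - mn x).
  (* [mo] x is x^2 / 2 up to a bounded amount, hence eventually beyond the threshold m0 of the exact
     formula. *)
  assert (Hev : Rbar_locally p_infty (fun x => X0 <= x /\ (m0 <= mo x)%nat /\ (0 < mo x)%nat /\ INR (mo x) = x ^ 2 / 2 - a + alpha x /\ Rabs (alpha x) <= 1)).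
  { assert (Hl : Rbar_locally p_infty (fun x => X0 + 2 * (INR m0 + Rabs a + 1) < x)) by (eexists; intros y Hy; exact Hy).
    generalize (filter_and _ _ Hl hmo). apply filter_imp. intros x (Hx & Hm1 & Hm2 & Hal).
    pose proof (pos_INR m0). pose proof (Rle_abs a). pose proof (Rabs_pos a). assert (Hal' : Rabs (alpha x) <= 1) by lra.
    repeat split; auto; [lra|]. apply INR_le. rewrite Hm2. apply Rabs_le_between in Hal'. nra. }
  assert (Hb12 : Rbar_locally p_infty (fun x => 0 < x /\ Rabs (dv x) <= C1 / x ^ (2 * M) /\ Rabs (dp x) <= C / x ^ (2 * M))).
  { revert Hev. apply filter_imp. intros x (Hx & _ & _ & Hm & Hal). split; [lra|]. split; [apply HC1; lra | now apply HP]. }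
  assert (Hc : Rabs (cos (PI * theta a)) <= 1) by (apply Rabs_le, COS_bound).
  assert (Hs : Rabs (sin (PI * theta a)) <= 1) by (apply Rabs_le, SIN_bound).
  (* The two remainders combine the error [dv] of the expansion of v and the error [dp] of Pi_m with
     the trigonometric weights of the exact formula, so the stated identities hold exactly. *)
  exists (fun x => cos (PI * theta a) * dv x + - sin (PI * theta a) * dp x), (fun x => sin (PI * theta a) * dv x + cos (PI * theta a) * dp x).
  split; [apply (trig_combination_bigO _ _ dv dp M C1 C); auto; now rewrite Rabs_Ropp|].
  split; [apply (trig_combination_bigO _ _ dv dp M C1 C); auto|].
  assert (Hsum : forall x, sum_f_R0 (fun j => (- 1) ^ j * 2 ^ j * B a (alpha x) j / x ^ (2 * j + 1)) (M - 1) = mn x * sqrt PI / 2).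
  { intros x. rewrite sumn_sum_f_R0 by auto. unfold mn. field. apply Rgt_not_eq, sqrt_lt_R0, PI_RGT_0. }
  assert (HsP : 0 < sqrt PI) by (apply sqrt_lt_R0, PI_RGT_0).
  assert (HPF : forall x, 0 < PF a x) by (intros; apply exp_pos).
  split; revert Hev; apply filter_imp; intros x (Hx & Hm0 & Hm1 & Hm & Hal); destruct (HF (mo x) Hm0) as (F1 & F2 & _);
    specialize (HPF x); rewrite dcoef_sum, Hsum by auto; unfold dp, dv.
  - fold (cH1 a) (cG1 a). rewrite (Rmult_assoc (cH1 a)), Xs_sum by auto. rewrite (Rmult_assoc (cG1 a)), PF_Rpower.
    rewrite (F1 x) by lra. set (Pq := Pv _ va x). rewrite (v_scaled a va x) at 1. field. lra.
  - fold (cH2 a) (cG2 a). rewrite (Rmult_assoc (cH2 a)), Xs_sum by auto. rewrite (Rmult_assoc (cG2 a)), PF_Rpower.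
    rewrite (F2 x) by lra. set (Pq := Pv _ va x). rewrite (v_scaled a va x) at 1. field. lra.
Qed.
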